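(* Let $d=2$, let $\Omega\subset\mathbb{R}^2$ be a bounded domain with sufficiently smooth boundary, and assume: (i) $J\in W^{1,1}(\mathbb{R}^2)$, $J(x)=J(-x)$, and $a(x):=\int_\Omega J(x-y)\,dy\ge 0$ for a.e. $x\in\Omega$; (ii) $\nu:\mathbb{R}\to\mathbb{R}$ is locally Lipschitz and there are $\nu_1,\nu_2>0$ with $\nu_1\le\nu(s)\le\nu_2$ for all $s\in\mathbb{R}$; (iii) $F\in C^{2,1}_{loc}(\mathbb{R})$ and there is $c_0>0$ with $F''(s)+a(x)\ge c_0$ for all $s\in\mathbb{R}$ and a.e. $x\in\Omega$; (iv) there are $c_3>0$, $c_4\ge 0$ and $p\in(1,2]$ with $|F'(s)|^p\le c_3|F(s)|+c_4$ for all $s\in\mathbb{R}$; (v) there are $c_7>0$, $c_8>0$, $q>0$ with $F''(s)+a(x)\ge c_7|s|^{2q}-c_8$ for all $s\in\mathbb{R}$ and a.e. $x\in\Omega$; (vi) $h\in V_{div}'$ is independent of time. Let $m\ge 0$, and let $\mathcal{G}$ be the set of all weak solutions $z=[u,\varphi]$ on $[0,\infty)$ of the nonlocal Cahn-Hilliard-Navier-Stokes system with external force $h$ corresponding to all initial data $z_0=[u_0,\varphi_0]\in\mathcal{X}_m$. Then $\mathcal{G}$ is point dissipative and eventually bounded.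
   Context: Function spaces (here $d=2$): $H=L^2(\Omega)$ (also for vector/matrix valued functions), $V=H^1(\Omega)$, $G_{div}$ is the closure in $L^2(\Omega)^d$ of $\{u\in C_0^\infty(\Omega)^d:\mathrm{div}(u)=0\}$, $V_{div}=\{u\in H^1_0(\Omega)^d:\mathrm{div}(u)=0\}$ with scalar product $(\nabla u,\nabla v)$. $\|\cdot\|$ and $(\cdot,\cdot)$ are the $L^2$ norm and scalar product, $\langle\cdot,\cdot\rangle$ denotes duality pairings, primes on spaces denote duals. $2Du=\nabla u+(\nabla u)^{tr}$, $b(u,v,w)=\int_\Omega (u\cdot\nabla)v\cdot w$, $(J\ast\varphi)(x)=\int_\Omega J(x-y)\varphi(y)\,dy$. Weak solution. The system is $\varphi_t+u\cdot\nabla\varphi=\Delta\mu$, $\mu=a\varphi-J\ast\varphi+F'(\varphi)$, $u_t-\mathrm{div}(\nu(\varphi)2Du)+(u\cdot\nabla)u+\nabla\pi=\mu\nabla\varphi+h$, $\mathrm{div}(u)=0$ in $\Omega$, with $\partial\mu/\partial n=0$, $u=0$ on $\partial\Omega$. For $T>0$, $u_0\in G_{div}$, $\varphi_0\in H$ with $F(\varphi_0)\in L^1(\Omega)$, $[u,\varphi]$ is a weak solution on $(0,T)$ with initial data $[u_0,\varphi_0]$ if: $u\in L^\infty(0,T;G_{div})\cap L^2(0,T;V_{div})$; $u_t\in L^{2-\gamma}(0,T;V_{div}')$ for all $\gamma\in(0,1)$; $\varphi\in L^\infty(0,T;H)\cap L^2(0,T;V)$; $\varphi_t\in L^{2-\delta}(0,T;V')$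 for all $\delta\in(0,1)$; $\varphi\in L^\infty(0,T;L^{2+2q}(\Omega))$; $\mu:=a\varphi-J\ast\varphi+F'(\varphi)\in L^2(0,T;V)$; for every $\psi\in V$, $v\in V_{div}$ and a.e. $t\in(0,T)$, $$\langle\varphi_t,\psi\rangle+(\nabla\mu,\nabla\psi)=(u,\varphi\nabla\psi),\qquad \langle u_t,v\rangle+(\nu(\varphi)2Du,Dv)+b(u,u,v)=-(v,\varphi\nabla\mu)+\langle h,v\rangle;$$ and $u(0)=u_0$, $\varphi(0)=\varphi_0$ (in the sense of the weakly continuous representatives $u\in C_w([0,T];G_{div})$, $\varphi\in C_w([0,T];H)$). A weak solution on $[0,\infty)$ is one whose restriction to $(0,T)$ is a weak solution for every $T>0$; it is viewed as a map $z:[0,\infty)\to\mathcal{X}_m$. Phase space. $\mathcal{X}_m=G_{div}\times\mathcal{Y}_m$, $\mathcal{Y}_m=\{\varphi\in H: F(\varphi)\in L^1(\Omega),\ |(\varphi,1)|\le m\}$, with metric $\mathbf{d}(z_1,z_2)=\|u_1-u_2\|+\|\varphi_1-\varphi_2\|+\big|\int_\Omega F(\varphi_1)-\int_\Omega F(\varphi_2)\big|^{1/2}$ for $z_i=[u_i,\varphi_i]$. Definitions. For $E\subset\mathcal{X}_m$ and $t\ge0$, $T(t)E=\{z(t): z\in\mathcal{G},\ z(0)\in E\}$, and $\gamma^\tau(E)=\bigcup_{t\ge\tau}T(t)E$. $\mathcal{G}$ is point dissipative if there is a bounded set $\mathcal{B}_0\subset\mathcal{X}_m$ such that for any $z\in\mathcal{G}$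 there is $t_0=t_0(z)\ge 0$ with $z(t)\in\mathcal{B}_0$ for all $t\ge t_0$. $\mathcal{G}$ is eventually bounded if for any bounded set $B\subset\mathcal{X}_m$ there is $\tau\ge0$ such that $\gamma^\tau(B)$ is bounded. *)

(* Defs.v *)
(* Functions are everywhere defined representatives;
   Sobolev, solenoidal and Bochner spaces are given by a membership predicate
   and a seminorm that only see values up to null sets. *)
From HB Require Import structures.
From mathcomp Require Import all_boot all_order all_algebra.
From mathcomp Require Import all_classical all_reals all_analysis.

Set Implicit Arguments.
Unset Strict Implicit.
Unset Printing Implicit Defensive.
Import Order.TTheory GRing.Theory Num.Theory.
Import numFieldNormedType.Exports.

Local Open Scope classical_set_scope.
Local Open Scope ring_scope.

Section smoothness.
Context {R : realType}.

Fixpoint Ck (V : normedModType R) (k : nat) (f : V -> R) : Prop :=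
  continuous f /\
  if k is k'.+1 then
    forall v : V, (forall x, derivable f x v) /\ Ck k' (fun x => 'D_v f x)
  else True.

(* test functions: C_c^oo(D) *)
Definition testfun (V : normedModType R) (D : set V) (chi : V -> R) : Prop :=
  (forall k, Ck k chi) /\
  exists K : set V, [/\ compact K, K `<=` D & forall x, ~ K x -> chi x = 0].

Definition locally_lipschitz (f : R -> R) : Prop :=
  forall s : R, exists2 U : set R, nbhs s U & [lipschitz f x | x in U].

Definition C21_loc (f : R -> R) : Prop := Ck 2 f /\
  locally_lipschitz (f^`(2))%classic.

(* Near each boundary point, in coordinates rotated by (c, s), the open set D
   is the strict epigraph of a C^2 function. *)
Definition C2_boundary (D : set (R * R)) : Prop :=
  forall p, (closure D `\` D) p ->
  exists (r c s : R) (g : R -> R),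
    [/\ 0 < r, c ^+ 2 + s ^+ 2 = 1, Ck 2 g &
      forall x : R * R, `|x - p| < r ->
        (D x <-> g (c * (x.1 - p.1) + s * (x.2 - p.2))
                   < c * (x.2 - p.2) - s * (x.1 - p.1))].

Definition smooth_bounded_domain (D : set (R * R)) : Prop :=
  [/\ D !=set0, open D, connected D, bounded_set D & C2_boundary D].

End smoothness.

Section abstract_spaces.
Context {R : realType}.

(* A space of functions: an ambient vector space of representatives, the set of
   members, and the (semi)norm, meaningful on members only. *)
Record nspace := NSpace {
  car :> lmodType R;
  mem_of : set car;
  nrm : car -> R }.

Definition dual (X : nspace) : nspace :=
  @NSpace (X -> R : lmodType R)
    [set l | (forall (a : R) (v w : X), mem_of v -> mem_of w ->
                l (a *: v + w) = a * l v + l w) /\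
             exists C : R, forall v : X, mem_of v -> `|l v| <= C * nrm v]
    (fun l => sup [set `|l v| | v in [set v : X | mem_of v /\ nrm v <= 1]]).

Notation leb := (@lebesgue_measure R).

Definition simple_fun (X : nspace) (s : R -> X) : Prop :=
  [/\ finite_set (range s), forall y, measurable (s @^-1` [set y])
    & forall t, mem_of (s t)].

Definition strongly_measurable (T : R) (X : nspace) (f : R -> X) : Prop :=
  exists s : nat -> R -> X, (forall n, simple_fun (s n)) /\
    {ae leb, forall t, t \in `]0, T[ ->
       (fun n => nrm (s n t - f t)) @ \oo --> (0 : R)}.

(* f \in L^r(0,T;X), 1 <= r <= +oo *)
Definition Bochner (T : R) (r : \bar R) (X : nspace) (f : R -> X) : Prop :=
  strongly_measurable T f /\
  exists2 g : R -> R, (g \_ `]0, T[%classic) \in Lfun leb r &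
    {ae leb, forall t, t \in `]0, T[ -> mem_of (f t) /\ nrm (f t) = g t}.

(* f \in C_w([0,T];X) *)
Definition weakly_continuous (T : R) (X : nspace) (f : R -> X) : Prop :=
  (forall t, t \in `[0, T] -> mem_of (f t)) /\
  forall l : dual X, mem_of l -> {within `[0, T], continuous (fun t => l (f t))}.

(* f' is the distributional derivative on (0,T) of f, with values in X'; f(t)
   acts on X through the pairing ip (here the L^2 product, i.e. through
   X c H = H' c X'). *)
Definition time_derivative (T : R) (X : nspace) (ip : X -> X -> R)
    (f : R -> X) (f' : R -> dual X) : Prop :=
  forall v : X, mem_of v -> forall chi : R -> R, testfun `]0, T[%classic chi ->
    \int[leb]_(t in `]0, T[) ((chi^`())%classic t * ip (f t) v)
      = - \int[leb]_(t in `]0, T[) (chi t * f' t v).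

End abstract_spaces.
Arguments nspace : clear implicits.

Section plane.
Context {R : realType}.

Notation pt := (R * R)%type.

Definition mu2 :
    {measure set (measurableTypeR R * measurableTypeR R) -> \bar R} :=
  (@lebesgue_measure R \x @lebesgue_measure R)%E.

Definition vfield : Type := 'I_2 -> pt -> R.

Definition e_ (i : 'I_2) : pt := if i == ord0 then (1, 0) else (0, 1).

Section on_domain.
Variable D : set pt.

Definition Lp (p : \bar R) (f : pt -> R) : Prop := (f \_ D) \in Lfun mu2 p.

Definition Lp_norm (p : \bar R) (f : pt -> R) : R :=
  fine ('N[mu2]_p[EFin \o (f \_ D)])%E.

Definition Lp_space (p : \bar R) : nspace R :=
  @NSpace R (pt -> R : lmodType R) (Lp p) (Lp_norm p).

(* H, scalar functions *)
Definition L2 : nspace R := Lp_space 2%:E.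

Definition L1loc (f : pt -> R) : Prop :=
  measurable_fun (D : set (measurableTypeR R * measurableTypeR R)) f /\
  forall K, compact K -> K `<=` D -> mu2.-integrable K (EFin \o f).

Definition is_weak_partial (i : 'I_2) (f g : pt -> R) : Prop :=
  L1loc g /\
  forall chi : pt -> R, testfun D chi ->
    \int[mu2]_(x in D) (f x * 'D_(e_ i) chi x)
      = - \int[mu2]_(x in D) (g x * chi x).

(* the weak partial derivative, unique a.e. on D when it exists *)
Definition wD (i : 'I_2) (f : pt -> R) : pt -> R := get (is_weak_partial i f).

Definition has_weak_partials (p : \bar R) (f : pt -> R) : Prop :=
  forall i, is_weak_partial i f (wD i f) /\ Lp p (wD i f).

Definition W1p (p : \bar R) (f : pt -> R) : Prop :=
  Lp p f /\ has_weak_partials p f.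

Definition H1_norm (f : pt -> R) : R :=
  Num.sqrt (Lp_norm 2%:E f ^+ 2 + \sum_i Lp_norm 2%:E (wD i f) ^+ 2).

(* V *)
Definition H1 : nspace R := @NSpace R (pt -> R : lmodType R) (W1p 2%:E) H1_norm.

Definition H10 (f : pt -> R) : Prop :=
  W1p 2%:E f /\
  forall eps : R, 0 < eps -> exists2 chi, testfun D chi & H1_norm (f - chi) < eps.

Definition L2v_norm (u : vfield) : R :=
  Num.sqrt (\sum_i Lp_norm 2%:E (u i) ^+ 2).

Definition solenoidal_test (w : vfield) : Prop :=
  (forall i, testfun D (w i)) /\ forall x, \sum_i 'D_(e_ i) (w i) x = 0.

Definition Gdiv : nspace R :=
  @NSpace R (vfield : lmodType R)
    [set u | (forall i, Lp 2%:E (u i)) /\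
       forall eps : R, 0 < eps ->
         exists2 w : vfield, solenoidal_test w & L2v_norm (u - w) < eps]
    L2v_norm.

Definition Vdiv : nspace R :=
  @NSpace R (vfield : lmodType R)
    [set u | (forall i, H10 (u i)) /\
       {ae mu2, forall x, D x -> \sum_i wD i (u i) x = 0}]
    (fun u => Num.sqrt (\sum_i \sum_j Lp_norm 2%:E (wD j (u i)) ^+ 2)).

Definition ip (f g : pt -> R) : R := \int[mu2]_(x in D) (f x * g x).

Definition ipv (u v : vfield) : R := \int[mu2]_(x in D) \sum_i (u i x * v i x).

Definition ip_grad (f g : pt -> R) : R :=
  \int[mu2]_(x in D) \sum_i (wD i f x * wD i g x).

(* (u, f grad g) *)
Definition ip_fgrad (u : vfield) (f g : pt -> R) : R :=
  \int[mu2]_(x in D) \sum_i (u i x * (f x * wD i g x)).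

Definition sym_grad (u : vfield) (i j : 'I_2) (x : pt) : R :=
  (wD j (u i) x + wD i (u j) x) / 2.

(* (nu(f) 2Du, Dv) *)
Definition viscous (nu : R -> R) (f : pt -> R) (u v : vfield) : R :=
  \int[mu2]_(x in D) \sum_i \sum_j
     (nu (f x) * (2 * sym_grad u i j x) * sym_grad v i j x).

(* b(u,v,w) *)
Definition trilinear (u v w : vfield) : R :=
  \int[mu2]_(x in D) \sum_i \sum_j (u j x * wD j (v i) x * w i x).

(* J * f *)
Definition convol (J f : pt -> R) (x : pt) : R :=
  \int[mu2]_(y in D) (J (x - y) * f y).

(* a *)
Definition acoef (J : pt -> R) (x : pt) : R := \int[mu2]_(y in D) J (x - y).

Definition chem_potential (J : pt -> R) (F : R -> R) (f : pt -> R) : pt -> R :=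
  fun x => acoef J x * f x - convol J f x + (F^`())%classic (f x).

End on_domain.

(* [u, phi] *)
Definition state : Type := (vfield * (pt -> R))%type.

Section system.
Variables (D : set pt) (J : pt -> R) (nu F : R -> R) (q : R).
Variable h : dual (Vdiv D).

Record weak_solution (T : R) (z0 : state) (z : R -> state) : Prop := {
  ws_u_Linfty : Bochner T +oo%E (fun t => (z t).1 : Gdiv D);
  ws_u_L2 : Bochner T 2%:E (fun t => (z t).1 : Vdiv D);
  ws_phi_Linfty : Bochner T +oo%E (fun t => (z t).2 : L2 D);
  ws_phi_L2 : Bochner T 2%:E (fun t => (z t).2 : H1 D);
  ws_phi_Lq :
    Bochner T +oo%E (fun t => (z t).2 : Lp_space D (2 + 2 * q)%:E);
  ws_mu : Bochner T 2%:E (fun t => chem_potential D J F (z t).2 : H1 D);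
  ws_phi_eq : exists phi_t : R -> dual (H1 D),
    [/\ time_derivative T (@ip D : H1 D -> H1 D -> R) (fun t => (z t).2) phi_t,
        forall delta : R, 0 < delta < 1 -> Bochner T (2 - delta)%:E phi_t &
        forall psi : H1 D, mem_of psi ->
          {ae @lebesgue_measure R, forall t, t \in `]0, T[ ->
             let phi := (z t).2 in let mu := chem_potential D J F phi in
             phi_t t psi + ip_grad D mu psi = ip_fgrad D (z t).1 phi psi}];
  ws_u_eq : exists u_t : R -> dual (Vdiv D),
    [/\ time_derivative T (@ipv D : Vdiv D -> Vdiv D -> R) (fun t => (z t).1) u_t,
        forall gamma : R, 0 < gamma < 1 -> Bochner T (2 - gamma)%:E u_t &
        forall v : Vdiv D, mem_of v ->
          {ae @lebesgue_measure R, forall t, t \in `]0, T[ ->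
             let u := (z t).1 in
             let phi := (z t).2 in let mu := chem_potential D J F phi in
             u_t t v + viscous D nu phi u v + trilinear D u u v
               = - ip_fgrad D v phi mu + h v}];
  ws_u_cont : weakly_continuous T (fun t => (z t).1 : Gdiv D);
  ws_phi_cont : weakly_continuous T (fun t => (z t).2 : L2 D);
  ws_init : {ae mu2, forall x, D x ->
    (forall i, (z 0).1 i x = z0.1 i x) /\ (z 0).2 x = z0.2 x} }.

(* X_m *)
Definition phase_space (m : R) : set state :=
  [set z | [/\ @mem_of _ (Gdiv D) z.1, @mem_of _ (L2 D) z.2,
     mu2.-integrable D (EFin \o (F \o z.2)) &
     `| \int[mu2]_(x in D) z.2 x | <= m]].

Definition phase_dist (z1 z2 : state) : R :=
  L2v_norm D (z1.1 - z2.1) + Lp_norm D 2%:E (z1.2 - z2.2)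
  + Num.sqrt `| \int[mu2]_(x in D) F (z1.2 x) - \int[mu2]_(x in D) F (z2.2 x) |.

(* Trajectories are indexed by R; only their values at times t >= 0 matter. *)
Definition weak_solutions (m : R) : set (R -> state) :=
  [set z | exists2 z0, phase_space m z0 &
     forall T : R, 0 < T -> weak_solution T z0 z].

End system.

Section dissipativity.
Context {X : Type}.
(* phase space S with metric d; boundedness of a set includes being in S *)
Variables (S : set X) (d : X -> X -> R) (G : set (R -> X)).

Definition bounded_in (B : set X) : Prop :=
  B `<=` S /\ exists M : R, forall x y, B x -> B y -> d x y <= M.

Definition flow (t : R) (E : set X) : set X :=
  [set x | exists z, [/\ G z, E (z 0) & x = z t]].

Definition orbit_from (tau : R) (E : set X) : set X :=
  \bigcup_(t in [set t : R | tau <= t]) flow t E.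

Definition point_dissipative : Prop :=
  exists2 B0 : set X, bounded_in B0 &
    forall z, G z -> exists2 t0 : R, 0 <= t0 & forall t, t0 <= t -> B0 (z t).

Definition eventually_bounded : Prop :=
  forall B : set X, bounded_in B ->
    exists2 tau : R, 0 <= tau & bounded_in (orbit_from tau B).

End dissipativity.
End plane.
Arguments weak_solution {R} D J nu F q h T z0 z.
Arguments weak_solutions {R} D J nu F q h m _.

(* Main.v *)
(* The energy of a state is
     E(u, phi) = |u|^2 / 2 + int (F(phi) + a phi^2 / 2) - (phi, J * phi) / 2.
   Since F'' + a >= c0, the integrand s |-> F(s) + a s^2 / 2 is uniformly convex, so
   E(t) - E(s) is bounded above by the weak equations integrated over ]s, t] and tested
   with the fixed functions u(t) and mu(t); b(u, u, u) = 0, the terms in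
   (u, phi grad mu) cancel, and only the oscillation of u and mu between t and r in ]s, t]
   is left. In dimension 2 the forms are bounded on V_div and V by a square-integrable
   function of time, hence summing over finer and finer partitions makes this remainder
   vanish, and weak lower semicontinuity of E gives E(t2) + int_t1^t2 d <= E(t1) for all
   t1 < t2 with E(t1) finite, where d is the viscous and diffusive dissipation minus a
   constant coming from h. No energy equality is needed.
   The Poincare inequalities for u and mu and the superquadratic growth (v) give
   d >= k E - C, so that E(t) <= (C + 1) / k as soon as t >= E(0) - (C + 1) / k. On X_m, a
   bound on E is the same as a bound in the metric, and the mean of phi is conserved. *)
Require Import Defs.
From HB Require Import structures.
From mathcomp Require Import all_boot all_order all_algebra.
From mathcomp Require Import all_classical all_reals all_analysis.
From mathcomp Require Import measurable_realfun ring lra.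
Set Implicit Arguments.
Unset Strict Implicit.
Unset Printing Implicit Defensive.
Import Order.TTheory GRing.Theory Num.Theory.
Import numFieldNormedType.Exports.
Local Open Scope classical_set_scope.
Local Open Scope ring_scope.

(** * Integrable and square-integrable functions *)

(** The time derivatives are only known in L^(2-gamma) and L^(2-delta), so they cannot be paired in
    time with u and mu, which are merely square-integrable; hence test functions frozen at an
    endpoint of each step. Taking the right endpoint lets a step start at any time of finite energy,
    in particular at 0, where no gradient is available. The nonlocal quadratic form has no sign: for
    delta = phi(t) - phi(s) it leaves (delta, J * delta) / 2. Since J is in W^{1,1}, the function J
    * delta lies in V with norm at most C |delta|; the phase equation tested with it bounds the
    remainder by C |delta| times a small time integral, and the term c0 |delta|^2 / 2 of uniform
    convexity absorbs it. Growth (v) enters twice: in the lower bound of E, and through phi in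
    L^(2+2q). As H^1_0 embeds into every L^(2k) in the plane, v phi is then square-integrable for v
    in V_div, which bounds (v, phi grad mu) as well as (u, phi grad psi). *)

Section integrable_functions.
Context d (T : measurableType d) (R : realType) (mu : {measure set T -> \bar R}).
Implicit Types (D A : set T) (f g h : T -> R).
Import HBNNSimple.

(** The functions may be nonmeasurable: the integral is a supremum over simple functions below [f],
    and cutting such a function to zero on [N] keeps its integral and brings it below [g]. *)
Lemma le_nnintegral_ae (N : set T) (f g : T -> \bar R) :
  measurable N -> mu N = 0%E ->
  (forall x, 0 <= f x)%E -> (forall x, 0 <= g x)%E ->
  (forall x, ~ N x -> f x = g x) ->
  (\int[mu]_x f x <= \int[mu]_x g x)%E.
Proof.
move=> mN N0 f0 g0 fg; rewrite !ge0_integralTE//.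
apply: ub_ereal_sup => _ [h hf <-].
have mNC : measurable (~` N) by exact: measurableC.
pose k := mul_nnsfun h (indic_nnsfun R mNC).
have kg x : ((k x)%:E <= g x)%E.
  rewrite /k /= [mindic _ _ _]indicE; have [/set_mem nx|nx] := boolP (x \in ~` N).
    by rewrite mulr1 -fg//; exact: hf.
  by rewrite mulr0; exact: g0.
apply: (@le_trans _ _ (sintegral mu k)); last first.
  by apply: ereal_sup_ubound; exists k.
rewrite -!integralT_nnsfun le_eqVlt; apply/orP; left; apply/eqP.
apply: ae_eq_integral => //; [exact/measurable_EFinP | exact/measurable_EFinP |].
exists N; split => // x /= /not_implyP[_ hk]; apply: contrapT => Nx.
by apply: hk; rewrite /k/= [mindic _ _ _]indicE mem_set ?mulr1.
Qed.

(** Stated for arbitrary functions, so that an integrand containing a weak derivative, known only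
    almost everywhere, can be replaced without a measurability check. *)
Lemma eq_Rintegral_ae D f g : {ae mu, forall x, D x -> f x = g x} ->
  \int[mu]_(x in D) f x = \int[mu]_(x in D) g x.
Proof.
move=> [N [mN N0 HN]].
have fgN x : ~ N x -> (f \_ D) x = (g \_ D) x.
  move=> Nx; rewrite !patchE; case: ifPn => // /set_mem Dx.
  by apply: contrapT => fg; apply: Nx; apply: HN => /= /(_ Dx).
have H (u v : T -> \bar R) : (forall x, 0 <= u x)%E -> (forall x, 0 <= v x)%E ->
    (forall x, ~ N x -> u x = v x) -> (\int[mu]_x u x = \int[mu]_x v x)%E.
  move=> u0 v0 uv; apply/eqP; rewrite eq_le; apply/andP; split.
    exact: (le_nnintegral_ae mN).
  by apply: (le_nnintegral_ae mN) => // x Nx; rewrite uv.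
rewrite Rintegral_mkcond [RHS]Rintegral_mkcond /Rintegral; congr fine.
rewrite integralE [RHS]integralE; congr (_ - _)%E; apply: H => //.
- by move=> x Nx; rewrite !funeposE fgN.
- by move=> x Nx; rewrite !funenegE fgN.
Qed.

Definition intg D f := mu.-integrable D (EFin \o f).

Lemma intg_meas D f : intg D f -> measurable_fun D f.
Proof. by move=> /integrableP[/measurable_EFinP]. Qed.

Lemma integral_intg D f : measurable D -> intg D f ->
  (\int[mu]_(x in D) (f x)%:E)%E = (\int[mu]_(x in D) f x)%:E.
Proof. by move=> mD fi; rewrite /Rintegral fineK//; exact: integrable_fin_num fi. Qed.

Lemma eq_Rint D f g : (forall x, D x -> f x = g x) ->
  \int[mu]_(x in D) f x = \int[mu]_(x in D) g x.
Proof. by move=> fg; apply: eq_Rintegral => x /set_mem; exact: fg. Qed.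

Variable D : set T.
Hypothesis mD : measurable D.

Lemma eq_intg f g : (forall x, D x -> f x = g x) -> intg D f -> intg D g.
Proof. by move=> fg; apply: eq_integrable => // x /set_mem Dx /=; rewrite fg. Qed.

Lemma intgD f g : intg D f -> intg D g -> intg D (fun x => f x + g x).
Proof. by move=> fi gi; exact: (integrableD mD fi gi). Qed.

Lemma intgZ a f : intg D f -> intg D (fun x => a * f x).
Proof. by move=> fi; exact: (integrableZl mD a fi). Qed.

Lemma intgZr a f : intg D f -> intg D (fun x => f x * a).
Proof. by move=> /(intgZ a); apply: eq_intg => x _; rewrite mulrC. Qed.

Lemma intgN f : intg D f -> intg D (fun x => - f x).
Proof. by move=> /(intgZ (-1)); apply: eq_intg => x _; rewrite mulN1r. Qed.

Lemma intgB f g : intg D f -> intg D g -> intg D (fun x => f x - g x).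
Proof. by move=> fi gi; apply: intgD => //; exact: intgN. Qed.

Lemma intg0 : intg D (fun=> 0).
Proof. exact: integrable0. Qed.

Lemma intg_sum (I : Type) (s : seq I) (F : I -> T -> R) :
  (forall i, intg D (F i)) -> intg D (fun x => \sum_(i <- s) F i x).
Proof.
move=> Fi; elim: s => [|i s IH].
  by apply: eq_intg intg0 => x _; rewrite big_nil.
by apply: eq_intg (intgD (Fi i) IH) => x _; rewrite big_cons.
Qed.

Lemma Rint_sum (I : Type) (s : seq I) (F : I -> T -> R) :
  (forall i, intg D (F i)) ->
  \int[mu]_(x in D) (\sum_(i <- s) F i x) = \sum_(i <- s) \int[mu]_(x in D) F i x.
Proof.
move=> Fi; elim: s => [|i s IH].
  rewrite big_nil (eq_Rint (g := fun=> 0)) => [|x _]; last by rewrite big_nil.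
  by rewrite /Rintegral integral0.
rewrite big_cons -IH -RintegralD//; [|exact: Fi|exact: intg_sum].
by apply: eq_Rint => x _; rewrite big_cons.
Qed.

Lemma intg_dom f g : measurable_fun D f -> intg D g ->
  (forall x, D x -> `|f x| <= g x) -> intg D f.
Proof.
move=> mf gi fg; apply: le_integrable gi => //; first exact/measurable_EFinP.
by move=> x Dx /=; rewrite lee_fin (le_trans (fg _ Dx))// ler_norm.
Qed.

Lemma intg_dom_ae f g : measurable_fun D f -> intg D g ->
  {ae mu, forall x, D x -> `|f x| <= g x} -> intg D f.
Proof.
move=> mf gi fg; apply/integrableP; split; first exact/measurable_EFinP.
have := integrable_lty mD (integrable_norm gi); apply: le_lt_trans.
apply: ae_ge0_le_integral => //.
- by apply/measurable_EFinP; exact: measurableT_comp mf.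
- by move=> x Dx /=; rewrite lee_fin.
- by apply/measurable_EFinP; apply: measurableT_comp (intg_meas gi).
- move: fg; apply: filterS => x fg Dx.
  by rewrite lee_fin (le_trans (fg Dx))// ler_norm.
Qed.

Lemma intg_abs f : intg D f -> intg D (fun x => `|f x|).
Proof. by move=> /integrable_norm. Qed.

Lemma intg_bounded f M : (mu D < +oo)%E -> measurable_fun D f ->
  (forall x, D x -> `|f x| <= M) -> intg D f.
Proof.
move=> Dfin mf fM; apply: (@intg_dom _ (fun=> M)) => //.
apply/integrableP; split; first exact/measurable_EFinP.
rewrite /= integral_cst// lte_mul_pinfty//.
Qed.

Lemma le_Rint_ae f g : intg D f -> intg D g ->
  {ae mu, forall x, D x -> f x <= g x} ->
  \int[mu]_(x in D) f x <= \int[mu]_(x in D) g x.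
Proof.
(* [k] equals [g] almost everywhere and dominates [f] everywhere, which reduces the claim to
   pointwise monotonicity. *)
move=> fi gi fg; pose k x := Num.max (f x) (g x).
have kg : \int[mu]_(x in D) k x = \int[mu]_(x in D) g x.
  by apply: eq_Rintegral_ae; move: fg; apply: filterS => x H /H; rewrite /k; case: ltgtP.
rewrite -kg; apply: le_Rintegral => //; last by move=> x Dx; rewrite le_max lexx.
apply: (@intg_dom _ (fun x => `|f x| + `|g x|)).
- by apply: measurable_maxr; exact: intg_meas.
- by apply: intgD; exact: intg_abs.
- move=> x _; rewrite /k; case: (leP (f x) (g x)) => _; first by rewrite lerDr.
  by rewrite lerDl.
Qed.

Lemma le_Rint f g : intg D f -> intg D g ->
  (forall x, D x -> f x <= g x) ->
  \int[mu]_(x in D) f x <= \int[mu]_(x in D) g x.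
Proof. by move=> *; exact: le_Rintegral. Qed.

Lemma Rint_ge0_ae f : {ae mu, forall x, D x -> 0 <= f x} ->
  0 <= \int[mu]_(x in D) f x.
Proof.
move=> f0; rewrite (@eq_Rintegral_ae _ _ (fun x => Num.max 0 (f x))).
  by apply: Rintegral_ge0 => x _; rewrite le_max lexx.
by move: f0; apply: filterS => x H /H; case: ltgtP.
Qed.

Lemma Rint_Z a f : intg D f ->
  \int[mu]_(x in D) (a * f x) = a * \int[mu]_(x in D) f x.
Proof. by move=> fi; rewrite RintegralZl. Qed.

Lemma Rint_N f : intg D f -> \int[mu]_(x in D) (- f x) = - \int[mu]_(x in D) f x.
Proof.
move=> fi; rewrite -[RHS]mulN1r -Rint_Z//.
by apply: eq_Rint => x _; rewrite mulN1r.
Qed.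

Lemma Rint_D f g : intg D f -> intg D g ->
  \int[mu]_(x in D) (f x + g x) = \int[mu]_(x in D) f x + \int[mu]_(x in D) g x.
Proof. by move=> fi gi; rewrite RintegralD. Qed.

Lemma Rint_B f g : intg D f -> intg D g ->
  \int[mu]_(x in D) (f x - g x) = \int[mu]_(x in D) f x - \int[mu]_(x in D) g x.
Proof. by move=> fi gi; rewrite RintegralB. Qed.

Lemma norm_Rint_le f g : intg D f -> intg D g ->
  {ae mu, forall x, D x -> `|f x| <= g x} ->
  `|\int[mu]_(x in D) f x| <= \int[mu]_(x in D) g x.
Proof.
move=> fi gi fg; apply: le_trans (le_normr_Rintegral mD fi) _.
by apply: le_Rint_ae => //; exact: intg_abs.
Qed.

Lemma intg_ae_eq f g : measurable_fun D g -> intg D f ->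
  {ae mu, forall x, D x -> f x = g x} -> intg D g.
Proof.
move=> mg fi fg; apply: (intg_dom_ae mg (intg_abs fi)).
by move: fg; apply: filterS => x H /H ->.
Qed.

Definition sqi f := measurable_fun D f /\ intg D (fun x => f x ^+ 2).

Definition n2 f := Num.sqrt (\int[mu]_(x in D) f x ^+ 2).

Lemma n2_ge0 f : 0 <= n2 f.
Proof. exact: sqrtr_ge0. Qed.

Lemma n2_sqr f : n2 f ^+ 2 = \int[mu]_(x in D) f x ^+ 2.
Proof. by rewrite sqr_sqrtr// Rintegral_ge0// => x _; rewrite sqr_ge0. Qed.

Lemma sqi_mul f g : sqi f -> sqi g -> intg D (fun x => f x * g x).
Proof.
move=> [mf fi] [mg gi]; apply: (@intg_dom _ (fun x => f x ^+ 2 + g x ^+ 2)).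
- exact: measurable_funM.
- exact: intgD.
- move=> x _; rewrite ler_norml; have := sqr_ge0 (f x + g x).
  have := sqr_ge0 (f x - g x); have := sqr_ge0 (f x); have := sqr_ge0 (g x).
  by rewrite !expr2 => *; apply/andP; split; lra.
Qed.

Lemma sqiZ a f : sqi f -> sqi (fun x => a * f x).
Proof.
move=> [mf fi]; split; first exact: measurable_funM.
by apply: eq_intg (intgZ (a ^+ 2) fi) => x _; rewrite exprMn.
Qed.

Lemma sqiD f g : sqi f -> sqi g -> sqi (fun x => f x + g x).
Proof.
move=> fs gs; have fg := sqi_mul fs gs; case: fs gs => mf fi [mg gi].
split; first exact: measurable_funD.
apply: eq_intg (intgD (intgD fi gi) (intgZ 2 fg)) => x _ /=; ring.
Qed.

Lemma sqiN f : sqi f -> sqi (fun x => - f x).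
Proof.
by move=> [mf fi]; split; [exact: measurableT_comp|apply: eq_intg fi => x _; rewrite sqrrN].
Qed.

Lemma sqiB f g : sqi f -> sqi g -> sqi (fun x => f x - g x).
Proof. by move=> fs gs; apply: sqiD => //; exact: sqiN. Qed.

Lemma sqi_dom f g : measurable_fun D f -> sqi g ->
  (forall x, D x -> `|f x| <= `|g x|) -> sqi f.
Proof.
move=> mf [mg gi] fg; split => //; apply: (intg_dom _ gi).
  exact: measurable_funX.
by move=> x Dx; rewrite normrX -(real_normK (num_real (g x))) ler_pXn2r ?nnegrE ?fg.
Qed.

Lemma eq_sqi f g : (forall x, D x -> f x = g x) -> sqi f -> sqi g.
Proof.
move=> fg [mf fi]; split; last by apply: eq_intg fi => x Dx; rewrite fg.
by apply: eq_measurable_fun mf => x /set_mem; exact: fg.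
Qed.

Lemma cauchy_schwarz_sqr f g : sqi f -> sqi g ->
  (\int[mu]_(x in D) (f x * g x)) ^+ 2 <=
  (\int[mu]_(x in D) f x ^+ 2) * (\int[mu]_(x in D) g x ^+ 2).
Proof.
move=> fs gs; have fg := sqi_mul fs gs; case: (fs) (gs) => mf fi [mg gi].
set A := \int[mu]_(x in D) f x ^+ 2; set C := \int[mu]_(x in D) g x ^+ 2.
set B := \int[mu]_(x in D) _.
have A0 : 0 <= A by apply: Rintegral_ge0 => x _; exact: sqr_ge0.
have C0 : 0 <= C by apply: Rintegral_ge0 => x _; exact: sqr_ge0.
(* The form is the integral of the square of [s * f + t * g]. *)
have H s t : 0 <= s ^+ 2 * A + 2 * (s * t) * B + t ^+ 2 * C.
  have -> : s ^+ 2 * A + 2 * (s * t) * B + t ^+ 2 * C =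
      \int[mu]_(x in D) (s * f x + t * g x) ^+ 2.
    rewrite /A /B /C -!Rint_Z//.
    rewrite -Rint_D//; [|exact: intgZ..].
    rewrite -Rint_D//; [|by apply: intgD; exact: intgZ|exact: intgZ].
    by apply: eq_Rint => x _; ring.
  by apply: Rintegral_ge0 => x _; exact: sqr_ge0.
have [C00|Cn0] := eqVneq C 0.
  rewrite C00 mulr0; have [->|Bn0] := eqVneq B 0; first by rewrite expr0n.
  (* When [C = 0] the form is affine in [t]; this choice gives it the value -1. *)
  have := H 1 (- (A + 1) / (2 * B)); rewrite C00 mulr0 addr0.
  have -> : 2 * (1 * (- (A + 1) / (2 * B))) * B = - (A + 1) by field.
  by rewrite expr1n mul1r; lra.
have Cp : 0 < C by rewrite lt_def Cn0.
have := H C (- B).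
have -> : C ^+ 2 * A + 2 * (C * - B) * B + (- B) ^+ 2 * C = C * (A * C - B ^+ 2).
  by ring.
by rewrite pmulr_rge0// subr_ge0.
Qed.

Lemma cauchy_schwarz f g : sqi f -> sqi g ->
  `|\int[mu]_(x in D) (f x * g x)| <= n2 f * n2 g.
Proof.
move=> fs gs; rewrite -sqrtrM; last by apply: Rintegral_ge0 => x _; exact: sqr_ge0.
rewrite -sqrtr_sqr ler_sqrt; first exact: cauchy_schwarz_sqr.
by rewrite mulr_ge0 // Rintegral_ge0 // => x _; exact: sqr_ge0.
Qed.

Lemma n2D f g : sqi f -> sqi g -> n2 (fun x => f x + g x) <= n2 f + n2 g.
Proof.
move=> fs gs; have fg := sqi_mul fs gs; case: (fs) (gs) => mf fi [mg gi].
rewrite -(@ler_pXn2r _ 2)// ?nnegrE ?addr_ge0 ?n2_ge0//.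
rewrite n2_sqr sqrrD !n2_sqr (@eq_Rint _ _ (fun x => f x ^+ 2 + g x ^+ 2 + 2 * (f x * g x))).
  rewrite Rint_D; [|exact: intgD|exact: intgZ].
  rewrite Rint_D// Rint_Z// -mulr_natl.
  have := le_trans (ler_norm _) (cauchy_schwarz fs gs); lra.
by move=> x _; ring.
Qed.

Lemma n2Z a f : sqi f -> n2 (fun x => a * f x) = `|a| * n2 f.
Proof.
move=> [mf fi]; rewrite /n2 (@eq_Rint _ _ (fun x => a ^+ 2 * f x ^+ 2)).
  by rewrite Rint_Z// sqrtrM ?sqr_ge0// sqrtr_sqr.
by move=> x _; rewrite exprMn.
Qed.

Lemma n2N f : n2 (fun x => - f x) = n2 f.
Proof. by rewrite /n2; congr Num.sqrt; apply: eq_Rint => x _; rewrite sqrrN. Qed.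

Lemma n2B f g : sqi f -> sqi g -> n2 (fun x => f x - g x) <= n2 f + n2 g.
Proof. by move=> fs gs; rewrite -(n2N g); apply: n2D => //; exact: sqiN. Qed.

Lemma eq_n2_ae f g : {ae mu, forall x, D x -> f x = g x} -> n2 f = n2 g.
Proof.
move=> fg; rewrite /n2; congr Num.sqrt; apply: eq_Rintegral_ae.
by move: fg; apply: filterS => x H /H ->.
Qed.

Lemma le_n2_ae f g : sqi f -> sqi g ->
  {ae mu, forall x, D x -> `|f x| <= `|g x|} -> n2 f <= n2 g.
Proof.
move=> [_ fi] [_ gi] fg; rewrite ler_sqrt; last first.
  by apply: Rintegral_ge0 => x _; exact: sqr_ge0.
apply: le_Rint_ae => //; move: fg; apply: filterS => x H Dx.
rewrite -(real_normK (num_real (f x))) -(real_normK (num_real (g x))).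
by rewrite ler_pXn2r ?nnegrE ?H.
Qed.

Lemma sqi_cst (c : R) : (mu D < +oo)%E -> sqi (fun=> c).
Proof.
by move=> Dfin; split => //; apply: (@intg_bounded _ (c ^+ 2)) => // x _; rewrite ger0_norm ?sqr_ge0.
Qed.

Lemma sqi_intg f : (mu D < +oo)%E -> sqi f -> intg D f.
Proof.
move=> Dfin fs; apply: eq_intg (sqi_mul fs (sqi_cst 1 Dfin)) => x _.
by rewrite mulr1.
Qed.

End integrable_functions.
Arguments intg {d T R} mu D f.
Arguments sqi {d T R} mu D f.
Arguments n2 {d T R} mu D f.

(** * Measure-preserving maps *)

Section measure_preserving.
Context d (T : measurableType d) (R : realType) (mu : {measure set T -> \bar R}).
Variable phi : T -> T.
Hypothesis mphi : measurable_fun [set: T] phi.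
Hypothesis muphi : forall A, measurable A -> mu (phi @^-1` A) = mu A.

Lemma preserving_ae (P : T -> Prop) :
  {ae mu, forall x, P x} -> {ae mu, forall x, P (phi x)}.
Proof.
move=> [N [mN N0 HN]]; exists (phi @^-1` N); split.
- by rewrite -[_ @^-1` _]setTI; exact: mphi.
- by rewrite muphi.
- by move=> x /= Px; apply: HN.
Qed.

Lemma preserving_integral (f : T -> \bar R) :
  measurable_fun setT f -> (forall x, 0 <= f x)%E ->
  (\int[mu]_x f (phi x) = \int[mu]_x f x)%E.
Proof.
move=> mf f0.
have := ge0_integral_pushforward mphi mu measurableT (measurable_funTS mf) (fun y _ => f0 y).
move=> <-; apply: eq_measure_integral => A mA _.
by rewrite /pushforward/=; apply: muphi.
Qed.

Lemma preserving_intg D (f : T -> R) : measurable D -> intg mu D f ->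
  intg mu (phi @^-1` D) (fun x => f (phi x)).
Proof.
move=> mD fi; have mphD : measurable (phi @^-1` D).
  by rewrite -[_ @^-1` _]setTI; exact: mphi.
have mf := (measurable_restrictT _ mD).1 (intg_meas fi).
apply/(integrable_mkcond _ mphD).
have -> : ((EFin \o (fun x => f (phi x))) \_ (phi @^-1` D)) =
    (fun x => ((f \_ D) (phi x))%:E).
  by apply/funext => x; rewrite !patchE; case: (boolP (phi x \in D)) => [/set_mem H|H];
    [rewrite mem_set|rewrite memNset// => K; move/negP: H; apply; exact: mem_set].
apply/integrableP; split.
  by apply/measurable_EFinP; exact: measurableT_comp mf mphi.
rewrite (preserving_integral (f := fun x => `|((f \_ D) x)%:E|%E))//; last first.
  by apply: measurableT_comp => //; exact/measurable_EFinP.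
move/(integrable_mkcond _ mD)/integrableP: fi => [_].
by rewrite restrict_EFin.
Qed.

Lemma preserving_Rint D (f : T -> R) : measurable D -> intg mu D f ->
  \int[mu]_(x in phi @^-1` D) f (phi x) = \int[mu]_(x in D) f x.
Proof.
move=> mD fi; have mphD : measurable (phi @^-1` D).
  by rewrite -[_ @^-1` _]setTI; exact: mphi.
rewrite Rintegral_mkcond [RHS]Rintegral_mkcond /Rintegral.
have mf := (measurable_restrictT _ mD).1 (intg_meas fi).
have E : ((fun x => f (phi x)) \_ (phi @^-1` D)) = (fun x => (f \_ D) (phi x)).
  by apply/funext => x; rewrite !patchE; case: (boolP (phi x \in D)) => [/set_mem H|H];
    [rewrite mem_set|rewrite memNset// => K; move/negP: H; apply; exact: mem_set].
have fi' : intg mu setT (f \_ D).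
  by move/(integrable_mkcond _ mD): fi; rewrite restrict_EFin.
rewrite E; congr fine.
rewrite -(@integral_pushforward _ _ _ _ _ phi mphi mu setT (fun x => ((f \_ D) x)%:E))//.
- by apply: eq_measure_integral => A mA _; exact: muphi.
- exact/measurable_EFinP.
- rewrite preimage_setT; have := preserving_intg measurableT fi'.
  by rewrite preimage_setT.
Qed.

End measure_preserving.

(** * Fubini and Tonelli theorems on rectangles *)

Section fubini_real.
Context d1 d2 (T1 : measurableType d1) (T2 : measurableType d2) (R : realType).
Variable m1 : {sigma_finite_measure set T1 -> \bar R}.
Variable m2 : {sigma_finite_measure set T2 -> \bar R}.
Variables (A : set T1) (B : set T2).
Hypotheses (mA : measurable A) (mB : measurable B).
Variable f : T1 * T2 -> R.

Lemma measurable_xsect x : measurable_fun (A `*` B) f -> A x ->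
  measurable_fun B (fun y => f (x, y)).
Proof.
move=> mf Ax; have mAB : measurable (A `*` B) by exact: measurableX.
have mF := (measurable_restrictT _ mAB).1 mf.
have := measurableT_comp mF (measurable_pair1 x) => H.
apply: (eq_measurable_fun (fun y => (f \_ (A `*` B)) (x, y))).
  by move=> y /set_mem By; rewrite patchE mem_set.
exact: measurable_funTS.
Qed.

(** Extension by zero turns integrals over the rectangle into integrals over the whole product; [g]
    stands for the inclusion into the extended reals or for the absolute value. *)
Let E1 (g : R -> \bar R) : g 0 = 0%E ->
  (fun x => \int[m2]_y g ((f \_ (A `*` B)) (x, y)))%E =
  ((fun x => \int[m2]_(y in B) g (f (x, y)))%E \_ A).
Proof.
move=> g0; apply/funext => x; rewrite [RHS]patchE; case: ifPn => [/set_mem Ax|xA].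
  rewrite [RHS]integral_mkcond; apply: eq_integral => y _; rewrite !patchE.
  case: (boolP (y \in B)) => [/set_mem By|yB]; first by rewrite mem_set.
  by rewrite memNset// => -[_ /= By]; move/negP: yB; apply; rewrite mem_set.
apply: integral0_eq => y _; rewrite patchE memNset// => -[/= Ax _].
by move/negP: xA; apply; rewrite mem_set.
Qed.

Let E2 (g : R -> \bar R) : g 0 = 0%E ->
  (fun y => \int[m1]_x g ((f \_ (A `*` B)) (x, y)))%E =
  ((fun y => \int[m1]_(x in A) g (f (x, y)))%E \_ B).
Proof.
move=> g0; apply/funext => y; rewrite [RHS]patchE; case: ifPn => [/set_mem By|yB].
  rewrite [RHS]integral_mkcond; apply: eq_integral => x _; rewrite !patchE.
  case: (boolP (x \in A)) => [/set_mem Ax|xA]; first by rewrite mem_set.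
  by rewrite memNset// => -[/= Ax _]; move/negP: xA; apply; rewrite mem_set.
apply: integral0_eq => x _; rewrite patchE memNset// => -[_ /= By].
by move/negP: yB; apply; rewrite mem_set.
Qed.

Hypothesis mf : measurable_fun (A `*` B) f.
Let mF : measurable_fun setT (f \_ (A `*` B)).
Proof. by apply/(measurable_restrictT _ (measurableX mA mB)). Qed.

Lemma tonelli_rect : (forall x y, A x -> B y -> 0 <= f (x, y)) ->
  (\int[m1]_(x in A) \int[m2]_(y in B) (f (x, y))%:E =
   \int[m2]_(y in B) \int[m1]_(x in A) (f (x, y))%:E)%E.
Proof.
move=> f0; rewrite integral_mkcond [RHS]integral_mkcond -E1// -E2//.
apply: (@fubini_tonelli _ _ _ _ _ m1 m2 (EFin \o (f \_ (A `*` B)))).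
  exact/measurable_EFinP.
move=> [x y]/=; rewrite patchE; case: ifPn => // /set_mem[/= Ax By].
by rewrite lee_fin f0.
Qed.

Lemma tonelli_measurable : (forall x y, A x -> B y -> 0 <= f (x, y)) ->
  measurable_fun A (fun x => \int[m2]_(y in B) (f (x, y))%:E)%E.
Proof.
move=> f0; apply/measurable_restrictT => //; rewrite -E1//.
apply: (@measurable_fun_fubini_tonelli_F _ _ _ _ _ m2 (EFin \o (f \_ (A `*` B)))).
  exact/measurable_EFinP.
move=> [x y]/=; rewrite patchE; case: ifPn => // /set_mem[/= Ax By].
by rewrite lee_fin f0.
Qed.

(** A real integral is 0 by default when its extended value is infinite. The integrability of almost
    every slice is therefore part of the conclusion: it identifies the real iterated integrals with
    the extended ones. *)
Lemma fubini_rect :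
  (\int[m1]_(x in A) \int[m2]_(y in B) `|f (x, y)|%:E < +oo)%E ->
  [/\ {ae m1, forall x, A x -> intg m2 B (fun y => f (x, y))},
      intg m1 A (fun x => \int[m2]_(y in B) f (x, y)),
      {ae m2, forall y, B y -> intg m1 A (fun x => f (x, y))},
      intg m2 B (fun y => \int[m1]_(x in A) f (x, y)) &
      \int[m1]_(x in A) \int[m2]_(y in B) f (x, y) =
      \int[m2]_(y in B) \int[m1]_(x in A) f (x, y)].
Proof.
move=> foo; pose g : T1 * T2 -> \bar R := EFin \o (f \_ (A `*` B)).
have mg : measurable_fun setT g by exact/measurable_EFinP.
have ig : (m1 \x m2)%E.-integrable setT g.
  apply: (integrable12ltyP m1 m2 mg).2.
  have -> : (fun x => \int[m2]_y `|g (x, y)|)%E = 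
      ((fun x => \int[m2]_(y in B) `|f (x, y)|%:E)%E \_ A).
    by rewrite -(E1 (g := fun r => `|r|%:E))// normr0.
  by rewrite -integral_mkcond.
have a1 : {ae m1, forall x, A x -> intg m2 B (fun y => f (x, y))}.
  have := ae_integrable1 ig; apply: filterS => x H Ax.
  apply/(integrable_mkcond _ mB); apply: eq_integrable H => // y _ /=.
  rewrite /g /= !patchE; case: (boolP (y \in B)) => [/set_mem By|yB].
    by rewrite mem_set.
  by rewrite memNset// => -[_ /= By]; move/negP: yB; apply; rewrite mem_set.
have a2 : {ae m2, forall y, B y -> intg m1 A (fun x => f (x, y))}.
  have := ae_integrable2 ig; apply: filterS => y H By.
  apply/(integrable_mkcond _ mA); apply: eq_integrable H => // x _ /=.
  rewrite /g /= !patchE; case: (boolP (x \in A)) => [/set_mem Ax|xA].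
    by rewrite mem_set.
  by rewrite memNset// => -[/= Ax _]; move/negP: xA; apply; rewrite mem_set.
have i1 : m1.-integrable A (fun x => \int[m2]_(y in B) (f (x, y))%:E)%E.
  apply/(integrable_mkcond _ mA); rewrite -E1//; exact: (integrable_fubini_F ig).
have i2 : m2.-integrable B (fun y => \int[m1]_(x in A) (f (x, y))%:E)%E.
  apply/(integrable_mkcond _ mB); rewrite -E2//.
  apply/integrableP; split; first exact: (measurable_fubini_G ig).
  apply: le_lt_trans ((integrable21ltyP m1 m2 mg).1 ig); apply: ge0_le_integral => //.
  - by apply: measurableT_comp => //; exact: (measurable_fubini_G ig).
  - have mag : measurable_fun setT (abse \o g) by exact: measurableT_comp mg.
    by apply: (@measurable_fun_fubini_tonelli_G _ _ _ _ _ m1 (abse \o g)) => // z /=.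
  - move=> y _; apply: (@le_abse_integral _ _ _ m1 setT (fun x => g (x, y))) => //.
    exact: (measurableT_comp mg (measurable_pair2 y)).
have fubini_eq : (\int[m1]_(x in A) \int[m2]_(y in B) (f (x, y))%:E =
   \int[m2]_(y in B) \int[m1]_(x in A) (f (x, y))%:E)%E.
  rewrite integral_mkcond [RHS]integral_mkcond -E1// -E2//.
  exact: (Fubini ig).
have i1' : intg m1 A (fun x => \int[m2]_(y in B) f (x, y)).
  apply/integrableP; split.
    by apply/measurable_EFinP; apply: measurableT_comp => //; exact: measurable_int i1.
  have/integrableP[_] := i1; apply: le_lt_trans; apply: ae_ge0_le_integral => //.
  - by apply: measurableT_comp => //; apply/measurable_EFinP; apply: measurableT_comp => //; exact: measurable_int i1.
  - by apply: measurableT_comp => //; exact: measurable_int i1.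
  - move: a1; apply: filterS => x H Ax; rewrite /= integral_intg//; exact: H.
have i2' : intg m2 B (fun y => \int[m1]_(x in A) f (x, y)).
  apply/integrableP; split.
    by apply/measurable_EFinP; apply: measurableT_comp => //; exact: measurable_int i2.
  have/integrableP[_] := i2; apply: le_lt_trans; apply: ae_ge0_le_integral => //.
  - by apply: measurableT_comp => //; apply/measurable_EFinP; apply: measurableT_comp => //; exact: measurable_int i2.
  - by apply: measurableT_comp => //; exact: measurable_int i2.
  - move: a2; apply: filterS => y H By; rewrite /= integral_intg//; exact: H.
split => //; apply: EFin_inj; rewrite -!integral_intg//.
transitivity (\int[m1]_(x in A) \int[m2]_(y in B) (f (x, y))%:E)%E.
  apply: ae_eq_integral => //; [exact: measurable_int i1'|exact: measurable_int i1|].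
  by move: a1; apply: filterS => x H Ax; rewrite /= integral_intg//; exact: H.
rewrite fubini_eq; apply: ae_eq_integral => //; [exact: measurable_int i2|exact: measurable_int i2'|].
by move: a2; apply: filterS => y H By; rewrite /= integral_intg//; exact: H.
Qed.

End fubini_real.

(** * Lebesgue spaces through integrable powers *)

Section Lfun_char.
Context d (T : measurableType d) (R : realType) (mu : {measure set T -> \bar R}).
Variable D : set T.
Hypothesis mD : measurable D.

Lemma Lfun2P (f : T -> R) : (f \_ D) \in Lfun mu 2%:E <-> sqi mu D f.
Proof.
have E (x : T) : ((f \_ D) x ^+ 2)%:E = ((EFin \o (fun x => f x ^+ 2)) \_ D) x.
  by rewrite /= !patchE; case: ifPn => // _; rewrite expr0n.
split=> [fL|[mf fi]].
  have fi := Lfun2_integrable_sqr fL.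
  move: fL; rewrite inE => /andP[]; rewrite inE/= => mf _.
  split; first exact/measurable_restrictT.
  apply/(integrable_mkcond _ mD); apply: eq_integrable fi => // x _ /=.
  by rewrite E.
rewrite inE; apply/andP; split; rewrite inE/=; first exact: (measurable_restrictT _ mD).1 mf.
rewrite /finite_norm unlock poweR_lty//.
move/(integrable_mkcond _ mD)/integrableP: fi => [_]; apply: le_lt_trans.
rewrite le_eqVlt; apply/orP; left; apply/eqP; apply: eq_integral => x _.
rewrite -E /= powR_mulrn// real_normK ?num_real//.
by rewrite ger0_norm // sqr_ge0.
Qed.

Lemma Lnorm2E (f : T -> R) : sqi mu D f ->
  fine ('N[mu]_2%:E[EFin \o (f \_ D)])%E = n2 mu D f.
Proof.
move=> [mf fi]; rewrite unlock.
have -> : (\int[mu]_x (`|(EFin \o f \_ D) x| `^ 2))%E = (\int[mu]_(x in D) f x ^+ 2)%:E.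
  rewrite -integral_intg// [RHS]integral_mkcond; apply: eq_integral => x _ /=.
  rewrite powR_mulrn// real_normK ?num_real//.
  by rewrite !patchE; case: ifPn => // _; rewrite expr0n.
by rewrite poweR_EFin /= powR12_sqrt// Rintegral_ge0// => x _; exact: sqr_ge0.
Qed.

Lemma LfunrW (f : T -> R) (r : R) : 1 <= r -> (f \_ D) \in Lfun mu r%:E ->
  measurable_fun D f /\ intg mu D (fun x => `|f x| `^ r).
Proof.
move=> r1 fL; have fi := Lfun_integrable r1 fL.
move: fL; rewrite inE => /andP[]; rewrite inE/= => mf _.
split; first exact/measurable_restrictT.
apply/(integrable_mkcond _ mD); apply: eq_integrable fi => // x _ /=.
rewrite !patchE; case: ifPn => // _; rewrite normr0 powR0// gt_eqF//.
exact: lt_le_trans r1.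
Qed.

Lemma Lfun1W (f : T -> R) : (f \_ D) \in Lfun mu 1%:E -> intg mu D f.
Proof.
move=> /Lfun1_integrable fi; apply/(integrable_mkcond _ mD).
by apply: eq_integrable fi => // x _; rewrite restrict_EFin.
Qed.

Lemma LfunyW (f : T -> R) : (f \_ D) \in Lfun mu +oo%E ->
  measurable_fun D f /\ exists M, {ae mu, forall x, D x -> `|f x| <= M}.
Proof.
rewrite inE => /andP[]; rewrite inE/= => mf; rewrite inE/= /finite_norm unlock.
move=> fy; split; first exact/measurable_restrictT.
(* The norm at [+oo] is the essential supremum only when the total mass is positive; on a null space
   every statement holds almost everywhere. *)
have [mu0|mu0] := ltP 0%E (mu setT); last first.
  exists 0; have : mu setT = 0%E by apply/eqP; rewrite eq_le mu0 measure_ge0.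
  by move=> m0; exists setT; split.
move: fy; rewrite mu0 => fy.
have [M HM] : exists M : R, (ess_sup_inf.ess_sup mu (abse \o (EFin \o f \_ D)) <= M%:E)%E.
  move: fy; case: (ess_sup_inf.ess_sup _ _) => [r _|//|_]; first by exists r.
  by exists 0; rewrite leNye.
exists M; move/ess_sup_inf.ess_supP : HM; apply: filterS => x /= H Dx.
by move: H; rewrite patchE mem_set// lee_fin.
Qed.

End Lfun_char.

(** * Translation and reflection invariance of the planar measure *)

Section plane_measure.
Context {R : realType}.
Notation pt := (R * R)%type.
Notation leb := (@lebesgue_measure R).
Notation mu2 := (@mu2 R).

(** By uniqueness of Lebesgue measure it is enough to compare the image measure on half-open
    intervals. *)
Lemma leb_translate (a : R) (A : set (measurableTypeR R)) : measurable A ->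
  leb ((fun x => x + a) @^-1` A) = leb A.
Proof.
move=> mA; have ma : measurable_fun setT ((fun x => x + a) : measurableTypeR R -> measurableTypeR R).
  exact: measurable_funD.
have := @lebesgue_measure_unique R (pushforward leb ((fun x => x + a) : measurableTypeR R -> measurableTypeR R)).
move=> /(_ _ _ A mA) -> // X [[u v] _ <-]/=.
rewrite /pushforward (_ : _ @^-1` _ = `](u - a), (v - a)]%classic); last first.
  by apply/funext => x /=; rewrite !in_itv/= ltrBlDr lerBrDr.
rewrite !lebesgue_measure_itv/= !lte_fin ltrD2r; case: ifPn => // _.
by rewrite -!EFinB; congr _%:E; ring.
Qed.

Lemma leb_reflect (A : set (measurableTypeR R)) : measurable A ->
  leb (-%R @^-1` A) = leb A.
Proof.
move=> mA.
have := @lebesgue_measure_unique R (pushforward leb (-%R : measurableTypeR R -> measurableTypeR R)).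
move=> /(_ _ _ A mA) -> // X [[u v] _ <-]/=.
rewrite /pushforward (_ : _ @^-1` _ = `[(- v), (- u)[%classic); last first.
  by apply/funext => x /=; rewrite !in_itv/= andbC lerNl ltrNr.
rewrite !lebesgue_measure_itv/= !lte_fin ltrN2; case: ifPn => // _.
by rewrite -!EFinB; congr _%:E; ring.
Qed.

Lemma mu2_rect (X Y : set (measurableTypeR R)) : measurable X -> measurable Y ->
  mu2 (X `*` Y) = (leb X * leb Y)%E.
Proof. by move=> mX mY; exact: (@product_measure1E _ _ _ _ R leb leb X Y mX mY). Qed.

(** A product measure is determined by its values on measurable rectangles, where invariance holds
    factor by factor. *)
Lemma mu2_translate (h : pt) (A : set (measurableTypeR R * measurableTypeR R)) :
  measurable A -> mu2 ((fun x : pt => x + h) @^-1` A) = mu2 A.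
Proof.
move=> mA.
have mh : measurable_fun setT ((fun x => x + h) : measurableTypeR R * measurableTypeR R -> measurableTypeR R * measurableTypeR R).
  apply/measurable_fun_pairP; split.
    by rewrite (_ : _ \o _ = (fun x => x.1 + h.1))//; apply: measurable_funD => //.
  by rewrite (_ : _ \o _ = (fun x => x.2 + h.2))//; apply: measurable_funD => //.
have := @product_measure_unique _ _ _ _ R leb leb (pushforward mu2 ((fun x => x + h) : measurableTypeR R * measurableTypeR R -> measurableTypeR R * measurableTypeR R)).
move=> H; rewrite [RHS](H mh _ A mA)// => X Y mX mY.
have mt (a : R) (Z : set (measurableTypeR R)) : measurable Z -> measurable ((fun x => x + a) @^-1` Z).
  move=> mZ; rewrite -[X in measurable X]setTI.
  have : measurable_fun setT ((fun x => x + a) : measurableTypeR R -> measurableTypeR R) by exact: measurable_funD.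
  exact.
transitivity (mu2 (((fun x => x + h.1) @^-1` X) `*` ((fun x => x + h.2) @^-1` Y))); first by [].
by rewrite (mu2_rect (mt _ _ mX) (mt _ _ mY)); congr (_ * _)%E; exact: leb_translate.
Qed.

Lemma mu2_reflect (A : set (measurableTypeR R * measurableTypeR R)) :
  measurable A -> mu2 ((fun x : pt => - x) @^-1` A) = mu2 A.
Proof.
move=> mA.
have mh : measurable_fun setT ((fun x => - x) : measurableTypeR R * measurableTypeR R -> measurableTypeR R * measurableTypeR R).
  apply/measurable_fun_pairP; split.
    by rewrite (_ : _ \o _ = (fun x => - x.1))//; apply: measurableT_comp.
  by rewrite (_ : _ \o _ = (fun x => - x.2))//; apply: measurableT_comp.
have := @product_measure_unique _ _ _ _ R leb leb (pushforward mu2 ((fun x => - x) : measurableTypeR R * measurableTypeR R -> measurableTypeR R * measurableTypeR R)).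
move=> H; rewrite [RHS](H mh _ A mA)// => X Y mX mY.
have mt (Z : set (measurableTypeR R)) : measurable Z -> measurable (-%R @^-1` Z).
  move=> mZ; rewrite -[X in measurable X]setTI.
  have : measurable_fun setT (-%R : measurableTypeR R -> measurableTypeR R) by [].
  exact.
transitivity (mu2 ((-%R @^-1` X) `*` (-%R @^-1` Y))); first by [].
by rewrite (mu2_rect (mt _ mX) (mt _ mY)); congr (_ * _)%E; exact: leb_reflect.
Qed.

End plane_measure.

(** * Test functions and the fundamental lemma *)

Section Ck_theory.
Context {R : realType}.
Implicit Type V : normedModType R.

Lemma Ck_continuous V k (f : V -> R) : Ck k f -> continuous f.
Proof. by case: k => [|k] []. Qed.

Lemma Ck_derivable V k (f : V -> R) v x : Ck k.+1 f -> derivable f x v.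
Proof. by move=> [_ /(_ v)[]]. Qed.

Lemma Ck_derive V k (f : V -> R) v : Ck k.+1 f -> Ck k (fun x => 'D_v f x).
Proof. by move=> [_ /(_ v)[]]. Qed.

Lemma CkW V k (f : V -> R) : Ck k.+1 f -> Ck k f.
Proof.
elim: k f => [|k IH] f [cf df]; first by split.
by split=> // v; have [dv Dv] := df v; split => //; exact: IH.
Qed.

Lemma Ck_cst V k (c : R) : Ck k (fun _ : V => c).
Proof.
elim: k c => [|k IH] c; split => //; try exact: cst_continuous.
move=> v; split=> [x|]; first exact: derivable_cst.
rewrite (_ : 'D_v _ = fun=> 0)//; apply/funext => x; exact: derive_cst.
Qed.

Lemma CkD V k (f g : V -> R) : Ck k f -> Ck k g -> Ck k (fun x => f x + g x).
Proof.
elim: k f g => [|k IH] f g [cf df] [cg dg].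
  by split => // x; apply: continuousD; [exact: cf|exact: cg].
split; first by move=> x; apply: continuousD; [exact: cf|exact: cg].
move=> v; have [dvf Dvf] := df v; have [dvg Dvg] := dg v; split.
  by move=> x; exact: derivableD.
rewrite (_ : (fun x => _) = fun x => 'D_v f x + 'D_v g x); first exact: IH.
by apply/funext => x; exact: deriveD.
Qed.

Lemma CkM V k (f g : V -> R) : Ck k f -> Ck k g -> Ck k (fun x => f x * g x).
Proof.
elim: k f g => [|k IH] f g fk gk; case: (fk) (gk) => cf df [cg dg].
  by split => // x; apply: continuousM; [exact: cf|exact: cg].
split; first by move=> x; apply: continuousM; [exact: cf|exact: cg].
move=> v; have [dvf Dvf] := df v; have [dvg Dvg] := dg v; split.
  by move=> x; exact: derivableM.
rewrite (_ : (fun x => _) = fun x => f x * 'D_v g x + g x * 'D_v f x).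
  by apply: CkD; apply: IH => //; exact: CkW.
by apply/funext => x; exact: deriveM.
Qed.

Lemma CkZ V k c (f : V -> R) : Ck k f -> Ck k (fun x => c * f x).
Proof. by move=> fk; apply: CkM => //; exact: Ck_cst. Qed.

Lemma CkN V k (f : V -> R) : Ck k f -> Ck k (fun x => - f x).
Proof.
move=> /(CkZ (-1)); congr (Ck _ _); apply/funext => x; exact: mulN1r.
Qed.

Lemma CkX V k n (f : V -> R) : Ck k f -> Ck k (fun x => f x ^+ n).
Proof.
move=> fk; elim: n => [|n IH].
  rewrite (_ : (fun x => _) = fun=> 1); [exact: Ck_cst|by apply/funext => x; rewrite expr0].
rewrite (_ : (fun x => _) = fun x => f x * f x ^+ n); first exact: CkM.
by apply/funext => x; rewrite exprS.
Qed.

Lemma is_deriveE V (f : V -> R) x v df : is_derive x v f df ->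
  derivable f x v /\ 'D_v f x = df.
Proof. by case. Qed.

Lemma derivable_shift V (f : V -> R) h x v : derivable f (x + h) v ->
  is_derive x v (fun y => f (y + h)) ('D_v f (x + h)).
Proof.
move=> df.
have E : (fun t : R => t^-1 *: (((fun y => f (y + h)) \o shift x) (t *: v) - f (x + h))) =
   (fun t : R => t^-1 *: ((f \o shift (x + h)) (t *: v) - f (x + h))).
  by apply/funext => t /=; rewrite addrA.
by split; rewrite /derivable/derive E.
Qed.

Lemma Ck_shift V k (f : V -> R) h : Ck k f -> Ck k (fun x => f (x + h)).
Proof.
elim: k f => [|k IH] f [cf df].
  split => // x; apply: (continuous_comp (f := fun x => x + h)); last exact: cf.
  by apply: continuousD; [exact: id|exact: cst_continuous].
split.
  move=> x; apply: (continuous_comp (f := fun x => x + h)); last exact: cf.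
  by apply: continuousD; [exact: id|exact: cst_continuous].
move=> v; have [dv Dv] := df v; split=> [x|].
  by case: (derivable_shift (dv (x + h))).
rewrite (_ : (fun x => _) = fun x => 'D_v f (x + h)); first exact: (IH _ Dv).
by apply/funext => x; have [_ ->] := is_deriveE (derivable_shift (dv (x + h))).
Qed.

(** Restriction to the line through [x] transports the one-variable rules to [V]. *)
Lemma deriv1P V (f : V -> R) x v :
  (derivable f x v <-> derivable (fun h : R => f (h *: v + x)) 0 1) /\
  'D_v f x = 'D_1 (fun h : R => f (h *: v + x)) 0.
Proof.
have E : (fun t : R => t^-1 *: ((f \o shift x) (t *: v) - f x)) =
   (fun t : R => t^-1 *: (((fun h : R => f (h *: v + x)) \o shift 0) (t *: 1) - f (0 *: v + x))).
  by apply/funext => t /=; rewrite scale0r add0r addr0 /GRing.scale/= mulr1.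
by split; rewrite /derivable /derive E.
Qed.

Lemma is_derive_comp1 (f g : R -> R) (x : R) : derivable f x 1 -> derivable g (f x) 1 ->
  derivable (g \o f) x 1 /\ 'D_1 (g \o f) x = 'D_1 f x * 'D_1 g (f x).
Proof.
move=> /derivableP df /derivableP dg.
have [d1 d2] := is_deriveE (is_derive1_comp dg df).
by split; [exact: d1|rewrite mulrC; exact: d2].
Qed.

(** Only the derivative of [f] along [v] is available, so the chain rule is obtained on the line
    through [x] rather than from a differential. *)
Lemma is_derive_chain V (f : V -> R) (g : R -> R) x v :
  derivable f x v -> derivable g (f x) 1 ->
  is_derive x v (g \o f) ('D_v f x * 'D_1 g (f x)).
Proof.
move=> df dg; pose f1 := fun h : R => f (h *: v + x).
have [df1 Ef1] := deriv1P f x v; have [dgf Egf] := deriv1P (g \o f) x v.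
have f10 : f1 0 = f x by rewrite /f1 scale0r add0r.
have d1 : derivable f1 0 1 := df1.1 df.
have d2 : derivable g (f1 0) 1 by rewrite f10.
have [d3 E3] := is_derive_comp1 d1 d2.
split; first exact: dgf.2 d3.
by rewrite Egf Ef1 -f10; exact: E3.
Qed.

Lemma Ck_comp V k (f : V -> R) (g : R -> R) : Ck k f -> Ck k g -> Ck k (g \o f).
Proof.
elim: k g => [|k IH] g fk gk; case: (fk) (gk) => cf df [cg dg].
  by split => // x; apply: continuous_comp; [exact: cf|exact: cg].
split; first by move=> x; apply: continuous_comp; [exact: cf|exact: cg].
move=> v; have [dvf Dvf] := df v; have [d1g D1g] := dg 1; split=> [x|].
  by case: (is_derive_chain (dvf x) (d1g (f x))).
rewrite (_ : (fun x => _) = fun x => 'D_v f x * ((fun y => 'D_1 g y) \o f) x).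
  by apply: CkM => //; apply: IH => //; exact: CkW.
by apply/funext => x; have [_ ->] := is_deriveE (is_derive_chain (dvf x) (d1g (f x))).
Qed.

(** In one variable a derivative along 1 is a full differential, so the derivative along [v] is [v]
    times it. *)
Lemma Ck_1d k (g g' : R -> R) : (forall x : R, is_derive x (1 : R) g (g' x)) -> Ck k g' ->
  Ck k.+1 g.
Proof.
move=> dg g'k.
have dif x : differentiable g x by apply/derivable1_diffP; case: (dg x).
split; first by move=> x; exact: differentiable_continuous.
move=> v; split=> [x|]; first exact: diff_derivable.
rewrite (_ : (fun x => _) = fun x => v * g' x); first exact: CkZ.
apply/funext => x; rewrite deriveE// diff1E//= derive1E.
by have [_ ->] := is_deriveE (dg x); rewrite /GRing.scale/=.
Qed.

Lemma Ck_cst_mul k (c : R) : Ck k (fun x : R => c * x).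
Proof.
case: k => [|k].
  by split => // x; apply: continuousM; [exact: cst_continuous|exact: id].
apply: (@Ck_1d k _ (fun=> c)); last exact: Ck_cst.
by move=> x; have := @is_deriveZ R R R id c x 1 1 (is_derive_id _ _); rewrite /GRing.scale/= mulr1.
Qed.

Lemma Ck_id k : Ck k (id : R -> R).
Proof.
rewrite (_ : id = fun x : R => 1 * x); first exact: Ck_cst_mul.
by apply/funext => x; rewrite mul1r.
Qed.

Lemma CkV V k (f : V -> R) : (forall x, f x != 0) -> Ck k f -> Ck k (fun x => (f x)^-1).
Proof.
move=> f0; elim: k => [|k IH] fk; case: (fk) => cf df.
  by split => // x; apply: continuousV; [exact: f0|exact: cf].
split; first by move=> x; apply: continuousV; [exact: f0|exact: cf].
move=> v; have [dvf Dvf] := df v; split=> [x|]; first exact: derivableV.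
have E : (fun x => 'D_v (fun x => (f x)^-1) x) = fun x => - ((f x)^-1 ^+ 2 * 'D_v f x).
  apply/funext => x; rewrite (deriveV (f0 x) (dvf x)) /GRing.scale/=.
  by rewrite -exprVn mulNr.
rewrite E; apply: CkN; apply: CkM => //; apply: CkX; exact: IH (CkW fk).
Qed.

Lemma Ck_fst k : Ck k (fst : R * R -> R).
Proof.
have d x v : is_derive x v (fst : R * R -> R) v.1.
  have E : (fun t : R => t^-1 *: (((fst : R * R -> R) \o shift x) (t *: v) - x.1)) @ 0^' --> v.1.
    apply/cvgrPdist_lt => e e0; near=> t.
    have t0 : t != 0 by near: t; exact: nbhs_dnbhs_neq.
    by rewrite /= addrK scalerA mulVf// scale1r subrr normr0.
  by split; [apply/cvg_ex; exists v.1|apply/cvg_lim].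
case: k => [|k]; split => //; [move=> x; exact: cvg_fst|move=> x; exact: cvg_fst|].
move=> v; split=> [x|]; first by case: (d x v).
rewrite (_ : (fun x => _) = fun=> v.1); first exact: Ck_cst.
by apply/funext => x; have [_ ->] := is_deriveE (d x v).
Unshelve. all: by end_near. Qed.

Lemma Ck_snd k : Ck k (snd : R * R -> R).
Proof.
have d x v : is_derive x v (snd : R * R -> R) v.2.
  have E : (fun t : R => t^-1 *: (((snd : R * R -> R) \o shift x) (t *: v) - x.2)) @ 0^' --> v.2.
    apply/cvgrPdist_lt => e e0; near=> t.
    have t0 : t != 0 by near: t; exact: nbhs_dnbhs_neq.
    by rewrite /= addrK scalerA mulVf// scale1r subrr normr0.
  by split; [apply/cvg_ex; exists v.2|apply/cvg_lim].
case: k => [|k]; split => //; [move=> x; exact: cvg_snd|move=> x; exact: cvg_snd|].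
move=> v; split=> [x|]; first by case: (d x v).
rewrite (_ : (fun x => _) = fun=> v.2); first exact: Ck_cst.
by apply/funext => x; have [_ ->] := is_deriveE (d x v).
Unshelve. all: by end_near. Qed.

End Ck_theory.

(** * Smooth step functions *)

Section smooth_step.
Context {R : realType}.

(* The powers of x^-1 make this family closed under differentiation. *)
Definition flat (n : nat) (x : R) : R := if 0 < x then x^-1 ^+ n * expR (- x^-1) else 0.

Lemma flat_ge0 n x : 0 <= flat n x.
Proof.
by rewrite /flat; case: ifPn => // x0; rewrite mulr_ge0 ?expR_ge0// exprn_ge0// invr_ge0 ltW.
Qed.

Lemma flat_le0 n x : x <= 0 -> flat n x = 0.
Proof. by rewrite /flat ltNge => ->. Qed.

Lemma flat_gt0 n x : 0 < x -> 0 < flat n x.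
Proof. by move=> x0; rewrite /flat x0 mulr_gt0 ?expR_gt0// exprn_gt0// invr_gt0. Qed.

(** With [y = x^-1], the exponential of [y] is at least [(y / n.+1%:R) ^+ n.+1]. The difference
    quotient of [flat n] at 0 is [flat n.+1], so this bound gives the derivative there. *)
Lemma flat_bound n (x : R) : flat n x <= n.+1%:R ^+ n.+1 * `|x|.
Proof.
rewrite /flat; case: ifPn => x0; last by rewrite mulr_ge0// exprn_ge0.
rewrite gtr0_norm//; set y := x^-1; have y0 : 0 < y by rewrite invr_gt0.
have n0 : (0 : R) < n.+1%:R by rewrite ltr0n.
have H : (y / n.+1%:R) ^+ n.+1 <= expR y.
  have -> : expR y = expR (y / n.+1%:R) ^+ n.+1.
    by rewrite -expRM_natl -mulr_natl mulrC divfK// gt_eqF.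
  rewrite ler_pXn2r ?nnegrE ?expR_ge0//; last by rewrite divr_ge0// ltW.
  by rewrite (le_trans _ (expR_ge1Dx _))// lerDr.
have -> : x = y^-1 by rewrite invrK.
rewrite expRN ler_pdivrMr ?expR_gt0// mulrAC ler_pdivlMr//.
rewrite -exprSr (le_trans _ (ler_wpM2l _ H))//.
by rewrite -exprMn [_ * (y / _)]mulrC divfK// gt_eqF.
Qed.

Lemma flat_derive n (x : R) : is_derive x 1 (flat n) (flat n.+2 x - n%:R * flat n.+1 x).
Proof.
have [x0|x0|->] := ltgtP x 0.
- have -> : flat n.+2 x - n%:R * flat n.+1 x = 0.
    by rewrite !flat_le0 ?ltW// mulr0 subr0.
  apply: (near_eq_is_derive (f := cst 0) _ (is_derive_cst _ _ _)).
  near=> y; rewrite flat_le0//; apply: ltW; near: y.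
  exact: lt_nbhsl.
- pose f : R -> R := fun x => (x^-1 ^+ n) * expR (- x^-1).
  apply: (@near_eq_is_derive _ _ _ f).
    near=> y; rewrite /flat/f ifT//; near: y.
    exact: lt_nbhsr.
  have xn0 : x != 0 by rewrite gt_eqF.
  have dV : is_derive x 1 (fun y : R => y^-1) (- x ^- 2).
    split; first by apply: derivableV => //; exact: derivable_id.
    by rewrite deriveV//; rewrite derive_id /GRing.scale/= mulr1.
  have dE : is_derive x 1 (fun y : R => expR (- y^-1)) (x ^- 2 * expR (- x^-1)).
    have dN : is_derive x 1 (fun y : R => - y^-1) (x ^- 2).
      by rewrite -[X in is_derive _ _ _ X]opprK; exact: is_deriveN.
    have [dN1 dN2] := is_deriveE dN; have [dE1 dE2] := is_deriveE (is_derive_expR (- x^-1)).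
    by have := is_derive_chain (g := expR) dN1 dE1; rewrite dN2 dE2.
  have dX : is_derive x 1 (fun y : R => y^-1 ^+ n) (n%:R * x^-1 ^+ n.-1 * - x ^- 2).
    have := is_deriveX (f := fun y : R => y^-1) n dV.
    by rewrite exprfctE /GRing.scale/=.
  have := is_deriveM dX dE; rewrite /GRing.scale/= /flat x0 => H.
  apply: is_derive_eq H _.
  clear dX f; rewrite -!exprVn; move: (x^-1) (expR _) => y E.
  case: n => [|n] /=; first by rewrite !mul0r !expr0 mulr0 subr0 mul1r addr0.
  by rewrite !exprS; ring.
- have -> : flat n.+2 0 - n%:R * flat n.+1 0 = 0 by rewrite !flat_le0// mulr0 subr0.
  have E : (fun t : R => t^-1 *: ((flat n \o shift 0) (t *: 1) - flat n 0)) @ 0^' --> (0 : R).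
    apply/cvgr0Pnorm_le => e e0; near=> t.
    have t0 : t != 0 by near: t; exact: nbhs_dnbhs_neq.
    rewrite /= addr0 /GRing.scale/= mulr1 (flat_le0 n (lexx 0)) subr0.
    have -> : t^-1 * flat n t = flat n.+1 t.
      by rewrite /flat; case: ifPn => _; rewrite ?mulr0// exprS mulrA.
    rewrite ger0_norm ?flat_ge0//; apply: le_trans (flat_bound _ _) _.
    have c0 : (0 : R) < n.+2%:R ^+ n.+2 by rewrite exprn_gt0// ltr0n.
    rewrite mulrC -ler_pdivlMr//; near: t.
    by apply: dnbhs0_le; rewrite divr_gt0.
  by split; [apply/cvg_ex; exists 0|apply/cvg_lim].
Unshelve. all: by end_near. Qed.

Lemma Ck_flat k n : Ck k (flat n).
Proof.
elim: k n => [|k IH] n.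
  split => // x; apply: differentiable_continuous; apply/derivable1_diffP.
  by case: (flat_derive n x).
apply: (@Ck_1d _ _ _ (fun x => flat n.+2 x - n%:R * flat n.+1 x)); first exact: flat_derive.
by apply: CkD => //; apply: CkN; apply: CkZ.
Qed.

(** The denominator never vanishes, because [x] and [1 - x] are not both nonpositive; the quotient
    passes smoothly from 0 on the left of 0 to 1 on the right of 1. *)
Definition step (x : R) : R := flat 0 x / (flat 0 x + flat 0 (1 - x)).

Lemma step_den x : 0 < flat 0 x + flat 0 (1 - x).
Proof.
have [x0|x0] := ltP 0 x; first by rewrite ltr_pwDl ?flat_gt0 ?flat_ge0.
by rewrite ltr_wpDl ?flat_ge0// flat_gt0// subr_gt0 (le_lt_trans x0).
Qed.

Lemma Ck_step k : Ck k step.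
Proof.
apply: CkM; first exact: Ck_flat.
apply: CkV => [x|]; first by rewrite gt_eqF// step_den.
apply: CkD; first exact: Ck_flat.
have H : Ck k (fun x : R => 1 + (-1) * x) by apply: CkD; [exact: Ck_cst|exact: Ck_cst_mul].
have := Ck_comp H (Ck_flat k 0); congr (Ck _ _); apply/funext => x.
by rewrite /= mulN1r.
Qed.

Lemma step_le0 x : x <= 0 -> step x = 0.
Proof. by move=> x0; rewrite /step flat_le0// mul0r. Qed.

Lemma step_ge1 x : 1 <= x -> step x = 1.
Proof.
move=> x1; rewrite /step (@flat_le0 0 (1 - x)) ?subr_le0// addr0 divff// gt_eqF//.
exact/flat_gt0/(lt_le_trans ltr01).
Qed.

Lemma step_itv x : 0 <= step x <= 1.
Proof.
have d := step_den x; apply/andP; split; first by rewrite divr_ge0 ?flat_ge0// ltW.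
by rewrite /step ler_pdivrMr// mul1r lerDl flat_ge0.
Qed.

End smooth_step.

(** * Boxes and measurability in the plane *)

Section plane_topology.
Context {R : realType}.
Notation pt := (R * R)%type.
Notation mpt := (measurableTypeR R * measurableTypeR R)%type.
Notation leb := (@lebesgue_measure R).
Notation mu2 := (@mu2 R).

Definition obox (a b c d : R) : set mpt := `]a, b[%classic `*` `]c, d[%classic.

Lemma measurable_obox a b c d : measurable (obox a b c d).
Proof. exact: measurableX. Qed.

Lemma oboxP a b c d (x : pt) : obox a b c d x <-> [/\ a < x.1, x.1 < b, c < x.2 & x.2 < d].
Proof.
rewrite /obox; split=> [[/=]|[h1 h2 h3 h4]]; last by split; rewrite /= in_itv/= ?h1 ?h2 ?h3 ?h4.
by rewrite !in_itv/= => /andP[? ?] /andP[? ?].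
Qed.

Lemma pt_normE (x : pt) : `|x| = Num.max `|x.1| `|x.2|.
Proof. by []. Qed.

Lemma pt_ballP (x : pt) e y : ball x e y <-> [/\ x.1 - e < y.1, y.1 < x.1 + e, x.2 - e < y.2 & y.2 < x.2 + e].
Proof.
split.
  move=> [/=]; rewrite -!ball_normE /ball_/= !ltr_distl => /andP[h1 h2] /andP[h3 h4].
  by split; lra.
move=> [h1 h2 h3 h4]; split; rewrite /= -!ball_normE /ball_/= !ltr_distl; apply/andP; split; lra.
Qed.

Definition ratbox (q : rat * rat * (rat * rat)) : set mpt :=
  obox (ratr q.1.1) (ratr q.1.2) (ratr q.2.1) (ratr q.2.2).

Definition cbox (a b c d : R) : set pt := `[a, b]%classic `*` `[c, d]%classic.

Lemma obox_cbox a b c d : obox a b c d `<=` cbox a b c d.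
Proof. by move=> x /oboxP[? ? ? ?]; split; rewrite /= in_itv/=; apply/andP; split; exact: ltW. Qed.

Lemma compact_cbox a b c d : compact (cbox a b c d).
Proof. by apply: compact_setX; exact: segment_compact. Qed.

Definition cratbox (q : rat * rat * (rat * rat)) : set pt :=
  cbox (ratr q.1.1) (ratr q.1.2) (ratr q.2.1) (ratr q.2.2).

Lemma open_cratbox (U : set pt) (x : pt) : open U -> U x ->
  exists2 q, ratbox q x & cratbox q `<=` U.
Proof.
move=> oU Ux; have /nbhs_ballP[e /= e0 xU] : nbhs x U by exact: open_nbhs_nbhs.
have Q a : exists q : rat, a - e < ratr q < a.
  by have [|q] := @rat_in_itvoo R (a - e) a; [rewrite gtrBl|rewrite in_itv/=; exists q].
have Q' a : exists q : rat, a < ratr q < a + e.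
  by have [|q] := @rat_in_itvoo R a (a + e); [rewrite ltrDl|rewrite in_itv/=; exists q].
have [a /andP[a1 a2]] := Q x.1; have [b /andP[b1 b2]] := Q' x.1.
have [c /andP[c1 c2]] := Q x.2; have [d /andP[d1 d2]] := Q' x.2.
exists (a, b, (c, d)); first by apply/oboxP.
move=> y [/=]; rewrite !in_itv/= => /andP[h1 h2] /andP[h3 h4].
by apply: xU; apply/pt_ballP; split; lra.
Qed.

Lemma open_ratbox (U : set pt) (x : pt) : open U -> U x ->
  exists2 q, ratbox q x & ratbox q `<=` U.
Proof.
move=> oU Ux; have [q qx qU] := open_cratbox oU Ux; exists q => //.
by apply: subset_trans qU; exact: obox_cbox.
Qed.

(** Boxes with rational corners are enumerated through [unpickle]; indices that do not code a box
    inside [U] contribute the empty set. *)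
Lemma open_bigcup_ratbox (U : set pt) : open U ->
  U = \bigcup_(n : nat) (if unpickle n is Some q then
    if `[< ratbox q `<=` U >] then ratbox q else set0 else set0).
Proof.
move=> oU; rewrite eqEsubset; split=> x.
  move=> Ux; have [q qx qU] := open_ratbox oU Ux.
  by exists (pickle q); [exact: I|rewrite pickleK asboolT].
by move=> [n _]; case: (unpickle n) => // q; case: asboolP => // H Hx; exact: H.
Qed.

Lemma open_measurable2 (U : set pt) : open U -> measurable (U : set mpt).
Proof.
move=> oU; rewrite (open_bigcup_ratbox oU); apply: bigcup_measurable => n _.
case: (unpickle n) => // q; case: asboolP => // _; exact: measurable_obox.
Qed.

Lemma continuous_measurable2 (f : pt -> R) : continuous f ->
  measurable_fun setT (f : mpt -> R).
Proof.
move=> /continuousP cf; apply: (measurability _ (RGenOpens.measurableE R)).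
move=> _ [_ [a [b ->] <-]]; rewrite setTI; apply: open_measurable2.
by apply: cf; exact: interval_open.
Qed.

Lemma mu2_obox_lty a b c d : (mu2 (obox a b c d) < +oo)%E.
Proof.
rewrite mu2_rect//= !lebesgue_measure_itv/= lte_mul_pinfty//.
- by case: ifPn => // ab; rewrite lee_fin subr_ge0 ltW.
- by case: ifPn.
- by case: ifPn => // _; rewrite ltry.
Qed.

Lemma bounded_mu2 (D : set pt) : bounded_set D -> measurable (D : set mpt) ->
  (mu2 D < +oo)%E.
Proof.
move=> [M [Mr HM]] mD.
pose r := `|M| + 2; have Mr' : M < `|M| + 1 by rewrite ltr_pwDr// ler_norm.
have DB : D `<=` obox (- r) r (- r) r.
  move=> x Dx; have := HM _ Mr' x Dx; rewrite /= pt_normE ge_max.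
  rewrite !ler_norml => /andP[/andP[h1 h2] /andP[h3 h4]]; apply/oboxP; rewrite /r.
  by split; lra.
apply: le_lt_trans (mu2_obox_lty (- r) r (- r) r).
by apply: le_measure => //; rewrite inE//; exact: measurable_obox.
Qed.

Lemma compact_measurable2 (K : set pt) : compact K -> measurable (K : set mpt).
Proof.
move=> cK; rewrite -[K]setCK; apply: measurableC; apply: open_measurable2.
by apply: closed_openC; exact: compact_closed.
Qed.

Lemma compact_mu2 (K : set pt) : compact K -> (mu2 K < +oo)%E.
Proof.
move=> cK; apply: bounded_mu2; first exact: compact_bounded.
exact: compact_measurable2.
Qed.

End plane_topology.

(** * Calculus of test functions *)

Section test_functions.
Context {R : realType}.
Variable V : normedModType R.
Implicit Types (D : set V) (f g : V -> R).

Lemma testfunS D E f : D `<=` E -> testfun D f -> testfun E f.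
Proof.
by move=> DE [fk [K [cK KD K0]]]; split => //; exists K; split => // x /KD; exact: DE.
Qed.

Lemma testfunM D f g : (forall k, Ck k g) -> testfun D f -> testfun D (fun x => f x * g x).
Proof.
move=> gk [fk [K [cK KD K0]]]; split; first by move=> k; exact: CkM.
by exists K; split => // x Kx; rewrite K0 ?mul0r.
Qed.

Lemma testfunZ D a f : testfun D f -> testfun D (fun x => a * f x).
Proof.
move=> [fk [K [cK KD K0]]]; split; first by move=> k; exact: CkZ.
by exists K; split => // x Kx; rewrite K0 ?mulr0.
Qed.

Lemma testfunD D f g : testfun D f -> testfun D g -> testfun D (fun x => f x + g x).
Proof.
move=> [fk [K [cK KD K0]]] [gk [L [cL LD L0]]]; split; first by move=> k; exact: CkD.
exists (K `|` L); split; first exact: compactU.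
  by move=> x [/KD|/LD].
by move=> x /not_orP[Kx Lx]; rewrite K0// L0// addr0.
Qed.

Lemma testfunN D f : testfun D f -> testfun D (fun x => - f x).
Proof.
move=> /(testfunZ (-1)); congr (testfun _ _); apply/funext => x; exact: mulN1r.
Qed.

Lemma testfun_bounded D f : testfun D f -> exists2 M, 0 <= M & forall x, `|f x| <= M.
Proof.
move=> [fk [K [cK KD K0]]].
have cf := Ck_continuous (fk 0%N).
have : compact (f @` K) by apply: continuous_compact => //; apply: continuous_subspaceT.
move/compact_bounded => [M [Mr HM]].
exists (`|M| + 1); first by rewrite addr_ge0.
move=> x; have [Kx|Kx] := pselect (K x); last by rewrite K0// normr0 addr_ge0.
by apply: (HM (`|M| + 1)); [rewrite ltr_pwDr// ler_norm|exists x].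
Qed.

Lemma testfun_derive D f v : testfun D f -> testfun D (fun x => 'D_v f x).
Proof.
move=> [fk [K [cK KD K0]]]; split; first by move=> k; exact: Ck_derive.
exists K; split => // x Kx.
have oK : open (~` K) by apply: closed_openC; exact: compact_closed.
rewrite -[RHS](derive_cst (0 : R) x v); apply: near_eq_derive.
have : nbhs x (~` K) by exact: open_nbhs_nbhs.
by apply: filterS => y /K0.
Qed.

Lemma testfun_shift D f h : testfun D f ->
  testfun [set x | D (x + h)] (fun x => f (x + h)).
Proof.
move=> [fk [K [cK KD K0]]]; split; first by move=> k; exact: Ck_shift.
exists ((fun x => x - h) @` K); split.
- apply: continuous_compact => //; apply: continuous_subspaceT => x.
  by apply: continuousB; [exact: id|exact: cst_continuous].
- by move=> _ [y Ky <-] /=; rewrite subrK; exact: KD.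
- move=> x Kx; apply: K0 => Kxh; apply: Kx; exists (x + h) => //.
  by rewrite addrK.
Qed.

Lemma derive_scale f x v c : derivable f x v -> 'D_(c *: v) f x = c * 'D_v f x.
Proof.
move=> df; have [d1 E1] := deriv1P f x v; have [d2 E2] := deriv1P f x (c *: v).
rewrite E2; pose f1 h := f (h *: v + x).
have -> : (fun h : R => f (h *: (c *: v) + x)) = f1 \o (fun h : R => c * h).
  by apply/funext => h /=; rewrite /f1 scalerA mulrC.
have Hc : is_derive (0 : R) (1 : R) (fun h : R => c * h) c.
  by have := @is_deriveZ R R R id c 0 1 1 (is_derive_id _ _); rewrite /GRing.scale/= mulr1.
have [Hc1 Hc2] := is_deriveE Hc.
have df1 : derivable f1 (c * 0) 1 by rewrite mulr0; exact: d1.1.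
by have [_ ->] := is_derive_comp1 Hc1 df1; rewrite Hc2 mulr0 E1.
Qed.

Lemma line_derive f x v (s : R) : derivable f (x + s *: v) v ->
  is_derive s (1 : R) (fun t : R => f (x + t *: v)) ('D_v f (x + s *: v)).
Proof.
move=> df; have [d1 E1] := deriv1P f (x + s *: v) v.
have E : (fun t : R => f (x + t *: v)) = (fun t => (fun h : R => f (h *: v + (x + s *: v))) (t + (- s))).
  apply/funext => t; congr f; rewrite scalerBl addrC [x + _]addrC addrA.
  by rewrite subrK.
have d2 : derivable (fun h : R => f (h *: v + (x + s *: v))) (s + - s) 1.
  by rewrite subrr; exact: d1.1.
by have := derivable_shift d2; rewrite -E subrr -E1.
Qed.

(** [Ck] speaks of directional derivatives only, so linearity in the direction has to be derived.
    The increment along [t *: (v + w)] is one along [t *: v] followed by one along [t *: w]; the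
    mean value theorem makes the latter a value of ['D_w f] near [x], where ['D_w f] is
    continuous. *)
Lemma deriveDv f x v w : Ck 1 f -> 'D_(v + w) f x = 'D_v f x + 'D_w f x.
Proof.
move=> fk; have dv y u : derivable f y u by exact: (@Ck_derivable _ _ 0%N).
have cw : continuous ('D_w f) by apply: (@Ck_continuous _ _ 0%N); exact: Ck_derive.
have H u : (fun t : R => t^-1 *: (f (t *: u + x) - f x)) @ 0^'+ --> 'D_u f x.
  exact: cvg_dnbhs_at_right (dv x u).
apply/eqP; rewrite -subr_eq0 -normr_le0.
apply/ler_addgt0Pl => e e0; rewrite addr0.
have e4 : 0 < e / 4 by rewrite divr_gt0.
have /cvgrPdist_lt /(_ _ e4) H1 := H (v + w).
have /cvgrPdist_lt /(_ _ e4) H2 := H v.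
have /cvgrPdist_lt /(_ _ e4) /nbhs_ballP[r /= r0 H3] := cw x.
have H4 : \forall t \near (0 : R)^'+, (`|t| * (`|v| + `|w|) < r).
  have : 0 < r / (`|v| + `|w| + 1) by rewrite divr_gt0// addr_gt0// ?addr_ge0 ltr_wpDl.
  move=> rp; near=> t.
  have t0 : 0 < t by near: t; exact: nbhs_right_gt.
  rewrite gtr0_norm//; apply: (@le_lt_trans _ _ (t * (`|v| + `|w| + 1))).
    by apply: ler_wpM2l; [exact: ltW|rewrite lerDl].
  rewrite -ltr_pdivlMr; last by rewrite ltr_wpDl// addr_ge0.
  by near: t; exact: nbhs_right_lt.
near (0 : R)^'+ => t.
have t0 : 0 < t by near: t; exact: nbhs_right_gt.
have h1 : `|'D_(v + w) f x - t^-1 *: (f (t *: (v + w) + x) - f x)| < e / 4 by near: t.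
have h2 : `|'D_v f x - t^-1 *: (f (t *: v + x) - f x)| < e / 4 by near: t.
have h4 : `|t| * (`|v| + `|w|) < r by near: t.
pose y := t *: v + x; pose g (s : R) := f (y + s *: w).
have gd s : is_derive s (1 : R) g ('D_w f (y + s *: w)) by exact: line_derive.
have cg : {within `[0, t], continuous g}.
  apply: continuous_subspaceT => s; apply: differentiable_continuous.
  by apply/derivable1_diffP; case: (gd s).
have [s] := MVT_segment (ltW t0) (fun s _ => gd s) cg.
rewrite in_itv/= subr0 => /andP[s0 st] E.
have h3 : `|'D_w f x - 'D_w f (y + s *: w)| < e / 4.
  apply: H3; rewrite -ball_normE /ball_/= /y opprD addrA opprD addrA.
  rewrite [x - _ - x]addrAC subrr sub0r -opprD normrN.
  apply: le_lt_trans h4; apply: le_trans (ler_normD _ _) _.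
  by rewrite !normrZ mulrDr lerD2l ler_wpM2r// !ger0_norm// ltW.
have E2 : t^-1 *: (f (t *: (v + w) + x) - f x) = t^-1 *: (f (t *: v + x) - f x) + 'D_w f (y + s *: w).
  have -> : f (t *: (v + w) + x) = g t by rewrite /g /y scalerDr addrAC.
  have -> : f (t *: v + x) = g 0 by rewrite /g /y scale0r addr0.
  have -> : 'D_w f (y + s *: w) = t^-1 *: (g t - g 0) by rewrite E /GRing.scale/= mulrC mulfK ?gt_eqF.
  by rewrite -scalerDr addrAC subrKC.
rewrite E2 in h1; move: h1 h2 h3; rewrite !ltr_norml !ler_norml.
move=> /andP[a1 a2] /andP[b1 b2] /andP[c1 c2].
by apply/andP; split; lra.
Unshelve. all: by end_near. Qed.

End test_functions.

Section dominated.
Context d (T : measurableType d) (R : realType) (mu : {measure set T -> \bar R}).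
Variable D : set T.
Hypothesis mD : measurable D.

Lemma dominated_Rint (f_ : nat -> T -> R) (f g : T -> R) :
  (forall n, measurable_fun D (f_ n)) -> measurable_fun D f ->
  {ae mu, forall x, D x -> f_ ^~ x @ \oo --> f x} ->
  intg mu D g -> (forall n x, D x -> `|f_ n x| <= g x) ->
  intg mu D f /\ (fun n => \int[mu]_(x in D) f_ n x) @ \oo --> \int[mu]_(x in D) f x.
Proof.
move=> mf_ mf fc gi fg.
have [|||||fi _ H] := @dominated_convergence _ _ _ mu D mD (fun n => EFin \o f_ n) (EFin \o f) (EFin \o g).
- by move=> n; exact/measurable_EFinP.
- exact/measurable_EFinP.
- move: fc; apply: filterS => x H Dx /=; have := H Dx => {}H.
  by apply/fine_cvgP; split; [exact: nearW|exact: H].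
- exact: gi.
- by apply: aeW => x n Dx /=; rewrite lee_fin fg.
have fi_ n : intg mu D (f_ n) by apply: intg_dom gi _ => // x; exact: fg.
split => //.
have E n : (\int[mu]_(x in D) (EFin \o f_ n) x)%E = (\int[mu]_(x in D) f_ n x)%:E.
  exact: integral_intg.
have {}H : ((\int[mu]_(x in D) f_ n x)%:E @[n --> \oo] --> (\int[mu]_(x in D) f x)%:E)%E.
  rewrite -integral_intg//; apply: cvg_trans H; apply: near_eq_cvg.
  by apply: nearW => n /=; rewrite -integral_intg.
by have [_] := (@fine_cvgP _ _ _ _ _ _).1 H.
Qed.

Lemma intg_restrict E (f : T -> R) : measurable E -> intg mu (D `&` E) f ->
  intg mu D (f \_ E).
Proof.
move=> mE fi; rewrite /intg -restrict_EFin; apply/integrable_restrict => //.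
Qed.

Lemma Rint_restrict E (f : T -> R) : \int[mu]_(x in D) (f \_ E) x = \int[mu]_(x in D `&` E) f x.
Proof. by rewrite Rintegral_mkcondr. Qed.

End dominated.

(** * Bump functions on boxes *)

Section box_tests.
Context {R : realType}.

(** The shift by 1 makes the function vanish within [n%:R^-1] of both endpoints, so that its support
    is compact in the open interval, while the pointwise limit is still the indicator of that
    interval. *)
Definition bump (a b : R) (n : nat) (x : R) : R :=
  step (n%:R * (x - a) - 1) * step (n%:R * (b - x) - 1).

Lemma Ck_bump a b n k : Ck k (bump a b n).
Proof.
have H (c e : R) : Ck k (fun x : R => step (c * x + e)).
  apply: (@Ck_comp R R k (fun x => c * x + e) step); last exact: Ck_step.
  by apply: CkD; [exact: Ck_cst_mul|exact: Ck_cst].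
apply: CkM.
  have := H n%:R (- (n%:R * a) - 1); congr (Ck _ _); apply/funext => x.
  by congr step; ring.
have := H (- n%:R) (n%:R * b - 1); congr (Ck _ _); apply/funext => x.
by congr step; ring.
Qed.

Lemma bump_itv a b n x : 0 <= bump a b n x <= 1.
Proof.
have /andP[h1 h2] := step_itv (n%:R * (x - a) - 1).
have /andP[h3 h4] := step_itv (n%:R * (b - x) - 1).
by rewrite /bump mulr_ge0//= mulr_ile1.
Qed.

Lemma bump_out a b n x : (0 < n)%N -> ~ (a + n%:R^-1 <= x <= b - n%:R^-1) -> bump a b n x = 0.
Proof.
move=> n0 /negP; rewrite negb_and -!ltNge.
have np : (0 : R) < n%:R by rewrite ltr0n.
case/orP => H; rewrite /bump.
  rewrite step_le0 ?mul0r// subr_le0 mulrC -ler_pdivlMr// mul1r; lra.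
rewrite [step (_ * (b - x) - 1)]step_le0 ?mulr0// subr_le0 mulrC -ler_pdivlMr// mul1r; lra.
Qed.

Lemma bump_cvg a b x : bump a b n x @[n --> \oo] --> (if a < x < b then 1 else 0 : R).
Proof.
case: ifPn => [/andP[ax xb]|H].
  apply: cvg_near_cst; near=> n.
  have n0 : (0 < n)%N by near: n; exact: nbhs_infty_gt.
  have [h1 h2] : 2 / (x - a) <= n%:R /\ 2 / (b - x) <= n%:R.
    by split; near: n; exact: nbhs_infty_ger.
  rewrite /bump !step_ge1 ?mulr1//.
    by rewrite lerBrDr -ler_pdivrMr ?subr_gt0//.
  by rewrite lerBrDr -ler_pdivrMr ?subr_gt0//.
apply: cvg_near_cst; near=> n.
have n0 : (0 < n)%N by near: n; exact: nbhs_infty_gt.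
apply: bump_out => // /andP[h1 h2]; move: H; rewrite negb_and -!leNgt.
have np : (0 : R) < n%:R^-1 by rewrite invr_gt0 ltr0n.
by case/orP => ?; lra.
Unshelve. all: by end_near. Qed.

Definition bump2 a b c d n (x : R * R) : R := bump a b n x.1 * bump c d n x.2.

Lemma testfun_bump2 (D : set (R * R)) a b c d n : (0 < n)%N ->
  obox a b c d `<=` D -> testfun D (bump2 a b c d n).
Proof.
move=> n0 BD; split=> [k|].
  apply: CkM.
    exact: (Ck_comp (Ck_fst k) (Ck_bump a b n k)).
  exact: (Ck_comp (Ck_snd k) (Ck_bump c d n k)).
have np : (0 : R) < n%:R^-1 by rewrite invr_gt0 ltr0n.
exists (`[a + n%:R^-1, b - n%:R^-1] `*` `[c + n%:R^-1, d - n%:R^-1]); split.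
- by apply: compact_setX; exact: segment_compact.
- move=> x [/=]; rewrite !in_itv/= => /andP[h1 h2] /andP[h3 h4]; apply/BD/oboxP.
  by split; lra.
- move=> x H; rewrite /bump2.
  have [K1|K1] := pselect (a + n%:R^-1 <= x.1 <= b - n%:R^-1); last first.
    by rewrite bump_out// mul0r.
  have [K2|K2] := pselect (c + n%:R^-1 <= x.2 <= d - n%:R^-1); last first.
    by rewrite [bump c d _ _]bump_out// mulr0.
  by exfalso; apply: H; split; rewrite /= in_itv.
Qed.

Lemma bump2_out a b c d n x : (0 < n)%N -> ~ obox a b c d x -> bump2 a b c d n x = 0.
Proof.
move=> n0 H; have [_ [K [_ KD K0]]] := testfun_bump2 n0 (@subset_refl _ (obox a b c d)).
by apply: K0 => /KD.
Qed.

Lemma bump2_itv a b c d n x : 0 <= bump2 a b c d n x <= 1.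
Proof.
have /andP[h1 h2] := bump_itv a b n x.1; have /andP[h3 h4] := bump_itv c d n x.2.
by rewrite /bump2 mulr_ge0//= mulr_ile1.
Qed.

Lemma bump2_cvg a b c d x : obox a b c d x -> bump2 a b c d n x @[n --> \oo] --> (1 : R).
Proof.
move=> /oboxP[h1 h2 h3 h4].
have H1 := @bump_cvg a b x.1; have H2 := @bump_cvg c d x.2.
rewrite h1 h2/= in H1; rewrite h3 h4/= in H2.
by rewrite -[X in _ --> X]mulr1 /bump2; exact: cvgM.
Qed.

End box_tests.

(** * The fundamental lemma of the calculus of variations *)

Section fundamental_lemma.
Context {R : realType}.
Notation pt := (R * R)%type.
Notation mpt := (measurableTypeR R * measurableTypeR R)%type.
Notation leb := (@lebesgue_measure R).
Notation mu2 := (@mu2 R).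

Definition oboxes : set (set mpt) := [set B | exists a b c d, B = obox a b c d].

(** Boxes are stable under intersection; once they generate the product sigma-algebra, Dynkin's
    theorem applies to them. Preimages of intervals under the projections are increasing unions of
    boxes. *)
Lemma oboxes_measurableE : @measurable _ mpt = <<s oboxes >>.
Proof.
rewrite eqEsubset; split; last first.
  apply: smallest_sub; first exact: sigma_algebra_measurable.
  by move=> _ [a [b [c [d ->]]]]; exact: measurable_obox.
pose GT := g_sigma_algebraType oboxes.
have sub (p : pt -> R) : (forall a b, <<s oboxes >> (p @^-1` `]a, b[%classic)) ->
    forall A : set (measurableTypeR R), measurable A -> <<s oboxes >> (p @^-1` A).
  move=> H A mA.
  have mp : measurable_fun [set: GT] (p : GT -> measurableTypeR R).
    apply: (measurability _ (RGenOpens.measurableE R)).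
    by move=> _ [_ [a [b ->] <-]]; rewrite setTI; exact: H.
  by have := mp measurableT A mA; rewrite setTI.
apply: smallest_sub; first exact: smallest_sigma_algebra.
rewrite subUset; split => _ [A mA <-]; rewrite setTI.
- apply: (sub fst) => // a b.
  have -> : fst @^-1` `]a, b[%classic = \bigcup_n (obox a b (- n%:R) n%:R).
    rewrite eqEsubset; split=> x /=.
      rewrite in_itv/= => /andP[h1 h2]; exists (Num.truncn `|x.2|).+1 => //.
      apply/oboxP; have := truncnS_gt `|x.2|; rewrite ltr_norml => /andP[h3 h4].
      by split.
    by move=> [n _ /oboxP[h1 h2 _ _]]; rewrite in_itv/= h1.
  apply: (@bigcup_measurable _ GT) => n _; apply: sub_sigma_algebra.
  by exists a, b, (- n%:R), n%:R.
- apply: (sub snd) => // a b.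
  have -> : snd @^-1` `]a, b[%classic = \bigcup_n (obox (- n%:R) n%:R a b).
    rewrite eqEsubset; split=> x /=.
      rewrite in_itv/= => /andP[h1 h2]; exists (Num.truncn `|x.1|).+1 => //.
      apply/oboxP; have := truncnS_gt `|x.1|; rewrite ltr_norml => /andP[h3 h4].
      by split.
    by move=> [n _ /oboxP[_ _ h1 h2]]; rewrite in_itv/= h1.
  apply: (@bigcup_measurable _ GT) => n _; apply: sub_sigma_algebra.
  by exists (- n%:R), n%:R, a, b.
Qed.

Lemma oboxI (a b c d a' b' c' d' : R) : obox a b c d `&` obox a' b' c' d' =
  obox (Num.max a a') (Num.min b b') (Num.max c c') (Num.min d d').
Proof.
rewrite eqEsubset; split=> x.
  move=> [/oboxP[h1 h2 h3 h4] /oboxP[k1 k2 k3 k4]]; apply/oboxP.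
  by rewrite !gt_max !lt_min h1 h2 h3 h4 k1 k2 k3 k4.
move=> /oboxP; rewrite !gt_max !lt_min => -[/andP[? ?] /andP[? ?] /andP[? ?] /andP[? ?]].
by split; apply/oboxP.
Qed.

Lemma zero_on_boxes (a b c d : R) (g : mpt -> R) : intg mu2 (obox a b c d) g ->
  (forall a' b' c' d', obox a' b' c' d' `<=` obox a b c d ->
    \int[mu2]_(x in obox a' b' c' d') g x = 0) ->
  {ae mu2, forall x, obox a b c d x -> g x = 0}.
Proof.
move=> gi g0; set B := obox a b c d; have mB : measurable B by exact: measurable_obox.
have gEi E : measurable E -> intg mu2 (E `&` B) g.
  move=> mE; apply: integrableS gi => //; first exact: measurableI.
have H : forall E, <<s oboxes >> E -> (\int[mu2]_(x in E `&` B) (g x)%:E = 0)%E.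
  apply: dynkin_induction.
  - exact: oboxes_measurableE.
  - move=> _ _ [a1 [b1 [c1 [d1 ->]]]] [a2 [b2 [c2 [d2 ->]]]]; rewrite oboxI.
    by eexists; eexists; eexists; eexists.
  - rewrite setTI integral_intg// g0//.
  - move=> _ [a1 [b1 [c1 [d1 ->]]]].
    rewrite integral_intg; [|by apply: measurableI => //; exact: measurable_obox|exact: gEi (measurable_obox _ _ _ _)].
    by rewrite /B oboxI g0// -oboxI; exact: subIsetr.
  - move=> S mS S0.
    have := @integral_setU_EFin _ _ _ mu2 (S `&` B) (~` S `&` B) g.
    rewrite -setIUl setUv setTI S0 add0e => <- //.
    + by rewrite integral_intg// g0//.
    + exact: measurableI.
    + by apply: measurableI => //; exact: measurableC.
    + exact: intg_meas gi.
    + by apply/disj_setPS => x [[Sx _] [Sx' _]].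
  - move=> F mF tF F0; rewrite setI_bigcupl integral_bigcup//.
    + by rewrite eseries0.
    + apply/trivIsetP => i j _ _ ij; rewrite setIACA.
      by move/trivIsetP : tF => /(_ _ _ I I ij) ->; rewrite set0I.
    + by move=> k; exact: measurableI.
    + by rewrite -setI_bigcupl; apply: gEi; exact: bigcupT_measurable.
have := @integral_ae_eq _ _ _ mu2 B mB (cst 0%E) (EFin \o g) gi (measurable_cst _).
case.
  move=> E EB mE; rewrite integral0; have := H E; rewrite setIidl//; apply.
  by rewrite -oboxes_measurableE.
move=> N [mN N0 HN]; exists N; split => // x /= Hx; apply: HN => /= K.
by apply: Hx => Bx; have := K Bx => -[].
Qed.

Lemma L1loc_testfun (D : set pt) (g chi : pt -> R) : measurable (D : set mpt) ->
  L1loc D g -> testfun D chi -> intg mu2 D (fun x => g x * chi x).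
Proof.
move=> mD [mg gi] tc; have [M M0 HM] := testfun_bounded tc.
case: tc => ck [K [cK KD K0]]; have mK := compact_measurable2 cK.
have mchi : measurable_fun D (chi : mpt -> R).
  apply: measurable_funTS; apply: continuous_measurable2; exact: Ck_continuous (ck 0%N).
apply: (@intg_dom _ _ _ mu2 D mD _ (fun x => M * ((fun x => `|g x|) \_ K) x)).
- exact: measurable_funM.
- apply: intgZ => //; apply: intg_restrict => //; rewrite setIidr//.
  exact/intg_abs/gi.
- move=> x _; rewrite patchE; case: ifPn => [_|/negP xK].
    by rewrite normrM mulrC ler_wpM2r.
  by rewrite K0 ?mulr0 ?normr0// => Kx; apply: xK; exact: mem_set.
Qed.

Lemma fundamental_lemma (D : set pt) (g : pt -> R) : open D -> L1loc D g ->
  (forall chi, testfun D chi -> \int[mu2]_(x in D) (g x * chi x) = 0) ->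
  {ae mu2, forall x, D x -> g x = 0}.
Proof.
move=> oD gL g0; have mD := open_measurable2 oD; have [mg gi] := gL.
(* The argument is local, on boxes whose closure lies in [D]: there [g] is integrable, since it is
   integrable on compact subsets. *)
have key q : cratbox q `<=` D -> {ae mu2, forall x, ratbox q x -> g x = 0}.
  move=> qD; have giq : intg mu2 (ratbox q) g.
    apply: (@integrableS _ _ _ mu2 (cratbox q)); [|exact: measurable_obox|exact: obox_cbox|].
      by apply: compact_measurable2; exact: compact_cbox.
    by apply: gi => //; exact: compact_cbox.
  apply: (zero_on_boxes giq) => a b c d Bq; set B := obox a b c d.
  have mB : measurable B by exact: measurable_obox.
  have BD : B `<=` D by apply: subset_trans qD; apply: subset_trans Bq _; exact: obox_cbox.
  have gB : intg mu2 B g by apply: (integrableS _ mB Bq giq); exact: measurable_obox.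
  (* Test functions converging to the indicator of [B], dominated by [g] cut to [B]; the order
     [n.+1] is positive, as [testfun_bump2] asks. *)
  pose f_ n x := g x * bump2 a b c d n.+1 x.
  have mf_ n : measurable_fun D (f_ n).
    apply: measurable_funM => //; apply: measurable_funTS; apply: continuous_measurable2.
    have [ck _] := testfun_bump2 (ltn0Sn n) BD; exact: Ck_continuous (ck 0%N).
  have fc x : D x -> f_ ^~ x @ \oo --> (g \_ B) x.
    move=> Dx; rewrite patchE; case: ifPn => [/set_mem Bx|/negP xB].
      rewrite -[X in _ --> X]mulr1; apply: cvgM; first exact: cvg_cst.
      by rewrite (cvg_shiftS (fun n => bump2 a b c d n x)); exact: bump2_cvg.
    rewrite (_ : f_ ^~ x = cst 0); first exact: cvg_cst.
    apply/funext => n; rewrite /f_ bump2_out ?mulr0// => Bx; apply: xB.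
    exact: mem_set.
  have [|||||_ H] := @dominated_Rint _ _ _ mu2 D mD f_ (g \_ B) ((fun x => `|g x|) \_ B).
  - exact: mf_.
  - by apply: (measurable_restrict _ mB mD).1; apply: measurable_funS mg => //; exact: subIsetl.
  - by apply: aeW => x; exact: fc.
  - by apply: intg_restrict => //; rewrite setIidr//; exact: intg_abs.
  - move=> n x _; rewrite patchE; case: ifPn => [_|/negP xB].
      rewrite normrM ler_piMr//; have /andP[h1 h2] := bump2_itv a b c d n.+1 x.
      by rewrite ger0_norm.
    rewrite /f_ bump2_out ?mulr0 ?normr0// => Bx; apply: xB; exact: mem_set.
  move: H; rewrite Rint_restrict setIidr//.
  rewrite (_ : (fun n => _) = cst 0); last first.
    by apply/funext => n; apply: g0; exact: testfun_bump2.
  by move/(cvg_unique (@Rhausdorff _) (cvg_cst _)) => <-.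
(* Countably many rational boxes exhaust [D], so the exceptional sets form a null set. *)
have neg n : mu2.-negligible (if unpickle n is Some q then
    if `[< cratbox q `<=` D >] then [set x | ratbox q x /\ g x <> 0] else set0 else set0).
  case: (unpickle n) => [q|]; last exact: negligible_set0.
  case: asboolP => [qD|_]; last exact: negligible_set0.
  have := key q qD; apply: negligibleS => x [qx gx] /= H; exact/gx/H.
have := negligible_bigcup neg; apply: negligibleS => x /= /not_implyP[Dx gx].
have [q qx qD] := open_cratbox oD Dx.
by exists (pickle q); [exact: I|rewrite pickleK asboolT].
Qed.

End fundamental_lemma.

(** * Weak derivatives *)

Section ae_lemmas.
Context d (T : measurableType d) (R : realType) (mu : {measure set T -> \bar R}).

Lemma ae_mono (P Q : T -> Prop) : (forall x, P x -> Q x) ->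
  {ae mu, forall x, P x} -> {ae mu, forall x, Q x}.
Proof. by move=> PQ [N [mN N0 H]]; exists N; split => // x /= Qx; apply: H => /PQ. Qed.

Lemma ae_and (P Q : T -> Prop) : {ae mu, forall x, P x} -> {ae mu, forall x, Q x} ->
  {ae mu, forall x, P x /\ Q x}.
Proof.
move=> [N [mN N0 H]] [M [mM M0 H']]; exists (N `|` M); split.
- exact: measurableU.
- by apply: null_set_setU.
- by move=> x /= /not_andP[?|?]; [left; exact: H|right; exact: H'].
Qed.

Lemma ae_all_fin (I : finType) (P : I -> T -> Prop) :
  (forall i, {ae mu, forall x, P i x}) -> {ae mu, forall x, forall i, P i x}.
Proof.
move=> H; have : forall s : seq I, {ae mu, forall x, forall i, i \in s -> P i x}.
  elim=> [|i s IH]; first exact: aeW.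
  apply: ae_mono (ae_and (H i) IH) => x [Pi Ps] j.
  by rewrite inE => /orP[/eqP ->//|/Ps].
by move=> /(_ (enum I)); apply: ae_mono => x K i; apply: K; rewrite mem_enum.
Qed.

Lemma ae_all_nat (P : nat -> T -> Prop) :
  (forall i, {ae mu, forall x, P i x}) -> {ae mu, forall x, forall i, P i x}.
Proof.
move=> H; have : mu.-negligible (\bigcup_i [set x | ~ P i x]).
  by apply: negligible_bigcup => i; exact: H.
by apply: negligibleS => x /= /existsNP[i Pi]; exists i.
Qed.

End ae_lemmas.

(** * Cauchy-Schwarz and triangle inequalities for finite sums *)

Section finite_l2.
Context {R : realType}.

Lemma sum_cauchy_schwarz (I : finType) (a b : I -> R) :
  \sum_i a i * b i <= Num.sqrt (\sum_i a i ^+ 2) * Num.sqrt (\sum_i b i ^+ 2).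
Proof.
set A := \sum_i a i ^+ 2; set B := \sum_i b i ^+ 2; set C := \sum_i a i * b i.
have A0 : 0 <= A by apply: sumr_ge0 => i _; exact: sqr_ge0.
have B0 : 0 <= B by apply: sumr_ge0 => i _; exact: sqr_ge0.
have H s t : 0 <= s ^+ 2 * A + 2 * (s * t) * C + t ^+ 2 * B.
  rewrite /A /B /C !mulr_sumr -!big_split/=; apply: sumr_ge0 => i _.
  by rewrite (_ : _ + _ = (s * a i + t * b i) ^+ 2) ?sqr_ge0//; ring.
rewrite -sqrtrM// (le_trans (ler_norm _))// -sqrtr_sqr ler_sqrt ?mulr_ge0//.
have [B00|Bn0] := eqVneq B 0.
  have [->|Cn0] := eqVneq C 0; first by rewrite expr0n/= mulr_ge0.
  have := H 1 (- (A + 1) / (2 * C)); rewrite B00 mulr0 addr0.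
  have -> : 2 * (1 * (- (A + 1) / (2 * C))) * C = - (A + 1) by field.
  by rewrite expr1n mul1r; lra.
have Bp : 0 < B by rewrite lt_def Bn0.
have := H B (- C).
have -> : B ^+ 2 * A + 2 * (B * - C) * C + (- C) ^+ 2 * B = B * (A * B - C ^+ 2) by ring.
by rewrite pmulr_rge0// subr_ge0.
Qed.

Lemma l2sum_triangle (I : finType) (a b c : I -> R) :
  (forall i, 0 <= c i <= a i + b i) ->
  Num.sqrt (\sum_i c i ^+ 2) <= Num.sqrt (\sum_i a i ^+ 2) + Num.sqrt (\sum_i b i ^+ 2).
Proof.
move=> H; rewrite -(@ler_pXn2r _ 2)// ?nnegrE ?addr_ge0 ?sqrtr_ge0//.
rewrite sqrrD !sqr_sqrtr; try by apply: sumr_ge0 => i _; exact: sqr_ge0.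
have := sum_cauchy_schwarz a b.
suff : \sum_i c i ^+ 2 <= \sum_i a i ^+ 2 + \sum_i b i ^+ 2 + 2 * \sum_i a i * b i.
  by rewrite -mulr_natl; lra.
rewrite mulr_sumr -!big_split/=; apply: ler_sum => i _.
have /andP[c0 cab] := H i.
have -> : a i ^+ 2 + b i ^+ 2 + 2 * (a i * b i) = (a i + b i) ^+ 2 by ring.
by rewrite ler_pXn2r ?nnegrE// (le_trans c0).
Qed.

Lemma sqrt_scale (a x : R) : 0 <= a -> a * Num.sqrt x = Num.sqrt (a ^+ 2 * x).
Proof. by move=> a0; rewrite sqrtrM ?sqr_ge0// sqrtr_sqr ger0_norm. Qed.

Lemma sqrt_add_triangle (a b c a' b' c' : R) : 0 <= c <= a + b -> 0 <= c' <= a' + b' ->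
  Num.sqrt (c ^+ 2 + c' ^+ 2) <= Num.sqrt (a ^+ 2 + a' ^+ 2) + Num.sqrt (b ^+ 2 + b' ^+ 2).
Proof.
move=> h h'; pose f (x y : R) (i : bool) := if i then x else y.
have := @l2sum_triangle bool (f a a') (f b b') (f c c').
by rewrite !big_bool/=; apply; case.
Qed.

End finite_l2.

Section weak_derivatives.
Context {R : realType}.
Notation pt := (R * R)%type.
Notation mpt := (measurableTypeR R * measurableTypeR R)%type.
Notation mu2 := (@mu2 R).
Variable D : set pt.
Hypothesis oD : open D.
Let mD : measurable (D : set mpt). Proof. exact: open_measurable2. Qed.
Implicit Types f g : pt -> R.

Lemma testfun_sqi chi : testfun D chi -> sqi mu2 D chi.
Proof.
move=> tc; have [M M0 HM] := testfun_bounded tc; case: tc => ck [K [cK KD K0]].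
have mK := compact_measurable2 cK.
have mchi : measurable_fun D (chi : mpt -> R).
  by apply: measurable_funTS; apply: continuous_measurable2; exact: Ck_continuous (ck 0%N).
split => //; apply: (@intg_dom _ _ _ mu2 D mD _ ((fun=> M ^+ 2) \_ K)).
- exact: measurable_funX.
- apply: intg_restrict => //; rewrite setIidr//.
  apply: (@intg_bounded _ _ _ mu2 K mK _ (M ^+ 2)) => //; first exact: compact_mu2.
  by move=> x _; rewrite ger0_norm ?sqr_ge0.
- move=> x _; rewrite patchE; case: ifPn => [_|/negP xK].
    by rewrite normrX ler_pXn2r ?nnegrE.
  by rewrite K0 ?expr0n ?normr0// => Kx; apply: xK; exact: mem_set.
Qed.

Lemma sqi_L1loc f : sqi mu2 D f -> L1loc D f.
Proof.
move=> [mf fi]; split => // K cK KD; have mK := compact_measurable2 cK.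
apply: (@sqi_intg _ _ _ mu2 K mK _ (compact_mu2 cK)); split.
  exact: measurable_funS mf.
exact: (@integrableS _ _ _ mu2 D).
Qed.

Lemma L1loc_lin a f g : L1loc D f -> L1loc D g -> L1loc D (fun x => a * f x + g x).
Proof.
move=> [mf fi] [mg gi]; split.
  by apply: measurable_funD => //; exact: measurable_funM.
move=> K cK KD; have mK := compact_measurable2 cK.
by apply: (@intgD _ _ _ mu2 K mK (fun x => a * f x)); [apply: intgZ => //; exact: fi|exact: gi].
Qed.

Lemma weak_partial_unique i f g g' : is_weak_partial D i f g ->
  is_weak_partial D i f g' -> {ae mu2, forall x, D x -> g x = g' x}.
Proof.
move=> [gL Hg] [gL' Hg'].
have H : {ae mu2, forall x, D x -> (-1) * g' x + g x = 0}.
  apply: (fundamental_lemma oD); first exact: L1loc_lin.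
  move=> chi tc; have i1 := L1loc_testfun mD gL tc; have i2 := L1loc_testfun mD gL' tc.
  rewrite (@eq_Rint _ _ _ mu2 D _ (fun x => (-1) * (g' x * chi x) + g x * chi x)); last first.
    by move=> x _; ring.
  rewrite Rint_D//; last exact: intgZ.
  rewrite Rint_Z//; have := Hg chi tc; have := Hg' chi tc.
  by move=> -> /oppr_inj ->; rewrite mulN1r addNr.
by apply: ae_mono H => x H /H; lra.
Qed.

Lemma weak_partial_lin i a f f' g g' : sqi mu2 D f -> sqi mu2 D f' ->
  is_weak_partial D i f g -> is_weak_partial D i f' g' ->
  is_weak_partial D i (fun x => a * f x + f' x) (fun x => a * g x + g' x).
Proof.
move=> fs fs' [gL Hg] [gL' Hg']; split; first exact: L1loc_lin.
move=> chi tc; have tdc := testfun_derive (e_ i) tc.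
have i1 := L1loc_testfun mD gL tc; have i2 := L1loc_testfun mD gL' tc.
have j1 := L1loc_testfun mD (sqi_L1loc fs) tdc.
have j2 := L1loc_testfun mD (sqi_L1loc fs') tdc.
rewrite (@eq_Rint _ _ _ mu2 D _ (fun x => a * (f x * 'D_(e_ i) chi x) + f' x * 'D_(e_ i) chi x)); last first.
  by move=> x _; ring.
rewrite [X in _ = - X](@eq_Rint _ _ _ mu2 D _ (fun x => a * (g x * chi x) + g' x * chi x)); last first.
  by move=> x _; ring.
rewrite Rint_D//; last exact: intgZ.
rewrite [X in _ = - X]Rint_D//; last exact: intgZ.
by rewrite !Rint_Z// Hg// Hg'//; ring.
Qed.

(** The space [W1p D 2%:E] (see [W12P]), with any weak derivative in place of the chosen one [wD],
    so that an explicit candidate proves membership. *)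
Definition inH1 f := sqi mu2 D f /\
  forall i, exists2 g, is_weak_partial D i f g & sqi mu2 D g.

Lemma weak_partial_wD i f g : is_weak_partial D i f g -> is_weak_partial D i f (wD D i f).
Proof. by move=> H; apply: (@getPex _ (is_weak_partial D i f)); exists g. Qed.

Lemma wD_ae i f g : is_weak_partial D i f g -> {ae mu2, forall x, D x -> wD D i f x = g x}.
Proof. by move=> H; exact: weak_partial_unique (weak_partial_wD H) H. Qed.

Lemma W12P f : W1p D 2%:E f <-> inH1 f.
Proof.
split.
  move=> [/(Lfun2P _ mD) fs H]; split => // i; have [H1 /(Lfun2P _ mD) H2] := H i.
  by exists (wD D i f).
move=> [fs H]; split; first exact/(Lfun2P _ mD).
move=> i; have [g Hg gs] := H i; split; first exact: weak_partial_wD Hg.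
apply/(Lfun2P _ mD); have [[mw _] _] := weak_partial_wD Hg; split => //.
case: gs => mg gi; apply: (intg_ae_eq mD _ gi); first exact: measurable_funX.
by apply: ae_mono (wD_ae Hg) => x H' /H' ->.
Qed.

Lemma inH1_sqi f : inH1 f -> sqi mu2 D f. Proof. by case. Qed.

Lemma inH1_wD f i : inH1 f -> is_weak_partial D i f (wD D i f) /\ sqi mu2 D (wD D i f).
Proof. by move=> /W12P[_ /(_ i)[H1 /(Lfun2P _ mD) H2]]. Qed.

Lemma inH1_lin a f g : inH1 f -> inH1 g -> inH1 (fun x => a * f x + g x) /\
  forall i, {ae mu2, forall x, D x ->
    wD D i (fun x => a * f x + g x) x = a * wD D i f x + wD D i g x}.
Proof.
move=> fH gH; have K i : is_weak_partial D i (fun x => a * f x + g x)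
    (fun x => a * wD D i f x + wD D i g x).
  by apply: weak_partial_lin; [exact: inH1_sqi|exact: inH1_sqi|
    exact: (inH1_wD i fH).1|exact: (inH1_wD i gH).1].
split; last by move=> i; exact: wD_ae (K i).
split; first by apply: sqiD => //; [apply: sqiZ => //; exact: inH1_sqi|exact: inH1_sqi].
move=> i; exists (fun x => a * wD D i f x + wD D i g x) => //.
by apply: sqiD => //; [apply: sqiZ => //; exact: (inH1_wD i fH).2|exact: (inH1_wD i gH).2].
Qed.

Definition gradnorm f := Num.sqrt (\sum_i n2 mu2 D (wD D i f) ^+ 2).

Lemma H1_normE f : inH1 f -> H1_norm D f = Num.sqrt (n2 mu2 D f ^+ 2 + gradnorm f ^+ 2).
Proof.
move=> fH; rewrite /H1_norm /Lp_norm Lnorm2E//; last exact: inH1_sqi.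
congr (Num.sqrt (_ + _)); rewrite sqr_sqrtr; last by apply: sumr_ge0 => i _; exact: sqr_ge0.
by apply: eq_bigr => i _; rewrite Lnorm2E//; exact: (inH1_wD i fH).2.
Qed.

Lemma wD_n2_lin a f g i : inH1 f -> inH1 g ->
  n2 mu2 D (wD D i (fun x => a * f x + g x)) <=
  `|a| * n2 mu2 D (wD D i f) + n2 mu2 D (wD D i g).
Proof.
move=> fH gH; have [_ /(_ i) E] := inH1_lin a fH gH.
rewrite (eq_n2_ae E) -n2Z//; last exact: (inH1_wD i fH).2.
by apply: n2D => //; [apply: sqiZ => //; exact: (inH1_wD i fH).2|exact: (inH1_wD i gH).2].
Qed.

Lemma gradnorm_lin a f g : inH1 f -> inH1 g ->
  gradnorm (fun x => a * f x + g x) <= `|a| * gradnorm f + gradnorm g.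
Proof.
move=> fH gH.
have -> : `|a| * gradnorm f = Num.sqrt (\sum_i (`|a| * n2 mu2 D (wD D i f)) ^+ 2).
  rewrite sqrt_scale// mulr_sumr.
  by congr Num.sqrt; apply: eq_bigr => i _; rewrite exprMn.
by apply: l2sum_triangle => i; rewrite n2_ge0 wD_n2_lin.
Qed.

Lemma gradnorm_ge0 f : 0 <= gradnorm f. Proof. exact: sqrtr_ge0. Qed.

Lemma H1_norm_lin a f g : inH1 f -> inH1 g ->
  H1_norm D (fun x => a * f x + g x) <= `|a| * H1_norm D f + H1_norm D g.
Proof.
move=> fH gH; have [fgH _] := inH1_lin a fH gH; rewrite !H1_normE//.
have -> : `|a| * Num.sqrt (n2 mu2 D f ^+ 2 + gradnorm f ^+ 2) =
    Num.sqrt ((`|a| * n2 mu2 D f) ^+ 2 + (`|a| * gradnorm f) ^+ 2).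
  by rewrite sqrt_scale// !exprMn mulrDr.
apply: sqrt_add_triangle; last by rewrite gradnorm_ge0 gradnorm_lin.
rewrite n2_ge0/= -n2Z//; last exact: inH1_sqi.
by apply: n2D => //; [apply: sqiZ => //; exact: inH1_sqi|exact: inH1_sqi].
Qed.

Lemma n2_le_H1 f : inH1 f -> n2 mu2 D f <= H1_norm D f.
Proof.
move=> fH; rewrite H1_normE// -[leLHS]ger0_norm ?n2_ge0// -sqrtr_sqr ler_sqrt.
  by rewrite lerDl sqr_ge0.
by rewrite addr_ge0 ?sqr_ge0.
Qed.

Lemma gradnorm_le_H1 f : inH1 f -> gradnorm f <= H1_norm D f.
Proof.
move=> fH; rewrite H1_normE// -[leLHS]ger0_norm ?gradnorm_ge0// -sqrtr_sqr ler_sqrt.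
  by rewrite lerDr sqr_ge0.
by rewrite addr_ge0 ?sqr_ge0.
Qed.

Lemma wD_le_gradnorm f i : n2 mu2 D (wD D i f) <= gradnorm f.
Proof.
rewrite -[leLHS]ger0_norm ?n2_ge0// -sqrtr_sqr ler_sqrt.
  by rewrite (bigD1 i)//= lerDl; apply: sumr_ge0 => j _; exact: sqr_ge0.
by apply: sumr_ge0 => j _; exact: sqr_ge0.
Qed.

Lemma gradnorm_sqr f : gradnorm f ^+ 2 = \sum_i \int[mu2]_(x in D) wD D i f x ^+ 2.
Proof.
rewrite sqr_sqrtr; last by apply: sumr_ge0 => i _; exact: sqr_ge0.
by apply: eq_bigr => i _; rewrite n2_sqr.
Qed.

End weak_derivatives.

(** * Translation estimates and the Poincare-Wirtinger inequality *)

Section translation.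
Context {R : realType}.
Notation pt := (R * R)%type.
Notation mpt := (measurableTypeR R * measurableTypeR R)%type.
Notation leb := (@lebesgue_measure R).
Notation mu2 := (@mu2 R).

Lemma mu2_sigma_finite : sigma_finite setT mu2.
Proof.
exists (fun n => obox (- n%:R) n%:R (- n%:R) n%:R).
  apply/seteqP; split=> // -[x y] _.
  exists (Num.truncn (`|x| + `|y|)).+1 => //; apply/oboxP => /=.
  have := truncnS_gt (`|x| + `|y|); move: (_.+1%:R) => N.
  have := ler_norm x; have := ler_norm (- x); have := ler_norm y; have := ler_norm (- y).
  have := normr_ge0 y; have := normr_ge0 x; rewrite (normrN x) (normrN y).
  move: (`|x|) (`|y|) => a b *.
  by split; lra.
move=> n; split; first exact: (measurable_obox (- n%:R) n%:R (- n%:R) n%:R).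
exact: (mu2_obox_lty (- n%:R) n%:R (- n%:R) n%:R).
Qed.

(** An alias of [mu2] carrying the sigma-finiteness that Fubini's theorem requires; the type of
    [mu2] records a measure only. *)
Definition mu2_fun : set (measurableTypeR R * measurableTypeR R)%type -> \bar R := mu2.
HB.instance Definition _ := Measure.copy mu2_fun mu2.
HB.instance Definition _ :=
  @Measure_isSigmaFinite.Build _ _ _ mu2_fun mu2_sigma_finite.
Definition mu2s : {sigma_finite_measure set (measurableTypeR R * measurableTypeR R)%type -> \bar R} := mu2_fun.

Definition seg (h x : pt) (s : R) : pt := x + s *: h.

Lemma measurable_seg (h : pt) : measurable_fun setT
  (fun z : mpt * measurableTypeR R => (seg h z.1 z.2 : mpt)).
Proof.
apply/measurable_fun_pairP; split.
  rewrite (_ : _ \o _ = (fun z : mpt * measurableTypeR R => z.1.1 + z.2 * h.1))//.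
  apply: measurable_funD; first exact: (measurableT_comp measurable_fst measurable_fst).
  exact: (measurable_funM measurable_snd (measurable_cst _)).
rewrite (_ : _ \o _ = (fun z : mpt * measurableTypeR R => z.1.2 + z.2 * h.2))//.
apply: measurable_funD; first exact: (measurableT_comp measurable_snd measurable_fst).
exact: (measurable_funM measurable_snd (measurable_cst _)).
Qed.

Lemma measurable_segC (h : pt) : measurable_fun setT
  (fun z : measurableTypeR R * mpt => (seg h z.2 z.1 : mpt)).
Proof.
apply/measurable_fun_pairP; split.
  rewrite (_ : _ \o _ = (fun z : measurableTypeR R * mpt => z.2.1 + z.1 * h.1))//.
  apply: measurable_funD; first exact: (measurableT_comp measurable_fst measurable_snd).
  exact: (measurable_funM measurable_fst (measurable_cst _)).
rewrite (_ : _ \o _ = (fun z : measurableTypeR R * mpt => z.2.2 + z.1 * h.2))//.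
apply: measurable_funD; first exact: (measurableT_comp measurable_snd measurable_snd).
exact: (measurable_funM measurable_fst (measurable_cst _)).
Qed.

Lemma measurable_shift (h : pt) : measurable_fun setT (fun x : mpt => (x + h : mpt)).
Proof.
apply/measurable_fun_pairP; split.
  by rewrite (_ : _ \o _ = (fun z : mpt => z.1 + h.1))//; apply: measurable_funD.
by rewrite (_ : _ \o _ = (fun z : mpt => z.2 + h.2))//; apply: measurable_funD.
Qed.

Lemma Rint_support (A B : set mpt) (g : mpt -> R) : measurable A -> A `<=` B ->
  (forall x, B x -> ~ A x -> g x = 0) ->
  \int[mu2]_(x in A) g x = \int[mu2]_(x in B) g x.
Proof.
move=> mA AB g0; rewrite (@eq_Rint _ _ _ mu2 B g (g \_ A)).
  by rewrite Rint_restrict setIidr.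
by move=> x Bx; rewrite patchE; case: ifPn => // /negP xA; rewrite g0// => Ax; apply: xA; rewrite inE.
Qed.

Lemma shift_intg (h : pt) (f : mpt -> R) : intg mu2 setT f ->
  intg mu2 setT (fun x => f (x + h)).
Proof.
move=> fi; have := @preserving_intg _ _ _ mu2 _ (measurable_shift h) (@mu2_translate R h) setT f measurableT fi.
by rewrite preimage_setT.
Qed.

Lemma shift_Rint (h : pt) (f : mpt -> R) : intg mu2 setT f ->
  \int[mu2]_x f (x + h) = \int[mu2]_x f x.
Proof.
move=> fi; have := @preserving_Rint _ _ _ mu2 _ (measurable_shift h) (@mu2_translate R h) setT f measurableT fi.
by rewrite preimage_setT.
Qed.

Lemma shift_integral (h : pt) (f : mpt -> \bar R) : measurable_fun setT f ->
  (forall x, 0 <= f x)%E -> (\int[mu2]_x f (x + h)%R = \int[mu2]_x f x)%E.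
Proof.
move=> mf f0; exact: (@preserving_integral _ _ _ mu2 _ (measurable_shift h) (@mu2_translate R h) f mf f0).
Qed.

Lemma intg_patch D (f : mpt -> R) : measurable D -> intg mu2 D f <-> intg mu2 setT (f \_ D).
Proof.
move=> mD; rewrite /intg; have := @integrable_mkcond _ _ _ mu2 D (EFin \o f) mD.
by rewrite restrict_EFin.
Qed.

Lemma sqi_patch D (f : mpt -> R) : measurable D -> sqi mu2 D f <-> sqi mu2 setT (f \_ D).
Proof.
move=> mD; have E : (fun x => (f \_ D) x ^+ 2) = (fun x => f x ^+ 2) \_ D.
  by apply/funext => x; rewrite !patchE; case: ifPn => // _; rewrite expr0n.
split=> -[mf fi]; split.
- exact: (measurable_restrictT _ mD).1 mf.
- by rewrite E; apply: (intg_patch _ mD).1 fi.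
- exact: (measurable_restrictT _ mD).2 mf.
- by apply/intg_patch => //; rewrite -E.
Qed.

Lemma shift_sqi (h : pt) (f : mpt -> R) : sqi mu2 setT f -> sqi mu2 setT (fun x => f (x + h)).
Proof.
move=> [mf fi]; split; first exact: measurableT_comp mf (measurable_shift h).
exact: (shift_intg h fi).
Qed.

Variable D : set pt.
Hypothesis oD : open D.
Let mD : measurable (D : set (measurableTypeR R * measurableTypeR R)%type). Proof. exact: open_measurable2. Qed.

Lemma derive_e (chi : pt -> R) h x : Ck 1 chi ->
  'D_h chi x = h.1 * 'D_(e_ ord0) chi x + h.2 * 'D_(e_ ord_max) chi x.
Proof.
move=> ck; have dv y u : derivable chi y u by exact: (@Ck_derivable _ _ 0%N).
have E : h = h.1 *: ((1, 0) : pt) + h.2 *: ((0, 1) : pt).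
  case: h => a b; congr (_, _); rewrite /= /GRing.scale/= ?mulr1 ?mulr0 ?addr0 ?add0r//.
rewrite {1}E deriveDv// !derive_scale//.
Qed.

Lemma Rint_lin_opp (a b : R) (f0 f1 g0 g1 : mpt -> R) :
  intg mu2 D g0 -> intg mu2 D g1 -> intg mu2 D f0 -> intg mu2 D f1 ->
  \int[mu2]_(x in D) f0 x = - (\int[mu2]_(x in D) g0 x) ->
  \int[mu2]_(x in D) f1 x = - (\int[mu2]_(x in D) g1 x) ->
  \int[mu2]_(x in D) (a * g0 x + b * g1 x) = - \int[mu2]_(x in D) (a * f0 x + b * f1 x).
Proof.
move=> i0 i1 j0 j1 E0 E1.
rewrite Rint_D//; [|exact: intgZ..].
rewrite [X in _ = - X]Rint_D//; [|exact: intgZ..].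
by rewrite !Rint_Z// E0 E1; ring.
Qed.

Lemma weak_gradient_dir f h chi : inH1 D f -> testfun D chi ->
  \int[mu2]_(x in D) ((h.1 * wD D ord0 f x + h.2 * wD D ord_max f x) * chi x) =
  - \int[mu2]_(x in D) (f x * 'D_h chi x).
Proof.
move=> fH tc.
have [[L0 H0] s0] := inH1_wD oD ord0 fH; have [[L1 H1] s1] := inH1_wD oD ord_max fH.
have i0 := L1loc_testfun mD L0 tc; have i1 := L1loc_testfun mD L1 tc.
have j0 := L1loc_testfun mD (sqi_L1loc oD (inH1_sqi fH)) (testfun_derive (e_ ord0) tc).
have j1 := L1loc_testfun mD (sqi_L1loc oD (inH1_sqi fH)) (testfun_derive (e_ ord_max) tc).
have := Rint_lin_opp h.1 h.2 i0 i1 j0 j1 (H0 _ tc) (H1 _ tc).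
have eL : forall x, D x -> (h.1 * wD D ord0 f x + h.2 * wD D ord_max f x) * chi x =
    h.1 * (wD D ord0 f x * chi x) + h.2 * (wD D ord_max f x * chi x).
  by move=> x _; move: (wD _ _ _ _) (wD _ _ _ _) => a b; ring.
have eR : forall x, D x -> f x * 'D_h chi x =
    h.1 * (f x * 'D_(e_ ord0) chi x) + h.2 * (f x * 'D_(e_ ord_max) chi x).
  by move=> x _; rewrite (derive_e h x (tc.1 1%N)); move: ('D_(e_ ord0) chi x) ('D_(e_ ord_max) chi x) => a b; ring.
move=> E; apply: (etrans (eq_Rint mu2 eL)); apply: (etrans E).
by congr (- _); apply/esym/(eq_Rint mu2 eR).
Qed.

Lemma line_integral_derive (chi : pt -> R) h x : (forall k, Ck k chi) ->
  \int[leb]_(s in `[0, 1]) 'D_h chi (x - s *: h) = chi x - chi (x - h).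
Proof.
move=> ck; have dv y u : derivable chi y u by apply: (@Ck_derivable _ _ 0%N); exact: ck.
have cD : continuous ('D_h chi) by apply: (@Ck_continuous _ _ 0%N); apply: Ck_derive; exact: ck.
pose F (s : R) := - chi (x - s *: h).
have dF s : is_derive s (1 : R) F ('D_h chi (x - s *: h)).
  have H := is_deriveN (@line_derive R _ chi x (- h) s (dv _ _)).
  have E : F = - (fun t : R => chi (x + t *: - h)).
    by apply/funext => t; rewrite /F -scalerN.
  have E2 : 'D_h chi (x - s *: h) = - 'D_(- h) chi (x + s *: - h).
    by rewrite -(scaleN1r h) derive_scale// mulN1r opprK scaleN1r -scalerN.
  by rewrite E E2.
have cF : continuous F.
  by move=> s; apply: differentiable_continuous; apply/derivable1_diffP; case: (dF s).
have cDs : continuous (fun s : R => 'D_h chi (x - s *: h)).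
  move=> s; apply: (@continuous_comp _ _ _ (fun s : R => x - s *: h) ('D_h chi)); last exact: cD.
  apply: continuousB; first exact: cst_continuous.
  by apply: continuousZl; exact: id.
rewrite /Rintegral (continuous_FTC2 (F := F) ltr01).
- by rewrite /F scale1r scale0r subr0 -EFinB /= opprK addrC.
- exact: continuous_subspaceT.
- split; first by move=> s _; case: (dF s).
  + exact/cvg_at_right_filter/cF.
  + exact/cvg_at_left_filter/cF.
- by move=> s _; rewrite derive1E; case: (dF s).
Qed.

(** * Increments of Sobolev functions along a fixed vector *)

Section segment.
Variables (K : set pt) (h : pt) (f : pt -> R).
Hypotheses (oK : open K) (Kfin : (mu2 K < +oo)%E) (Dfin : (mu2 D < +oo)%E).
Hypothesis KD : forall x (s : R), K x -> 0 <= s <= 1 -> D (seg h x s).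
Hypothesis fH : inH1 D f.

Let mK : measurable (K : set mpt). Proof. exact: open_measurable2. Qed.
Let G (x : mpt) : R := h.1 * wD D ord0 f x + h.2 * wD D ord_max f x.
Let G0 : mpt -> R := G \_ D.
Let Km : set mpt := K.
Let I : set (measurableTypeR R) := `[0%R, 1%R]%classic.

Let Gs : sqi mu2 D G.
Proof.
by apply: sqiD => //; apply: sqiZ => //; exact: (inH1_wD oD _ fH).2.
Qed.

Let G0s : sqi mu2 setT G0. Proof. exact: (sqi_patch _ mD).1 Gs. Qed.

Let mI : measurable I. Proof. exact: measurable_itv. Qed.

Let lebI : leb I = 1%E.
Proof. by rewrite lebesgue_measure_itv/= lte_fin ltr01 oppr0 adde0. Qed.

Let lebIfin : (leb I < +oo)%E. Proof. by rewrite lebI ltry. Qed.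

Let mG0 : measurable_fun setT
  (fun z : mpt * measurableTypeR R => G0 (seg h z.1 z.2)).
Proof. exact: measurableT_comp (G0s.1) (measurable_seg h). Qed.

Let G0sq (x : mpt) (s : measurableTypeR R) : R := G0 (seg h x s) ^+ 2.
Let G0sq_ge0 x s : 0 <= G0sq x s. Proof. exact: sqr_ge0. Qed.

Let mG0sq : measurable_fun (Km `*` I) (fun z => G0sq z.1 z.2).
Proof. by apply: measurable_funTS; exact: measurable_funX. Qed.

(** Tonelli integrates in [x] first: for each [s], translation invariance bounds the inner integral
    by that of [G0] squared over the plane, which is that of [G] squared over [D], and [s] ranges
    over an interval of length 1. *)
Lemma segment_tonelli :
  (\int[mu2]_(x in Km) \int[leb]_(s in I) (G0sq x s)%:E <=
   (\int[mu2]_(x in D) (G x) ^+ 2)%R%:E)%E.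
Proof.
have := @tonelli_rect _ _ mpt (measurableTypeR R) R mu2s leb Km I mK mI
  (fun z => G0sq z.1 z.2) mG0sq (fun _ _ _ _ => sqr_ge0 _).
move=> /= ->.
apply: (@le_trans _ _ (\int[leb]_(s in I) (\int[mu2]_(x in D) G x ^+ 2)%R%:E)%E); last first.
  by rewrite integral_cst// [X in (_ * X)%E](_ : _ = 1%E)// mule1.
apply: ge0_le_integral => //.
- by move=> s _; apply: integral_ge0 => x _; rewrite lee_fin.
- have mswap : measurable_fun (I `*` Km)
     (fun z : measurableTypeR R * mpt => G0sq z.2 z.1).
    apply: measurable_funTS; apply: measurable_funX.
    exact: measurableT_comp (G0s.1) (measurable_segC h).
  exact: (@tonelli_measurable _ _ (measurableTypeR R) mpt R mu2s I Km mI mK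
     (fun z => G0sq z.2 z.1) mswap (fun _ _ _ _ => sqr_ge0 _)).
move=> s _; have m2 : measurable_fun setT (fun x : mpt => (G0 x ^+ 2)%:E).
  by apply/measurable_EFinP; apply: measurable_funX; exact: G0s.1.
apply: (@le_trans _ _ (\int[mu2]_x (G0sq x s)%:E)%E).
  apply: ge0_subset_integral => //.
    exact: (measurableT_comp m2 (measurable_shift _)).
  by move=> x _; rewrite lee_fin.
have -> : (\int[mu2]_x (G0sq x s)%:E = \int[mu2]_x (G0 x ^+ 2)%:E)%E.
  by apply: (shift_integral (s *: h) m2) => x; rewrite lee_fin sqr_ge0.
rewrite -integral_intg//; last exact: Gs.2.
rewrite [in leRHS]integral_mkcond le_eqVlt; apply/orP; left; apply/eqP.
by apply: eq_integral => x _; rewrite /G0 !patchE; case: ifPn => // _; rewrite expr0n.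
Qed.

Lemma segment_fubini (psi : mpt -> R) M : measurable_fun setT psi ->
  (forall x, `|psi x| <= M) ->
  [/\ {ae mu2, forall x, K x -> intg leb I (fun s => G0 (seg h x s) * psi x)},
     intg mu2 K (fun x => \int[leb]_(s in I) (G0 (seg h x s) * psi x)) &
   \int[mu2]_(x in K) \int[leb]_(s in I) (G0 (seg h x s) * psi x) =
   \int[leb]_(s in I) \int[mu2]_(x in K) (G0 (seg h x s) * psi x)].
Proof.
move=> mpsi psiM.
have M0 : 0 <= M by apply: le_trans (psiM (0, 0)).
have mk : measurable_fun (Km `*` I)
    (fun z : mpt * measurableTypeR R => G0 (seg h z.1 z.2) * psi z.1).
  apply: measurable_funTS; apply: measurable_funM; first exact: mG0.
  exact: measurableT_comp mpsi measurable_fst.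
have [|H1 H2 _ _ H3] := @fubini_rect _ _ mpt (measurableTypeR R) R mu2s leb Km I mK mI _ mk.
  have mGM : measurable_fun (Km `*` I) (fun z => G0sq z.1 z.2 + M ^+ 2).
    by apply: measurable_funD => //; exact: mG0sq.
  have pGM x y : 0 <= G0sq x y + M ^+ 2 by rewrite addr_ge0 ?sqr_ge0.
  rewrite /=; apply: (@le_lt_trans _ _ (\int[mu2]_(x in Km) \int[leb]_(s in I) (G0sq x s + M ^+ 2)%R%:E)%E).
    apply: ge0_le_integral => //.
    - by move=> x _; apply: integral_ge0 => s _; rewrite lee_fin.
    - apply: (@tonelli_measurable _ _ mpt (measurableTypeR R) R leb Km I mK mI
         (fun z => `|G0 (seg h z.1 z.2) * psi z.1|)) => //.
      exact: measurableT_comp mk.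
    - exact: (@tonelli_measurable _ _ mpt (measurableTypeR R) R leb Km I mK mI
         (fun z => G0sq z.1 z.2 + M ^+ 2) mGM (fun x y _ _ => pGM x y)).
    - move=> x Kx; apply: ge0_le_integral => //.
      + by apply/measurable_EFinP; apply: measurableT_comp => //; exact: (measurable_xsect mK mI mk).
      + by apply/measurable_EFinP; exact: (measurable_xsect mK mI mGM).
      (* The bound [a * b <= a * M <= a ^+ 2 + M ^+ 2] reduces integrability to the square of
         [G0]. *)
      + move=> s _; rewrite lee_fin normrM /G0sq.
        have := psiM x; have := normr_ge0 (psi x); have := normr_ge0 (G0 (seg h x s)).
        rewrite -(real_normK (num_real (G0 _))); move: (`|G0 _|) (`|psi x|) => a b a0 b0 bM.
        have : a * b <= a * M by rewrite ler_wpM2l.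
        by have := sqr_ge0 (a - M); rewrite !expr2 => ? ?; nra.
  have -> : (\int[mu2]_(x in Km) \int[leb]_(s in I) (G0sq x s + M ^+ 2)%R%:E =
     \int[mu2]_(x in Km) (\int[leb]_(s in I) (G0sq x s)%:E + (M ^+ 2)%R%:E))%E.
    apply: eq_integral => x /set_mem Kx.
    rewrite [LHS](_ : _ = \int[leb]_(s in I) ((G0sq x s)%:E + (M ^+ 2)%R%:E))%E//.
    rewrite ge0_integralD//.
    - by rewrite integral_cst//= [X in (_ * X)%E](_ : _ = 1%E)// mule1.
    - by move=> s _; rewrite lee_fin.
    - by apply/measurable_EFinP; exact: (measurable_xsect mK mI mG0sq).
    - by move=> s _; rewrite lee_fin sqr_ge0.
  rewrite ge0_integralD//.
  - rewrite integral_cst// lte_add_pinfty//.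
      by apply: le_lt_trans segment_tonelli _; rewrite ltry.
    by rewrite lte_mul_pinfty// lee_fin sqr_ge0.
  - by move=> x _; apply: integral_ge0 => s _; rewrite lee_fin sqr_ge0.
  - exact: (@tonelli_measurable _ _ mpt (measurableTypeR R) R leb Km I mK mI
         (fun z => G0sq z.1 z.2) mG0sq (fun _ _ _ _ => sqr_ge0 _)).
  - by move=> x _; rewrite lee_fin sqr_ge0.
by split.
Qed.

Let f0 : mpt -> R := f \_ D.
Let f0s : sqi mu2 setT f0. Proof. exact: (sqi_patch _ mD).1 (inH1_sqi fH). Qed.

(* Weak form of the fundamental theorem of calculus along h: Fubini integrates the
   derivative of the test function along h first. *)
Lemma segment_test chi : testfun D chi ->
  intg leb I (fun s => \int[mu2]_(x in D) (f x * 'D_h chi (seg (- h) x s))) /\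
  \int[leb]_(s in I) \int[mu2]_(x in D) (f x * 'D_h chi (seg (- h) x s)) =
  \int[mu2]_(x in D) (f x * (chi x - chi (x - h))).
Proof.
move=> tc; have tD := testfun_derive h tc; have [M M0 HM] := testfun_bounded tD.
have mDh : measurable_fun setT ('D_h chi : mpt -> R).
  by apply: continuous_measurable2; exact: Ck_continuous (tD.1 0%N).
have fi : intg mu2 D f by exact: (sqi_intg mD Dfin (inH1_sqi fH)).
have mk : measurable_fun ((D : set mpt) `*` I)
    (fun z : mpt * measurableTypeR R => f z.1 * 'D_h chi (seg (- h) z.1 z.2)).
  apply: measurable_funM; last first.
    by apply: measurable_funTS; exact: measurableT_comp mDh (measurable_seg (- h)).
  apply: (eq_measurable_fun (fun z : mpt * measurableTypeR R => f0 z.1)).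
    by move=> z /set_mem[/= Dz _]; rewrite /f0 patchE mem_set.
  by apply: measurable_funTS; exact: measurableT_comp (f0s.1) measurable_fst.
have [|_ _ _ i4 E5] := @fubini_rect _ _ mpt (measurableTypeR R) R mu2s leb D I mD mI _ mk.
  rewrite /=; apply: (@le_lt_trans _ _ (\int[mu2]_(x in D) (M * `|f x|)%R%:E)%E).
    apply: ge0_le_integral => //.
    - by move=> x _; apply: integral_ge0 => s _; rewrite lee_fin.
    - apply: (@tonelli_measurable _ _ mpt (measurableTypeR R) R leb D I mD mI
         (fun z => `|f z.1 * 'D_h chi (seg (- h) z.1 z.2)|)) => //.
      exact: measurableT_comp mk.
    - by apply/measurable_EFinP; apply: measurable_funM => //; apply: measurableT_comp => //; exact: (intg_meas fi).
    - move=> x Dx; apply: (@le_trans _ _ (\int[leb]_(s in I) (M * `|f x|)%R%:E)%E).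
        apply: ge0_le_integral => //.
        + by apply/measurable_EFinP; apply: measurableT_comp => //; exact: (measurable_xsect mD mI mk).
        + by move=> s _; rewrite lee_fin normrM mulrC ler_wpM2r.
      by rewrite integral_cst// [X in (_ * X)%E](_ : _ = 1%E)// mule1.
  rewrite integral_intg ?ltry//.
  by apply: intgZ => //; exact: intg_abs.
split; first exact: i4.
apply: (etrans (esym E5)); apply: eq_Rint => x Dx.
have iD : intg leb I (fun s => 'D_h chi (seg (- h) x s)).
  apply: (@intg_bounded _ _ _ leb I mI _ M lebIfin).
    apply: measurable_funTS; apply: measurableT_comp mDh _.
    exact: (measurableT_comp (measurable_seg (- h)) (measurable_pair1 (x : mpt))).
  by move=> s _; exact: HM.
apply: (etrans (@Rint_Z _ _ _ leb I mI (f x) _ iD)); congr (_ * _).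
apply: etrans (line_integral_derive h x tc.1).
by apply: eq_Rint => s _; rewrite /seg scalerN.
Qed.

(** Both sides are integrable on [K], so equality is checked against test functions supported in
    [K]. For each [s] the translated test function is supported in [D], where the weak derivative
    may be used. *)
Lemma segment_identity : {ae mu2, forall x, K x ->
  f (x + h) - f x = \int[leb]_(s in I) G0 (seg h x s)}.
Proof.
have K1 x : K x -> D (x + h).
  by move=> Kx; have := KD Kx (ltac:(by rewrite ler01 lexx) : 0 <= 1 <= 1); rewrite /seg scale1r.
have K0 x : K x -> D x.
  by move=> Kx; have := KD Kx (ltac:(by rewrite ler01 lexx) : 0 <= 0 <= 1); rewrite /seg scale0r addr0.
have [_ Gi _] := @segment_fubini (fun=> 1) 1 (measurable_cst _) (fun=> ltac:(by rewrite normr1)).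
have {}Gi : intg mu2 K (fun x => \int[leb]_(s in I) G0 (seg h x s)).
  by apply: eq_intg Gi => // x _; apply: eq_Rint => s _; rewrite mulr1.
have fi0 : intg mu2 K f.
  apply: (@eq_intg _ _ _ mu2 _ mK f0); first by move=> x /K0 Dx; rewrite /f0 patchE mem_set.
  apply: (sqi_intg mK Kfin); split; first exact: measurable_funTS f0s.1.
  by apply: integrableS f0s.2.
have fi1 : intg mu2 K (fun x => f (x + h)).
  have H := shift_sqi h f0s.
  apply: (@eq_intg _ _ _ mu2 _ mK (fun x => f0 (x + h))).
    by move=> x /K1 Dx; rewrite /f0 patchE mem_set.
  apply: (sqi_intg mK Kfin); split; first exact: measurable_funTS H.1.
  by apply: integrableS H.2.
have gi := intgB mK (intgB mK fi1 fi0) Gi.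
suff : {ae mu2, forall x, K x ->
    (f (x + h) - f x) - \int[leb]_(s in I) G0 (seg h x s) = 0}.
  by apply: ae_mono => x H /H /eqP; rewrite subr_eq0 => /eqP.
apply: fundamental_lemma => //.
  split; first exact: (intg_meas gi).
  by move=> L cL LK; apply: integrableS gi => //; exact: compact_measurable2.
move=> chi tc; have tcD : testfun D chi by apply: testfunS tc.
have [M M0 HM] := testfun_bounded tc.
have mchi : measurable_fun setT (chi : mpt -> R).
  by apply: continuous_measurable2; exact: Ck_continuous (tc.1 0%N).
have bm g : intg mu2 K g -> intg mu2 K (fun x => g x * chi x).
  move=> {}gi; apply: (@intg_dom _ _ _ mu2 K mK _ (fun x => M * `|g x|)).
  - by apply: measurable_funM; [exact: (intg_meas gi)|exact: measurable_funTS].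
  - by apply: intgZ => //; exact: intg_abs.
  - by move=> x _; rewrite normrM mulrC ler_wpM2r.
have [_ _ H3] := segment_fubini mchi HM.
have [aG _ _] := @segment_fubini (fun=> 1) 1 (measurable_cst _) (fun=> ltac:(by rewrite normr1)).
have E1 : \int[mu2]_(x in K) ((\int[leb]_(s in I) G0 (seg h x s)) * chi x) =
    \int[mu2]_(x in K) \int[leb]_(s in I) (G0 (seg h x s) * chi x).
  apply: eq_Rintegral_ae; apply: ae_mono aG => x H Kx.
  have H' : intg leb I (fun s => G0 (seg h x s)) by apply: eq_intg (H Kx) => // s _; rewrite mulr1.
  by rewrite mulrC -Rint_Z//; apply: eq_Rint => s _; rewrite mulrC.
have chi0 x : ~ K x -> chi x = 0 by move: tc => [_ [L [_ LK L0]]] Kx; apply: L0 => /LK.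
have sc v : sqi mu2 setT (fun x => chi (x + v)).
  by apply: shift_sqi; apply: testfun_sqi; [exact: openT|exact: testfunS tc].
(* Translation by [s *: h] brings the gradient back to its variable in [D] and moves [chi]; by [KD]
   the moved support still lies in [D]. *)
have E2 s : I s -> \int[mu2]_(x in K) (G0 (seg h x s) * chi x) =
    - (\int[mu2]_(x in D) (f x * 'D_h chi (seg (- h) x s))).
  move=> Is; have ts : testfun D (fun x => chi (x - s *: h)).
    apply: testfunS (testfun_shift (- (s *: h)) tc) => x /= Kx.
    by have := KD Kx Is; rewrite /seg subrK.
  rewrite (@Rint_support K setT)//; last by move=> x _ /chi0 ->; rewrite mulr0.
  pose Q (y : mpt) := G0 y * chi (y - s *: h).
  rewrite (@eq_Rint _ _ _ mu2 setT _ (fun x => Q (x + s *: h))); last first.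
    by move=> x _; rewrite /Q addrK.
  rewrite shift_Rint; last by apply: sqi_mul => //; exact: sc.
  rewrite -(@Rint_support D setT)//; last first.
    by move=> x _ Dx; rewrite /Q /G0 patchE memNset ?mul0r.
  rewrite (@eq_Rint _ _ _ mu2 D _ (fun x => G x * chi (x - s *: h))); last first.
    by move=> x Dx; rewrite /Q /G0 patchE mem_set.
  have W := weak_gradient_dir h fH ts.
  apply: (etrans W).
  apply: (congr1 (fun z : R => - z)).
  apply: eq_Rint => x _.
  congr (_ * _); have dx : derivable chi (x + - (s *: h)) h.
    by apply: (@Ck_derivable _ _ 0%N); exact: tc.1.
  by have [_ ->] := is_deriveE (derivable_shift dx); rewrite /seg scalerN.
have E3 : \int[mu2]_(x in K) (f (x + h) * chi x) = \int[mu2]_(x in D) (f x * chi (x - h)).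
  pose Q (y : mpt) := f0 y * chi (y - h).
  rewrite (@eq_Rint _ _ _ mu2 K _ (fun x => Q (x + h))); last first.
    by move=> x /K1 Dx; rewrite /Q addrK /f0 patchE mem_set.
  rewrite (@Rint_support K setT)//; last by move=> x _ /chi0 C; rewrite /Q addrK C mulr0.
  rewrite shift_Rint; last by apply: sqi_mul => //; exact: sc.
  rewrite -(@Rint_support D setT)//; last first.
    by move=> x _ Dx; rewrite /Q /f0 patchE memNset ?mul0r.
  by apply: eq_Rint => x Dx; rewrite /Q /f0 patchE mem_set.
have E4 : \int[mu2]_(x in K) (f x * chi x) = \int[mu2]_(x in D) (f x * chi x).
  by apply: Rint_support => // x _ /chi0 ->; rewrite mulr0.
have [i5 E5] := segment_test tcD.
have fcv v : intg mu2 D (fun x => f x * chi (x + v)).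
  by apply: sqi_mul => //; [exact: inH1_sqi|have [m1 m2] := sc v; split; [exact: measurable_funTS|exact: integrableS m2]].
have fc : intg mu2 D (fun x => f x * chi x).
  by apply: eq_intg (fcv 0) => // x _; rewrite addr0.
have E6 : \int[mu2]_(x in K) ((\int[leb]_(s in I) G0 (seg h x s)) * chi x) =
    \int[mu2]_(x in D) (f x * chi (x - h)) - \int[mu2]_(x in D) (f x * chi x).
  rewrite E1 H3 (eq_Rint _ E2) (@Rint_N _ _ _ leb I mI)// E5.
  rewrite (@eq_Rint _ _ _ mu2 D _ (fun x => f x * chi x - f x * chi (x - h))).
    by rewrite Rint_B// opprB.
  by move=> x _; rewrite mulrBr.
have gc := bm _ (intgB mK fi1 fi0).
rewrite (@eq_Rint _ _ _ mu2 K _ (fun x => (f (x + h) - f x) * chi x -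
    (\int[leb]_(s in I) G0 (seg h x s)) * chi x)); last by move=> x _; rewrite mulrBl.
rewrite Rint_B//; last exact: bm.
rewrite E6 (@eq_Rint _ _ _ mu2 K _ (fun x => f (x + h) * chi x - f x * chi x)); last first.
  by move=> x _; rewrite mulrBl.
rewrite Rint_B//; [|exact: bm..].
by rewrite E3 E4 subrr.
Qed.

Let Gsq_le : \int[mu2]_(x in D) G x ^+ 2 <= (h.1 ^+ 2 + h.2 ^+ 2) * gradnorm D f ^+ 2.
Proof.
have s0 := (inH1_wD oD ord0 fH).2; have s1 := (inH1_wD oD ord_max fH).2.
rewrite gradnorm_sqr big_ord_recr big_ord1 /=.
have -> : widen_ord (leqnSn 1) ord0 = ord0 :> 'I_2 by apply: val_inj.
rewrite -Rint_D//; [|exact: s0.2|exact: s1.2].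
rewrite -Rint_Z//; last by apply: intgD => //; [exact: s0.2|exact: s1.2].
apply: le_Rint => //; [exact: Gs.2| |].
  by apply: intgZ => //; apply: intgD => //; [exact: s0.2|exact: s1.2].
move=> x _; rewrite /G; move: (wD _ _ _ _) (wD _ _ _ _) (h.1) (h.2) => a b c d.
by have := sqr_ge0 (c * a - d * b); rewrite !expr2; nra.
Qed.

(** Square [segment_identity], apply Cauchy-Schwarz on the unit interval and exchange the integrals;
    each slice is bounded by translation invariance. *)
Lemma translation_estimate :
  sqi mu2 K (fun x => f (x + h) - f x) /\
  \int[mu2]_(x in K) (f (x + h) - f x) ^+ 2 <=
     (h.1 ^+ 2 + h.2 ^+ 2) * gradnorm D f ^+ 2.
Proof.
have sK (g : mpt -> R) : sqi mu2 setT g -> sqi mu2 K g.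
  by move=> [m1 m2]; split; [exact: measurable_funTS|exact: integrableS m2].
have K1 x : K x -> D (x + h).
  by move=> Kx; have := KD Kx (ltac:(by rewrite ler01 lexx) : 0 <= 1 <= 1); rewrite /seg scale1r.
have K0 x : K x -> D x.
  by move=> Kx; have := KD Kx (ltac:(by rewrite ler01 lexx) : 0 <= 0 <= 1); rewrite /seg scale0r addr0.
have si : sqi mu2 K (fun x => f (x + h) - f x).
  apply: (@eq_sqi _ _ _ mu2 K mK (fun x => f0 (x + h) - f0 x)).
    by move=> x Kx; rewrite /f0 !patchE !mem_set//; [exact: K0|exact: K1].
  by apply: sqiB => //; [exact: sK (shift_sqi h f0s)|exact: sK].
split => //.
have [|H1 H2 _ H4 H3] := @fubini_rect _ _ mpt (measurableTypeR R) R mu2s leb Km I mK mI _ mG0sq.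
  apply: (@le_lt_trans _ _ (\int[mu2]_(x in Km) \int[leb]_(s in I) (G0sq x s)%:E)%E).
    rewrite le_eqVlt; apply/orP; left; apply/eqP.
    by apply: eq_integral => x _; apply: eq_integral => s _ /=; rewrite ger0_norm.
  by apply: le_lt_trans segment_tonelli _; rewrite ltry.
have GI s : \int[mu2]_(x in Km) G0sq x s <= \int[mu2]_(x in D) G x ^+ 2.
  rewrite (@eq_Rint _ _ _ mu2 D _ (fun x => G0 x ^+ 2)); last first.
    by move=> x Dx; rewrite /G0 patchE mem_set.
  rewrite (@Rint_support D setT)//; last first.
    by move=> x _ Dx; rewrite /G0 patchE memNset// expr0n.
  rewrite -(shift_Rint (s *: h) G0s.2).
  have H := (shift_sqi (s *: h) G0s).2.
  have -> : \int[mu2]_(x in Km) G0sq x s = \int[mu2]_x ((fun x => G0sq x s) \_ Km) x.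
    by rewrite Rint_restrict setTI.
  apply: le_Rint => //.
    by apply: intg_restrict => //; rewrite setTI; apply: integrableS H.
  by move=> x _; rewrite patchE; case: ifPn => // _; exact: sqr_ge0.
apply: le_trans Gsq_le.
apply: (@le_trans _ _ (\int[mu2]_(x in K) \int[leb]_(s in I) G0sq x s)).
  have H2' : intg mu2 K (fun x => \int[leb]_(s in I) G0sq x s).
    by apply: eq_intg H2.
  apply: (@le_Rint_ae _ _ _ mu2 K mK _ _ si.2 H2').
  apply: ae_mono (ae_and segment_identity H1) => x [E Hx] Kx; rewrite (E Kx).
  have gs : sqi leb I (fun s => G0 (seg h x s)).
    split; last exact: Hx.
    apply: measurable_funTS; apply: measurableT_comp (G0s.1) _.
    exact: (measurableT_comp (measurable_seg h) (measurable_pair1 (x : mpt))).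
  have := cauchy_schwarz_sqr mI (sqi_cst mI 1 lebIfin) gs.
  rewrite (@eq_Rint _ _ _ leb I (fun _ => 1 ^+ 2) (cst 1)); last by move=> s _; rewrite expr1n.
  rewrite Rintegral_cst//= mul1r [X in fine X](_ : _ = 1%E)// mul1r.
  by congr (_ ^+ 2 <= _); apply: eq_Rint => s _; rewrite mul1r.
rewrite [leLHS]H3.
apply: (@le_trans _ _ (\int[leb]_(s in I) \int[mu2]_(x in D) G x ^+ 2)).
  apply: le_Rint => //; first exact: (@intg_bounded _ _ _ leb I mI _ `|\int[mu2]_(x in D) G x ^+ 2| lebIfin).
  by move=> s _; exact: GI.
by rewrite Rintegral_cst//= [X in fine X](_ : _ = 1%E)// mulr1.
Qed.

End segment.
End translation.

(** * The Poincare-Wirtinger inequality by chaining local estimates *)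

Section poincare.
Context {R : realType}.
Notation pt := (R * R)%type.
Notation mpt := (measurableTypeR R * measurableTypeR R)%type.
Notation leb := (@lebesgue_measure R).
Notation mu2 := (@mu2 R).

Lemma Rint_subset (A B : set mpt) (g : mpt -> R) : measurable A -> measurable B ->
  A `<=` B -> intg mu2 B g -> (forall x, B x -> 0 <= g x) ->
  \int[mu2]_(x in A) g x <= \int[mu2]_(x in B) g x.
Proof.
move=> mA mB AB gi g0.
have -> : \int[mu2]_(x in A) g x = \int[mu2]_(x in B) (g \_ A) x.
  by rewrite Rint_restrict setIidr.
apply: le_Rint => //.
  by apply: intg_restrict => //; rewrite setIidr//; exact: integrableS gi.
by move=> x Bx; rewrite patchE; case: ifPn => // _; exact: g0.
Qed.

Lemma sqiS (A B : set mpt) (g : mpt -> R) : measurable A -> measurable B ->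
  A `<=` B -> sqi mu2 B g -> sqi mu2 A g.
Proof.
move=> mA mB AB [mg gi]; split; first exact: measurable_funS mg.
exact: integrableS gi.
Qed.

Lemma Rint_setU_le (A B : set mpt) (g : mpt -> R) : measurable A -> measurable B ->
  intg mu2 (A `|` B) g -> (forall x, 0 <= g x) ->
  \int[mu2]_(x in A `|` B) g x <= \int[mu2]_(x in A) g x + \int[mu2]_(x in B) g x.
Proof.
move=> mA mB gi g0; have mU := measurableU _ _ mA mB.
have E S : S `<=` A `|` B -> \int[mu2]_(x in S) g x = \int[mu2]_(x in A `|` B) (g \_ S) x.
  by move=> SU; rewrite Rint_restrict setIidr.
have i S : measurable S -> S `<=` A `|` B -> intg mu2 (A `|` B) (g \_ S).
  by move=> mS SU; apply: intg_restrict => //; rewrite setIidr//; exact: integrableS gi.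
have sA : A `<=` A `|` B by move=> x; left.
have sB : B `<=` A `|` B by move=> x; right.
rewrite (E A sA) (E B sB) -Rint_D//; [|exact: i..].
apply: le_Rint => //; first by apply: intgD => //; exact: i.
move=> x [Ax|Bx]; rewrite !patchE.
  by rewrite (mem_set Ax) lerDl; case: ifPn.
by rewrite (mem_set Bx) lerDr; case: ifPn.
Qed.

Lemma Rint_sqrD_le (A : set mpt) (u v w : mpt -> R) : measurable A ->
  sqi mu2 A u -> sqi mu2 A v -> (forall x, A x -> w x = u x + v x) ->
  \int[mu2]_(x in A) w x ^+ 2 <=
  2 * (\int[mu2]_(x in A) u x ^+ 2) + 2 * \int[mu2]_(x in A) v x ^+ 2.
Proof.
move=> mA us vs wE; have ws : sqi mu2 A w.
  by apply: (@eq_sqi _ _ _ mu2 A mA (fun x => u x + v x)); [move=> x /wE|exact: sqiD].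
rewrite -!Rint_Z//; [|exact: vs.2|exact: us.2].
rewrite -Rint_D//; [|apply: intgZ => //; exact: us.2|apply: intgZ => //; exact: vs.2].
apply: le_Rint => //; first exact: ws.2.
  by apply: intgD => //; apply: intgZ => //; [exact: us.2|exact: vs.2].
move=> x Ax; rewrite wE//; move: (u x) (v x) => a b.
by have := sqr_ge0 (a - b); rewrite !expr2; nra.
Qed.

Lemma open_mu2_gt0 (U : set pt) : open U -> U !=set0 -> (0 < mu2 U)%E.
Proof.
move=> oU [p Up]; have /nbhs_ballP[e /= e0 pU] : nbhs p U by exact: open_nbhs_nbhs.
have -> : 0%E = 0%:E by []; apply: (@lt_le_trans _ _ (mu2 (obox (p.1 - e) (p.1 + e) (p.2 - e) (p.2 + e)))).
  rewrite mu2_rect//= !lebesgue_measure_itv/= !lte_fin.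
  have e2 (a : R) : (a - e < a + e) by lra.
  rewrite !e2 -!EFinB -EFinM lte_fin mulr_gt0// subr_gt0//.
apply: le_measure; rewrite ?inE//; [exact: measurable_obox|exact: open_measurable2|].
by move=> x /oboxP[? ? ? ?]; apply: pU; apply/pt_ballP.
Qed.

Lemma convex_lt (a x h s : R) : 0 <= s -> s <= 1 -> a < x -> a < x + h -> a < x + s * h.
Proof.
move=> s0 s1 ax axh; case: (ltP s 1) => [s1'|s1'].
  have : 0 < (1 - s) * (x - a) by rewrite mulr_gt0// subr_gt0.
  have : 0 <= s * (x + h - a) by rewrite mulr_ge0// subr_ge0 ltW.
  by nra.
have -> : s = 1 by apply/le_anti; rewrite s1 s1'.
by rewrite mul1r.
Qed.

Lemma convex_gt (a x h s : R) : 0 <= s -> s <= 1 -> x < a -> x + h < a -> x + s * h < a.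
Proof.
move=> s0 s1 ax axh; have := @convex_lt (- a) (- x) (- h) s s0 s1 (ltac:(lra)) (ltac:(lra)).
by rewrite mulrN; lra.
Qed.

Lemma ereal_val (x : \bar R) : (0 <= x)%E -> (x < +oo)%E -> exists2 a : R, 0 <= a & x = a%:E.
Proof. by case: x => // a a0 _; exists a. Qed.

Lemma ereal_pval (x : \bar R) : (0 < x)%E -> (x < +oo)%E -> exists2 a : R, 0 < a & x = a%:E.
Proof. by case: x => // a a0 _; exists a. Qed.

(** If [phi] exceeded [2 * M / b] on all of [B], its integral would be at least [2 * M]; the factor
    2 and [0 < M] make this contradict the bound [M]. *)
Lemma average_point (B : set mpt) (b : R) (phi : mpt -> \bar R) (M : R) : measurable B ->
  mu2 B = b%:E -> 0 < b -> measurable_fun B phi -> (forall x, 0 <= phi x)%E ->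
  0 < M -> (\int[mu2]_(x in B) phi x <= M%:E)%E ->
  exists2 x, B x & (phi x <= (2 * M / b)%:E)%E.
Proof.
move=> mB BE b0 mphi phi0 M0 HM.
apply: contrapT => H.
have : ((2 * M)%:E <= \int[mu2]_(x in B) phi x)%E.
  have -> : (2 * M)%:E = (\int[mu2]_(x in B) (2 * M / b)%:E)%E.
    by rewrite integral_cst// BE -EFinM/= divfK ?gt_eqF.
  apply: ge0_le_integral => //.
  - by move=> x _; rewrite lee_fin divr_ge0// ltW// mulr_gt0.
  - move=> x Bx; rewrite leNgt; apply/negP => /ltW K; apply: H; exists x => //.
move=> /le_trans /(_ HM); rewrite lee_fin; lra.
Qed.

Variable D : set pt.
Hypothesis oD : open D.
Hypothesis Dfin : (mu2 D < +oo)%E.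
Let mD : measurable (D : set mpt). Proof. exact: open_measurable2. Qed.

(* The additive slack 1 is harmless here and spares the case of a null gradient. *)
Definition poinc (A : set pt) := [/\ open A, A `<=` D &
  exists2 C : R, 0 <= C & forall f, inH1 D f -> exists c : R,
    \int[mu2]_(x in A) (f x - c) ^+ 2 <= C * (gradnorm D f ^+ 2 + 1)].

Lemma subset_fin (A : set mpt) : measurable A -> A `<=` D -> (mu2 A < +oo)%E.
Proof. by move=> mA AD; apply: le_lt_trans Dfin; apply: le_measure; rewrite ?inE. Qed.

Lemma inH1_sub_cst (A : set pt) f c : open A -> A `<=` D -> inH1 D f ->
  sqi mu2 A (fun x => f x - c).
Proof.
move=> oA AD fH; have mA := open_measurable2 oA.
apply: sqiB => //; first exact: sqiS (inH1_sqi fH).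
by apply: sqi_cst => //; exact: subset_fin.
Qed.

(** The constant is the value of [f] at one point. The squared increments, integrated over the base
    point [x] and over the vector [h], are controlled by [translation_estimate]; a base point with
    at most twice the mean then compares [f] with [f x] on the whole ball. *)
Lemma poinc_box p r : 0 < r -> ball p r `<=` D -> poinc (ball p r).
Proof.
move=> r0 BD; set B := ball p r.
have oB : open B by exact: ball_open.
have mB : measurable (B : set mpt) by exact: open_measurable2.
have Bfin : (mu2 B < +oo)%E by exact: subset_fin.
have B0 : (0 < mu2 B)%E by apply: open_mu2_gt0 => //; exists p; exact: ballxx.
(* Contains all differences of two points of [B]. *)
pose H : set pt := ball (0 : pt) (2 * r).
have mH : measurable (H : set mpt) by apply: open_measurable2; exact: ball_open.
have Hfin : (mu2 H < +oo)%E.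
  by apply: le_lt_trans (mu2_obox_lty (0 - 2 * r) (0 + 2 * r) (0 - 2 * r) (0 + 2 * r)); apply: le_measure;
    rewrite ?inE//; [exact: measurable_obox|move=> x /pt_ballP[? ? ? ?]; exact/oboxP].
have [aH aH0 HE] := ereal_val (measure_ge0 mu2 H) Hfin.
have [aB aB0 BE] := ereal_pval B0 Bfin.
(* [aH] and [aB] are the measures of [H] and [B]; [8 * r ^+ 2] bounds the squared Euclidean length
   of a vector of [H], the summand 1 makes [M] positive, and the factor [2 / aB] comes from
   [average_point]. *)
split => //; exists (2 * (aH * (8 * r ^+ 2) + 1) / aB).
  by rewrite divr_ge0 ?(ltW aB0)// mulr_ge0// addr_ge0// mulr_ge0// mulr_ge0// sqr_ge0.
move=> f fH; pose f0 : mpt -> R := f \_ D.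
have f0s : sqi mu2 setT f0 by exact: (sqi_patch _ mD).1 (inH1_sqi fH).
pose k (x h : mpt) : R := \1_(B : set mpt) x * \1_(B : set mpt) (x + h : pt) * (f0 (x + h : pt) - f0 x) ^+ 2.
have i0 (x : mpt) : 0 <= \1_(B : set mpt) x :> R by rewrite indicE ler0n.
have k0 x h : 0 <= k x h by apply: mulr_ge0; [apply: mulr_ge0; exact: i0|exact: sqr_ge0].
have madd : measurable_fun setT (fun z : mpt * mpt => (z.1 + z.2 : pt) : mpt).
  apply/measurable_fun_pairP; split.
    rewrite (_ : _ \o _ = (fun z : mpt * mpt => z.1.1 + z.2.1))//.
    by apply: measurable_funD; [exact: (measurableT_comp measurable_fst measurable_fst)|exact: (measurableT_comp measurable_fst measurable_snd)].
  rewrite (_ : _ \o _ = (fun z : mpt * mpt => z.1.2 + z.2.2))//.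
  by apply: measurable_funD; [exact: (measurableT_comp measurable_snd measurable_fst)|exact: (measurableT_comp measurable_snd measurable_snd)].
have mi : measurable_fun setT (\1_(B : set mpt) : mpt -> R) by exact: measurable_indic.
have mk : measurable_fun setT (fun z : mpt * mpt => k z.1 z.2).
  apply: measurable_funM; first apply: measurable_funM.
  - exact: (measurableT_comp mi measurable_fst).
  - exact: (measurableT_comp mi madd).
  - apply: measurable_funX; apply: measurable_funB.
      exact: (measurableT_comp f0s.1 madd).
    exact: (measurableT_comp f0s.1 measurable_fst).
pose g2 := gradnorm D f ^+ 2; have g20 : 0 <= g2 by exact: sqr_ge0.
pose M := (aH * (8 * r ^+ 2) + 1) * (g2 + 1).
have M0 : 0 < M.
  by rewrite mulr_gt0// ltr_wpDl// mulr_ge0// mulr_ge0// sqr_ge0.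
have inner h : (\int[mu2]_(x in B) (k x h)%:E <= (8 * r ^+ 2 * g2)%:E)%E.
  (* The ball is a square, hence convex: the segment from [x] to [x + h] stays in it when both ends
     do. *)
  pose K : set pt := B `&` [set x | B (x + h)].
  have oK : open K.
    apply: openI => //; apply: open_comp oB => x _.
    by apply: (@continuousD _ _ _ id (cst (h : pt))); [exact: id|exact: cst_continuous].
  have mK : measurable (K : set mpt) by exact: open_measurable2.
  have KB : K `<=` B by move=> x [].
  have KD x (s : R) : K x -> 0 <= s <= 1 -> D (seg h x s).
    move=> [/pt_ballP[a1 a2 a3 a4] /pt_ballP[/= b1 b2 b3 b4]] /andP[s0 s1].
    by apply: BD; apply/pt_ballP; rewrite /seg/= /GRing.scale/=; split;
      [exact: convex_lt|exact: convex_gt|exact: convex_lt|exact: convex_gt].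
  have Kfin : (mu2 K < +oo)%E by apply: subset_fin => //; apply: subset_trans BD.
  have [si le] := translation_estimate oD oK Kfin Dfin KD fH.
  have -> : (\int[mu2]_(x in B) (k x h)%:E = \int[mu2]_(x in K) ((f (x + h : pt)%R - f x) ^+ 2)%:E)%E.
    rewrite integral_mkcond [RHS]integral_mkcond; apply: eq_integral => x _.
    rewrite !patchE /k !indicE; case: (boolP (x \in K)) => [/set_mem[Bx Bxh]|xK].
      move: Bxh => /= Bxh; rewrite (mem_set Bx) (mem_set Bxh) !mul1r /f0 !patchE !mem_set//; exact: BD.
    case: (boolP ((x : mpt) \in (B : set mpt))) => // xB; rewrite mul1r.
    case: (boolP (_ \in _)) => [xhB|]; last by rewrite mul0r.
    by move: xK; rewrite mem_set//; split; exact: set_mem.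
  rewrite integral_intg//; last exact: si.2.
  rewrite lee_fin.
  have [[x0 Kx0]|K0] := pselect (K !=set0).
    apply: (le_trans le); rewrite ler_wpM2r//.
    move: Kx0 => [/pt_ballP[a1 a2 a3 a4] /pt_ballP[/= b1 b2 b3 b4]].
    have h1 : h.1 ^+ 2 <= (2 * r) ^+ 2 by rewrite !expr2; nra.
    have h2 : h.2 ^+ 2 <= (2 * r) ^+ 2 by rewrite !expr2; nra.
    by move: h1 h2; rewrite !expr2; lra.
  have -> : K = set0 by apply/eqP; apply: contra_notT K0 => /set0P.
  rewrite Rintegral_set0; apply: mulr_ge0 => //; apply: mulr_ge0 => //; exact: sqr_ge0.
have total : (\int[mu2]_(x in B) \int[mu2]_(h in H) (k x h)%:E <= M%:E)%E.
  have := @tonelli_rect _ _ mpt mpt R mu2s mu2s B H mB mH (fun z => k z.1 z.2) (measurable_funTS mk) (fun x y _ _ => k0 x y).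
  move=> /= E; apply: (@le_trans _ _ (\int[mu2s]_(y in H) \int[mu2s]_(x in B) (k x y)%:E)%E).
    by rewrite le_eqVlt; apply/orP; left; apply/eqP.
  apply: (@le_trans _ _ (\int[mu2s]_(y in H) (8 * r ^+ 2 * g2)%:E)%E).
    apply: ge0_le_integral; [exact: mH| | |exact: measurable_cst|by move=> y _; exact: inner].
    - by move=> y _; apply: integral_ge0 => x _; rewrite lee_fin.
    - have mk' : measurable_fun setT (fun z : mpt * mpt => k z.2 z.1).
        have -> : (fun z : mpt * mpt => k z.2 z.1) = (fun z : mpt * mpt =>
            \1_(B : set mpt) z.2 * \1_(B : set mpt) (z.1 + z.2 : pt) * (f0 (z.1 + z.2 : pt) - f0 z.2) ^+ 2).
          by apply/funext => z; rewrite /k addrC.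
        apply: measurable_funM; first apply: measurable_funM.
        - exact: (measurableT_comp mi measurable_snd).
        - exact: (measurableT_comp mi madd).
        - apply: measurable_funX; apply: measurable_funB.
            exact: (measurableT_comp f0s.1 madd).
          exact: (measurableT_comp f0s.1 measurable_snd).
      exact: (@tonelli_measurable _ _ mpt mpt R mu2s H B mH mB (fun z => k z.2 z.1) (measurable_funTS mk') (fun x y _ _ => k0 y x)).
  rewrite integral_cst; last exact: mH.
  rewrite [X in (_ * X)%E](_ : _ = aH%:E); last exact: HE.
  rewrite -EFinM lee_fin.
  have := mulr_ge0 aH0 (mulr_ge0 (ler0n R 8) (sqr_ge0 r)).
  by rewrite /M; move: (r ^+ 2) => b ab; nra.
have mphi : measurable_fun B (fun x => \int[mu2]_(h in H) (k x h)%:E)%E.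
  exact: (@tonelli_measurable _ _ mpt mpt R mu2s B H mB mH (fun z => k z.1 z.2) (measurable_funTS mk) (fun x y _ _ => k0 x y)).
have [|x Bx Hx] := average_point mB BE aB0 mphi _ M0 total.
  by move=> x; apply: integral_ge0 => h _; rewrite lee_fin.
exists (f x).
rewrite -lee_fin -integral_intg//; last exact: (inH1_sub_cst _ oB BD fH).2.
have -> : (2 * (aH * (8 * r ^+ 2) + 1) / aB * (gradnorm D f ^+ 2 + 1))%:E = (2 * M / aB)%:E.
  by congr (_%:E); rewrite /M -/g2; field; rewrite gt_eqF.
apply: le_trans Hx.
(* The substitution [y = x + h] turns the integral over increments into that of [(f y - f x) ^+ 2]
   over [B]. *)
pose Q (y : mpt) : \bar R := (\1_(B : set mpt) y * (f0 y - f0 x) ^+ 2)%:E.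
have mQ : measurable_fun setT Q.
  apply/measurable_EFinP; apply: measurable_funM; first exact: measurable_indic.
  by apply: measurable_funX; apply: measurable_funB => //; exact: f0s.1.
rewrite (_ : (\int[mu2]_(y in B) _ = \int[mu2]_y Q y)%E); last first.
  rewrite integral_mkcond; apply: eq_integral => y _; rewrite patchE /Q indicE.
  case: ifPn => yB; last by rewrite mul0r.
  by rewrite mul1r /f0 !patchE !mem_set//; apply: BD => //; exact: set_mem.
rewrite -(shift_integral x mQ); last first.
  by move=> y; rewrite lee_fin; apply: mulr_ge0; [exact: i0|exact: sqr_ge0].
rewrite [leRHS]integral_mkcond le_eqVlt; apply/orP; left; apply/eqP.
apply: eq_integral => h _; rewrite patchE /Q /k; case: ifPn => hH.
  have E1 : \1_(B : set mpt) x = 1 :> R by rewrite indicE mem_set.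
  by rewrite E1 mul1r addrC.
rewrite indicE; case: (boolP (_ \in _)) => [/set_mem xhB|]; last by rewrite mul0r.
exfalso; move/negP: hH; apply; rewrite inE.
move: Bx xhB => /pt_ballP[a1 a2 a3 a4] /pt_ballP[/= b1 b2 b3 b4].
by apply/pt_ballP => /=; split; lra.
Qed.

(** The intersection is open and nonempty, so it has positive measure, and the two constants can be
    compared there; one of them then serves on the union. *)
Lemma poinc_union A1 A2 : poinc A1 -> poinc A2 -> A1 `&` A2 !=set0 -> poinc (A1 `|` A2).
Proof.
move=> [ op1 AD1 [C1 C10 HA1]] [ op2 AD2 [C2 C20 HA2]] ne.
have m1 := open_measurable2 op1; have m2 := open_measurable2 op2.
have oI := openI op1 op2; have mI := open_measurable2 oI.
have Ifin : (mu2 (A1 `&` A2) < +oo)%E by apply: subset_fin => // x [/AD1].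
have I0 := open_mu2_gt0 oI ne.
have [a a0 aE] := ereal_pval I0 Ifin.
have [b b0 bE] := ereal_val (measure_ge0 mu2 A2) (subset_fin m2 AD2).
have UD : A1 `|` A2 `<=` D by move=> x [/AD1|/AD2].
split => //; first exact: openU.
exists (C1 + 2 * C2 + 2 * (b / a) * (2 * C1 + 2 * C2)).
  have ba : 0 <= b / a by rewrite divr_ge0// ltW.
  have : 0 <= b / a * (2 * C1 + 2 * C2) by rewrite mulr_ge0// addr_ge0// mulr_ge0.
  by move: (b / a) => v; lra.
move=> f fH; have [c1 K1] := HA1 f fH; have [c2 K2] := HA2 f fH.
set g := gradnorm D f ^+ 2 + 1 in K1 K2 *.
have s c A : open A -> A `<=` D -> sqi mu2 A (fun x => f x - c) by move=> *; exact: inH1_sub_cst.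
have cst A (c v : R) : measurable (A : set mpt) -> mu2 A = v%:E -> \int[mu2]_(x in A) (c ^+ 2) = c ^+ 2 * v.
  by move=> mA AE; rewrite Rintegral_cst ?AE ?ltry.
(* On the intersection [c1 - c2] is the difference of [f - c2] and [f - c1], both already
   estimated. *)
have c12 : (c1 - c2) ^+ 2 * a <= (2 * C1 + 2 * C2) * g.
  rewrite -(cst _ _ _ mI aE).
  have S1 : A1 `&` A2 `<=` A1 by move=> x [].
  have S2 : A1 `&` A2 `<=` A2 by move=> x [].
  have sI c : sqi mu2 (A1 `&` A2) (fun x => f x - c) by apply: s => // x [/AD1].
  have := @Rint_sqrD_le (A1 `&` A2) (fun x => f x - c2) (fun x => - (f x - c1)) (fun=> c1 - c2) mI (sI _) (sqiN mI (sI _)).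
  move=> /(_ (fun x _ => ltac:(ring))) le.
  have l1 := Rint_subset mI m1 S1 (s c1 _ op1 AD1).2 (fun x _ => sqr_ge0 _).
  have l2 := Rint_subset mI m2 S2 (s c2 _ op2 AD2).2 (fun x _ => sqr_ge0 _).
  have E : \int[mu2]_(x in A1 `&` A2) (- (f x - c1)) ^+ 2 = \int[mu2]_(x in A1 `&` A2) (f x - c1) ^+ 2.
    by apply: eq_Rint => x _; rewrite sqrrN.
  rewrite E in le; move: le l1 l2 K1 K2.
  move: (Rintegral _ _ _) (Rintegral _ _ _) (Rintegral _ _ _) (Rintegral _ _ _) (Rintegral _ _ _).
  by move=> u v w x y *; nra.
exists c1.
have gi := (s c1 _ (openU op1 op2) UD).2.
apply: (le_trans (Rint_setU_le m1 m2 gi (fun x => sqr_ge0 _))).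
have := @Rint_sqrD_le A2 (fun x => f x - c2) (fun=> c2 - c1) (fun x => f x - c1) m2 (s _ _ op2 AD2) (sqi_cst m2 _ (subset_fin m2 AD2)).
move=> /(_ (fun x _ => ltac:(ring))); rewrite (cst _ _ _ m2 bE) => le.
have c12' : (c2 - c1) ^+ 2 * b <= (b / a) * (2 * C1 + 2 * C2) * g.
  rewrite -sqrrN opprB -[leRHS]mulrA -(ler_pM2r a0) (_ : b / a * _ * a = b * ((2 * C1 + 2 * C2) * g)).
    by rewrite mulrAC [leRHS]mulrC ler_wpM2r.
  by field; rewrite gt_eqF.
move: le c12' K1 K2; set u := b / a * _.
move: (Rintegral _ _ _) (Rintegral _ _ _) (Rintegral _ _ _) => x y z.
by rewrite /u; move: (b / a) ((c2 - c1) ^+ 2 * b) => v w *; nra.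
Qed.

(** Serves near the boundary, where a set can be pushed into a good one along segments inside [D]:
    on [N], [f] differs from its translate by an increment that the gradient controls. *)
Lemma poinc_shift A N tau : poinc A -> open N ->
  (forall x (s : R), N x -> 0 <= s <= 1 -> D (seg tau x s)) ->
  (forall x, N x -> A (x + tau)) -> poinc N.
Proof.
move=> [ oA AD [C C0 HC]] oN ND NA.
have mN := open_measurable2 oN; have mA := open_measurable2 oA.
have ND0 : N `<=` D.
  by move=> x Nx; have := ND x 0 Nx; rewrite /seg scale0r addr0; apply; rewrite lexx ler01.
have Nfin := subset_fin mN ND0.
split => //; exists (2 * (tau.1 ^+ 2 + tau.2 ^+ 2) + 2 * C).
  by rewrite addr_ge0// mulr_ge0// addr_ge0 ?sqr_ge0.
move=> f fH; have [c Hc] := HC f fH; exists c.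
have [si le] := translation_estimate oD oN Nfin Dfin ND fH.
have As := inH1_sub_cst c oA AD fH.
pose v (x : mpt) := ((fun x => f x - c) \_ A) x.
have vs : sqi mu2 setT v by exact: (sqi_patch _ mA).1 As.
have vts := shift_sqi tau vs.
have vN := sqiS mN measurableT (@subsetT _ _) vts.
have wE x : N x -> f x - c = - (f (x + tau) - f x) + v (x + tau).
  by move=> Nx; rewrite /v patchE mem_set; [ring|exact: NA].
have := Rint_sqrD_le mN (sqiN mN si) vN wE.
have -> : \int[mu2]_(x in N) (- (f (x + tau) - f x)) ^+ 2 = \int[mu2]_(x in N) (f (x + tau) - f x) ^+ 2.
  by apply: eq_Rint => x _; rewrite sqrrN.
have : \int[mu2]_(x in N) (v (x + tau)) ^+ 2 <= \int[mu2]_(x in A) (f x - c) ^+ 2.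
  apply: le_trans (Rint_subset mN measurableT (@subsetT _ _) vts.2 (fun x _ => sqr_ge0 _)) _.
  rewrite (shift_Rint tau vs.2) -(@Rint_support R A setT (fun x => v x ^+ 2))//.
    rewrite le_eqVlt; apply/orP; left; apply/eqP.
    by apply: eq_Rint => x Ax; rewrite /v patchE mem_set.
  by move=> x _ Ax; rewrite /v patchE memNset// expr0n.
move: le Hc; have := sqr_ge0 (gradnorm D f).
have : 0 <= tau.1 ^+ 2 + tau.2 ^+ 2 by rewrite addr_ge0 ?sqr_ge0.
move: (Rintegral _ _ _) (Rintegral _ _ _) (Rintegral _ _ _) (Rintegral _ _ _) (gradnorm D f ^+ 2) => x y z w g.
by move: (tau.1 ^+ 2 + tau.2 ^+ 2) => t *; nra.
Qed.

(** In the chart [D] lies where [psi] is positive. Moving along the axis of the epigraph increases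
    [psi], so the part of [D] near [p] is pushed into a ball around [p + tau] contained in [D]. *)
Lemma poinc_chart p (r c s : R) (g : R -> R) : 0 < r -> c ^+ 2 + s ^+ 2 = 1 ->
  continuous g -> closure D p -> ~ D p ->
  (forall x : pt, `|x - p| < r ->
     (D x <-> g (c * (x.1 - p.1) + s * (x.2 - p.2))
              < c * (x.2 - p.2) - s * (x.1 - p.1))) ->
  exists2 d, 0 < d & poinc (D `&` ball p d).
Proof.
move=> r0 cs cg clp nDp HD.
pose psi (x : pt) := c * (x.2 - p.2) - s * (x.1 - p.1) - g (c * (x.1 - p.1) + s * (x.2 - p.2)).
have cpsi : continuous psi.
  have c1 : continuous (fun x : pt => x.1 - p.1).
    by move=> x; apply: continuousB; [exact: cvg_fst|exact: cst_continuous].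
  have c2 : continuous (fun x : pt => x.2 - p.2).
    by move=> x; apply: continuousB; [exact: cvg_snd|exact: cst_continuous].
  have cM (a : R) (f : pt -> R) : continuous f -> continuous (fun x => a * f x).
    by move=> cf x; apply: continuousM; [exact: cst_continuous|exact: cf].
  move=> x; apply: (@continuousB _ _ _ (fun x : pt => c * (x.2 - p.2) - s * (x.1 - p.1))
    (fun x => g (c * (x.1 - p.1) + s * (x.2 - p.2)))).
    by apply: (@continuousB _ _ _ (fun x : pt => c * (x.2 - p.2)) (fun x => s * (x.1 - p.1))); exact: cM.
  apply: (@continuous_comp _ _ _ (fun x : pt => c * (x.1 - p.1) + s * (x.2 - p.2)) g); last exact: cg.
  by apply: (@continuousD _ _ _ (fun x : pt => c * (x.1 - p.1)) (fun x => s * (x.2 - p.2))); exact: cM.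
have DP x : `|x - p| < r -> (D x <-> 0 < psi x) by move=> /HD ->; rewrite /psi subr_gt0.
have psip : psi p = - g 0 by rewrite /psi !subrr !mulr0 addr0 subr0 sub0r.
(* Otherwise [psi p < 0], and [psi] would be negative in a neighbourhood of [p], which the closure
   of [D] excludes. *)
have g0 : g 0 <= 0.
  rewrite leNgt; apply/negP => g0.
  have : nbhs p [set x | psi x < 0 /\ `|x - p| < r].
    apply: filterI.
      apply: (cpsi p [set y | y < 0]); apply: open_nbhs_nbhs; split; first exact: open_lt.
      by rewrite /= psip oppr_lt0.
    by have := @nbhsx_ballx R _ p r r0; apply: filterS => x; rewrite -ball_normE /= distrC.
  move=> /clp[x [Dx [px xr]]].
  by have := (DP x xr).1 Dx; rewrite ltNge ltW.
have [c1 c2] : `|c| <= 1 /\ `|s| <= 1.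
  have := sqr_ge0 c; have := sqr_ge0 s; rewrite !ler_norml => ? ?.
  by split; apply/andP; split; nra.
(* [tau] is [t] times the unit vector of the epigraph's axis, so [psi] grows by exactly [t] along
   it; with [t = r / 4], segments starting in the ball of radius [r / 2] stay in the chart. *)
pose t := r / 4; pose tau : pt := (- (t * s), t * c).
have t0 : 0 < t by rewrite divr_gt0.
have psit x (a : R) : psi (x + a *: tau) = psi x + a * t.
  rewrite /psi /tau/= /GRing.scale/=.
  have -> : c * (x.1 + a * - (t * s) - p.1) + s * (x.2 + a * (t * c) - p.2) = c * (x.1 - p.1) + s * (x.2 - p.2) by ring.
  have -> : a * t = a * t * (c ^+ 2 + s ^+ 2) by rewrite cs mulr1.
  by ring.
have ntau (a : R) : 0 <= a <= 1 -> `|a *: tau| <= t.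
  move=> /andP[a0 a1]; rewrite normrZ (ger0_norm a0).
  have : `|tau| <= t.
    have tu (u : R) : `|u| <= 1 -> `|t * u| <= t.
      by move=> u1; rewrite normrM gtr0_norm// ler_piMr// ltW.
    by rewrite pt_normE ge_max; apply/andP; split; [rewrite /tau/= normrN|]; exact: tu.
  by have := normr_ge0 tau; nra.
have Dq : D (p + tau).
  apply/DP; first by rewrite addrC addKr -[tau]scale1r; apply: (le_lt_trans (ntau _ _)); rewrite ?ler01 ?lexx// /t; lra.
  by rewrite -[tau]scale1r psit psip mul1r; lra.
have /nbhs_ballP[e /= e0 De] : nbhs (p + tau) D by exact: open_nbhs_nbhs.
exists (Num.min e (r / 2)); first by rewrite lt_min e0 divr_gt0.
have PB := poinc_box e0 De.
have dP x : ball p (Num.min e (r / 2)) x -> `|x - p| < e /\ `|x - p| < r / 2.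
  by rewrite -ball_normE /= distrC lt_min => /andP[].
apply: (poinc_shift (tau := tau) PB).
- by apply: openI => //; exact: ball_open.
- move=> x a [Dx /dP[_ xp]] a01; rewrite /seg; apply/DP.
    rewrite addrAC; apply: le_lt_trans (ler_normD _ _) _.
    by have := ntau a a01; rewrite /t; lra.
  rewrite psit; have := (DP x _).1 Dx; move: a01 => /andP[a0 _].
  have : 0 <= a * t by rewrite mulr_ge0// ltW.
  by move=> ? /(_ (ltac:(lra))); lra.
- move=> x [Dx /dP[xp _]]; rewrite -ball_normE /= distrC.
  by have -> : x + tau - (p + tau) = x - p by rewrite opprD addrACA subrr addr0.
Qed.

(** The points that share a good set with [p0] form an open set, and so do the others, since a ball
    around a point can be attached by [poinc_union]. *)
Lemma poinc_connected p0 : connected D -> D p0 -> forall x, D x ->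
  exists A, [/\ poinc A, A p0 & A x].
Proof.
move=> cD Dp0.
pose S := [set x | D x /\ exists A, [/\ poinc A, A p0 & A x]].
have small x : D x -> exists2 e, 0 < e & poinc (ball x e).
  move=> Dx; have /nbhs_ballP[e /= e0 xD] : nbhs x D by exact: open_nbhs_nbhs.
  by exists e => //; exact: poinc_box.
have SD : S `<=` D by move=> x [].
have oS : open S.
  rewrite openE => x [Dx [A [PA A0 Ax]]]; have [oA AD _] := PA.
  apply: filterS (open_nbhs_nbhs (conj oA Ax)) => y Ay; split; first exact: AD.
  by exists A.
have oDS : open (D `\` S).
  rewrite openE => x [Dx nSx]; have [e e0 Pe] := small x Dx.
  have [_ eD _] := Pe.
  apply: filterS (nbhsx_ballx x e e0) => y xy; split; first exact: eD.
  move=> [_ [A [PA A0 Ay]]]; apply: nSx; split => //.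
  exists (A `|` ball x e); split; [|by left|by right; exact: ballxx].
  by apply: poinc_union => //; exists y.
have ES : S = D.
  apply: cD.
  - exists p0; split => //; have [e e0 Pe] := small p0 Dp0.
    by exists (ball p0 e); split => //; exact: ballxx.
  - by exists S => //; apply/seteqP; split=> [x Sx|x []//]; split => //; exact: SD.
  - exists (~` (D `\` S)); first exact: open_closedC.
    apply/seteqP; split=> [x Sx|x [Dx /not_andP[]//]]; first by split; [exact: SD|move=> []].
    by move=> /contrapT.
by move=> x; rewrite -{1}ES => -[].
Qed.

(** Good sets containing [p0] are directed under union, since any two of them overlap. Compactness
    of the closure then produces a single good set that covers [D]. *)
Lemma poinc_local p0 : connected D -> D p0 -> compact (closure D) ->
  (forall p, closure D p -> exists2 d, 0 < d & poinc (D `&` ball p d)) -> poinc D.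
Proof.
move=> cD Dp0 cK loc.
pose good A := poinc A /\ A p0.
have goodU A B : good A -> good B -> good (A `|` B).
  move=> [PA A0] [PB B0]; split; last by left.
  by apply: poinc_union => //; exists p0.
(* The filter of properties that hold for all sufficiently large good sets; a finite subcover
   becomes a statement about points near the closure and large good sets. *)
pose F : set_system (set pt) := [set S | exists2 A, good A & forall B, good B -> A `<=` B -> S B].
have FF : Filter F.
  split.
  - by have [A [PA A0 _]] := poinc_connected cD Dp0 Dp0; exists A.
  - move=> S1 S2 [A1 g1 h1] [A2 g2 h2]; exists (A1 `|` A2); first exact: goodU.
    move=> B gB AB; split; [apply: h1 => // x ?; apply: AB; by left|apply: h2 => // x ?; apply: AB; by right].
  - by move=> S1 S2 S12 [A gA h]; exists A => // B gB AB; apply/S12/h.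
have := (compact_near_coveringP _).1 cK _ F (fun A x => D x -> A x) FF.
case.
  move=> x clx; have [d d0 Pd] := loc x clx.
  have [A [PA A0 NA]] : exists A, [/\ poinc A, A p0 & D `&` ball x d `<=` A].
    have [y [Dy yx]] := clx _ (nbhsx_ballx x d d0).
    have [B [PB B0 By]] := poinc_connected cD Dp0 Dy.
    exists (B `|` (D `&` ball x d)); split; [|by left|by move=> z ?; right].
    by apply: poinc_union => //; exists y.
  exists (ball x d, [set B | good B /\ A `<=` B]); first split.
  - exact: nbhsx_ballx.
  - by exists A => // B gB AB.
  - by move=> [y B] /= [xy [_ AB]] Dy; apply/AB/NA.
move=> A gA HA; have AA := HA A gA (@subset_refl _ A).
have [PA _] := gA; have [_ AD _] := PA.
suff -> : D = A by [].
by apply/seteqP; split => // x Dx; apply: AA => //; exact: subset_closure.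
Qed.

End poincare.

Lemma poincare_wirtinger (R : realType) (D : set (R * R)) : smooth_bounded_domain D ->
  exists2 C : R, 0 <= C & forall f, inH1 D f -> exists c : R,
    \int[@mu2 R]_(x in D) (f x - c) ^+ 2 <= C * (gradnorm D f ^+ 2 + 1).
Proof.
move=> [[p0 Dp0] oD cD bD bdry].
have mD := open_measurable2 oD; have Dfin := bounded_mu2 bD mD.
have loc p : closure D p -> exists2 d, 0 < d & poinc D (D `&` ball p d).
  move=> clp; have [Dp|nDp] := pselect (D p).
    have /nbhs_ballP[e /= e0 pD] : nbhs p D by exact: open_nbhs_nbhs.
    by exists e => //; rewrite setIidr//; exact: poinc_box.
  have [|r [c [s [g [r0 cs cg HD]]]]] := bdry p; first by split.
  exact: (poinc_chart oD Dfin r0 cs (Ck_continuous cg) clp nDp HD).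
have cK : compact (closure D).
  have [M [Mr HM]] := bD.
  pose r : R := `|M| + 1; have Mr' : M < r by rewrite /r (le_lt_trans (ler_norm _))// ltrDl.
  apply: (@subclosed_compact _ _ (cbox (- r) r (- r) r)); [exact: closed_closure|exact: compact_cbox|].
  have cb : closed (cbox (- r) r (- r) r) by apply: compact_closed; [exact: norm_hausdorff|exact: compact_cbox].
  apply: (subset_trans (@closure_subset _ D (cbox (- r) r (- r) r) _)).
    move=> x Dx; have := HM _ Mr' x Dx; rewrite /= pt_normE ge_max !ler_norml => /andP[h1 h2].
    by split; rewrite /= in_itv.
  by move=> x; rewrite -(closure_id _).1.
by have [_ _ H] := poinc_local oD Dfin cD Dp0 cK loc.
Qed.

(** * Planar inequalities for functions vanishing on the boundary *)

Section line_integrals.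
Context {R : realType}.
Notation leb := (@lebesgue_measure R).
Variables (F F' : R -> R) (r : R).
Hypothesis r0 : 0 < r.
Hypothesis dF : forall s : R, is_derive s (1 : R) F (F' s).
Hypothesis cF' : continuous F'.
Hypothesis F0 : forall s, r <= `|s| -> F s = 0.

Let cF : continuous F.
Proof. by move=> s; apply: differentiable_continuous; apply/derivable1_diffP; case: (dF s). Qed.

Lemma line_ftc (a b : R) : a < b ->
  (\int[leb]_(s in `[a, b]) (F' s)%:E = (F b - F a)%:E)%E.
Proof.
move=> ab; rewrite (continuous_FTC2 (F := F) ab) ?EFinB//.
- exact: continuous_subspaceT.
- split; first by move=> s _; case: (dF s).
  + exact/cvg_at_right_filter/cF.
  + exact/cvg_at_left_filter/cF.
- by move=> s _; rewrite derive1E; case: (dF s).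
Qed.

Lemma line_bound t : (`|F t|%:E <= \int[leb]_s `|F' s|%:E)%E.
Proof.
have mF' : measurable_fun setT F' by exact: continuous_measurable_fun.
have [rt|tr] := leP r `|t|.
  by rewrite (F0 rt) normr0; apply: integral_ge0 => s _; rewrite lee_fin.
move: tr; rewrite ltr_norml => /andP[rt tr].
have E := line_ftc rt.
have Fr : F (- r) = 0 by apply: F0; rewrite normrN ger0_norm// ltW.
rewrite -[F t]subr0 -Fr -abse_EFin -E.
apply: le_trans (le_abse_integral _ _ _) _ => //.
  by apply/measurable_EFinP; exact: measurable_funTS.
by apply: ge0_subset_integral => //; apply/measurable_EFinP; exact: measurableT_comp.
Qed.

Lemma line_zero : (forall s, r <= `|s| -> F' s = 0) -> (\int[leb]_s (F' s)%:E = 0)%E.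
Proof.
move=> F'0; have rr : - r < r by rewrite gtrN.
have Fr s : `|s| = r -> F s = 0 by move=> sr; apply: F0; rewrite sr.
have := line_ftc rr; rewrite !Fr ?normrN ?ger0_norm ?(ltW r0)// subrr => E.
apply: etrans E; rewrite [RHS]integral_mkcond; apply: eq_integral => s _; rewrite patchE; case: ifPn => // sr.
rewrite F'0//; rewrite leNgt; apply: contra sr => sr.
by rewrite inE /= in_itv/= -ler_norml ltW.
Qed.

End line_integrals.

Lemma mul_le_sqrD (R : realType) (a b : R) : a * b <= a ^+ 2 + b ^+ 2.
Proof. by have := sqr_ge0 (a - b); have := sqr_ge0 (a + b); rewrite !expr2; nra. Qed.

(** * Gagliardo's inequality and the moments of test functions *)

Section test_functions_plane.
Context {R : realType}.
Notation pt := (R * R)%type.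
Notation mpt := (measurableTypeR R * measurableTypeR R)%type.
Notation leb := (@lebesgue_measure R).
Notation mu2 := (@mu2 R).

Lemma testfun_radius (D : set pt) chi : testfun D chi ->
  exists2 r : R, 0 < r & forall x : pt, r <= `|x| -> chi x = 0.
Proof.
move=> [_ [K [cK _ K0]]]; have [M [Mr HM]] := compact_bounded cK.
exists (`|M| + 1 + 1); first by rewrite !ltr_wpDl.
move=> x xr; apply: K0 => Kx.
have : M < `|M| + 1 by rewrite (le_lt_trans (ler_norm _))// ltrDl.
by move=> /HM /(_ x Kx) /=; lra.
Qed.

Lemma testfun_measurable (D : set pt) chi : testfun D chi ->
  measurable_fun setT (chi : mpt -> R).
Proof.
move=> tc; have cc : continuous chi := Ck_continuous (tc.1 0%N).
exact: continuous_measurable2.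
Qed.

Lemma testfun_intg (D A : set pt) chi : measurable (A : set mpt) -> testfun D chi ->
  intg mu2 A chi.
Proof.
move=> mA tc; have tT := testfunS (@subsetT _ D) tc.
have : intg mu2 setT chi.
  have H := L1loc_testfun (D := setT) (g := fun=> 1) measurableT _ tT.
  apply: eq_intg (H _) => //; first by move=> x _; rewrite mul1r.
  split => // K cK _; have mK := compact_measurable2 cK.
  by apply: (@intg_bounded _ _ _ mu2 K mK _ 1 (compact_mu2 cK)) => // x _; rewrite normr1.
by apply: integrableS.
Qed.

Section coordinate_lines.
Variables (chi : pt -> R).
Hypothesis tc : testfun setT chi.

Let D0 := 'D_(e_ (@ord0 1)) chi.
Let D1 := 'D_(e_ (@ord_max 1)) chi.

Let lines : exists2 r : R, 0 < r &
  (forall y, (forall s : R, is_derive s (1 : R) (fun s => chi (s, y)) (D0 (s, y))) /\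
    continuous (fun s : R => D0 (s, y))) /\
  (forall x, (forall s : R, is_derive s (1 : R) (fun s => chi (x, s)) (D1 (x, s))) /\
    continuous (fun s : R => D1 (x, s))) /\
  forall z : pt, r <= `|z.1| \/ r <= `|z.2| -> [/\ chi z = 0, D0 z = 0 & D1 z = 0].
Proof.
have t0 := testfun_derive (e_ (@ord0 1)) tc; have t1 := testfun_derive (e_ (@ord_max 1)) tc.
have [r r0 H] := testfun_radius tc.
have [r' r0' H'] := testfun_radius t0; have [r'' r0'' H''] := testfun_radius t1.
exists (r + r' + r''); first by rewrite !addr_gt0.
have c0 : continuous D0 := Ck_continuous (t0.1 0%N).
have c1 : continuous D1 := Ck_continuous (t1.1 0%N).
have dv y u : derivable chi y u by apply: (@Ck_derivable _ _ 0%N); exact: tc.1.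
split; last split.
- move=> y; split => s.
    have := @line_derive R _ chi (0, y) (e_ (@ord0 1)) s (dv _ _).
    rewrite /D0; have E (t : R) : (0, y) + t *: e_ (@ord0 1) = (t, y).
      by rewrite /e_ eqxx; congr (_, _); rewrite /= /GRing.scale/= ?mulr1 ?mulr0 ?addr0 ?add0r.
    by rewrite E; under eq_fun do rewrite E.
  have -> : (fun s : R => D0 (s, y)) = (fun s : R => D0 ((0, y) + s *: e_ (@ord0 1))).
    apply/funext => t; congr D0.
    by rewrite /e_ eqxx; congr (_, _); rewrite /= /GRing.scale/= ?mulr1 ?mulr0 ?addr0 ?add0r.
  apply: (@continuous_comp _ _ _ (fun s : R => (0, y) + s *: e_ (@ord0 1)) D0); last exact: c0.
  by apply: continuousD; [exact: cst_continuous|apply: continuousZl; exact: id].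
- move=> x; split => s.
    have := @line_derive R _ chi (x, 0) (e_ (@ord_max 1)) s (dv _ _).
    rewrite /D1; have E (t : R) : (x, 0) + t *: e_ (@ord_max 1) = (x, t).
      by rewrite /e_ /=; congr (_, _); rewrite /= /GRing.scale/= ?mulr1 ?mulr0 ?addr0 ?add0r.
    by rewrite E; under eq_fun do rewrite E.
  have -> : (fun s : R => D1 (x, s)) = (fun s : R => D1 ((x, 0) + s *: e_ (@ord_max 1))).
    apply/funext => t; congr D1.
    by rewrite /e_ /=; congr (_, _); rewrite /= /GRing.scale/= ?mulr1 ?mulr0 ?addr0 ?add0r.
  apply: (@continuous_comp _ _ _ (fun s : R => (x, 0) + s *: e_ (@ord_max 1)) D1); last exact: c1.
  by apply: continuousD; [exact: cst_continuous|apply: continuousZl; exact: id].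
- move=> z zr; have rz : r + r' + r'' <= `|z|.
    by rewrite pt_normE le_max; case: zr => ->; rewrite ?orbT.
  by split; [apply: H|apply: H'|apply: H'']; lra.
Qed.

Let mchi := testfun_measurable tc.
Let mD0 : measurable_fun setT (D0 : mpt -> R) := testfun_measurable (testfun_derive _ tc).
Let mD1 : measurable_fun setT (D1 : mpt -> R) := testfun_measurable (testfun_derive _ tc).

Lemma Rint_testfun_derive i : \int[mu2]_x 'D_(e_ i) chi x = 0.
Proof.
have [r r0 [L0 [L1 LZ]]] := lines.
have i0 : intg mu2 setT D0 by apply: testfun_intg (testfun_derive _ tc).
have i1 : intg mu2 setT D1 by apply: testfun_intg (testfun_derive _ tc).
suff [E0 E1] : \int[mu2]_x D0 x = 0 /\ \int[mu2]_x D1 x = 0.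
  case: i => [[|[|//]] im].
    have e0 : Ordinal im = ord0 :> 'I_2 by apply: val_inj.
    by rewrite e0; exact: E0.
  have e1 : Ordinal im = ord_max :> 'I_2 by apply: val_inj.
  by rewrite e1; exact: E1.
split; apply: EFin_inj; rewrite -integral_intg//.
  rewrite -(@integral21_prod_meas1 _ _ _ _ R leb leb (EFin \o D0) i0).
  apply: integral0_eq => y _; apply: (line_zero r0 (L0 y).1 (L0 y).2).
    by move=> s rs; have [] := LZ (s, y) (or_introl rs).
  by move=> s rs; have [] := LZ (s, y) (or_introl rs).
rewrite -(@integral12_prod_meas1 _ _ _ _ R leb leb (EFin \o D1) i1).
apply: integral0_eq => x _; apply: (line_zero r0 (L1 x).1 (L1 x).2).
  by move=> s rs; have [] := LZ (x, s) (or_intror rs).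
by move=> s rs; have [] := LZ (x, s) (or_intror rs).
Qed.

(** At each point [chi] is bounded by the integral [A] of one partial derivative over the horizontal
    line and by the integral [B] of the other over the vertical line. [A] depends on [y] only and
    [B] on [x] only, so the integral of their product factors. *)
Lemma gagliardo : \int[mu2]_x chi x ^+ 2 <=
  (\int[mu2]_x `|D0 x|) * (\int[mu2]_x `|D1 x|).
Proof.
have [r r0 [L0 [L1 LZ]]] := lines.
have i0 : intg mu2 setT D0 by apply: testfun_intg (testfun_derive _ tc).
have i1 : intg mu2 setT D1 by apply: testfun_intg (testfun_derive _ tc).
have i2 : intg mu2 setT (fun x => chi x ^+ 2).
  apply: (@testfun_intg setT) => //.
  have -> : (fun x => chi x ^+ 2) = (fun x => chi x * chi x) by [].
  by apply: testfunM tc; exact: tc.1.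
pose A (y : R) : \bar R := (\int[leb]_s `|D0 (s, y)|%:E)%E.
pose B (x : R) : \bar R := (\int[leb]_s `|D1 (x, s)|%:E)%E.
have A0 y : (0 <= A y)%E by apply: integral_ge0 => s _; rewrite lee_fin.
have B0 x : (0 <= B x)%E by apply: integral_ge0 => s _; rewrite lee_fin.
have m0 : measurable_fun setT (fun z : mpt => `|D0 z|%:E).
  by apply/measurable_EFinP; exact: measurableT_comp.
have m1 : measurable_fun setT (fun z : mpt => `|D1 z|%:E).
  by apply/measurable_EFinP; exact: measurableT_comp.
have p0 (z : mpt) : (0 <= `|D0 z|%:E)%E by rewrite lee_fin.
have p1 (z : mpt) : (0 <= `|D1 z|%:E)%E by rewrite lee_fin.
have mA : measurable_fun setT (A : measurableTypeR R -> \bar R).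
  exact: (@measurable_fun_fubini_tonelli_G _ _ _ _ R leb (fun z : mpt => `|D0 z|%:E) m0 p0).
have mB : measurable_fun setT (B : measurableTypeR R -> \bar R).
  exact: (@measurable_fun_fubini_tonelli_F _ _ _ _ R leb (fun z : mpt => `|D1 z|%:E) m1 p1).
have EA : (\int[leb]_y A y = (\int[mu2]_x `|D0 x|)%:E)%E.
  rewrite -integral_intg//; last exact: intg_abs.
  by rewrite (@fubini_tonelli2 _ _ _ _ R leb leb _ m0 p0).
have EB : (\int[leb]_y B y = (\int[mu2]_x `|D1 x|)%:E)%E.
  rewrite -integral_intg//; last exact: intg_abs.
  by rewrite (@fubini_tonelli1 _ _ _ _ R leb leb _ m1 p1).
have lbB x y : (`|chi (x, y)|%:E <= B x)%E.
  by apply: (line_bound r0 (L1 x).1 (L1 x).2) => s rs; have [] := LZ (x, s) (or_intror rs).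
have lbA x y : (`|chi (x, y)|%:E <= A y)%E.
  by apply: (line_bound r0 (L0 y).1 (L0 y).2) => s rs; have [] := LZ (s, y) (or_introl rs).
clearbody A B; move: (\int[mu2]_x `|D0 x|) (\int[mu2]_x `|D1 x|) EA EB => a b EA EB.
suff : ((\int[mu2]_x chi x ^+ 2)%:E <= (\int[leb]_y A y) * \int[leb]_x B x)%E.
  by rewrite EA EB -EFinM lee_fin.
rewrite -(integral_intg measurableT i2).
have m2 : measurable_fun setT (fun z : mpt => (chi z ^+ 2)%:E).
  by apply/measurable_EFinP; exact: measurable_funX.
have p2 (z : mpt) : (0 <= (chi z ^+ 2)%:E)%E by rewrite lee_fin sqr_ge0.
rewrite (@fubini_tonelli1 _ _ _ _ R leb leb _ m2 p2) /fubini_F.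
have mBA : measurable_fun setT (fun x : measurableTypeR R => B x * \int[leb]_y A y)%E.
  exact: emeasurable_funM.
apply: (@le_trans _ _ (\int[leb]_x (B x * \int[leb]_y A y))%E).
  apply: ge0_le_integral => //.
  - by move=> x _; exact: integral_ge0.
  - exact: (@measurable_fun_fubini_tonelli_F _ _ _ _ R leb _ m2 p2).
  - move=> x _; rewrite -ge0_integralZl//.
    apply: ge0_le_integral => //.
    + by apply/measurable_EFinP; apply: measurable_funX; exact: (measurableT_comp mchi (measurable_pair1 (x : measurableTypeR R))).
    + exact: emeasurable_funM.
    + move=> y _; rewrite -(real_normK (num_real (chi _))) expr2 EFinM.
      apply: lee_pmul; rewrite ?lee_fin ?normr_ge0//.
under eq_integral do rewrite muleC.
rewrite ge0_integralZl//; exact: integral_ge0.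
Qed.

End coordinate_lines.

Variable D : set pt.
Hypothesis oD : open D.
Hypothesis Dfin : (mu2 D < +oo)%E.
Let mD : measurable (D : set mpt). Proof. exact: open_measurable2. Qed.

Lemma testfun_out chi x : testfun D chi -> ~ D x -> chi x = 0.
Proof. by move=> [_ [K [_ KD K0]]] Dx; apply: K0 => /KD. Qed.

Lemma testfun_Rint chi : testfun D chi -> \int[mu2]_(x in D) chi x = \int[mu2]_x chi x.
Proof.
by move=> tc; apply: Rint_support => // x _; exact: testfun_out.
Qed.

Lemma test_ibp i chi psi : testfun D chi -> testfun D psi ->
  \int[mu2]_(x in D) (chi x * 'D_(e_ i) psi x) = - (\int[mu2]_(x in D) ('D_(e_ i) chi x * psi x)).
Proof.
move=> tc tp; have tcp := testfunM tp.1 tc.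
have tdc := testfun_derive (e_ i) tc; have tdp := testfun_derive (e_ i) tp.
have i1 : intg mu2 D (fun x => chi x * 'D_(e_ i) psi x) by apply: testfun_intg (testfunM tdp.1 tc).
have i2 : intg mu2 D (fun x => 'D_(e_ i) chi x * psi x) by apply: testfun_intg (testfunM tp.1 tdc).
apply/eqP; rewrite -subr_eq0 opprK -Rint_D//.
have E x : 'D_(e_ i) (fun x => chi x * psi x) x = chi x * 'D_(e_ i) psi x + 'D_(e_ i) chi x * psi x.
  have dc : derivable chi x (e_ i) by apply: (@Ck_derivable _ _ 0%N); exact: tc.1.
  have dp : derivable psi x (e_ i) by apply: (@Ck_derivable _ _ 0%N); exact: tp.1.
  by have := deriveM dc dp; rewrite /GRing.scale/= [psi x * _]mulrC.
rewrite -(eq_Rint mu2 (fun x _ => E x)) testfun_Rint; last exact: testfun_derive.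
rewrite Rint_testfun_derive//.
by apply: testfunS tcp.
Qed.

Lemma testfun_weak_partial i chi : testfun D chi -> is_weak_partial D i chi ('D_(e_ i) chi).
Proof.
move=> tc; split; first exact: (sqi_L1loc oD (testfun_sqi oD (testfun_derive _ tc))).
by move=> psi tp; rewrite test_ibp.
Qed.

Lemma testfun_inH1 chi : testfun D chi -> inH1 D chi.
Proof.
move=> tc; split; first exact: testfun_sqi.
move=> i; exists ('D_(e_ i) chi); first exact: testfun_weak_partial.
exact: (testfun_sqi oD (testfun_derive _ tc)).
Qed.

Lemma testfun_wD i chi : testfun D chi ->
  {ae mu2, forall x, D x -> wD D i chi x = 'D_(e_ i) chi x}.
Proof. by move=> tc; apply: (wD_ae oD); exact: testfun_weak_partial. Qed.

Lemma testfunX k chi : testfun D chi -> testfun D (fun x => chi x ^+ k.+1).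
Proof.
move=> tc; have -> : (fun x => chi x ^+ k.+1) = (fun x => chi x * chi x ^+ k).
  by apply/funext => x; rewrite exprS.
by apply: (testfunM _ tc) => j; apply: CkX; exact: tc.1.
Qed.

Lemma gradnorm_test chi : testfun D chi ->
  gradnorm D chi ^+ 2 = n2 mu2 D ('D_(e_ ord0) chi) ^+ 2 + n2 mu2 D ('D_(e_ ord_max) chi) ^+ 2.
Proof.
move=> tc.
have e i : \int[mu2]_(x in D) wD D i chi x ^+ 2 = n2 mu2 D ('D_(e_ i) chi) ^+ 2.
  rewrite (n2_sqr mu2 D ('D_(e_ i) chi)).
  by apply: eq_Rintegral_ae; apply: ae_mono (testfun_wD i tc) => x H Dx; rewrite H.
rewrite gradnorm_sqr big_ord_recr big_ord1 /=.
have -> : widen_ord (leqnSn 1) ord0 = ord0 :> 'I_2 by apply: val_inj.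
by congr (_ + _); exact: e.
Qed.

(** [gagliardo] for [chi ^+ k.+1], whose derivatives are [k.+1%:R * chi ^+ k] times those of [chi];
    Cauchy-Schwarz separates the two factors. The case [k = 1] is Ladyzhenskaya's inequality. *)
Lemma moment_step k chi : testfun D chi ->
  \int[mu2]_(x in D) chi x ^+ k.+1.*2 <=
  k.+1%:R ^+ 2 * (\int[mu2]_(x in D) chi x ^+ k.*2) * gradnorm D chi ^+ 2.
Proof.
move=> tc; have tX := testfunX k tc; have tT := testfunS (@subsetT _ D) tX.
have sX : sqi mu2 D (fun x => chi x ^+ k).
  case: k {tX tT} => [|k]; last exact: (testfun_sqi oD (testfunX k tc)).
  by apply: (@eq_sqi _ _ _ mu2 D mD (fun=> 1)) => //; exact: sqi_cst.
have dE i x : 'D_(e_ i) (fun x => chi x ^+ k.+1) x = k.+1%:R * (chi x ^+ k * 'D_(e_ i) chi x).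
  have dc : derivable chi x (e_ i) by apply: (@Ck_derivable _ _ 0%N); exact: tc.1.
  have := deriveX k.+1 dc; rewrite exprfctE => ->.
  by rewrite /GRing.scale/= mulrA.
have sd i : sqi mu2 D ('D_(e_ i) chi) by exact: (testfun_sqi oD (testfun_derive _ tc)).
have bound i : \int[mu2]_x `|'D_(e_ i) (fun x => chi x ^+ k.+1) x| <=
    k.+1%:R * (n2 mu2 D (fun x => chi x ^+ k) * n2 mu2 D ('D_(e_ i) chi)).
  have tdX := testfun_derive (e_ i) tX.
  rewrite -(@Rint_support R D setT)//; last by move=> x _ Dx; rewrite (testfun_out tdX Dx) normr0.
  have ii := sqi_mul mD sX (sd i).
  rewrite (@eq_Rint _ _ _ mu2 D _ (fun x => k.+1%:R * `|chi x ^+ k * 'D_(e_ i) chi x|)); last first.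
    by move=> x _; rewrite dE normrM ger0_norm.
  rewrite Rint_Z//; last exact: intg_abs.
  rewrite ler_wpM2l//.
  have sabs (g : mpt -> R) : sqi mu2 D g -> sqi mu2 D (fun x => `|g x|).
    move=> gs; apply: (sqi_dom mD _ gs) => [|x _]; last by rewrite normr_id.
    by apply: measurableT_comp => //; exact: gs.1.
  have nabs (g : mpt -> R) : n2 mu2 D (fun x => `|g x|) = n2 mu2 D g.
    by rewrite /n2; congr Num.sqrt; apply: eq_Rint => x _; rewrite real_normK// num_real.
  rewrite (@eq_Rint _ _ _ mu2 D _ (fun x => `|chi x ^+ k| * `|'D_(e_ i) chi x|)); last first.
    by move=> x _; rewrite normrM.
  rewrite -(nabs (fun x => chi x ^+ k)) -(nabs ('D_(e_ i) chi)).
  by apply: le_trans (ler_norm _) _; apply: cauchy_schwarz => //; exact: sabs.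
have := gagliardo tT.
rewrite -(@Rint_support R D setT)//; last first.
  by move=> x _ Dx; rewrite (testfun_out tX Dx) expr0n.
rewrite (@eq_Rint _ _ _ mu2 D _ (fun x => chi x ^+ k.+1.*2)); last first.
  by move=> x _; rewrite -exprM muln2.
move=> le1; apply: (le_trans le1).
apply: (@le_trans _ _ ((k.+1%:R * (n2 mu2 D (fun x => chi x ^+ k) * n2 mu2 D ('D_(e_ ord0) chi))) *
   (k.+1%:R * (n2 mu2 D (fun x => chi x ^+ k) * n2 mu2 D ('D_(e_ ord_max) chi))))).
  by apply: ler_pM => //; apply: Rintegral_ge0.
have -> : \int[mu2]_(x in D) chi x ^+ k.*2 = n2 mu2 D (fun x => chi x ^+ k) ^+ 2.
  by rewrite n2_sqr; apply: eq_Rint => x _; rewrite -exprM muln2.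
rewrite (gradnorm_test tc).
move: (n2_ge0 mu2 D (fun x => chi x ^+ k)) (n2_ge0 mu2 D ('D_(e_ ord0) chi)) (n2_ge0 mu2 D ('D_(e_ ord_max) chi)).
move: (n2 mu2 D (fun x => chi x ^+ k)) (n2 mu2 D ('D_(e_ ord0) chi)) (n2 mu2 D ('D_(e_ ord_max) chi)).
move=> m a b m0 a0 b0; have -> : k.+1%:R * (m * a) * (k.+1%:R * (m * b)) = k.+1%:R ^+ 2 * m ^+ 2 * (a * b) by ring.
rewrite ler_wpM2l//; first by rewrite mulr_ge0// sqr_ge0.
exact: mul_le_sqrD.
Qed.

(** Iterating [moment_step] down to the measure of [D] multiplies the constants to the square of a
    factorial. *)
Lemma moment_bound k chi : testfun D chi ->
  \int[mu2]_(x in D) chi x ^+ k.*2 <=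
  k`!%:R ^+ 2 * fine (mu2 D) * gradnorm D chi ^+ k.*2.
Proof.
move=> tc; elim: k => [|k IH].
  rewrite fact0 expr1n mul1r expr0 mulr1.
  by rewrite (@eq_Rint _ _ _ mu2 D _ (cst 1))// Rintegral_cst// mul1r.
apply: (le_trans (moment_step k tc)).
have -> : k.+1`!%:R ^+ 2 * fine (mu2 D) * gradnorm D chi ^+ k.+1.*2 =
   k.+1%:R ^+ 2 * (k`!%:R ^+ 2 * fine (mu2 D) * gradnorm D chi ^+ k.*2) * gradnorm D chi ^+ 2.
  by rewrite factS natrM doubleS !exprS; ring.
by rewrite ler_wpM2r ?sqr_ge0// ler_wpM2l ?sqr_ge0.
Qed.

End test_functions_plane.

(** * Weak lower semicontinuity *)

Section convex_functions.
Context {R : realType}.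

Lemma mvt_sign (f f' : R -> R) (a b : R) : (forall s : R, is_derive s (1 : R) f (f' s)) ->
  exists2 t, (a <= t <= b) \/ (b <= t <= a) & f b - f a = f' t * (b - a).
Proof.
move=> df; have cf : continuous f.
  by move=> s; apply: differentiable_continuous; apply/derivable1_diffP; case: (df s).
have [ab|ba|->] := ltgtP a b; last first.
- by exists b; rewrite ?subrr ?mulr0//; left; rewrite lexx.
- have [|t tab E] := MVT ba (fun s _ => df s); first exact: continuous_subspaceT.
  move: tab; rewrite in_itv/= => /andP[t1 t2].
  by exists t; [right; rewrite !ltW|rewrite -opprB E -mulrN opprB].
- have [|t tab E] := MVT ab (fun s _ => df s); first exact: continuous_subspaceT.
  move: tab; rewrite in_itv/= => /andP[t1 t2].
  by exists t; [left; rewrite !ltW|].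
Qed.

Lemma is_derive_pow (n : nat) (s : R) :
  is_derive s (1 : R) (fun s : R => s ^+ n) (n%:R * s ^+ n.-1).
Proof.
apply: DeriveDef; last by rewrite exp_derive /GRing.scale/= mulr1.
have H := (@Ck_derivable R _ 0%N (fun s : R => s ^+ n)).
by apply: H; apply: (@CkX R _ 1%N n id); exact: Ck_id.
Qed.

Lemma convex_tangent (H H1 H2 : R -> R) (s0 s1 : R) :
  (forall s : R, is_derive s (1 : R) H (H1 s)) ->
  (forall s : R, is_derive s (1 : R) H1 (H2 s)) -> (forall s, 0 <= H2 s) ->
  H s0 + H1 s0 * (s1 - s0) <= H s1.
Proof.
move=> dH dH1 cH.
have [t tb E] := mvt_sign s0 s1 dH.
have [t' tb' E'] := mvt_sign s0 t dH1.
have : 0 <= H2 t' * ((t - s0) * (s1 - s0)).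
  apply: mulr_ge0 => //.
  case: tb => /andP[h1 h2]; first by rewrite mulr_ge0// subr_ge0// (le_trans h1).
  by rewrite mulr_le0// subr_le0// (le_trans h1).
by rewrite mulrA -E' mulrBl -E; lra.
Qed.

Lemma convex_bound (H H1 H2 : R -> R) (c s0 s1 : R) :
  (forall s : R, is_derive s (1 : R) H (H1 s)) ->
  (forall s : R, is_derive s (1 : R) H1 (H2 s)) -> (forall s, c <= H2 s) ->
  H s0 + H1 s0 * (s1 - s0) + c / 2 * (s1 - s0) ^+ 2 <= H s1.
Proof.
move=> dH dH1 cH.
have d2 (s : R) : is_derive s (1 : R) (fun s => H s - c / 2 * s ^+ 2) (H1 s - c * s).
  have := is_deriveB (dH s) (is_deriveZ (c / 2) (is_derive_pow 2 s)).
  by rewrite /GRing.scale/= (_ : c / 2 * (2 * s ^+ 1) = c * s)//; field.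
have d1 (s : R) : is_derive s (1 : R) (fun s => H1 s - c * s) (H2 s - c).
  have := is_deriveB (dH1 s) (is_deriveZ c (is_derive_id s (1 : R))).
  by rewrite /GRing.scale/= mulr1.
have := convex_tangent s0 s1 d2 d1 (fun s => ltac:(by rewrite subr_ge0)).
move: (H s0) (H s1) (H1 s0) => a b e; rewrite !expr2; lra.
Qed.

Lemma even_pow_subgradient k (s0 s1 : R) :
  s0 ^+ k.*2 + k.*2%:R * s0 ^+ k.*2.-1 * (s1 - s0) <= s1 ^+ k.*2.
Proof.
have := @convex_bound (fun s => s ^+ k.*2) (fun s => k.*2%:R * s ^+ k.*2.-1)
  (fun s => k.*2%:R * (k.*2.-1%:R * s ^+ k.*2.-2)) 0 s0 s1 (is_derive_pow k.*2).
rewrite mul0r mul0r addr0; apply.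
- move=> s; have := is_deriveZ (k.*2%:R : R) (is_derive_pow k.*2.-1 s).
  by [].
- move=> s; rewrite mulr_ge0// mulr_ge0//; case: k => [|k]; first by rewrite expr0.
  by rewrite doubleS /= exprn_even_ge0// odd_double.
Qed.

End convex_functions.

Section weak_lower_semicontinuity.
Context d (T : measurableType d) (R : realType) (mu : {measure set T -> \bar R}).
Variables (D : set T) (mD : measurable D) (Dfin : (mu D < +oo)%E).

(** Monotone convergence along the exhaustion [A]; integrability of [h] is a conclusion, drawn from
    the uniform bound on the truncated integrals. *)
Lemma monotone_bound (h : T -> R) (A : nat -> set T) (K : R) :
  measurable_fun D h -> (forall n, measurable (A n)) -> {ae mu, forall x, D x -> 0 <= h x} ->
  (forall x, D x -> exists n, A n x) -> (forall n m, (n <= m)%N -> A n `<=` A m) ->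
  (forall n, intg mu D (h \_ (A n)) /\ \int[mu]_(x in D) (h \_ (A n)) x <= K) ->
  intg mu D h /\ \int[mu]_(x in D) h x <= K.
Proof.
move=> mh mA h0 cA iA bA.
(* [h] is nonnegative almost everywhere only; the truncations of its positive part increase at every
   point. *)
pose p x := Num.max (h x) 0.
have mp : measurable_fun D p by apply: measurable_maxr => //; exact: measurable_cst.
have p0 x : 0 <= p x by rewrite le_max lexx orbT.
have pA n : {ae mu, forall x, D x -> (h \_ (A n)) x = (p \_ (A n)) x}.
  apply: ae_mono h0 => x H Dx; rewrite !patchE; case: ifPn => // _.
  by rewrite /p max_l// H.
have mpA n : measurable_fun D (p \_ (A n)).
  by apply/measurable_restrict => //; apply: measurable_funS mp => //; exact: subIsetl.
have ipA n : intg mu D (p \_ (A n)) by apply: (intg_ae_eq mD (mpA n) (bA n).1).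
have pAK n : (\int[mu]_(x in D) ((p \_ (A n)) x)%:E <= K%:E)%E.
  by rewrite integral_intg// lee_fin -(eq_Rintegral_ae (pA n)); exact: (bA n).2.
have homo x : {homo (fun n => ((p \_ (A n)) x)%:E) : n m / (n <= m)%N >-> (n <= m)%E}.
  move=> n m nm; rewrite lee_fin !patchE; case: ifPn => [/set_mem An|_]; last by case: ifPn.
  by rewrite (mem_set (iA n m nm x An)).
have pt x : D x -> limn (fun n => ((p \_ (A n)) x)%:E) = (p x)%:E.
  move=> Dx; have [n An] := cA x Dx; apply: cvg_lim => //.
  apply: (@cvg_trans _ ((fun=> (p x)%:E) @ \oo)); last exact: cvg_cst.
  apply: near_eq_cvg; near=> m; rewrite patchE mem_set//.
  by apply: (iA n m) An; near: m; exact: nbhs_infty_ge.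
have pK : (\int[mu]_(x in D) (p x)%:E <= K%:E)%E.
  have cv := @cvg_monotone_convergence _ _ _ mu D mD (fun n x => ((p \_ (A n)) x)%:E)
    (fun n => (measurable_EFinP _ _).2 (mpA n)) (fun n x _ => ltac:(rewrite lee_fin patchE; case: ifPn => //)) (fun x _ => homo x).
  rewrite (eq_integral (fun x => limn (fun n => ((p \_ (A n)) x)%:E))); last first.
    by move=> x /set_mem Dx; rewrite pt.
  rewrite -(cvg_lim _ cv)//; apply: lime_le; first by apply/cvg_ex; eexists; exact: cv.
  by apply: nearW.
have ip : intg mu D p.
  apply/integrableP; split; first exact/measurable_EFinP.
  under eq_integral => x _ do rewrite /= ger0_norm//.
  by apply: le_lt_trans pK _; rewrite ltry.
have hp : {ae mu, forall x, D x -> p x = h x}.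
  by apply: ae_mono h0 => x H Dx; rewrite /p max_l// H.
split; first exact: (intg_ae_eq mD mh ip hp).
by rewrite -(eq_Rintegral_ae hp) -lee_fin -integral_intg.
Unshelve. all: by end_near.
Qed.

(* Truncating the subgradient at the level sets of phi makes it an admissible
   test function for weak L^2 convergence. *)
Lemma weak_lsc (H Hp : T -> R -> R) (phi : T -> R) (c C : R) :
  measurable_fun D (fun x => H x (phi x)) -> measurable_fun D (fun x => Hp x (phi x)) ->
  sqi mu D phi ->
  {ae mu, forall x, D x -> forall s, H x (phi x) + Hp x (phi x) * (s - phi x) <= H x s} ->
  {ae mu, forall x, D x -> forall s, - C <= H x s} ->
  (forall N : R, exists M : R, {ae mu, forall x, D x -> `|phi x| <= N ->
     `|H x (phi x)| <= M /\ `|Hp x (phi x)| <= M}) ->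
  (forall w eps, sqi mu D w -> 0 < eps -> exists psi, [/\ sqi mu D psi,
     intg mu D (fun x => H x (psi x)), \int[mu]_(x in D) H x (psi x) <= c + eps &
     `|\int[mu]_(x in D) (w x * psi x) - \int[mu]_(x in D) (w x * phi x)| <= eps]) ->
  intg mu D (fun x => H x (phi x)) /\ \int[mu]_(x in D) H x (phi x) <= c.
Proof.
move=> mH mHp phis sub lb bd app.
have [[mphi _] ID] := (phis, fun k => sqi_intg mD Dfin (sqi_cst mD k Dfin)).
(* On these sets [bd] bounds both the density and its subgradient. *)
pose A n := D `&` [set x | `|phi x| <= n%:R].
have mA n : measurable (A n).
  have : measurable_fun D (fun x => `|phi x|) by exact: measurableT_comp.
  move=> /(_ mD `]-oo, n%:R]%classic (measurable_itv _)).
  by congr (measurable _); apply/seteqP; split=> x [Dx]; rewrite /= in_itv.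
pose h x := H x (phi x) + C.
have mh : measurable_fun D h by apply: measurable_funD.
have IC : \int[mu]_(x in D) C = C * fine (mu D) by rewrite Rintegral_cst.
have [ih bh] : intg mu D h /\ \int[mu]_(x in D) h x <= c + C * fine (mu D).
  apply: (monotone_bound (A := A)) => //.
  - by apply: ae_mono lb => x L Dx; have := L Dx (phi x); rewrite /h; lra.
  - move=> x Dx; exists (Num.truncn `|phi x|).+1; split => //=.
    by apply/ltW/truncnS_gt.
  - by move=> n m nm x [Dx] /= xn; split => //=; apply: (le_trans xn); rewrite ler_nat.
  - move=> n; have [M HM] := bd n%:R.
    have mhA : measurable_fun D (h \_ (A n)).
      by apply/measurable_restrict => //; apply: measurable_funS mh => //; exact: subIsetl.
    have mwA : measurable_fun D ((fun x => Hp x (phi x)) \_ (A n)).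
      by apply/measurable_restrict => //; apply: measurable_funS mHp => //; exact: subIsetl.
    have M0 : 0 <= `|M| by [].
    have ihA : intg mu D (h \_ (A n)).
      apply: (intg_dom_ae mD mhA (ID (`|M| + `|C|))).
      apply: ae_mono HM => x K Dx; rewrite patchE; case: ifPn => [/set_mem[_ /= xn]|_]; last first.
        by rewrite normr0 addr_ge0.
      have [K1 _] := K Dx xn; apply: (le_trans (ler_normD _ _)).
      by rewrite lerD2r (le_trans K1)// ler_norm.
    split => //; apply/ler_addgt0Pr => e e0.
    pose w := (fun x => Hp x (phi x)) \_ (A n).
    have ws : sqi mu D w.
      split => //; apply: (intg_dom_ae mD (measurable_funX _ mwA) (ID (`|M| ^+ 2))).
      apply: ae_mono HM => x K Dx; rewrite ger0_norm ?sqr_ge0// /w patchE.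
      case: ifPn => [/set_mem[_ /= xn]|_]; last by rewrite expr0n sqr_ge0.
      have [_ K2] := K Dx xn; rewrite -(real_normK (num_real (Hp _ _))).
      by rewrite ler_sqr ?nnegrE// (le_trans K2)// ler_norm.
    have e20 : 0 < e / 2 by rewrite divr_gt0.
    have [psi [ps ip bp wp]] := app w (e / 2) ws e20.
    have iwp := sqi_mul mD ws ps; have iwf := sqi_mul mD ws phis.
    (* On [A n] this is the subgradient inequality; elsewhere [w] vanishes and the right-hand side
       is [H x (psi x) + C], which is nonnegative. *)
    have le1 : \int[mu]_(x in D) (h \_ (A n)) x <=
       \int[mu]_(x in D) ((H x (psi x) + C) - (w x * psi x - w x * phi x)).
      apply: (le_Rint_ae mD ihA).
        by apply: intgB => //; [apply: intgD|apply: intgB].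
      apply: ae_mono (ae_and sub lb) => x [S L] Dx; rewrite /w !patchE.
      have L0 : 0 <= H x (psi x) + C by have := L Dx (psi x); lra.
      case: ifPn => [_|_]; last by rewrite !mul0r subrr subr0.
      have := S Dx (psi x); rewrite /h; move: (H x _) (H x _) (Hp x _) => a b g.
      by rewrite mulrBr; lra.
    apply: (le_trans le1); rewrite Rint_B//; [|by apply: intgD|by apply: intgB].
    rewrite Rint_D// Rint_B// IC.
    move: wp; rewrite ler_norml => /andP[w1 w2]; move: bp w1 w2.
    move: (Rintegral _ _ _) (Rintegral _ _ _) (Rintegral _ _ _) (C * _) => a b g k.
    by lra.
have iH : intg mu D (fun x => H x (phi x)).
  by apply: (eq_intg mD _ (intgB mD ih (ID C))) => x _; rewrite /h addrK.
split => //; move: bh; rewrite /h Rint_D// IC; move: (C * _) => k; lra.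
Qed.

End weak_lower_semicontinuity.

Lemma le_add_shift (R : realType) (x y z d d' : R) :
  x <= y + z -> y <= d' -> d' <= d -> x <= z + d.
Proof. lra. Qed.

(** * Estimates in the closure of the test functions *)

Section H10_estimates.
Context {R : realType}.
Notation pt := (R * R)%type.
Notation mpt := (measurableTypeR R * measurableTypeR R)%type.
Notation mu2 := (@mu2 R).
Variable D : set pt.
Hypothesis oD : open D.
Hypothesis Dfin : (mu2 D < +oo)%E.
Let mD : measurable (D : set mpt). Proof. exact: open_measurable2. Qed.

Lemma H10_inH1 f : H10 D f -> inH1 D f.
Proof. by move=> [/(W12P oD)]. Qed.

Lemma H10_approx f e : H10 D f -> 0 < e -> exists2 chi, testfun D chi &
  [/\ inH1 D (fun x => f x - chi x), n2 mu2 D (fun x => f x - chi x) <= e &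
      gradnorm D (fun x => f x - chi x) <= e].
Proof.
move=> fH e0; have [chi tc Hc] := fH.2 e e0; exists chi => //.
have fc : inH1 D (fun x => f x - chi x).
  have [H _] := inH1_lin oD (-1) (testfun_inH1 oD tc) (H10_inH1 fH).
  by have -> : (fun x => f x - chi x) = (fun x => -1 * chi x + f x)
    by apply/funext => x; rewrite mulN1r addrC.
have Hc' : H1_norm D (fun x => f x - chi x) < e by [].
by split => //; apply: le_trans (ltW Hc'); [exact: n2_le_H1|exact: gradnorm_le_H1].
Qed.

(** Continuity at [d = 0]: approximants whose norms exceed those of the limit by at most [d] lose
    only [e] in the estimate. *)
Lemma poly_room (A G C e : R) (a b : nat) : 0 < e ->
  exists2 d, 0 < d & C * (A + d) ^+ a * (G + d) ^+ b <= C * A ^+ a * G ^+ b + e.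
Proof.
move=> e0; pose P (d : R) := C * (A + d) ^+ a * (G + d) ^+ b.
have cP : continuous P.
  have cl (B : R) : Ck 0 (fun d : R => B + d) by apply: CkD; [exact: Ck_cst|exact: Ck_id].
  apply: (@Ck_continuous R _ 0%N); apply: CkM; last exact: CkX.
  by apply: CkZ; exact: CkX.
have : nbhs (0 : R) [set d | P d < P 0 + e].
  by apply: (cP 0 [set y | y < P 0 + e]); apply: open_nbhs_nbhs; split; [exact: open_lt|rewrite /= ltrDl].
move=> /nbhs_ballP[r /= r0 Hr]; exists (r / 2); first by rewrite divr_gt0.
have := Hr (r / 2); rewrite /P addr0 addr0 => H; apply/ltW/H.
by rewrite -ball_normE /= sub0r normrN gtr0_norm ?divr_gt0//; lra.
Qed.

(** For [f] in the closure the left-hand integral is not known to be finite. Convexity of the even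
    power and weak lower semicontinuity along test functions give finiteness and the bound
    together. *)
Lemma H10_lsc (k a b : nat) (C : R) f : 0 <= C ->
  (forall chi, testfun D chi ->
    \int[mu2]_(x in D) chi x ^+ k.*2 <= C * n2 mu2 D chi ^+ a * gradnorm D chi ^+ b) ->
  H10 D f -> intg mu2 D (fun x => f x ^+ k.*2) /\
  \int[mu2]_(x in D) f x ^+ k.*2 <= C * n2 mu2 D f ^+ a * gradnorm D f ^+ b.
Proof.
move=> C0 test fH; have fi := H10_inH1 fH; have fs := inH1_sqi fi.
apply: (weak_lsc mD Dfin (H := fun _ s => s ^+ k.*2) (Hp := fun _ s => k.*2%:R * s ^+ k.*2.-1)
  (phi := f) (C := 0)) => //.
- by apply: measurable_funX; exact: fs.1.
- by apply: measurable_funM => //; apply: measurable_funX; exact: fs.1.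
- by apply: aeW => x _ s; exact: even_pow_subgradient.
- by apply: aeW => x _ s; rewrite oppr0 exprn_even_ge0// odd_double.
- move=> N; exists (`|N| ^+ k.*2 + k.*2%:R * `|N| ^+ k.*2.-1); apply: aeW => x _ fN.
  have fN' : `|f x| <= `|N| by rewrite (le_trans fN)// ler_norm.
  have p j : `|f x ^+ j| <= `|N| ^+ j by rewrite normrX lerXn2r ?nnegrE.
  split; first by rewrite (le_trans (p _))// lerDl mulr_ge0// exprn_ge0.
  rewrite normrM ger0_norm// (@le_trans _ _ (k.*2%:R * `|N| ^+ k.*2.-1))//.
    by rewrite ler_wpM2l.
  by rewrite lerDr exprn_ge0.
- move=> w e ws e0.
  have [d d0 Hd] := poly_room (n2 mu2 D f) (gradnorm D f) C a b e0.
  pose nw := n2 mu2 D w; have nw0 : 0 <= nw by exact: n2_ge0.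
  (* The first bound serves [poly_room]; the second keeps the pairing with [w] within [e]. *)
  pose d' := Num.min d (e / (nw + 1)).
  have nw1 : 0 < nw + 1 by lra.
  have d'0 : 0 < d' by rewrite lt_min d0 divr_gt0.
  have [chi tc [dH d1 d2]] := H10_approx fH d'0.
  have cs := testfun_sqi oD tc; have cH := testfun_inH1 oD tc.
  have [dd de] : d' <= d /\ d' <= e / (nw + 1) by split; rewrite ge_min lexx ?orbT.
  exists chi; split => //.
  + case: k test => [|k] test; last exact: (testfun_intg mD (testfunX _ tc)).
    by apply: (eq_intg mD _ (sqi_intg mD Dfin (sqi_cst mD 1 Dfin))).
  + apply: (le_trans (test chi tc)); apply: le_trans Hd.
    have chiE : chi = (fun x => -1 * (f x - chi x) + f x) by apply/funext => x; ring.
    have n1 : n2 mu2 D chi <= n2 mu2 D f + d.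
      have := n2D mD fs (sqiN mD (inH1_sqi dH)); rewrite n2N.
      have -> : (fun x => f x + - (f x - chi x)) = chi by apply/funext => x; ring.
      by lra.
    have g1 : gradnorm D chi <= gradnorm D f + d.
      have := gradnorm_lin oD (-1) dH fi; rewrite -chiE normrN1 mul1r => G.
      exact: le_add_shift G d2 dd.
    apply: ler_pM; rewrite ?mulr_ge0 ?exprn_ge0 ?n2_ge0 ?gradnorm_ge0//.
      by rewrite ler_wpM2l// lerXn2r// nnegrE ?n2_ge0// addr_ge0 ?n2_ge0 ?ltW.
    by rewrite lerXn2r// nnegrE ?gradnorm_ge0// addr_ge0 ?gradnorm_ge0 ?ltW.
  + rewrite -Rint_B//; [|exact: sqi_mul..].
    have -> : \int[mu2]_(x in D) (w x * chi x - w x * f x) = \int[mu2]_(x in D) (w x * - (f x - chi x)).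
      by apply: eq_Rint => x _; ring.
    apply: le_trans (cauchy_schwarz mD ws (sqiN mD (inH1_sqi dH))) _; rewrite n2N -/nw.
    apply: (@le_trans _ _ (nw * (e / (nw + 1)))).
      by rewrite ler_wpM2l// (le_trans d1).
    by rewrite mulrA ler_pdivrMr// mulrC ler_wpM2l ?ltW//; lra.
Qed.

Lemma H10_moment k f : H10 D f -> intg mu2 D (fun x => f x ^+ k.*2) /\
  \int[mu2]_(x in D) f x ^+ k.*2 <= k`!%:R ^+ 2 * fine (mu2 D) * gradnorm D f ^+ k.*2.
Proof.
move=> fH; have C0 : 0 <= k`!%:R ^+ 2 * fine (mu2 D) by rewrite mulr_ge0 ?sqr_ge0 ?fine_ge0.
have [|i b] := @H10_lsc k 0 k.*2 _ f C0 _ fH.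
  by move=> chi tc; rewrite expr0 mulr1; exact: moment_bound.
by split => //; move: b; rewrite expr0 mulr1.
Qed.

Lemma ladyzhenskaya f : H10 D f -> intg mu2 D (fun x => f x ^+ 4) /\
  \int[mu2]_(x in D) f x ^+ 4 <= 4 * n2 mu2 D f ^+ 2 * gradnorm D f ^+ 2.
Proof.
move=> fH; have C0 : 0 <= 4 :> R by [].
apply: (@H10_lsc 2 2 2 _ f C0 _ fH) => chi tc.
have := moment_step oD Dfin 1 tc; rewrite n2_sqr.
by have -> : (2 : R) ^+ 2 = 4 by ring.
Qed.

Lemma poincare_H10 f : H10 D f ->
  n2 mu2 D f ^+ 2 <= fine (mu2 D) * gradnorm D f ^+ 2.
Proof.
by move=> fH; have [_] := H10_moment 1 fH; rewrite n2_sqr expr1n mul1r.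
Qed.

End H10_estimates.

(** * The transport term and Korn's inequality *)

Lemma sumI2 (R : realType) (F : 'I_2 -> R) : \sum_i F i = F ord0 + F ord_max.
Proof.
rewrite big_ord_recr big_ord1 /=.
by have -> : widen_ord (leqnSn 1) ord0 = ord0 :> 'I_2 by apply: val_inj.
Qed.

Section sequences_of_reals.
Context {R : realType}.

Lemma cvg0_le (a b : nat -> R) : (forall n, `|a n| <= b n) ->
  b @ \oo --> (0 : R) -> a @ \oo --> (0 : R).
Proof.
move=> ab b0; apply/cvgrPdist_le => e e0.
have /cvgrPdist_le/(_ e e0) := b0; apply: filterS => n.
rewrite !sub0r !normrN => H; apply: le_trans H.
by apply: (le_trans (ab n)); exact: ler_norm.
Qed.

Lemma cvg0_shift (a : nat -> R) (l : R) : (fun n => a n - l) @ \oo --> (0 : R) -> a @ \oo --> l.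
Proof.
move=> H; have H2 : (fun n => (a n - l) + l) @ \oo --> 0 + l by apply: cvgD => //; exact: cvg_cst.
have E : (fun n => (a n - l) + l) = a by apply/funext => n; rewrite subrK.
by rewrite E add0r in H2.
Qed.

Lemma eq_cvg_unique (a b : nat -> R) (l m : R) : a =1 b ->
  a @ \oo --> l -> b @ \oo --> m -> l = m.
Proof.
move=> /funext -> bl bm; exact: (cvg_unique _ bl bm).
Qed.

(** The right-hand side is at most [4 * U * h ^+ 4], and [4 * U <= (1 + 4 * U) ^+ 4]; the crude
    factor avoids fourth roots. *)
Lemma quartic_root (x U a b h : R) : 0 <= x -> 0 <= U -> 0 <= a -> a <= h -> 0 <= b -> b <= h ->
  x ^+ 4 <= U * (4 * a ^+ 2 * b ^+ 2) -> x <= (1 + 4 * U) * h.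
Proof.
move=> x0 U0 a0 ah b0 bh H; have h0 : 0 <= h by exact: le_trans ah.
have k0 : 0 <= (1 + 4 * U) * h by rewrite mulr_ge0//; lra.
rewrite -(@ler_pXn2r _ 4)// (le_trans H)//.
have ab : a ^+ 2 * b ^+ 2 <= h ^+ 4.
  rewrite (_ : h ^+ 4 = h ^+ 2 * h ^+ 2); last by rewrite -exprD.
  by apply: ler_pM; rewrite ?sqr_ge0// lerXn2r// nnegrE.
have h4 : 0 <= h ^+ 4 by exact: exprn_even_ge0.
rewrite exprMn -mulrA; apply: (@le_trans _ _ (4 * U * h ^+ 4)).
  by rewrite mulrCA mulrA; apply: ler_wpM2l => //; lra.
apply: ler_wpM2r => //; set v := 4 * U; have v0 : 0 <= v by rewrite /v; lra.
apply: (@le_trans _ _ (1 + v)); first by lra.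
have v1 : 1 <= 1 + v by lra.
by apply: ler_eXnr.
Qed.

End sequences_of_reals.

Section l2_convergence.
Context d (T : measurableType d) (R : realType) (mu : {measure set T -> \bar R}).
Variables (D : set T) (mD : measurable D).

Definition l2cvg (a_ : nat -> T -> R) (a : T -> R) :=
  [/\ forall n, sqi mu D (a_ n), sqi mu D a &
      (fun n => n2 mu D (fun x => a_ n x - a x)) @ \oo --> (0 : R)].

Lemma l2cvg_int a_ a b_ b : l2cvg a_ a -> l2cvg b_ b ->
  (fun n => \int[mu]_(x in D) (a_ n x * b_ n x)) @ \oo --> \int[mu]_(x in D) (a x * b x).
Proof.
move=> [an as_ ac] [bn bs bc].
pose al n := n2 mu D (fun x => a_ n x - a x); pose be n := n2 mu D (fun x => b_ n x - b x).
apply: cvg0_shift; apply: (@cvg0_le _ _ (fun n => al n * (n2 mu D b + be n) + n2 mu D a * be n)).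
  move=> n; have da := sqiB mD (an n) as_; have db := sqiB mD (bn n) bs.
  rewrite -Rint_B//; [|exact: sqi_mul..].
  rewrite (@eq_Rint _ _ _ mu D _ (fun x => (a_ n x - a x) * b_ n x + a x * (b_ n x - b x))); last first.
    by move=> x _; ring.
  rewrite Rint_D//; [|exact: sqi_mul..].
  apply: le_trans (ler_normD _ _) _; apply: lerD; last exact: cauchy_schwarz.
  apply: le_trans (cauchy_schwarz mD da (bn n)) _.
  apply: ler_wpM2l; first exact: n2_ge0.
  apply: le_trans (n2D mD bs db); rewrite le_eqVlt; apply/orP; left; apply/eqP.
  by congr n2; apply/funext => x; ring.
have -> : (0 : R) = 0 * (n2 mu D b + 0) + n2 mu D a * 0 by rewrite mul0r mulr0 addr0.
apply: cvgD; first by apply: cvgM => //; apply: cvgD => //; exact: cvg_cst.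
by apply: cvgM => //; exact: cvg_cst.
Qed.

End l2_convergence.

(** * Exchange of derivatives in integrals of products *)

Section weak_schwarz.
Context {R : realType}.
Notation pt := (R * R)%type.
Notation mpt := (measurableTypeR R * measurableTypeR R)%type.
Notation leb := (@lebesgue_measure R).
Notation mu2 := (@mu2 R).

Lemma diff_quotient_bound (psi : pt -> R) v : testfun setT psi ->
  exists2 M, 0 <= M & forall x (t : R), 0 < t -> `|t^-1 * (psi (x + t *: v) - psi x)| <= M.
Proof.
move=> tp; have [M M0 HM] := testfun_bounded (testfun_derive v tp).
exists M => // x t t0.
have dp y u : derivable psi y u by apply: (@Ck_derivable _ _ 0%N); exact: tp.1.
have ld s : is_derive s (1 : R) (fun s : R => psi (x + s *: v)) ('D_v psi (x + s *: v)) by exact: line_derive.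
have [s _ E] := mvt_sign 0 t ld.
rewrite scale0r addr0 subr0 in E; rewrite E mulrCA mulVf ?gt_eqF// mulr1.
exact: HM.
Qed.

Lemma diff_quotient_cvg v (w psi : pt -> R) : intg mu2 setT w -> testfun setT psi ->
  (fun n : nat => \int[mu2]_x (w x * (n.+1%:R * (psi (x + n.+1%:R^-1 *: v) - psi x)))) @ \oo -->
  \int[mu2]_x (w x * 'D_v psi x).
Proof.
move=> wi tp; have [M M0 HM] := diff_quotient_bound v tp.
have mp := testfun_measurable tp; have mdp := testfun_measurable (testfun_derive v tp).
have mw := intg_meas wi.
have dp y u : derivable psi y u by apply: (@Ck_derivable _ _ 0%N); exact: tp.1.
have [] // := @dominated_Rint _ _ _ mu2 setT measurableT
  (fun n x => w x * (n.+1%:R * (psi (x + n.+1%:R^-1 *: v) - psi x)))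
  (fun x => w x * 'D_v psi x) (fun x => M * `|w x|).
- move=> n; apply: measurable_funM => //; apply: measurable_funM => //.
  by apply: measurable_funB => //; exact: (measurableT_comp mp (measurable_shift _)).
- exact: measurable_funM.
- apply: aeW => x _; apply: cvgM; first exact: cvg_cst.
  have := (cvg_at_rightP _ 0 _).1 (cvg_dnbhs_at_right (dp x v)) (fun n => n.+1%:R^-1).
  move=> H; have n0 n : (0 : R) < n.+1%:R^-1 by rewrite invr_gt0.
  have {}H := H (conj n0 (@cvg_harmonic R)).
  apply: cvg_trans H; apply: near_eq_cvg; apply: nearW => n /=.
  by rewrite invrK /GRing.scale/= [_ *: v + x]addrC.
- by apply: intgZ => //; exact: intg_abs.
- move=> n x _; rewrite normrM mulrC ler_wpM2r//.
  have n0 : (0 : R) < n.+1%:R^-1 by rewrite invr_gt0.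
  by have := HM x _ n0; rewrite invrK.
Qed.

Lemma Rint_scale_diff (c : R) (f g k : mpt -> R) :
  intg mu2 setT f -> intg mu2 setT g -> (forall x, k x = c * (f x - g x)) ->
  \int[mu2]_x k x = c * (\int[mu2]_x f x - \int[mu2]_x g x).
Proof.
move=> fi gi kE; rewrite -Rint_B// -Rint_Z//; last exact: intgB.
by apply: eq_Rint => x _; exact: kE.
Qed.

(** Replace ['D_(e_ i) psi] by a difference quotient, with which ['D_(e_ j)] commutes. Integration
    by parts moves ['D_(e_ j)] onto [psi], and a translation moves the quotient onto [chi]; no
    second derivative is taken. *)
Lemma test_schwarz i j (chi psi : pt -> R) : testfun setT chi -> testfun setT psi ->
  \int[mu2]_x ('D_(e_ j) chi x * 'D_(e_ i) psi x) =
  \int[mu2]_x ('D_(e_ i) chi x * 'D_(e_ j) psi x).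
Proof.
move=> tc tp.
have tdc k := testfun_derive (e_ k) tc; have tdp k := testfun_derive (e_ k) tp.
have c1 := diff_quotient_cvg (v := e_ i) (testfun_intg (D := setT) measurableT (tdc j)) tp.
have c2 := diff_quotient_cvg (v := - e_ i) (testfun_intg (D := setT) measurableT (tdp j)) tc.
have dc x u : derivable chi x u by apply: (@Ck_derivable _ _ 0%N); exact: tc.1.
have E x : 'D_(- e_ i) chi x = - 'D_(e_ i) chi x by rewrite -scaleN1r derive_scale// mulN1r.
have c3 := cvgN c2.
have L : \int[mu2]_x ('D_(e_ i) chi x * 'D_(e_ j) psi x) = - \int[mu2]_x ('D_(e_ j) psi x * 'D_(- e_ i) chi x).
  rewrite -Rint_N//; first by apply: eq_Rint => x _; rewrite E mulrN opprK mulrC.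
  apply: (testfun_intg (D := setT)) => //; apply: testfunM (tdp j) => k.
  by have [] := testfun_derive (- e_ i) tc.
rewrite L; apply: (eq_cvg_unique _ c1 (c3 _)) => n; rewrite fctE; apply: esym.
set t := n.+1%:R^-1.
have tpt : testfun setT (fun x => psi (x + t *: e_ i)).
  by apply: testfunS (testfun_shift (t *: e_ i) tp).
have tpn : testfun setT (fun x => - psi x) by exact: testfunN.
have td := testfunD tpt tpn.
have dpx x u : derivable psi x u by apply: (@Ck_derivable _ _ 0%N); exact: tp.1.
have dE x : 'D_(e_ j) (fun x => psi (x + t *: e_ i) + - psi x) x =
    'D_(e_ j) psi (x + t *: e_ i) - 'D_(e_ j) psi x.
  have [d1 e1] := is_deriveE (derivable_shift (dpx (x + t *: e_ i) (e_ j))).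
  by have := deriveB d1 (dpx x (e_ j)); rewrite e1.
have mI g k : testfun setT g -> testfun setT k -> intg mu2 setT (fun x => g x * k x).
  by move=> tg tk; apply: (testfun_intg (D := setT)) => //; exact: (testfunM tk.1 tg).
have tct : testfun setT (fun x => chi (x - t *: e_ i)).
  by apply: testfunS (testfun_shift (- (t *: e_ i)) tc).
have tdt : testfun setT (fun x => 'D_(e_ j) psi (x + t *: e_ i)).
  by apply: testfunS (testfun_shift (t *: e_ i) (tdp j)).
have E1 := test_ibp openT j tc td.
have S : \int[mu2]_x (chi x * 'D_(e_ j) psi (x + t *: e_ i)) = \int[mu2]_x (chi (x - t *: e_ i) * 'D_(e_ j) psi x).
  apply: etrans (shift_Rint (t *: e_ i) (mI _ _ tct (tdp j))).
  by apply: eq_Rint => x _; rewrite addrK.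
have k2 x : chi x * 'D_(e_ j) (fun x => psi (x + t *: e_ i) + - psi x) x =
    1 * (chi x * 'D_(e_ j) psi (x + t *: e_ i) - chi x * 'D_(e_ j) psi x).
  by rewrite dE mulrBr mul1r.
have k3 x : 'D_(e_ j) psi x * (n.+1%:R * (chi (x + t *: - e_ i) - chi x)) =
    n.+1%:R * (chi (x - t *: e_ i) * 'D_(e_ j) psi x - chi x * 'D_(e_ j) psi x).
  by rewrite scalerN; move: ('D_(e_ j) psi x) => z; ring.
have E2 := Rint_scale_diff (mI _ _ tc tdt) (mI _ _ tc (tdp j)) k2.
have E3 := Rint_scale_diff (mI _ _ tct (tdp j)) (mI _ _ tc (tdp j)) k3.
have E4 : \int[mu2]_x ('D_(e_ j) chi x * (n.+1%:R * (psi (x + t *: e_ i) - psi x))) =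
   n.+1%:R * \int[mu2]_x ('D_(e_ j) chi x * (psi (x + t *: e_ i) + - psi x)).
  apply: etrans (@Rint_Z _ _ _ mu2 setT measurableT _ _ (mI _ _ (tdc j) td)).
  by apply: eq_Rint => x _; move: ('D_(e_ j) chi x) => z; ring.
have alg (a1 a2 a3 a4 a5 a6 a7 N : R) : a1 = - a2 -> a1 = 1 * (a3 - a4) ->
    a5 = N * (a6 - a4) -> a7 = N * a2 -> a3 = a6 -> - a5 = a7.
  move=> -> e2 -> -> e3; have -> : a6 - a4 = - a2 by rewrite -e3 -[a3 - a4]mul1r -e2.
  by ring.
exact: (alg _ _ _ _ _ _ _ _ E1 E2 E3 E4 S).
Qed.

End weak_schwarz.

(** * Approximation by test functions in products *)

Section H10_density.
Context {R : realType}.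
Notation pt := (R * R)%type.
Notation mpt := (measurableTypeR R * measurableTypeR R)%type.
Notation mu2 := (@mu2 R).
Variable D : set pt.
Hypothesis oD : open D.
Hypothesis Dfin : (mu2 D < +oo)%E.
Let mD : measurable (D : set mpt). Proof. exact: open_measurable2. Qed.

Lemma H10_sub_test f chi : H10 D f -> testfun D chi -> H10 D (fun x => f x - chi x).
Proof.
move=> fH tc; split.
  apply/(W12P oD).
  have [H _] := inH1_lin oD (-1) (testfun_inH1 oD tc) (H10_inH1 oD fH).
  by have -> : (fun x => f x - chi x) = (fun x => -1 * chi x + f x)
    by apply/funext => x; rewrite mulN1r addrC.
move=> e e0; have [psi tp Hp] := fH.2 e e0.
exists (fun x => psi x + - chi x); first by apply: testfunD => //; exact: testfunN.
have E : (fun x => f x - chi x) - (fun x => psi x + - chi x) = f - psi.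
  by apply/funext => x; rewrite !fctE; ring.
by rewrite E.
Qed.

(** One sequence serves all limits. Convergence of the products with [u] is not a consequence of
    convergence in L^2 of the sequence alone; it uses the fourth-power bound of [ladyzhenskaya] for
    [u] and for the error. *)
Lemma H10_seq f : H10 D f -> exists chi_ : nat -> pt -> R,
  [/\ forall n, testfun D (chi_ n), l2cvg mu2 D chi_ f,
      forall i, l2cvg mu2 D (fun n => 'D_(e_ i) (chi_ n)) (wD D i f) &
      forall u, H10 D u -> l2cvg mu2 D (fun n x => u x * chi_ n x) (fun x => u x * f x)].
Proof.
move=> fH; have fi := H10_inH1 oD fH.
have ex n : {chi | testfun D chi & [/\ inH1 D (fun x => f x - chi x),
    n2 mu2 D (fun x => f x - chi x) <= n.+1%:R^-1 &
    gradnorm D (fun x => f x - chi x) <= n.+1%:R^-1]}.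
  by apply: cid2; apply: H10_approx => //; rewrite invr_gt0.
exists (fun n => s2val (ex n)).
have tc n : testfun D (s2val (ex n)) := s2valP (ex n).
have dn (chi : pt -> R) g : n2 mu2 D (fun x => chi x - g x) = n2 mu2 D (fun x => g x - chi x).
  by rewrite -n2N; congr n2; apply/funext => x; rewrite opprB.
have h0 := @cvg_harmonic R.
split => //.
- split; [by move=> n; exact: testfun_sqi|exact: inH1_sqi fi|].
  apply: (cvg0_le _ h0) => n; rewrite ger0_norm ?n2_ge0// dn.
  by have [] := s2valP' (ex n).
- move=> i; split; [by move=> n; exact: (testfun_sqi oD (testfun_derive _ (tc n)))|exact: (inH1_wD oD i fi).2|].
  apply: (cvg0_le _ h0) => n; rewrite ger0_norm ?n2_ge0// dn.
  have [dH _ g1] := s2valP' (ex n).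
  apply: le_trans g1; apply: le_trans (wD_le_gradnorm D _ i).
  rewrite le_eqVlt; apply/orP; left; apply/eqP; apply: eq_n2_ae.
  have [_ /(_ i) L] := inH1_lin oD (-1) (testfun_inH1 oD (tc n)) fi.
  apply: ae_mono (ae_and L (testfun_wD oD i (tc n))) => x [H1 H2] Dx.
  have -> : (fun x => f x - s2val (ex n) x) = (fun x => -1 * s2val (ex n) x + f x).
    by apply/funext => y; rewrite mulN1r addrC.
  by rewrite (H1 Dx) (H2 Dx) mulN1r addrC.
- move=> u uH; have [iu4 _] := ladyzhenskaya oD Dfin uH.
  have us := inH1_sqi (H10_inH1 oD uH).
  have sq (g : pt -> R) : H10 D g -> sqi mu2 D (fun x => g x ^+ 2).
    move=> gH; have [g4 _] := ladyzhenskaya oD Dfin gH.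
    split; first by apply: measurable_funX; exact: (inH1_sqi (H10_inH1 oD gH)).1.
    by apply: (eq_intg mD _ g4) => x _; rewrite -exprM.
  (* Cauchy-Schwarz for the squares of [u] and [g], followed by the fourth-power bound for [g]. *)
  have ug (g : pt -> R) : H10 D g -> sqi mu2 D (fun x => u x * g x) /\
      n2 mu2 D (fun x => u x * g x) ^+ 4 <= (\int[mu2]_(x in D) u x ^+ 4) *
        (4 * n2 mu2 D g ^+ 2 * gradnorm D g ^+ 2).
    move=> gH; have E x : (u x * g x) ^+ 2 = u x ^+ 2 * g x ^+ 2 by rewrite exprMn.
    have ii := sqi_mul mD (sq _ uH) (sq _ gH).
    have gs := inH1_sqi (H10_inH1 oD gH).
    split; first split.
    - by apply: measurable_funM; [exact: us.1|exact: gs.1].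
    - by apply: (eq_intg mD _ ii) => x _.
    have := cauchy_schwarz_sqr mD (sq _ uH) (sq _ gH).
    have [_ g4] := ladyzhenskaya oD Dfin gH.
    rewrite -(@eq_Rint _ _ _ mu2 D (fun x => (u x * g x) ^+ 2)); last by move=> x _; rewrite E.
    rewrite -n2_sqr -exprM.
    have e4 (k : pt -> R) : \int[mu2]_(x in D) (k x ^+ 2) ^+ 2 = \int[mu2]_(x in D) k x ^+ 4.
      by apply: eq_Rint => x _; rewrite -exprM.
    rewrite !e4 => H; apply: (le_trans H); apply: ler_wpM2l => //.
    by apply: Rintegral_ge0 => x _; exact: exprn_even_ge0.
  pose U := \int[mu2]_(x in D) u x ^+ 4.
  have U0 : 0 <= U by apply: Rintegral_ge0 => x _; exact: exprn_even_ge0.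
  split; [|exact: (ug _ fH).1|].
    move=> n; have [M M0 HM] := testfun_bounded (tc n).
    apply: (sqi_dom mD _ (sqiZ mD M us)).
      by apply: measurable_funM; [exact: us.1|exact: measurable_funTS (testfun_measurable (tc n))].
    by move=> x _; rewrite !normrM (ger0_norm M0) mulrC ler_wpM2r.
  apply: (@cvg0_le _ _ (fun n => (1 + 4 * U) * harmonic n)); last first.
    by rewrite -[X in _ --> X](mulr0 (1 + 4 * U)); apply: cvgM => //; exact: cvg_cst.
  move=> n; rewrite ger0_norm ?n2_ge0//.
  have [_ d1 g1] := s2valP' (ex n).
  have [_ H] := ug _ (H10_sub_test fH (tc n)).
  have -> : (fun x => u x * s2val (ex n) x - u x * f x) = (fun x => - (u x * (f x - s2val (ex n) x))).
    by apply/funext => x; ring.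
  rewrite n2N.
  exact: (quartic_root (n2_ge0 _ _ _) U0 (n2_ge0 _ _ _) d1 (gradnorm_ge0 _ _) g1 H).
Qed.

(** Limit of [test_schwarz] along [H10_seq]. Applied to the two components of a velocity it provides
    the hypothesis of [stress_coercive]. *)
Lemma H10_schwarz i j f g : H10 D f -> H10 D g ->
  \int[mu2]_(x in D) (wD D j f x * wD D i g x) =
  \int[mu2]_(x in D) (wD D i f x * wD D j g x).
Proof.
move=> /H10_seq[chi_ [tc _ dc _]] /H10_seq[psi_ [tp _ dp _]].
have c1 := l2cvg_int mD (dc j) (dp i); have c2 := l2cvg_int mD (dc i) (dp j).
apply: (eq_cvg_unique _ c1 c2) => n.
have tT (k : pt -> R) := testfunS (@subsetT _ D) (f := k).
have sup k l : \int[mu2]_(x in D) ('D_(e_ k) (chi_ n) x * 'D_(e_ l) (psi_ n) x) =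
    \int[mu2]_x ('D_(e_ k) (chi_ n) x * 'D_(e_ l) (psi_ n) x).
  apply: Rint_support => // x _ Dx.
  by rewrite (testfun_out (testfun_derive (e_ k) (tc n)) Dx) mul0r.
by rewrite !sup test_schwarz//; exact: tT.
Qed.

(** The integral of [u] against the gradient of [f * g], expanded by the product rule so that each
    term pairs two square-integrable functions. For test functions the product is again one, and it
    sees only the divergence of [u]. *)
Lemma transport_zero (u : vfield) f g : @mem_of _ (Vdiv D) u -> H10 D f -> H10 D g ->
  \sum_j (\int[mu2]_(x in D) ((u j x * g x) * wD D j f x) +
           \int[mu2]_(x in D) ((u j x * f x) * wD D j g x)) = 0.
Proof.
move=> [uH div0] /H10_seq[chi_ [tc _ dc mc]] /H10_seq[psi_ [tp _ dp mp]].
have c n : \sum_j (\int[mu2]_(x in D) ((u j x * psi_ n x) * 'D_(e_ j) (chi_ n) x) +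
           \int[mu2]_(x in D) ((u j x * chi_ n x) * 'D_(e_ j) (psi_ n) x)) = 0.
  have tcp := testfunM (tp n).1 (tc n).
  have E j : \int[mu2]_(x in D) ((u j x * psi_ n x) * 'D_(e_ j) (chi_ n) x) +
      \int[mu2]_(x in D) ((u j x * chi_ n x) * 'D_(e_ j) (psi_ n) x) =
      - (\int[mu2]_(x in D) (wD D j (u j) x * (chi_ n x * psi_ n x))).
    have uj := H10_inH1 oD (uH j).
    have [_ L1] := inH1_wD oD j uj; have [[_ <-//] _] := inH1_wD oD j uj.
    have uL := sqi_L1loc oD (inH1_sqi uj).
    have i1 := L1loc_testfun mD uL (testfunM (testfun_derive (e_ j) (tc n)).1 (tp n)).
    have i2 := L1loc_testfun mD uL (testfunM (testfun_derive (e_ j) (tp n)).1 (tc n)).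
    have i1' : intg mu2 D (fun x => u j x * psi_ n x * 'D_(e_ j) (chi_ n) x).
      by apply: (eq_intg mD _ i1) => x _; rewrite mulrA.
    have i2' : intg mu2 D (fun x => u j x * chi_ n x * 'D_(e_ j) (psi_ n) x).
      by apply: (eq_intg mD _ i2) => x _; rewrite mulrA.
    rewrite -Rint_D//; apply: eq_Rint => x _.
    have dcx : derivable (chi_ n) x (e_ j) by apply: (@Ck_derivable _ _ 0%N); exact: (tc n).1.
    have dp' : derivable (psi_ n) x (e_ j) by apply: (@Ck_derivable _ _ 0%N); exact: (tp n).1.
    have -> : 'D_(e_ j) (fun x => chi_ n x * psi_ n x) x = chi_ n x * 'D_(e_ j) (psi_ n) x + psi_ n x * 'D_(e_ j) (chi_ n) x.
      exact: (deriveM dcx dp').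
    by move: ('D_(e_ j) (chi_ n) x) ('D_(e_ j) (psi_ n) x) => y z; ring.
  apply: (etrans (eq_bigr _ (fun j _ => E j))); rewrite sumI2 -opprD.
  have ii j : intg mu2 D (fun x => wD D j (u j) x * (chi_ n x * psi_ n x)).
    have [_ wL] := inH1_wD oD j (H10_inH1 oD (uH j)).
    exact: (L1loc_testfun mD (sqi_L1loc oD wL) tcp).
  rewrite -Rint_D// (@eq_Rintegral_ae _ _ _ mu2 D _ (cst 0)); first by rewrite Rintegral_cst// mul0r oppr0.
  apply: ae_mono div0 => x dx Dx; have := dx Dx; rewrite sumI2 => d0.
  by rewrite -mulrDl d0 mul0r.
have cv j : (fun n => \int[mu2]_(x in D) ((u j x * psi_ n x) * 'D_(e_ j) (chi_ n) x) +
           \int[mu2]_(x in D) ((u j x * chi_ n x) * 'D_(e_ j) (psi_ n) x)) @ \oo -->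
    \int[mu2]_(x in D) ((u j x * g x) * wD D j f x) +
           \int[mu2]_(x in D) ((u j x * f x) * wD D j g x).
  by apply: cvgD; [exact: (l2cvg_int mD (mp _ (uH j)) (dc j))|exact: (l2cvg_int mD (mc _ (uH j)) (dp j))].
rewrite sumI2; apply: (eq_cvg_unique _ (cvgD (cv ord0) (cv ord_max)) (cvg_cst (0 : R))).
by move=> n; rewrite fctE -(c n) sumI2.
Qed.

End H10_density.

Section small_sums.
Context {R : realType}.

Lemma sum22_le (F : 'I_2 -> 'I_2 -> R) (k : R) : (forall i j, `|F i j| <= k) ->
  `|\sum_i \sum_j F i j| <= 4 * k.
Proof.
move=> Fk; rewrite !sumI2.
have -> : 4 * k = (k + k) + (k + k) by ring.
apply: le_trans (ler_normD _ _) _; apply: lerD;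
  by apply: le_trans (ler_normD _ _) _; apply: lerD; exact: Fk.
Qed.

Lemma half_le (x y z t : R) : x <= t -> y <= t -> z <= y + x -> 2^-1 * z <= t.
Proof. move=> *; lra. Qed.

Lemma half_sum22 (F G : 'I_2 -> 'I_2 -> R) :
  (forall i j, F i j = 2^-1 * (G i j + G j i)) -> \sum_i \sum_j F i j = \sum_i \sum_j G i j.
Proof. by move=> FG; rewrite !sumI2 !FG; field. Qed.

Lemma four_mul (a b : R) : 4 * (a * b) = 2 * a * (2 * b). Proof. ring. Qed.

End small_sums.

(** * Symmetrised matrix fields and viscous stress *)

Section matrix_fields.
Context d (T : measurableType d) (R : realType) (mu : {measure set T -> \bar R}).
Variables (D : set T) (mD : measurable D).

Lemma intg_sumI2 (F : 'I_2 -> T -> R) : (forall i, intg mu D (F i)) ->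
  intg mu D (fun x => \sum_i F i x).
Proof. by move=> Fi; exact: (intg_sum mD _ Fi). Qed.

Lemma Rint_sumI2 (F : 'I_2 -> T -> R) : (forall i, intg mu D (F i)) ->
  \int[mu]_(x in D) \sum_i F i x = \sum_i \int[mu]_(x in D) F i x.
Proof. by move=> Fi; exact: (Rint_sum mD _ Fi). Qed.

Variables (w : T -> R) (nu1 nu2 : R).
Hypotheses (mw : measurable_fun D w) (nu10 : 0 < nu1) (nub : forall x, nu1 <= w x <= nu2).

Definition msym (a : 'I_2 -> 'I_2 -> T -> R) i j x := (a i j x + a j i x) / 2.

Section one_field.
Variable a : 'I_2 -> 'I_2 -> T -> R.
Hypothesis as_ : forall i j, sqi mu D (a i j).

Let w_le x : `|w x| <= nu2.
Proof. by have /andP[h1 h2] := nub x; rewrite ger0_norm// (le_trans _ h1)// ltW. Qed.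

Lemma msym_sqi i j : sqi mu D (msym a i j).
Proof.
apply: (@eq_sqi _ _ _ mu D mD (fun x => 2^-1 * (a i j x + a j i x))).
  by move=> x _; rewrite /msym mulrC.
by apply: sqiZ => //; apply: sqiD.
Qed.

Lemma msym_le V i j : (forall i j, n2 mu D (a i j) <= V) -> n2 mu D (msym a i j) <= V.
Proof.
move=> aV.
have -> : n2 mu D (msym a i j) = n2 mu D (fun x => 2^-1 * (a i j x + a j i x)).
  by congr n2; apply/funext => x; rewrite /msym mulrC.
rewrite n2Z//; last exact: sqiD.
have := n2D mD (as_ i j) (as_ j i); have := aV i j; have := aV j i.
by rewrite ger0_norm ?invr_ge0// => h1 h2 h3; exact: half_le h1 h2 h3.
Qed.

Definition stress i j x := w x * (2 * msym a i j x).

Lemma stress_sqi i j : sqi mu D (stress i j).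
Proof.
have n20 : 0 <= nu2 by apply: le_trans (w_le point).
have ss := msym_sqi i j; apply: (sqi_dom mD _ (sqiZ mD (2 * nu2) ss)).
  by apply: measurable_funM => //; apply: measurable_funM => //; exact: ss.1.
move=> x _; rewrite /stress !normrM (ger0_norm n20) mulrCA mulrA.
by apply: ler_wpM2r => //; apply: ler_wpM2l.
Qed.

Lemma stress_le V i j : (forall i j, n2 mu D (a i j) <= V) -> n2 mu D (stress i j) <= 2 * nu2 * V.
Proof.
move=> aV; have n20 : 0 <= nu2 by apply: le_trans (w_le point).
have ss := msym_sqi i j.
apply: (@le_trans _ _ (n2 mu D (fun x => 2 * nu2 * msym a i j x))).
  apply: (le_n2_ae mD (stress_sqi i j) (sqiZ mD _ ss)); apply: aeW => x _.
  rewrite /stress !normrM (ger0_norm n20) mulrCA mulrA.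
  by apply: ler_wpM2r => //; apply: ler_wpM2l.
by rewrite n2Z// ger0_norm ?mulr_ge0// ler_wpM2l ?mulr_ge0//; exact: msym_le.
Qed.

(** The stress is symmetric, so it has the same contraction with [b] as with the symmetric part of
    [b]. *)
Lemma stress_flux (b : 'I_2 -> 'I_2 -> T -> R) : (forall i j, sqi mu D (b i j)) ->
  \int[mu]_(x in D) \sum_i \sum_j (stress i j x * msym b i j x) =
  \sum_i \sum_j \int[mu]_(x in D) (stress i j x * b i j x).
Proof.
move=> bs; have bss i j : sqi mu D (msym b i j).
  apply: (@eq_sqi _ _ _ mu D mD (fun x => 2^-1 * (b i j x + b j i x))).
    by move=> x _; rewrite /msym mulrC.
  by apply: sqiZ => //; apply: sqiD.
have ss := stress_sqi.
have ii i j : intg mu D (fun x => stress i j x * msym b i j x) by apply: sqi_mul.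
have iw i j k l : intg mu D (fun x => stress i j x * b k l x) by apply: sqi_mul.
rewrite Rint_sumI2; last by move=> i; apply: intg_sumI2.
rewrite (eq_bigr (fun i => \sum_j \int[mu]_(x in D) (stress i j x * msym b i j x))); last first.
  by move=> i _; rewrite Rint_sumI2.
apply: half_sum22 => i j.
have -> : \int[mu]_(x in D) (stress j i x * b j i x) = \int[mu]_(x in D) (stress i j x * b j i x).
  by apply: eq_Rint => x _; rewrite /stress /msym [a j i x + _]addrC.
rewrite -Rint_D// -Rint_Z//; last exact: intgD.
by apply: eq_Rint => x _; rewrite /msym; field.
Qed.

(* Korn's inequality: for fields vanishing on the boundary, the hypothesis holds by
   a double integration by parts. *)
Lemma stress_coercive :
  \int[mu]_(x in D) (a ord0 ord_max x * a ord_max ord0 x) =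
  \int[mu]_(x in D) (a ord0 ord0 x * a ord_max ord_max x) ->
  nu1 * (\sum_i \sum_j \int[mu]_(x in D) a i j x ^+ 2) <=
  \int[mu]_(x in D) \sum_i \sum_j (stress i j x * msym a i j x).
Proof.
move=> E1; have ii i j k l : intg mu D (fun x => a i j x * a k l x) by exact: sqi_mul.
have i2 i j : intg mu D (fun x => a i j x ^+ 2) by exact: (as_ i j).2.
(* Pointwise, twice the squared norm of the symmetric part is [S + P + 2 * m]. By [E1] the integral
   of [m] may be replaced by that of [n], and [P + 2 * n] is the square of the trace. *)
pose S x := \sum_i \sum_j a i j x ^+ 2.
pose m x := a ord0 ord_max x * a ord_max ord0 x.
pose n x := a ord0 ord0 x * a ord_max ord_max x.
pose P x := a ord0 ord0 x ^+ 2 + a ord_max ord_max x ^+ 2.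
have Si : intg mu D S by apply: intg_sumI2 => i; exact: intg_sumI2.
have Pi : intg mu D P by apply: intgD.
have i4 (f : T -> R) : intg mu D f -> intg mu D (fun x => P x + 2 * f x) /\
    \int[mu]_(x in D) (P x + 2 * f x) = \int[mu]_(x in D) P x + 2 * \int[mu]_(x in D) f x.
  move=> fi; have f2 : intg mu D (fun x => 2 * f x) by exact: intgZ.
  by split; [exact: intgD|rewrite Rint_D// Rint_Z].
have [mi mE] := i4 m (ii _ _ _ _); have [_ nE] := i4 n (ii _ _ _ _).
have Q0 : 0 <= \int[mu]_(x in D) (P x + 2 * m x).
  rewrite mE E1 -nE; apply: Rintegral_ge0 => x _; rewrite /P /n.
  move: (a _ _ _) (a _ _ _) => y z.
  by have := sqr_ge0 (y + z); rewrite !expr2; lra.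
apply: (@le_trans _ _ (\int[mu]_(x in D) (nu1 * (S x + (P x + 2 * m x))))).
  rewrite Rint_Z//; last exact: intgD.
  rewrite Rint_D//; apply: ler_wpM2l; first exact: ltW.
  have -> : \int[mu]_(x in D) S x = \sum_i \sum_j \int[mu]_(x in D) a i j x ^+ 2.
    rewrite Rint_sumI2; last by move=> i; exact: intg_sumI2.
    by apply: eq_bigr => i _; rewrite Rint_sumI2.
  by rewrite lerDl.
have iss i j : intg mu D (fun x => stress i j x * msym a i j x).
  by apply: sqi_mul => //; [exact: stress_sqi|exact: msym_sqi].
apply: le_Rint => //.
- by apply: intgZ => //; exact: intgD.
- by apply: intg_sumI2 => i; exact: intg_sumI2.
move=> x _; have -> : S x + (P x + 2 * m x) = 2 * (\sum_i \sum_j msym a i j x ^+ 2).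
  by rewrite !sumI2 /S /P /m !sumI2 /msym; field.
rewrite mulr_sumr mulr_sumr; apply: ler_sum => i _.
rewrite mulr_sumr mulr_sumr; apply: ler_sum => j _.
have /andP[h1 _] := nub x; rewrite /stress; move: (msym _ _ _ _) => s.
rewrite -[leRHS]mulrA; have -> : 2 * s * s = 2 * s ^+ 2 by ring.
by apply: ler_wpM2r => //; rewrite mulr_ge0 ?sqr_ge0.
Qed.

End one_field.
End matrix_fields.

(** * Forms on solenoidal fields *)

Section vdiv.
Context {R : realType}.
Notation pt := (R * R)%type.
Notation mpt := (measurableTypeR R * measurableTypeR R)%type.
Notation mu2 := (@mu2 R).
Variable D : set pt.
Hypothesis oD : open D.
Hypothesis Dfin : (mu2 D < +oo)%E.
Let mD : measurable (D : set mpt). Proof. exact: open_measurable2. Qed.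

Lemma H10_lin a f g : H10 D f -> H10 D g -> H10 D (fun x => a * f x + g x).
Proof.
move=> fH gH; have fi := H10_inH1 oD fH; have gi := H10_inH1 oD gH.
split; first by apply/(W12P oD); exact: (inH1_lin oD a fi gi).1.
move=> e e0; have a1 : 0 < `|a| + 1 by rewrite ltr_wpDl.
have [chi tc Hc] := fH.2 (e / 2 / (`|a| + 1)) (divr_gt0 (divr_gt0 e0 (ltr0n _ 2)) a1).
have [psi tp Hp] := gH.2 (e / 2) (divr_gt0 e0 (ltr0n _ 2)).
exists (fun x => a * chi x + psi x); first by apply: testfunD => //; exact: testfunZ.
have E : (fun x => a * f x + g x) - (fun x => a * chi x + psi x) =
   (fun x => a * (f - chi) x + (g - psi) x) by apply/funext => x; rewrite !fctE; ring.
have fc := (W12P oD _).1 (H10_sub_test oD fH tc).1.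
have gc := (W12P oD _).1 (H10_sub_test oD gH tp).1.
rewrite E; apply: le_lt_trans (H1_norm_lin oD a fc gc) _.
have h1 : `|a| * H1_norm D (f - chi) <= e / 2.
  apply: (@le_trans _ _ ((`|a| + 1) * (e / 2 / (`|a| + 1)))).
    by apply: ler_pM => //; [exact: sqrtr_ge0|rewrite lerDl|exact: ltW].
  by rewrite mulrC divfK// gt_eqF.
by move: h1 Hp; move: (`|a| * _) (H1_norm _ (g - psi)) => x y *; lra.
Qed.

Notation vmem u := (@mem_of _ (Vdiv D) u).
Definition vnorm (u : vfield) : R := @nrm _ (Vdiv D) u.

Lemma vnorm_sqr u : vmem u -> vnorm u ^+ 2 = \sum_i gradnorm D (u i) ^+ 2.
Proof.
move=> [uH _]; rewrite sqr_sqrtr; last by do 2! (apply: sumr_ge0 => ? _); exact: sqr_ge0.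
apply: eq_bigr => i _; rewrite gradnorm_sqr; apply: eq_bigr => j _.
by rewrite /Lp_norm Lnorm2E ?n2_sqr//; exact: (inH1_wD oD j (H10_inH1 oD (uH i))).2.
Qed.

Lemma vnorm_ge0 u : 0 <= vnorm u. Proof. exact: sqrtr_ge0. Qed.

Lemma gradnorm_le_vnorm u i : vmem u -> gradnorm D (u i) <= vnorm u.
Proof.
move=> uV; rewrite -(@ler_pXn2r _ 2) ?nnegrE ?gradnorm_ge0 ?vnorm_ge0//.
by rewrite vnorm_sqr// (bigD1 i)//= lerDl; apply: sumr_ge0 => j _; exact: sqr_ge0.
Qed.

Lemma wD_le_vnorm u i j : vmem u -> n2 mu2 D (wD D j (u i)) <= vnorm u.
Proof. by move=> uV; apply: le_trans (gradnorm_le_vnorm i uV); exact: wD_le_gradnorm. Qed.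

Lemma vmem_lin a u v : vmem u -> vmem v -> vmem (a *: u + v : vfield).
Proof.
move=> [uH ud] [vH vd]; split; first by move=> i; exact: (H10_lin a (uH i) (vH i)).
have L i := (inH1_lin oD a (H10_inH1 oD (uH i)) (H10_inH1 oD (vH i))).2 i.
apply: ae_mono (ae_and (ae_all_fin L) (ae_and ud vd)) => x [H [du dv]] Dx.
rewrite (eq_bigr (fun i => a * wD D i (u i) x + wD D i (v i) x)); last first.
  by move=> i _; exact: H.
by rewrite big_split/= -mulr_sumr (du Dx) (dv Dx) mulr0 addr0.
Qed.

Lemma vnorm_lin a u v : vmem u -> vmem v -> vnorm (a *: u + v : vfield) <= `|a| * vnorm u + vnorm v.
Proof.
move=> uV vV; have wV := vmem_lin a uV vV.
have E w : vmem w -> vnorm w = Num.sqrt (\sum_i gradnorm D (w i) ^+ 2).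
  by move=> wV'; rewrite -vnorm_sqr// sqrtr_sqr ger0_norm// vnorm_ge0.
rewrite !E//.
have -> : `|a| * Num.sqrt (\sum_i gradnorm D (u i) ^+ 2) =
    Num.sqrt (\sum_i (`|a| * gradnorm D (u i)) ^+ 2).
  rewrite sqrt_scale// mulr_sumr.
  by congr Num.sqrt; apply: eq_bigr => i _; rewrite exprMn.
apply: l2sum_triangle => i; rewrite gradnorm_ge0/=.
by apply: (gradnorm_lin oD); [exact: H10_inH1 (uV.1 i)|exact: H10_inH1 (vV.1 i)].
Qed.

Lemma vmem_sqi u i : vmem u -> sqi mu2 D (u i).
Proof. by move=> [uH _]; exact: inH1_sqi (H10_inH1 oD (uH i)). Qed.

Lemma vmem_wD u i j : vmem u -> sqi mu2 D (wD D j (u i)).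
Proof. by move=> [uH _]; exact: (inH1_wD oD j (H10_inH1 oD (uH i))).2. Qed.

(** Cauchy-Schwarz for the squares of [f] and [g], each controlled by [ladyzhenskaya]. *)
Lemma H10_mul f g : H10 D f -> H10 D g -> sqi mu2 D (fun x => f x * g x) /\
  n2 mu2 D (fun x => f x * g x) ^+ 2 <=
  4 * (n2 mu2 D f * gradnorm D f * (n2 mu2 D g * gradnorm D g)).
Proof.
move=> fH gH.
have sq k : H10 D k -> sqi mu2 D (fun x => k x ^+ 2) /\
    n2 mu2 D (fun x => k x ^+ 2) <= 2 * (n2 mu2 D k * gradnorm D k).
  move=> kH; have [k4 b4] := ladyzhenskaya oD Dfin kH.
  have E : forall x, D x -> k x ^+ 4 = (k x ^+ 2) ^+ 2 by move=> x _; rewrite -exprM.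
  split; first split.
  - by apply: measurable_funX; exact: (inH1_sqi (H10_inH1 oD kH)).1.
  - by apply: (eq_intg mD E).
  - rewrite -(@ler_pXn2r _ 2) ?nnegrE ?n2_ge0// ?mulr_ge0 ?n2_ge0 ?gradnorm_ge0//.
    rewrite n2_sqr -(eq_Rint mu2 E); apply: (le_trans b4).
    by rewrite !exprMn; move: (_ ^+ 2) (_ ^+ 2) => a b; rewrite expr2; lra.
have [fs fb] := sq _ fH; have [gs gb] := sq _ gH.
have ii := sqi_mul mD fs gs.
have E : forall x, D x -> f x ^+ 2 * g x ^+ 2 = (f x * g x) ^+ 2 by move=> x _; rewrite exprMn.
split; first split.
- apply: measurable_funM; [exact: (inH1_sqi (H10_inH1 oD fH)).1|exact: (inH1_sqi (H10_inH1 oD gH)).1].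
- by apply: (eq_intg mD E).
- rewrite n2_sqr -(eq_Rint mu2 E).
  apply: le_trans (ler_norm _) _; apply: le_trans (cauchy_schwarz mD fs gs) _.
  have -> : 4 * (n2 mu2 D f * gradnorm D f * (n2 mu2 D g * gradnorm D g)) =
    2 * (n2 mu2 D f * gradnorm D f) * (2 * (n2 mu2 D g * gradnorm D g)).
    exact: four_mul.
  by apply: ler_pM; [exact: n2_ge0|exact: n2_ge0|exact: fb|exact: gb].
Qed.

Lemma trilinearE u v w : vmem u -> vmem v -> vmem w ->
  trilinear D u v w = \sum_i \sum_j \int[mu2]_(x in D) ((u j x * w i x) * wD D j (v i) x).
Proof.
move=> uV vV wV.
have ii i j : intg mu2 D (fun x => u j x * wD D j (v i) x * w i x).
  have := sqi_mul mD (H10_mul (uV.1 j) (wV.1 i)).1 (vmem_wD i j vV).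
  by apply: eq_intg => // x _; rewrite mulrAC.
rewrite /trilinear (Rint_sumI2 mD); last by move=> i; exact: (intg_sumI2 mD).
apply: eq_bigr => i _; rewrite (Rint_sumI2 mD (ii i)); apply: eq_bigr => j _.
by apply: eq_Rint => x _; rewrite mulrAC.
Qed.

Lemma trilinear_anti u v w : vmem u -> vmem v -> vmem w ->
  trilinear D u v w = - trilinear D u w v.
Proof.
move=> uV vV wV; apply/eqP; rewrite -addr_eq0 !trilinearE// -big_split/=.
apply/eqP/big1 => i _; rewrite -big_split/=.
exact: (transport_zero oD Dfin uV (vV.1 i) (wV.1 i)).
Qed.

Lemma trilinear_zero u v : vmem u -> vmem v -> trilinear D u v v = 0.
Proof.
move=> uV vV; have := trilinear_anti uV vV vV; move: (trilinear _ _ _ _) => x; lra.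
Qed.

Lemma vmem_mul_le u i j (L : R) : vmem u -> (forall i, n2 mu2 D (u i) <= L) ->
  n2 mu2 D (fun x => u j x * u i x) <= 2 * (L * vnorm u).
Proof.
move=> uV uL; have [_ b] := H10_mul (uV.1 j) (uV.1 i).
have L0 : 0 <= L by apply: le_trans (uL i); exact: n2_ge0.
have k0 : 0 <= L * vnorm u by apply: mulr_ge0 => //; exact: vnorm_ge0.
have k2 : 0 <= 2 * (L * vnorm u) by apply: mulr_ge0.
rewrite -(@ler_pXn2r _ 2) ?nnegrE ?n2_ge0//.
apply: (le_trans b).
have -> : (2 * (L * vnorm u)) ^+ 2 = 4 * (L * vnorm u * (L * vnorm u)) by ring.
rewrite ler_wpM2l//; apply: ler_pM; rewrite ?mulr_ge0 ?n2_ge0 ?gradnorm_ge0//;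
  by apply: ler_pM; rewrite ?n2_ge0 ?gradnorm_ge0//; exact: gradnorm_le_vnorm.
Qed.

(** The viscous and the convective terms both have this form with [P] square-integrable, which gives
    linearity and boundedness on [Vdiv D] for both. *)
Definition flux (P : 'I_2 -> 'I_2 -> pt -> R) (v : vfield) : R :=
  \sum_i \sum_j \int[mu2]_(x in D) (P i j x * wD D j (v i) x).

Lemma flux_lin P a v w : (forall i j, sqi mu2 D (P i j)) -> vmem v -> vmem w ->
  flux P (a *: v + w : vfield) = a * flux P v + flux P w.
Proof.
move=> Ps vV wV; rewrite /flux mulr_sumr -big_split/=; apply: eq_bigr => i _.
rewrite mulr_sumr -big_split/=; apply: eq_bigr => j _.
have iv := sqi_mul mD (Ps i j) (vmem_wD i j vV); have iw := sqi_mul mD (Ps i j) (vmem_wD i j wV).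
rewrite -Rint_Z// -Rint_D//; last exact: intgZ.
apply: eq_Rintegral_ae.
have L := (inH1_lin oD a (H10_inH1 oD (vV.1 i)) (H10_inH1 oD (wV.1 i))).2 j.
apply: ae_mono L => x H Dx.
have -> : wD D j ((a *: v + w : vfield) i) x = a * wD D j (v i) x + wD D j (w i) x by exact: H.
by move: (wD D j (v i) x) (wD D j (w i) x) => y z; ring.
Qed.

Lemma flux_bound P (M : R) v : (forall i j, sqi mu2 D (P i j)) ->
  (forall i j, n2 mu2 D (P i j) <= M) -> vmem v -> `|flux P v| <= 4 * M * vnorm v.
Proof.
move=> Ps PM vV.
have b i j : `|\int[mu2]_(x in D) (P i j x * wD D j (v i) x)| <= M * vnorm v.
  apply: le_trans (cauchy_schwarz mD (Ps i j) (vmem_wD i j vV)) _.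
  by apply: ler_pM; rewrite ?n2_ge0//; exact: wD_le_vnorm.
by rewrite -mulrA; exact: sum22_le.
Qed.

Definition jac (u : vfield) (i j : 'I_2) : mpt -> R := wD D j (u i).

Section viscosity.
Variables (nu : R -> R) (nu1 nu2 : R) (phi : pt -> R).
Hypotheses (cnu : continuous nu) (nu10 : 0 < nu1) (nub : forall s, nu1 <= nu s <= nu2).
Hypothesis mphi : measurable_fun (D : set mpt) phi.

Let w : mpt -> R := fun x => nu (phi x).
Let wb x : nu1 <= w x <= nu2 := nub (phi x).
Let mw : measurable_fun D w.
Proof. by apply: (measurableT_comp _ mphi); exact: continuous_measurable_fun. Qed.

Lemma visc_stress_sqi u i j : vmem u -> sqi mu2 D (stress w (jac u) i j).
Proof. by move=> uV; apply: (stress_sqi mD mw nu10 wb) => k l; exact: vmem_wD. Qed.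

Lemma visc_stress_le u i j : vmem u -> n2 mu2 D (stress w (jac u) i j) <= 2 * nu2 * vnorm u.
Proof.
move=> uV; apply: (stress_le mD mw nu10 wb) => k l; first exact: vmem_wD.
exact: wD_le_vnorm.
Qed.

Lemma viscousE u v : vmem u -> vmem v -> viscous D nu phi u v = flux (stress w (jac u)) v.
Proof.
move=> uV vV; apply: (stress_flux mD mw nu10 wb (a := jac u) _ (b := jac v)) => i j;
  exact: vmem_wD.
Qed.

Lemma korn u : vmem u -> nu1 * vnorm u ^+ 2 <= viscous D nu phi u u.
Proof.
move=> uV.
have E1 := H10_schwarz oD Dfin ord0 ord_max (uV.1 ord0) (uV.1 ord_max).
have js i j : sqi mu2 D (jac u i j) by exact: vmem_wD.
have := stress_coercive mD mw nu10 wb js E1.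
have -> : \sum_i \sum_j \int[mu2]_(x in D) jac u i j x ^+ 2 = vnorm u ^+ 2; last by [].
apply: etrans (esym (vnorm_sqr uV)).
by apply: eq_bigr => i _; exact: esym (gradnorm_sqr D (u i)).
Qed.

End viscosity.

End vdiv.

(** * A Young inequality with an integer power *)

Section powers.
Context {R : realType}.

Lemma le_pow_one (A : R) k : 0 <= A -> A <= 1 + A ^+ k.+1.
Proof.
move=> A0; have [A1|A1] := leP A 1; first by rewrite (le_trans A1)// lerDl exprn_ge0.
by rewrite (@le_trans _ _ (A ^+ k.+1))// ?lerDr//; apply: ler_eXnr => //; exact: ltW.
Qed.

(** If [a ^+ 2] is at most the power [2 * q] of [b], the last term dominates. Otherwise either [b]
    is at most 1 in absolute value and [a ^+ 2] suffices, or [b ^+ 2 <= a ^+ n.*2] and the even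
    power of [a] dominates. That power is an integer because the moments of [H10_moment] are. *)
Lemma young_pow (q : R) : 0 < q -> exists k : nat, forall a b : R,
  a ^+ 2 * b ^+ 2 <= 1 + a ^+ k.*2 + `|b| `^ (2 + 2 * q).
Proof.
(* Chosen so that [q * n%:R] is at least 1. *)
move=> q0; pose n := (Num.truncn q^-1).+1.
have nq : 1 <= q * n%:R.
  have h : q^-1 <= n%:R by exact: ltW (truncnS_gt _).
  have qn0 : q != 0 by rewrite gt_eqF.
  by have := ler_wpM2l (ltW q0) h; rewrite mulfV.
exists n.+1 => a b.
have p0 : 0 <= `|b| `^ (2 + 2 * q) by exact: powR_ge0.
have a0 : 0 <= a ^+ n.+1.*2 by rewrite exprn_even_ge0// odd_double.
have [->|b0] := eqVneq b 0; first by rewrite expr0n mulr0 !addr_ge0.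
pose c := `|b| `^ (2 * q); have c0 : 0 <= c by exact: powR_ge0.
have bE : b ^+ 2 = `|b| `^ 2 by rewrite powR_mulrn// real_normK// num_real.
have pE : `|b| `^ (2 + 2 * q) = b ^+ 2 * c.
  by rewrite powRD ?bE//; apply/implyP => _; rewrite normr_eq0.
have aE : a ^+ n.+1.*2 = (a ^+ 2) ^+ n.+1 by rewrite -exprM mul2n.
move: p0; rewrite pE aE; set A := a ^+ 2; have A0 : 0 <= A by exact: sqr_ge0.
have B0 : 0 <= b ^+ 2 by exact: sqr_ge0.
have An : 0 <= A ^+ n.+1 by exact: exprn_ge0.
move=> p0; have [Ac|cA] := leP A c.
  have : A * b ^+ 2 <= b ^+ 2 * c by rewrite mulrC ler_wpM2l.
  by lra.
have [b1|b1] := leP `|b| 1.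
  have b21 : b ^+ 2 <= 1 by rewrite -(real_normK (num_real b)) expr_le1.
  have : A * b ^+ 2 <= A by rewrite ler_piMr.
  by have := le_pow_one n A0; lra.
have bc : b ^+ 2 <= A ^+ n.
  rewrite bE; apply: (@le_trans _ _ (`|b| `^ (2 * q * n%:R))).
    apply: ler_powR; first exact: ltW.
    by rewrite -mulrA ler_peMr.
  by rewrite powRrM powR_mulrn// lerXn2r// ?nnegrE// ltW.
have : A * b ^+ 2 <= A ^+ n.+1 by rewrite exprS ler_wpM2l.
by lra.
Qed.

(** Lets a bound quadratic in [g] be proved through divisions by numbers [N > g], which covers
    [g = 0]. *)
Lemma le_limit_sqr (X Y g : R) : (forall N, g < N -> X <= N ^+ 2 * Y) -> X <= g ^+ 2 * Y.
Proof.
move=> H; apply/ler_addgt0Pr => e e0.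
have [d d0] := poly_room g 1 Y 2 0 e0; rewrite !expr0 !mulr1 => le.
have := H (g + d) (ltac:(by rewrite ltrDl)); rewrite mulrC => /le_trans; apply.
by rewrite [g ^+ 2 * _]mulrC.
Qed.

End powers.

(** * Products with a function in L^(2+2q) *)

Section weighted_products.
Context {R : realType}.
Notation pt := (R * R)%type.
Notation mpt := (measurableTypeR R * measurableTypeR R)%type.
Notation mu2 := (@mu2 R).
Variable D : set pt.
Hypothesis oD : open D.
Hypothesis Dfin : (mu2 D < +oo)%E.
Let mD : measurable (D : set mpt). Proof. exact: open_measurable2. Qed.

(** With [b] the phase field this bounds the coupling terms of both equations. [young_pow] splits
    the squared product into a power of [f], integrable by [H10_moment], and the given power of
    [b]. *)
Lemma H10_mul_Lq (q : R) : 0 < q -> exists2 K : R, 0 <= K & forall f (b : mpt -> R),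
  H10 D f -> measurable_fun D b -> intg mu2 D (fun x => `|b x| `^ (2 + 2 * q)) ->
  sqi mu2 D (fun x => f x * b x) /\
  n2 mu2 D (fun x => f x * b x) ^+ 2 <=
    gradnorm D f ^+ 2 * (K * (1 + \int[mu2]_(x in D) (`|b x| `^ (2 + 2 * q)))).
Proof.
move=> q0; have [k yk] := young_pow q0.
have [m m0 mE] := ereal_val (measure_ge0 mu2 D) Dfin.
pose c := k`!%:R ^+ 2 : R; have c0 : 0 <= c by exact: sqr_ge0.
exists (m * (1 + c) + 1); first by rewrite addr_ge0// mulr_ge0// addr_ge0.
move=> f b fH mb bi; have fs := inH1_sqi (H10_inH1 oD fH).
set I := Rintegral _ _ _; have I0 : 0 <= I by apply: Rintegral_ge0 => x _; exact: powR_ge0.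
set g := gradnorm D f; have g0 : 0 <= g by exact: gradnorm_ge0.
have mfb : measurable_fun D (fun x => f x * b x) by apply: measurable_funM => //; exact: fs.1.
have [f2k fb] := H10_moment oD Dfin k fH.
have i1 : intg mu2 D (fun=> 1 : R) by exact: (sqi_intg mD Dfin (sqi_cst mD 1 Dfin)).
(* [young_pow] is not homogeneous, so it is applied to [N^-1 * f]: for [N] above the gradient norm
   the moment of this function is bounded by a constant, and [N ^+ 2] becomes the squared gradient
   norm in the limit. *)
have pw N x : 0 < N -> (f x * b x) ^+ 2 <=
    N ^+ 2 * (1 + N^-1 ^+ k.*2 * f x ^+ k.*2 + `|b x| `^ (2 + 2 * q)).
  move=> N0; have := yk (N^-1 * f x) (b x); rewrite [X in 1 + X](exprMn).
  move: (1 + _ + _) => z; have -> : (N^-1 * f x) ^+ 2 * b x ^+ 2 = N^-1 ^+ 2 * (f x * b x) ^+ 2 by ring.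
  move=> H; have : N ^+ 2 * (N^-1 ^+ 2 * (f x * b x) ^+ 2) <= N ^+ 2 * z by rewrite ler_wpM2l// sqr_ge0.
  by rewrite mulrA -exprMn mulfV ?gt_eqF// expr1n mul1r.
have iN N : intg mu2 D (fun x => N ^+ 2 * (1 + N^-1 ^+ k.*2 * f x ^+ k.*2 + `|b x| `^ (2 + 2 * q))).
  by apply: intgZ => //; apply: intgD => //; apply: intgD => //; exact: intgZ.
have sfb : sqi mu2 D (fun x => f x * b x).
  split => //; apply: (intg_dom mD (measurable_funX 2 mfb) (iN 1)) => x _.
  by rewrite ger0_norm ?sqr_ge0//; exact: pw.
split => //; apply: le_limit_sqr => N gN; have N0 : 0 < N by exact: le_lt_trans gN.
rewrite n2_sqr; apply: (le_trans (le_Rint mD sfb.2 (iN N) (fun x _ => pw N x N0))).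
rewrite Rint_Z//; last by apply: intgD => //; apply: intgD => //; exact: intgZ.
rewrite Rint_D//; last by apply: intgD => //; exact: intgZ.
rewrite Rint_D//; last exact: intgZ.
rewrite Rint_Z// Rintegral_cst// mE /= mul1r -/I.
apply: ler_wpM2l; first exact: sqr_ge0.
have le1 : N^-1 ^+ k.*2 * \int[mu2]_(x in D) f x ^+ k.*2 <= c * m.
  apply: (@le_trans _ _ (N^-1 ^+ k.*2 * (c * m * g ^+ k.*2))).
    apply: ler_wpM2l; first by rewrite exprn_ge0// invr_ge0 ltW.
    by apply: (le_trans fb); rewrite mE.
  rewrite mulrCA -exprMn ler_piMr ?mulr_ge0// exprn_ile1//.
    by rewrite mulr_ge0// invr_ge0 ltW.
  by rewrite mulrC ler_pdivrMr// mul1r ltW.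
have e1 : 0 <= (m * (1 + c)) * I by rewrite mulr_ge0// mulr_ge0// addr_ge0.
move: le1; move: (N^-1 ^+ _ * _) => z le1.
have -> : (m * (1 + c) + 1) * (1 + I) = m + c * m + (m * (1 + c)) * I + 1 + I by ring.
by lra.
Qed.

Lemma ip_gradE f g : inH1 D f -> inH1 D g ->
  ip_grad D f g = \sum_i \int[mu2]_(x in D) (wD D i f x * wD D i g x).
Proof.
move=> fH gH; apply: (Rint_sumI2 mD) => i.
exact: (sqi_mul mD (inH1_wD oD i fH).2 (inH1_wD oD i gH).2).
Qed.

Lemma ip_grad_self f : inH1 D f -> ip_grad D f f = gradnorm D f ^+ 2.
Proof.
move=> fH; rewrite ip_gradE// gradnorm_sqr.
by apply: eq_bigr => i _; apply: eq_Rint => x _; rewrite expr2.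
Qed.

Definition vflux (P : 'I_2 -> mpt -> R) (g : pt -> R) : R :=
  \sum_i \int[mu2]_(x in D) (P i x * wD D i g x).

Lemma vflux_lin P a f g : (forall i, sqi mu2 D (P i)) -> inH1 D f -> inH1 D g ->
  vflux P (fun x => a * f x + g x) = a * vflux P f + vflux P g.
Proof.
move=> Ps fH gH; rewrite /vflux mulr_sumr -big_split/=; apply: eq_bigr => i _.
have If := sqi_mul mD (Ps i) (inH1_wD oD i fH).2; have Ig := sqi_mul mD (Ps i) (inH1_wD oD i gH).2.
rewrite -(Rint_Z mD a If) -(Rint_D mD (intgZ mD a If) Ig).
apply: eq_Rintegral_ae.
apply: ae_mono ((inH1_lin oD a fH gH).2 i) => x H Dx; rewrite (H Dx).
by move: (wD D i f x) (wD D i g x) => y z; ring.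
Qed.

Lemma vflux_bound P (M : R) g : (forall i, sqi mu2 D (P i)) ->
  (forall i, n2 mu2 D (P i) <= M) -> inH1 D g -> `|vflux P g| <= 2 * M * gradnorm D g.
Proof.
move=> Ps PM gH.
have b i : `|\int[mu2]_(x in D) (P i x * wD D i g x)| <= M * gradnorm D g.
  apply: le_trans (cauchy_schwarz mD (Ps i) (inH1_wD oD i gH).2) _.
  by apply: ler_pM; [exact: n2_ge0|exact: n2_ge0|exact: PM|exact: wD_le_gradnorm].
rewrite /vflux sumI2; apply: le_trans (ler_normD _ _) _.
by have := lerD (b ord0) (b ord_max); rewrite -mulrA mulr2n mulrDl mul1r.
Qed.

Lemma ip_fgradE (u : vfield) f g : (forall i, sqi mu2 D (fun x => u i x * f x)) -> inH1 D g ->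
  ip_fgrad D u f g = vflux (fun i x => u i x * f x) g.
Proof.
move=> us gH; rewrite /ip_fgrad (@eq_Rint _ _ _ mu2 D _ (fun x => \sum_i (u i x * f x * wD D i g x))).
  by apply: (Rint_sumI2 mD) => i; exact: (sqi_mul mD (us i) (inH1_wD oD i gH).2).
by move=> x _; apply: eq_bigr => i _; rewrite mulrA.
Qed.

Lemma ip_fgrad_linl (u v : vfield) a f g : (forall i, sqi mu2 D (fun x => u i x * f x)) ->
  (forall i, sqi mu2 D (fun x => v i x * f x)) -> inH1 D g ->
  ip_fgrad D (a *: u + v : vfield) f g = a * ip_fgrad D u f g + ip_fgrad D v f g.
Proof.
move=> us vs gH.
have E i : forall x, D x -> a * (u i x * f x) + v i x * f x = (a *: u + v : vfield) i x * f x.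
  by move=> x _; rewrite /= mulrDl -mulrA.
have ws i : sqi mu2 D (fun x => (a *: u + v : vfield) i x * f x).
  by apply: (eq_sqi mD (E i)); apply: sqiD => //; exact: sqiZ.
rewrite !ip_fgradE// /vflux mulr_sumr -big_split/=; apply: eq_bigr => i _.
have Iu := sqi_mul mD (us i) (inH1_wD oD i gH).2; have Iv := sqi_mul mD (vs i) (inH1_wD oD i gH).2.
rewrite -(Rint_Z mD a Iu) -(Rint_D mD (intgZ mD a Iu) Iv).
by apply: eq_Rint => x Dx; rewrite -(E i x Dx); move: (wD D i g x) => y; ring.
Qed.

End weighted_products.

(** * Convolution *)

Section convolution.
Context {R : realType}.
Notation pt := (R * R)%type.
Notation mpt := (measurableTypeR R * measurableTypeR R)%type.
Notation mu2 := (@mu2 R).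

Lemma measurable_opp2 : measurable_fun setT (fun x : mpt => (- x : mpt)).
Proof.
apply/measurable_fun_pairP; split.
  by rewrite (_ : _ \o _ = (fun z : mpt => - z.1))//; apply: measurableT_comp.
by rewrite (_ : _ \o _ = (fun z : mpt => - z.2))//; apply: measurableT_comp.
Qed.

Lemma reflect_intg (f : mpt -> R) : intg mu2 setT f -> intg mu2 setT (fun x => f (- x)).
Proof.
move=> fi; have := @preserving_intg _ _ _ mu2 _ measurable_opp2 (@mu2_reflect R) setT f measurableT fi.
by rewrite preimage_setT.
Qed.

Lemma reflect_Rint (f : mpt -> R) : intg mu2 setT f ->
  \int[mu2]_x f (- x) = \int[mu2]_x f x.
Proof.
move=> fi; have := @preserving_Rint _ _ _ mu2 _ measurable_opp2 (@mu2_reflect R) setT f measurableT fi.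
by rewrite preimage_setT.
Qed.

Lemma kernel_intg (K : mpt -> R) (x : pt) : intg mu2 setT K ->
  intg mu2 setT (fun y => K (x - y)) /\ \int[mu2]_y K (x - y) = \int[mu2]_y K y.
Proof.
move=> Ki; have K1 := shift_intg x Ki; have K2 := reflect_intg K1.
have E (y : pt) : K (- y + x) = K (x - y) by rewrite addrC.
split; first by apply: (eq_intg measurableT _ K2) => y _; exact: E.
rewrite -(eq_Rint mu2 (fun y _ => E y)) (reflect_Rint K1); exact: shift_Rint.
Qed.

Definition msub (z : mpt * mpt) : mpt := (z.2 - z.1 : pt).

Lemma measurable_msub : measurable_fun setT msub.
Proof.
apply/measurable_fun_pairP; split.
  rewrite (_ : _ \o _ = (fun z : mpt * mpt => z.2.1 - z.1.1))//.
  by apply: measurable_funB; [exact: (measurableT_comp measurable_fst measurable_snd)|exact: (measurableT_comp measurable_fst measurable_fst)].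
rewrite (_ : _ \o _ = (fun z : mpt * mpt => z.2.2 - z.1.2))//.
by apply: measurable_funB; [exact: (measurableT_comp measurable_snd measurable_snd)|exact: (measurableT_comp measurable_snd measurable_fst)].
Qed.

Variable D : set pt.
Hypothesis oD : open D.
Hypothesis Dfin : (mu2 D < +oo)%E.
Let mD : measurable (D : set mpt). Proof. exact: open_measurable2. Qed.

Definition norm1 (K : mpt -> R) := \int[mu2]_x `|K x|.

Lemma norm1_ge0 K : 0 <= norm1 K.
Proof. by apply: Rintegral_ge0. Qed.

Lemma convol_fubini (K g th : mpt -> R) (M : R) : intg mu2 setT K -> intg mu2 D g ->
  measurable_fun setT th -> (forall x, `|th x| <= M) ->
  [/\ {ae mu2, forall x, intg mu2 D (fun y => K (x - y) * g y * th x)},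
      intg mu2 setT (fun x => \int[mu2]_(y in D) (K (x - y) * g y * th x)),
      intg mu2 D (fun y => \int[mu2]_x (K (x - y) * g y * th x)) &
      \int[mu2]_x \int[mu2]_(y in D) (K (x - y) * g y * th x) =
      \int[mu2]_(y in D) \int[mu2]_x (K (x - y) * g y * th x)].
Proof.
move=> Ki gi mth thM.
have M0 : 0 <= M by apply: le_trans (thM point).
have mgD : measurable_fun setT (g \_ D) by apply/(measurable_restrictT _ mD); exact: intg_meas gi.
have mk : measurable_fun ((D : set mpt) `*` [set: mpt])
    (fun z : mpt * mpt => K (z.2 - z.1 : pt) * g z.1 * th z.2).
  apply: (eq_measurable_fun (fun z : mpt * mpt => K (msub z) * (g \_ D) z.1 * th z.2)).
    by move=> z /set_mem[/= Dz _]; rewrite patchE mem_set.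
  apply: measurable_funTS; apply: measurable_funM; first apply: measurable_funM.
  - exact: measurableT_comp (intg_meas Ki) measurable_msub.
  - exact: measurableT_comp mgD measurable_fst.
  - exact: measurableT_comp mth measurable_snd.
have Ka := intg_abs Ki.
have inner y : (\int[mu2]_x `|K (x - y : pt)%R * g y * th x|%:E <= (norm1 K * M * `|g y|)%:E)%E.
  have S : \int[mu2]_x (M * `|g y| * `|K (x - y)|) = norm1 K * M * `|g y|.
    rewrite Rint_Z//; last exact: (shift_intg (- y) Ka).
    by rewrite (shift_Rint (- y) Ka) mulrC mulrA.
  have iS : intg mu2 setT (fun x => M * `|g y| * `|K (x - y)|).
    by apply: intgZ => //; exact: (shift_intg (- y) Ka).
  rewrite -S -(integral_intg measurableT iS); apply: ge0_le_integral => //.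
  - apply/measurable_EFinP; apply: measurableT_comp => //; apply: measurable_funM => //.
    apply: measurable_funM => //; exact: (intg_meas (shift_intg (- y) Ki)).
  - by apply/measurable_EFinP; exact: (intg_meas iS).
  - move=> x _; rewrite lee_fin !normrM; move: (thM x) (normr_ge0 (g y)) (normr_ge0 (K (x - y))).
    move: (`|g y|) (`|K _|) (`|th x|) => a b c cM a0 b0.
    have -> : b * a * c = a * b * c by ring.
    have -> : M * a * b = a * b * M by ring.
    by apply: ler_wpM2l => //; exact: mulr_ge0.
have ga := intg_abs gi.
have iN : intg mu2 D (fun y => norm1 K * M * `|g y|) by exact: intgZ.
have [|H1 H2 H3 H4 H5] := @fubini_rect _ _ mpt mpt R mu2s mu2s D setT mD measurableT _ mk.
  apply: (@le_lt_trans _ _ (\int[mu2]_(y in D) (norm1 K * M * `|g y|)%:E)%E); last first.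
    by rewrite integral_intg// ltry.
  apply: ge0_le_integral => //.
  - by move=> y _; apply: integral_ge0 => x _; rewrite lee_fin.
  - have mka : measurable_fun ((D : set mpt) `*` [set: mpt])
      (fun z : mpt * mpt => `|K (z.2 - z.1 : pt) * g z.1 * th z.2|) by exact: measurableT_comp.
    exact: (@tonelli_measurable _ _ mpt mpt R mu2s D setT mD measurableT _ mka (fun x y _ _ => normr_ge0 _)).
  - by apply/measurable_EFinP; exact: (intg_meas iN).
  - by move=> y _; exact: inner.
split; [|exact H4|exact H2|exact: esym H5].
by apply: ae_mono H3 => x H; exact: H.
Qed.

Lemma convol_ae (K g : mpt -> R) : intg mu2 setT K -> intg mu2 D g ->
  {ae mu2, forall x, intg mu2 D (fun y => K (x - y) * g y)} /\
  intg mu2 setT (convol D K g).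
Proof.
move=> Ki gi.
have [|H1 H2 _ _] := @convol_fubini K g (fun=> 1) 1 Ki gi (measurable_cst _); first by move=> x; rewrite normr1.
split.
  by apply: ae_mono H1 => x H; apply: (eq_intg mD _ H) => y _; rewrite mulr1.
apply: (eq_intg measurableT _ H2) => x _; rewrite /convol.
by apply: eq_Rint => y _; rewrite mulr1.
Qed.

(** Fubini moves the convolution onto [th]; on the right only the kernel meets [th], so that a
    derivative of [th] can be integrated by parts against the kernel. *)
Lemma convol_test (K g th : mpt -> R) (M : R) : intg mu2 setT K -> intg mu2 D g ->
  measurable_fun setT th -> (forall x, `|th x| <= M) ->
  intg mu2 D (fun y => g y * \int[mu2]_z (K z * th (z + y))) /\
  \int[mu2]_x (convol D K g x * th x) =
  \int[mu2]_(y in D) (g y * \int[mu2]_z (K z * th (z + y))).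
Proof.
move=> Ki gi mth thM; have [H1 H2 H3 H4] := convol_fubini Ki gi mth thM.
have [C1 _] := convol_ae Ki gi.
have M0 : 0 <= M by apply: le_trans (thM point).
have E y : D y -> \int[mu2]_x (K (x - y) * g y * th x) = g y * \int[mu2]_z (K z * th (z + y)).
  move=> Dy.
  have iK : intg mu2 setT (fun z => K z * th (z + y)).
    apply: (intg_dom measurableT _ (intgZ measurableT M (intg_abs Ki))).
      apply: measurable_funM; first exact: (intg_meas Ki).
      exact: measurableT_comp mth (measurable_shift y).
    by move=> z _; rewrite normrM mulrC ler_wpM2r.
  rewrite -(Rint_Z measurableT (g y) iK) -(shift_Rint (- y) (intgZ measurableT (g y) iK)).
  by apply: eq_Rint => x _; rewrite subrK; ring.
split; first by apply: (eq_intg mD E).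
transitivity (\int[mu2]_x \int[mu2]_(y in D) (K (x - y) * g y * th x)).
  apply: eq_Rintegral_ae; apply: ae_mono C1 => x C _.
  by rewrite /convol mulrC -Rint_Z//; apply: eq_Rint => y _; rewrite mulrC.
by rewrite H4; apply: eq_Rint.
Qed.

(** Young's inequality for an integrable kernel: Cauchy-Schwarz with respect to the weight [K]
    bounds the squared convolution by [norm1 K] times the convolution of the absolute kernel with
    the square of [f]. *)
Lemma convol_L2 (K f : mpt -> R) : intg mu2 setT K -> sqi mu2 D f ->
  sqi mu2 D (convol D K f) /\ n2 mu2 D (convol D K f) <= norm1 K * n2 mu2 D f.
Proof.
move=> Ki fs; have Ka := intg_abs Ki; have fi := sqi_intg mD Dfin fs.
have [C1 C2] := convol_ae Ki fi; have [W1 W2] := convol_ae Ka fs.2.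
pose W := convol D (fun x => `|K x|) (fun y => f y ^+ 2).
have WI : \int[mu2]_x W x = norm1 K * \int[mu2]_(y in D) f y ^+ 2.
  have := @convol_test (fun x => `|K x|) (fun y => f y ^+ 2) (fun=> 1) 1 Ka fs.2 (measurable_cst _).
  move=> /(_ (fun=> ltac:(by rewrite normr1)))[_].
  rewrite (@eq_Rint _ _ _ mu2 setT _ W) => [->|x _]; last by rewrite mulr1.
  rewrite -(Rint_Z mD (norm1 K) fs.2); apply: eq_Rint => y _; rewrite mulrC; congr (_ * _).
  by apply: eq_Rint => z _; rewrite mulr1.
have mf := fs.1.
have pw : {ae mu2, forall x, D x -> `|convol D K f x ^+ 2| <= norm1 K * W x}.
  apply: ae_mono (ae_and C1 W1) => x [c w] _; rewrite ger0_norm ?sqr_ge0//.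
  have [Kx EKx] := kernel_intg x Ka.
  have mKx : measurable_fun D (fun y => K (x - y)) by apply: measurable_funTS; exact: (intg_meas (kernel_intg x Ki).1).
  (* The absolute kernel is split into two equal factors, one of which stays with [f]. *)
  pose s y := Num.sqrt `|K (x - y)|.
  have ms : measurable_fun D s.
    by apply: (measurableT_comp (continuous_measurable_fun (@sqrt_continuous R))); apply: measurableT_comp.
  have s2 y : s y ^+ 2 = `|K (x - y)| by rewrite sqr_sqrtr.
  have KxD : intg mu2 D (fun y => `|K (x - y)|) by exact: integrableS Kx.
  have ss : sqi mu2 D s by split => //; apply: (eq_intg mD _ KxD) => y _; rewrite s2.
  have sf : sqi mu2 D (fun y => s y * `|f y|).
    split; first by apply: measurable_funM => //; exact: measurableT_comp.
    by apply: (eq_intg mD _ w) => y _; rewrite exprMn s2 real_normK// num_real.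
  have := cauchy_schwarz_sqr mD ss sf.
  have -> : \int[mu2]_(y in D) (s y * (s y * `|f y|)) = \int[mu2]_(y in D) `|K (x - y) * f y|.
    by apply: eq_Rint => y _; rewrite mulrA -expr2 s2 normrM.
  have -> : \int[mu2]_(y in D) (s y * `|f y|) ^+ 2 = W x.
    by apply: eq_Rint => y _; rewrite exprMn s2 real_normK// num_real.
  have W0 : 0 <= W x by apply: Rintegral_ge0 => y _; rewrite mulr_ge0// sqr_ge0.
  have le1 : \int[mu2]_(y in D) s y ^+ 2 <= norm1 K.
    rewrite /norm1 -EKx (@eq_Rint _ _ _ mu2 D _ (fun y => `|K (x - y)|)) => [|y _]; last exact: s2.
    exact: (Rint_subset mD measurableT (@subsetT _ _) Kx).
  move=> H; apply: (@le_trans _ _ ((\int[mu2]_(y in D) `|K (x - y) * f y|) ^+ 2)).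
    rewrite -(real_normK (num_real (convol D K f x))) ler_sqr ?nnegrE//.
      by apply: norm_Rint_le => //; [exact: intg_abs|apply: aeW].
    by apply: Rintegral_ge0.
  by apply: (le_trans H); apply: ler_wpM2r.
have mc : measurable_fun D (convol D K f) by apply: measurable_funTS; exact: (intg_meas C2).
have iW : intg mu2 D W by exact: integrableS W2.
have iNW := intgZ mD (norm1 K) iW.
have cs : sqi mu2 D (convol D K f) by split => //; apply: (intg_dom_ae mD (measurable_funX 2 mc) iNW).
split => //.
rewrite -(@ler_pXn2r _ 2) ?nnegrE ?n2_ge0 ?mulr_ge0 ?norm1_ge0 ?n2_ge0//.
rewrite exprMn !n2_sqr.
apply: (@le_trans _ _ (\int[mu2]_(x in D) (norm1 K * W x))).
  by apply: (le_Rint_ae mD cs.2 iNW); apply: ae_mono pw => x H Dx; apply: le_trans (H Dx); exact: ler_norm.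
rewrite Rint_Z// expr2 -mulrA; apply: ler_wpM2l; first exact: norm1_ge0.
rewrite -WI; apply: (Rint_subset mD measurableT (@subsetT _ _) W2) => x _.
by apply: Rintegral_ge0 => y _; rewrite mulr_ge0// sqr_ge0.
Qed.

Lemma acoef_bound (K : mpt -> R) : intg mu2 setT K ->
  measurable_fun setT (acoef D K) /\ forall x, `|acoef D K x| <= norm1 K.
Proof.
move=> Ki; have Ka := intg_abs Ki.
have i1 : intg mu2 D (fun=> 1 : R) by exact: (sqi_intg mD Dfin (sqi_cst mD 1 Dfin)).
have E x : convol D K (fun=> 1) x = acoef D K x by apply: eq_Rint => y _; rewrite mulr1.
split.
  have [_ C] := convol_ae Ki i1; have := intg_meas C.
  by congr measurable_fun; apply/funext.
move=> x; have [Kx EKx] := kernel_intg x Ka; have [Kx' _] := kernel_intg x Ki.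
have KxD : intg mu2 D (fun y => `|K (x - y)|) by exact: integrableS Kx.
have KxD' : intg mu2 D (fun y => K (x - y)) by exact: integrableS Kx'.
apply: (@le_trans _ _ (\int[mu2]_(y in D) `|K (x - y)|)).
  by apply: (norm_Rint_le mD KxD' KxD); apply: aeW.
by rewrite /norm1 -EKx; exact: (Rint_subset mD measurableT (@subsetT _ _) Kx).
Qed.

(** Fubini exchanges the two variables, and evenness almost everywhere turns [K (x - y)] into
    [K (y - x)]. *)
Lemma convol_sym (K f g : mpt -> R) : intg mu2 setT K ->
  {ae mu2, forall x : pt, K x = K (- x)} -> sqi mu2 D f -> sqi mu2 D g ->
  \int[mu2]_(x in D) (convol D K f x * g x) = \int[mu2]_(x in D) (f x * convol D K g x).
Proof.
move=> Ki Kev fs gs; have Ka := intg_abs Ki.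
have fi := sqi_intg mD Dfin fs; have gi := sqi_intg mD Dfin gs.
have [Cf _] := convol_ae Ki fi; have [Cg _] := convol_ae Ki gi.
have fa : sqi mu2 D (fun y => `|f y|).
  apply: (sqi_dom mD _ fs) => [|x _]; last by rewrite normr_id.
  by apply: measurableT_comp => //; exact: fs.1.
have ga : sqi mu2 D (fun y => `|g y|).
  apply: (sqi_dom mD _ gs) => [|x _]; last by rewrite normr_id.
  by apply: measurableT_comp => //; exact: gs.1.
have [Ca _] := convol_ae Ka (sqi_intg mD Dfin fa).
have [Cs _] := convol_L2 Ka fa.
have iC := sqi_mul mD Cs ga.
have mfD : measurable_fun setT (f \_ D) by apply/(measurable_restrictT _ mD); exact: fs.1.
have mgD : measurable_fun setT (g \_ D) by apply/(measurable_restrictT _ mD); exact: gs.1.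
pose k (y x : mpt) := K (x - y : pt) * f y * g x.
have mk : measurable_fun ((D : set mpt) `*` (D : set mpt)) (fun z : mpt * mpt => k z.1 z.2).
  apply: (eq_measurable_fun (fun z : mpt * mpt => K (msub z) * (f \_ D) z.1 * (g \_ D) z.2)).
    by move=> z /set_mem[/= Dz Dz']; rewrite !patchE !mem_set.
  apply: measurable_funTS; apply: measurable_funM; first apply: measurable_funM.
  - exact: measurableT_comp (intg_meas Ki) measurable_msub.
  - exact: measurableT_comp mfD measurable_fst.
  - exact: measurableT_comp mgD measurable_snd.
have mka : measurable_fun ((D : set mpt) `*` (D : set mpt)) (fun z : mpt * mpt => `|k z.1 z.2|).
  exact: measurableT_comp.
(* Absolute integrability is [convol_L2] for the absolute values of the kernel and of [f], paired
   with that of [g]. *)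
have fin : (\int[mu2s]_(y in D) \int[mu2s]_(x in D) `|k y x|%:E < +oo)%E.
  have := @tonelli_rect _ _ mpt mpt R mu2s mu2s D D mD mD _ mka (fun x y _ _ => normr_ge0 _).
  move=> /= ->; apply: (@le_lt_trans _ _ (\int[mu2]_(x in D) (convol D (fun x => `|K x|) (fun y => `|f y|) x * `|g x|)%:E)%E).
    rewrite le_eqVlt; apply/orP; left; apply/eqP; apply: ae_eq_integral => //.
    - have mka' : measurable_fun ((D : set mpt) `*` (D : set mpt)) (fun z : mpt * mpt => `|k z.2 z.1|).
        apply: measurableT_comp => //.
        apply: (eq_measurable_fun (fun z : mpt * mpt => K (- msub z : pt) * (f \_ D) z.2 * (g \_ D) z.1)).
          by move=> z /set_mem[/= Dz Dz']; rewrite !patchE !mem_set// /k /msub opprB.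
        apply: measurable_funTS; apply: measurable_funM; first apply: measurable_funM.
        + exact: measurableT_comp (intg_meas (reflect_intg Ki)) measurable_msub.
        + exact: measurableT_comp mfD measurable_snd.
        + exact: measurableT_comp mgD measurable_fst.
      exact: (@tonelli_measurable _ _ mpt mpt R mu2s D D mD mD _ mka' (fun x y _ _ => normr_ge0 _)).
    - by apply/measurable_EFinP; exact: (intg_meas iC).
    - apply: ae_mono Ca => x c Dx.
      have kxi : intg mu2 D (fun y => `|k y x|).
        by apply: (eq_intg mD _ (intgZr mD `|g x| c)) => y _; rewrite /k !normrM.
      apply: (etrans (integral_intg mD kxi)); congr (_%:E).
      rewrite /convol mulrC -(Rint_Z mD _ c).
      by apply: eq_Rint => y _; rewrite /k !normrM mulrC.
  by rewrite integral_intg// ltry.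
have [H1 H2 H3 H4 H5] := @fubini_rect _ _ mpt mpt R mu2s mu2s D D mD mD _ mk fin.
transitivity (\int[mu2]_(x in D) \int[mu2]_(y in D) k y x).
  apply: eq_Rintegral_ae; apply: ae_mono Cf => x c Dx.
  rewrite /convol mulrC -(Rint_Z mD _ c); apply: eq_Rint => y _.
  by rewrite /k mulrC.
apply: (etrans (esym H5)).
apply: eq_Rintegral_ae; apply: ae_mono Cg => y c Dy.
rewrite /convol -(Rint_Z mD _ c); apply: eq_Rintegral_ae.
have Ky := preserving_ae (measurable_shift (- y)) (@mu2_translate R (- y)) Kev.
by apply: ae_mono Ky => x E _; rewrite /k /= E opprB; ring.
Qed.

Lemma W11_intg (J : pt -> R) : W1p setT 1%:E J ->
  intg mu2 setT J /\ forall i, is_weak_partial setT i J (wD setT i J) /\ intg mu2 setT (wD setT i J).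
Proof.
by move=> [JL H]; split; [exact: Lfun1W JL|move=> i; have [H1 H2] := H i; split => //; exact: Lfun1W H2].
Qed.

(** The derivative falls on the kernel, so [f] may be merely square-integrable. *)
Lemma convol_weak_partial (J : pt -> R) i f : W1p setT 1%:E J -> sqi mu2 D f ->
  is_weak_partial D i (convol D J f) (convol D (wD setT i J) f).
Proof.
move=> /W11_intg[Ji /(_ i)[[_ HJ] Ki]] fs; have fi := sqi_intg mD Dfin fs.
split; first exact: (sqi_L1loc oD (convol_L2 Ki fs).1).
move=> chi tc; have td := testfun_derive (e_ i) tc.
have [M _ HM] := testfun_bounded tc; have [M' _ HM'] := testfun_bounded td.
have S (g th : mpt -> R) : testfun D th -> \int[mu2]_(x in D) (g x * th x) = \int[mu2]_x (g x * th x).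
  by move=> tth; apply: Rint_support => // x _ Dx; rewrite (testfun_out tth Dx) mulr0.
apply: (etrans (S _ _ td)); apply: (etrans (convol_test Ji fi (testfun_measurable td) HM').2).
have [iT ET] := convol_test Ki fi (testfun_measurable tc) HM.
rewrite (S _ _ tc) ET -(Rint_N mD iT).
have E y : \int[mu2]_z (J z * 'D_(e_ i) chi (z + y)) = - (\int[mu2]_z (wD setT i J z * chi (z + y))).
  have ty : testfun setT (fun z => chi (z + y)) by apply: testfunS (testfun_shift y tc).
  rewrite -(HJ _ ty); apply: eq_Rint => z _; congr (_ * _).
  have dx : derivable chi (z + y) (e_ i) by apply: (@Ck_derivable _ _ 0%N); exact: tc.1.
  by have [_ ->] := is_deriveE (derivable_shift dx).
by apply: eq_Rint => y _; rewrite E mulrN.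
Qed.

(** The gain of one derivative makes the convolution of a difference of phase fields an admissible
    test function for the phase equation. *)
Lemma convol_H1 (J : pt -> R) : W1p setT 1%:E J -> exists2 C, 0 <= C &
  forall f, sqi mu2 D f -> [/\ inH1 D (convol D J f),
    n2 mu2 D (convol D J f) <= C * n2 mu2 D f & gradnorm D (convol D J f) <= C * n2 mu2 D f].
Proof.
move=> JW; have [Ji Ki] := W11_intg JW.
pose k i := norm1 (wD setT i J); have k0 i : 0 <= k i by exact: norm1_ge0.
pose C := norm1 J + k ord0 + k ord_max.
have J0 := norm1_ge0 J; have C0 : 0 <= C by rewrite /C !addr_ge0.
exists C => // f fs; have f0 := n2_ge0 mu2 D f.
have [cs cn] := convol_L2 Ji fs.
have cH : inH1 D (convol D J f).
  split => // i; exists (convol D (wD setT i J) f); first exact: convol_weak_partial.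
  exact: (convol_L2 (Ki i).2 fs).1.
have wb i : n2 mu2 D (wD D i (convol D J f)) <= k i * n2 mu2 D f.
  rewrite (eq_n2_ae (wD_ae oD (convol_weak_partial i JW fs))).
  exact: (convol_L2 (Ki i).2 fs).2.
split => //.
  by apply: (le_trans cn); apply: ler_wpM2r => //; rewrite /C -addrA lerDl addr_ge0.
have sum_sq (x y : R) : 0 <= x -> 0 <= y -> Num.sqrt (x ^+ 2 + y ^+ 2) <= x + y.
  move=> x0 y0; rewrite -[leRHS]ger0_norm ?addr_ge0// -sqrtr_sqr ler_sqrt ?sqr_ge0//.
  by have := mulr_ge0 x0 y0; rewrite !expr2; lra.
rewrite /gradnorm sumI2; apply: (le_trans (sum_sq _ _ (n2_ge0 _ _ _) (n2_ge0 _ _ _))).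
apply: (le_trans (lerD (wb ord0) (wb ord_max))); rewrite -mulrDl; apply: ler_wpM2r => //.
by rewrite /C -addrA lerDr.
Qed.

End convolution.

(** * Bochner functions and weak time derivatives *)

Section simple_maps.
Context {R : realType}.
Notation leb := (@lebesgue_measure R).
Notation mt := (measurableTypeR R).

Lemma measurable_oo (s t : R) : measurable (`]s, t[%classic : set mt).
Proof. exact: measurable_itv. Qed.

Lemma finite_oo (s t : R) : (leb (`]s, t[%classic : set mt) < +oo)%E.
Proof. by rewrite lebesgue_measure_itv; case: ifP => _; rewrite -?EFinB ltry. Qed.

Definition simple_map (Y : Type) (s : mt -> Y) : Prop :=
  finite_set (range s) /\ forall y, measurable (s @^-1` [set y]).

Lemma simple_preimage (Y : Type) (s : mt -> Y) (B : set Y) : simple_map s ->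
  measurable (s @^-1` B).
Proof.
move=> [fs ms].
have -> : s @^-1` B = \bigcup_(y in range s `&` B) s @^-1` [set y].
  apply/seteqP; split=> [t Bt|t [y [_ By] /= E]]; last by rewrite /preimage /= E.
  by exists (s t) => //; split=> //; exists t.
by apply: fin_bigcup_measurable => [|y _]; [exact: finite_setIl|exact: ms].
Qed.

(** The range is finite and its fibres are measurable, so [k] may be any function. *)
Lemma simple_comp (Y : Type) (s : mt -> Y) (k : Y -> R) : simple_map s ->
  measurable_fun setT (fun t : mt => k (s t)).
Proof. by move=> ss _ B _; rewrite setTI; exact: (simple_preimage (k @^-1` B) ss). Qed.

Lemma simple_pair (Y Y' : Type) (s : mt -> Y) (s' : mt -> Y') : simple_map s -> simple_map s' ->
  simple_map (fun t => (s t, s' t)).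
Proof.
move=> [fs ms] [fs' ms']; split.
  apply: (sub_finite_set _ (finite_setX fs fs')) => _ [t _ <-] /=.
  by split; exists t.
move=> [y y']; have -> : (fun t => (s t, s' t)) @^-1` [set (y, y')] =
    s @^-1` [set y] `&` s' @^-1` [set y'].
  by apply/seteqP; split=> t /=; [move=> [-> ->]|move=> [-> ->]].
exact: measurableI.
Qed.

Lemma simple_funE (X : nspace R) (s : R -> X) : simple_fun s -> simple_map (s : mt -> X).
Proof. by case=> fs ms _; split=> // y; exact: ms. Qed.

(** The measurable representative is the upper limit of [p] along the simple approximations, which
    is defined at every time; the Lipschitz bound identifies it with [p (f t)] wherever these
    converge. *)
Lemma strong_meas_lip (T c : R) (X : nspace R) (f : R -> X) (p : X -> R) :
  strongly_measurable T f -> {ae leb, forall t, t \in `]0, T[ -> mem_of (f t)} ->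
  (forall v w : X, mem_of v -> mem_of w -> `|p v - p w| <= c * nrm (v - w)) ->
  exists2 G : mt -> R, measurable_fun setT G &
    {ae leb, forall t, t \in `]0, T[ -> p (f t) = G t}.
Proof.
move=> [s [ss sf]] mf pl.
pose L n (t : mt) : \bar R := (p (s n t))%:E.
have mL n : measurable_fun setT (L n).
  by apply/measurable_EFinP; exact: (simple_comp p (simple_funE (ss n))).
exists (fun t => fine (limn_esup (L ^~ t))).
  by apply: measurableT_comp => //; exact: measurable_fun_limn_esup.
have := ae_and sf mf; apply: ae_mono => t [h1 h2] t0.
have {h1}h1 := h1 t0; have {h2}h2 := h2 t0.
have cv : (fun n => (p (s n t))%:E) @ \oo --> (p (f t))%:E.
  apply: cvg_EFin; first by near=> n.
  have c0 : (fun n => c * nrm (s n t - f t)) @ \oo --> c * 0 by apply: cvgMr.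
  rewrite mulr0 in c0; apply/cvgrPdist_le => e e0; move/cvgrPdist_le: c0 => /(_ e e0).
  apply: filterS => n /=; rewrite sub0r normrN distrC => le; apply: le_trans le.
  by apply: le_trans (ler_norm _); apply: pl => //; case: (ss n).
by rewrite (cvg_limn_einf_sup cv).2.
Unshelve. all: by end_near. Qed.

Lemma simple_bounded (Y : choiceType) (s : mt -> Y) (k : Y -> R) : simple_map s ->
  exists2 N, 0 <= N & forall t, k (s t) <= N.
Proof.
move=> [/finite_seqP[l El] _]; exists (\sum_(y <- l) `|k y|).
  by apply: sumr_ge0 => y _.
move=> t; have tl : s t \in l.
  by have : [set` l] (s t) by rewrite -El; exists t.
rewrite (big_rem _ tl) /=; apply: le_trans (ler_norm _) _; rewrite lerDl.
by apply: sumr_ge0.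
Qed.

Lemma uniform_continuity (f : R -> R) (T e : R) : continuous f -> 0 < e ->
  exists2 eta, 0 < eta & forall t r, t \in `[0, T] -> r \in `[0, T] -> `|t - r| < eta ->
    `|f t - f r| <= e.
Proof.
move=> cf e0; have cK := @segment_compact R 0 T.
have := (compact_near_coveringP _).1 cK _ (0^'+ : set_system R)
  (fun eta x => forall r : R, `|x - r| < eta -> `|f x - f r| <= e) _.
case.
  move=> x _; have := cf x; move=> /cvgrPdist_le /(_ (e / 2) (divr_gt0 e0 (ltr0Sn R 1))).
  move=> /nbhs_ballP[d /= d0 hd].
  exists (ball x (d / 2), [set eta | eta < d / 2]); first split.
  - by apply: nbhsx_ballx; rewrite divr_gt0.
  - by apply: nbhs_right_lt; rewrite divr_gt0.
  - move=> [y eta] [/= xy ed] r yr.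
    have h1 : `|f x - f y| <= e / 2.
      by apply: hd; rewrite /ball /=; apply: lt_le_trans xy _; rewrite ler_pdivrMr// ler_peMr ?ler1n// ltW.
    have h2 : `|f x - f r| <= e / 2.
      apply: hd; rewrite /ball /= -(subrKA y) (splitr d).
      by apply: le_lt_trans (ler_normD _ _) _; rewrite ltrD// (lt_trans yr).
    rewrite -(subrKA (f x)) (splitr e); apply: le_trans (ler_normD _ _) _.
    by rewrite lerD// distrC.
move=> d /= d0 hd; exists (d / 2); first by rewrite divr_gt0.
move=> t r t0 _ tr; apply: (hd (d / 2)) => //=; last by rewrite divr_gt0.
by rewrite sub0r normrN gtr0_norm ?divr_gt0// ltr_pdivrMr// ltr_pMr// ltr1n.
Qed.

Definition clamp (M x : R) : R := Num.max 0 (Num.min x M).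

Lemma clamp_lip M x y : `|clamp M x - clamp M y| <= `|x - y|.
Proof.
rewrite /clamp /Num.max /Num.min.
have := ler_norm (x - y); have := ler_norm (y - x); rewrite (distrC y x) => h1 h2.
rewrite ler_norml.
by case: (ltP x M) => a1; case: (ltP y M) => a2; try case: (ltP 0 x) => a3;
  try case: (ltP 0 y) => a4; try case: (ltP 0 M) => a5; apply/andP; split; lra.
Qed.

Lemma clamp_id M x : 0 <= x <= M -> clamp M x = x.
Proof. by move=> /andP[x0 xM]; rewrite /clamp min_l// max_r. Qed.

Lemma clamp_itv M x : 0 <= M -> 0 <= clamp M x <= M.
Proof. by move=> M0; rewrite /clamp le_max lexx/= ge_max M0 ge_min lexx orbT. Qed.

(** [theta] is close in L^1 to a continuous function, which after clamping has the same bounds. The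
    error is then also small in L^2, since its square is at most [M] times itself, and the
    continuous part is uniformly continuous. *)
Lemma bounded_osc (theta : mt -> R) (T M e : R) : measurable_fun setT theta ->
  (forall t, 0 <= theta t <= M) -> 0 < e ->
  exists eta (del : R -> R), [/\ 0 < eta, sqi leb `]0, T[%classic del,
    \int[leb]_(t in `]0, T[) del t ^+ 2 <= e, forall t, 0 <= del t &
    forall t r, t \in `]0, T[ -> r \in `]0, T[ -> `|t - r| < eta ->
      `|theta t - theta r| <= del t + del r].
Proof.
move=> mth th e0; pose D : set mt := `]0, T[%classic.
have M0 : 0 <= M by have /andP[h1] := th 0; exact: le_trans.
have mD : measurable D := measurable_oo 0 T; have Dfin := finite_oo 0 T.
have ith : intg leb D theta.
  apply: (intg_bounded (M := M) mD Dfin); first exact: measurable_funTS.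
  by move=> t _; have /andP[h1 h2] := th t; rewrite ger0_norm.
have [g [gc gi g0]] := approximation_continuous_integrable mD Dfin ith.
(* The squared error is counted twice with weight [M]: [2 * M * e1 <= e / 2]. *)
pose e1 := e / (4 * (M + 1)).
have e10 : 0 < e1 by rewrite divr_gt0// mulr_gt0// ltr_wpDl.
have [n gn] : exists n, \int[leb]_(t in D) `|theta t - g n t| <= e1.
  move/fine_cvgP: g0 => [_ /cvgrPdist_le /(_ _ e10)] [n _ /(_ n (leqnn n))] /= H.
  exists n; apply: le_trans (ler_norm _) _; move: H; rewrite sub0r normrN.
  by apply: le_trans; rewrite /Rintegral.
pose k (t : mt) := clamp M (g n t).
have ck : continuous k.
  move=> t; apply/cvgrPdist_le => a a0; have := gc n t; move/cvgrPdist_le/(_ _ a0).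
  by apply: filterS => x le; apply: le_trans le; exact: clamp_lip.
have mk : measurable_fun setT k by exact: continuous_measurable_fun.
(* The bound 1 gives [e2 * e2 <= e2]; the other makes the constant [2 * e2] contribute at most
   [e / 2] over the interval. *)
pose e2 := Num.min 1 (e / (4 * (`|T| + 1))).
have e20 : 0 < e2.
  by rewrite lt_min ltr01 divr_gt0// mulr_gt0// ltr_wpDl.
have [eta eta0 Heta] := uniform_continuity T ck e20.
pose del (t : mt) := `|theta t - k t| + e2.
have mdel : measurable_fun setT del.
  by apply: measurable_funD => //; apply: measurableT_comp => //; exact: measurable_funB.
have kM t : `|theta t - k t| <= M.
  have /andP[a1 a2] := th t; have /andP[b1 b2] := clamp_itv (g n t) M0.
  by rewrite ler_norml; apply/andP; split; rewrite /k; lra.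
have kg t : `|theta t - k t| <= `|theta t - g n t|.
  by rewrite -{1}(clamp_id (th t)); exact: clamp_lip.
have del0 t : 0 <= del t by rewrite /del addr_ge0// ltW.
have delM t : `|del t| <= M + e2 by rewrite ger0_norm// /del lerD.
have sdel : sqi leb D del.
  split; first exact: measurable_funTS.
  apply: (intg_bounded (M := (M + e2) ^+ 2) mD Dfin).
    by apply: measurable_funX; exact: measurable_funTS.
  by move=> t _; rewrite normrX lerXn2r// nnegrE ?addr_ge0// ltW.
exists eta, del; split => //; last first.
  move=> t r t0 r0 tr; have := Heta t r (subset_itv_oo_cc t0) (subset_itv_oo_cc r0) tr.
  move=> h; apply: (@le_trans _ _ (`|theta t - k t| + (`|k t - k r| + `|theta r - k r|))).
    rewrite -(subrKA (k t) (theta t)) -(subrKA (k r) (k t)).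
    apply: le_trans (ler_normD _ _) _; rewrite lerD2l.
    by apply: le_trans (ler_normD _ _) _; rewrite lerD2l distrC.
  by rewrite /del; lra.
have ia : intg leb D (fun t => `|theta t - g n t|).
  by apply: intg_abs; apply: intgB => //; exact: gi.
have ic : intg leb D (fun=> 2 * e2) by exact: (sqi_intg mD Dfin (sqi_cst mD _ Dfin)).
have i1 := intgZ mD (2 * M) ia.
apply: le_trans (le_Rint mD sdel.2 (intgD mD i1 ic) _) _.
  move=> t _; have := kM t; have := kg t; have := normr_ge0 (theta t - k t).
  have e21 : e2 <= 1 by rewrite ge_min lexx.
  rewrite /del; move: `|theta t - k t| `|theta t - g n t| => x y x0 xy xM.
  have h1 : x * x <= M * y by rewrite mulrC ler_pM.
  have h2 : e2 * e2 <= e2 by rewrite ger_pMr.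
  have := sqr_ge0 (x - e2); rewrite !expr2; nra.
rewrite (Rint_D mD i1 ic) (Rint_Z mD _ ia).
have -> : \int[leb]_(t in D) (2 * e2) = 2 * e2 * fine (leb D).
  by rewrite /Rintegral integral_cst//= fineM// ge0_fin_numE.
have DT : fine (leb D) <= `|T|.
  by rewrite /D lebesgue_measure_itv/=; case: ifP => _ //=; rewrite subr0 ler_norm.
have p1 : 2 * M * \int[leb]_(t in D) `|theta t - g n t| <= 2 * M * e1.
  by rewrite ler_wpM2l// mulr_ge0.
have p2 : 2 * M * e1 <= e / 2.
  rewrite /e1 mulrA ler_pdivrMr ?mulr_gt0 ?ltr_wpDl//.
  by have := mulr_ge0 (ltW e0) M0; lra.
have p3 : 2 * e2 * fine (leb D) <= e / 2.
  have a1 : e2 <= e / (4 * (`|T| + 1)) by rewrite ge_min lexx orbT.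
  have T1 : 0 < 4 * (`|T| + 1) by rewrite mulr_gt0// ltr_wpDl.
  move: a1; rewrite ler_pdivlMr// => a1.
  have := ler_wpM2l (ltW e20) DT; lra.
by rewrite (splitr e); apply: lerD => //; exact: le_trans p1 p2.
Qed.

(** An [nspace] carries no axioms; these are the ones used for [H1 D] and [Vdiv D]. *)
Record seminormed (X : nspace R) : Prop := Seminormed {
  mem0 : @mem_of _ X 0;
  mem_lin : forall (a : R) (v w : X), mem_of v -> mem_of w -> mem_of (a *: v + w);
  nrm0 : nrm (0 : X) = 0;
  nrm_pos : forall v : X, mem_of v -> 0 <= nrm v;
  nrm_lin : forall (a : R) (v w : X), mem_of v -> mem_of w ->
    nrm (a *: v + w) <= `|a| * nrm v + nrm w }.

Section seminorm_facts.
Variable X : nspace R.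
Hypothesis SX : seminormed X.
Implicit Types v w x : X.

Lemma memB v w : mem_of v -> mem_of w -> mem_of (v - w).
Proof. by move=> mv mw; rewrite addrC -scaleN1r; exact: (mem_lin SX). Qed.

Lemma memZ a v : mem_of v -> mem_of (a *: v).
Proof. by move=> mv; rewrite -[_ *: _]addr0; apply: (mem_lin SX) => //; exact: (mem0 SX). Qed.

Lemma nrmZ_le a v : mem_of v -> nrm (a *: v) <= `|a| * nrm v.
Proof.
move=> mv; rewrite -[_ *: _]addr0; apply: le_trans (nrm_lin SX a mv (mem0 SX)) _.
by rewrite (nrm0 SX) addr0.
Qed.

Lemma nrmB v w : mem_of v -> mem_of w -> nrm (v - w) <= nrm v + nrm w.
Proof.
move=> mv mw; rewrite addrC -scaleN1r; apply: le_trans (nrm_lin SX _ mw mv) _.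
by rewrite normrN1 mul1r addrC.
Qed.

Lemma nrm_distr v w x : mem_of v -> mem_of w -> mem_of x ->
  nrm (v - w) <= nrm (x - v) + nrm (x - w).
Proof.
move=> mv mw mx; have -> : v - w = -1 *: (x - v) + (x - w).
  by rewrite scaleN1r opprB addrA subrK.
apply: le_trans (nrm_lin SX _ (memB mx mv) (memB mx mw)) _.
by rewrite normrN1 mul1r.
Qed.

Lemma nrm_le_dist v w : mem_of v -> mem_of w -> nrm v <= nrm w + nrm (w - v).
Proof.
move=> mv mw; have -> : nrm v = nrm (-1 *: (w - v) + w) by rewrite scaleN1r opprB subrK.
apply: le_trans (nrm_lin SX _ (memB mw mv) mw) _.
by rewrite normrN1 mul1r addrC.
Qed.

Lemma nrmC v w : mem_of v -> mem_of w -> nrm (v - w) = nrm (w - v).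
Proof.
move=> mv mw; apply/eqP; rewrite eq_le; apply/andP; split.
  by apply: le_trans (nrm_distr mv mw mw) _; rewrite subrr (nrm0 SX) addr0.
by apply: le_trans (nrm_distr mw mv mv) _; rewrite subrr (nrm0 SX) addr0.
Qed.

End seminorm_facts.

(* Replaces mollification in time: a square-integrable trajectory may be evaluated at a
   nearby time at a cost that is small in L^2. *)
Lemma bochner_osc (X : nspace R) (f : R -> X) (T e : R) : seminormed X ->
  Bochner T 2%:E f -> 0 < e ->
  exists eta (del : R -> R) (P : R -> Prop),
    [/\ 0 < eta, sqi leb `]0, T[%classic del,
    \int[leb]_(t in `]0, T[) del t ^+ 2 <= e, forall t, 0 <= del t &
    {ae leb, forall t, t \in `]0, T[ -> P t} /\
    forall t r, t \in `]0, T[ -> r \in `]0, T[ -> P t -> P r -> `|t - r| < eta ->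
      nrm (f t - f r) <= del t + del r].
Proof.
move=> SX [[s [ss sf]] [g gL fg]] e0.
pose D : set mt := `]0, T[%classic.
have mD : measurable D := measurable_oo 0 T; have Dfin := finite_oo 0 T.
have gs : sqi leb D g := (@Lfun2P _ _ _ leb _ mD g).1 gL.
pose e1 := Num.min 1 (e / (16 * (`|T| + 1))).
have e10 : 0 < e1 by rewrite lt_min ltr01 divr_gt0// mulr_gt0// ltr_wpDl.
(* Times at which [s n] is within [e1] of all later approximations. Only simple functions occur, so
   [B n] is measurable, and almost every time belongs to [B n] for large [n]. *)
pose B n : set mt := [set t | forall m, (n <= m)%N -> nrm (s n t - s m t) <= e1].
have mB n : measurable (B n).
  have -> : B n = \bigcap_(m in [set m | (n <= m)%N])
      ((fun t => (s n t, s m t)) @^-1` [set y | nrm (y.1 - y.2) <= e1]).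
    by apply/seteqP; split=> t /= h m; exact: h.
  apply: bigcap_measurableType => // m _.
  by apply: simple_preimage; apply: simple_pair; exact: simple_funE.
(* The squared norm of [f] off [B n]; its integral tends to 0 by dominated convergence. *)
pose cg n (t : mt) := g t ^+ 2 * \1_(~` B n) t.
have mcg n : measurable_fun D (cg n).
  apply: measurable_funM; first by apply: measurable_funX; exact: gs.1.
  by apply: measurable_indic; exact: measurableC.
have indB n t : \1_(~` B n) t = 0 :> R \/ (\1_(~` B n) t = 1 :> R /\ ~ B n t).
  rewrite indicE; case: (pselect (B n t)) => h; first by left; rewrite memNset//; exact.
  by right; rewrite mem_set.
have [|||||_ cv] := @dominated_Rint _ _ _ leb D mD cg (fun=> 0) (fun t => g t ^+ 2).
- exact: mcg.
- exact: measurable_cst.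
- apply: ae_mono (ae_and sf fg) => t [h1 h2] Dt.
  have {h1}h1 := h1 Dt; have {h2}[mt _] := h2 Dt.
  have e12 : 0 < e1 / 2 by rewrite divr_gt0.
  move/cvgrPdist_le: h1 => /(_ _ e12) [N _ HN].
  apply: cvg_near_cst; exists N => // n /= Nn; rewrite /cg indicE memNset ?mulr0//=; apply.
  move=> m nm; have mn k : mem_of (s k t) by case: (ss k).
  apply: le_trans (nrm_distr SX (mn n) (mn m) mt) _.
  rewrite (nrmC SX mt (mn n)) (nrmC SX mt (mn m)) (splitr e1).
  by apply: lerD; [have := HN n Nn|have := HN m (leq_trans Nn nm)] => /=;
    rewrite sub0r normrN => h; apply: le_trans (ler_norm _) h.
- exact: gs.2.
- move=> n t _; rewrite /cg normrM ger0_norm ?sqr_ge0//.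
  by case: (indB n t) => [->|[-> _]]; rewrite ?normr0 ?normr1 ?mulr0 ?mulr1 ?sqr_ge0.
have e8 : 0 < e / 16 by rewrite divr_gt0.
have [n Hn] : exists n, \int[leb]_(t in D) cg n t <= e / 16.
  rewrite (_ : \int[leb]_(x in D) 0 = 0) in cv; last by rewrite /Rintegral integral0.
  move/cvgrPdist_le: cv => /(_ _ e8) [N _ /(_ N (leqnn N))] /= h; exists N.
  by move: h; rewrite sub0r normrN; apply: le_trans; exact: ler_norm.
have [N0 N00 HN0] := @simple_bounded X (s n) (@nrm _ X) (simple_funE (ss n)).
have sfin := simple_funE (ss n).
have bs : simple_map (fun t : mt => `[< B n t >]).
  split; first by apply: (sub_finite_set (@subsetT _ _)); exact: finite_finset.
  move=> b; have -> : (fun t => `[< B n t >]) @^-1` [set b] = if b then B n else ~` B n.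
    by apply/seteqP; case: b; split=> t /=; [move/asboolP|move=> h; exact/asboolP|move/asboolP|move=> h; exact/asboolP].
  by case: b => //; exact: measurableC.
have [l El] : exists l : seq X, range (s n) = [set` l] by apply/finite_seqP; case: sfin.
(* A scalar code of the value of [s n] and of membership in [B n]. Different outcomes get codes at
   least [2 * N0] apart, which dominates the distance of two values of [s n]; the successor reserves
   the code 0 for the complement of [B n]. *)
pose th0 (y : X * bool) : R := 2 * N0 * (if y.2 then (index y.1 l).+1%:R else 0).
pose theta (t : mt) : R := th0 (s n t, `[< B n t >]).
have mth : measurable_fun setT theta := simple_comp th0 (simple_pair sfin bs).
have thM t : 0 <= theta t <= 2 * N0 * (size l).+1%:R.
  rewrite /theta /th0 /=; apply/andP; split; first by rewrite mulr_ge0 ?mulr_ge0//; case: ifP.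
  by rewrite ler_wpM2l ?mulr_ge0//; case: ifP => // _; rewrite ler_nat ltnS index_size.
have e4 : 0 < e / 4 by rewrite divr_gt0.
have [eta [d1 [eta0 sd1 id1 d10 Hd1]]] := bounded_osc T mth thM e4.
(* On [B n] the approximation error is at most [e1]; off [B n] the norm of [f] itself, given by [g],
   is paid. *)
pose d0 (t : mt) := e1 + `|g t| * \1_(~` B n) t.
have ind0 t : 0 <= \1_(~` B n) t :> R by rewrite indicE.
have d00 t : 0 <= d0 t by rewrite /d0 addr_ge0 ?mulr_ge0// ltW.
pose del (t : mt) := d0 t + d1 t.
have md0 : measurable_fun D d0.
  apply: measurable_funD => //; apply: measurable_funM; first by apply: measurableT_comp => //; exact: gs.1.
  by apply: measurable_indic; exact: measurableC.
have e11 : e1 <= 1 by rewrite ge_min lexx.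
have delb t : del t ^+ 2 <= 4 * e1 + 4 * cg n t + 2 * d1 t ^+ 2.
  have h : d0 t ^+ 2 <= 2 * e1 + 2 * cg n t.
    have a1 : e1 * e1 <= e1 by rewrite ger_pMr.
    rewrite /d0 /cg -(real_normK (num_real (g t))); have := sqr_ge0 (e1 - `|g t|).
    by case: (indB n t) => [->|[-> _]]; rewrite !expr2; nra.
  by move: h; rewrite /del; have := sqr_ge0 (d0 t - d1 t); rewrite !expr2; nra.
have icg : intg leb D (cg n).
  apply: (intg_dom mD (mcg n) gs.2) => t _; rewrite /cg normrM ger0_norm ?sqr_ge0//.
  by case: (indB n t) => [->|[-> _]]; rewrite ?normr0 ?normr1 ?mulr0 ?mulr1 ?sqr_ge0.
have ic : intg leb D (fun=> 4 * e1) by exact: (sqi_intg mD Dfin (sqi_cst mD _ Dfin)).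
have i1 := intgD mD ic (intgZ mD 4 icg); have i2 := intgZ mD 2 sd1.2.
have i3 := intgD mD i1 i2.
have mdel : measurable_fun D del by apply: measurable_funD => //; exact: sd1.1.
have sdel : sqi leb D del.
  split=> //; apply: (intg_dom mD _ i3); first exact: measurable_funX.
  by move=> t _; rewrite ger0_norm ?sqr_ge0.
pose P t := [/\ mem_of (f t), nrm (f t) = g t & (fun n => nrm (s n t - f t)) @ \oo --> (0 : R)].
exists eta, del, P; split => //; last 1 first.
- split.
    by apply: ae_mono (ae_and sf fg) => t [h1 h2] Dt; have [? ?] := h2 Dt; split=> //; exact: h1.
  move=> t r t0 r0 [mt gt ct] [mr gr cr] tr.
  have ms k x : mem_of (s k x) by case: (ss k).
  have near_s x : mem_of (f x) -> (fun n => nrm (s n x - f x)) @ \oo --> (0 : R) ->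
      B n x -> nrm (s n x - f x) <= e1.
    move=> mx cx Bx; apply/ler_addgt0Pr => a a0; move/cvgrPdist_le: cx => /(_ _ a0) [N _ HN].
    have := HN (maxn n N) (leq_maxr _ _); rewrite /= sub0r normrN => /(le_trans (ler_norm _)) h.
    apply: le_trans (nrm_distr SX (ms n x) mx (ms (maxn n N) x)) _; apply: lerD => //.
    by rewrite (nrmC SX (ms _ x) (ms n x)); apply: Bx; exact: leq_maxl.
  have th := Hd1 t r t0 r0 tr.
  have gn x : nrm (f x) = g x -> mem_of (f x) -> nrm (f x) = `|g x|.
    by move=> h mx; rewrite -h ger0_norm// (nrm_pos SX).
  have far x y : mem_of (f x) -> mem_of (f y) -> nrm (f x) = g x -> nrm (f y) = g y ->
      (fun n => nrm (s n x - f x)) @ \oo --> (0 : R) -> B n x -> ~ B n y ->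
      nrm (f x - f y) <= d0 x + d0 y + `|theta x - theta y|.
    move=> mx my gx gy cx Bx By; apply: le_trans (nrmB SX mx my) _.
    have h1 := nrm_le_dist SX mx (ms n x); have h2 := near_s x mx cx Bx; have h3 := HN0 x.
    rewrite /d0 !indicE (memNset (A := ~` B n)); last by apply.
    rewrite (mem_set (A := ~` B n) (u := y))// -gn// -gn//.
    rewrite /theta /th0 /= (asboolT Bx) (asboolF By) -mulrBr subr0 normrM (ger0_norm (_ : 0 <= 2 * N0)) ?mulr_ge0// normr_nat.
    have h4 : N0 * 1 <= N0 * (index (s n x) l).+1%:R by rewrite ler_wpM2l// ler1n.
    by move: h1 h2 h3 h4 (ltW e10) N00; lra.
  rewrite /del -addrA [d1 t + _]addrCA addrA; apply: (@le_trans _ _ (d0 t + d0 r + `|theta t - theta r|)); last by rewrite lerD2l.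
  (* With both times in [B n], either the values of [s n] agree or [theta] jumps; with one of them
     in [B n], [theta] also jumps; with none, the two norms suffice. *)
  have [Bt|Bt] := pselect (B n t); have [Br|Br] := pselect (B n r); last first.
  + apply: le_trans (nrmB SX mt mr) _; rewrite /d0 !indicE !(mem_set (A := ~` B n))// !mulr1.
    rewrite (gn t)// (gn r)//; have := normr_ge0 (theta t - theta r); move: (ltW e10); lra.
  + by rewrite (nrmC SX mt mr) distrC [d0 t + _]addrC; exact: far.
  + exact: far.
  have h1 := near_s t mt ct Bt; have h2 := near_s r mr cr Br.
  have h3 := nrm_distr SX mt mr (ms n t).
  rewrite /d0 !indicE !(memNset (A := ~` B n)); try by apply.
  rewrite !mulr0 !addr0.
  have [E|NE] := eqVneq (s n t) (s n r).
    by have := normr_ge0 (theta t - theta r); move: h3; rewrite {2}E; lra.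
  have h4 := nrm_distr SX (ms n t) mr (ms n r); have h5 := nrmB SX (ms n r) (ms n t).
  have h6 := HN0 t; have h7 := HN0 r.
  have h8 : 2 * N0 <= `|theta t - theta r|.
    rewrite /theta /th0 /= (asboolT Bt) (asboolT Br) -mulrBr normrM ger0_norm ?mulr_ge0// ler_peMr ?mulr_ge0//.
    have tl x : s n x \in l by have : [set` l] (s n x) by rewrite -El; exists x.
    have : index (s n t) l != index (s n r) l.
      by apply: contra NE => /eqP ie; rewrite -(nth_index (s n t) (tl t)) ie nth_index.
    move: (index (s n t) l) (index (s n r) l) => a b ab.
    have [ba|ab'] := ltnP b a.
      by rewrite ger0_norm ?subr_ge0 ?ler_nat 1?ltnW// -natrB 1?ltnW// ler1n subSS subn_gt0.
    by rewrite distrC ger0_norm ?subr_ge0 ?ler_nat// -natrB// ler1n subSS subn_gt0 ltn_neqAle ab.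
  by move: h1 h2 h3 h4 h5 h6 h7 h8; lra.
- apply: le_trans (le_Rint mD sdel.2 i3 (fun t _ => delb t)) _.
  rewrite (Rint_D mD i1 i2) (Rint_D mD ic (intgZ mD 4 icg)) (Rint_Z mD _ icg) (Rint_Z mD _ sd1.2).
  have -> : \int[leb]_(t in D) (4 * e1) = 4 * e1 * fine (leb D).
    by rewrite /Rintegral integral_cst//= fineM// ge0_fin_numE.
  have DT : fine (leb D) <= `|T|.
    by rewrite /D lebesgue_measure_itv/=; case: ifP => _ //=; rewrite subr0 ler_norm.
  have a1 : e1 <= e / (16 * (`|T| + 1)) by rewrite ge_min lexx orbT.
  have T1 : 0 < 16 * (`|T| + 1) by rewrite mulr_gt0// ltr_wpDl.
  move: a1; rewrite ler_pdivlMr// => a1.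
  move: id1 Hn; move: (\int[leb]_(t in D) d1 t ^+ 2) (\int[leb]_(t in D) cg n t) => x y xe ye.
  by have := ler_wpM2l (ltW e10) DT; move: (fine _) => w ww; lra.
- by move=> t; rewrite addr_ge0.
Qed.
End simple_maps.

(** * Weak time derivatives and integrated equations *)

Section weak_time_derivative.
Context {R : realType}.
Notation leb := (@lebesgue_measure R).
Notation mt := (measurableTypeR R).

Definition dstep (x : R) : R := 'D_1 (@step R) x.

Lemma is_derive_step (s e r : R) :
  is_derive r (1 : R) (fun r => step ((r - s) / e)) (e^-1 * dstep ((r - s) / e)).
Proof.
have d1 : is_derive r (1 : R) (fun r => (r - s) / e) e^-1.
  have -> : (fun r => (r - s) / e) = (e^-1 \*: (id - cst s : R -> R)).
    by apply/funext => x /=; rewrite mulrC.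
  by apply: is_derive_eq; rewrite subr0 /GRing.scale /= mulr1.
have [df Ef] := is_deriveE d1.
have dg : derivable (@step R) ((r - s) / e) 1 by apply: (@Ck_derivable _ _ 0); exact: Ck_step.
by have := is_derive_chain df dg; rewrite Ef.
Qed.

Lemma continuous_dstep : continuous dstep.
Proof. exact: (Ck_continuous (Ck_derive (1 : R) (@Ck_step R 1))). Qed.

Lemma dstep_out x : x < 0 \/ 1 < x -> dstep x = 0.
Proof.
move=> [x0|x1]; rewrite /dstep.
  rewrite -[RHS](derive_cst (0 : R) x (1 : R)); apply: near_eq_derive.
  by near=> y; rewrite /cst step_le0//; near: y; apply: filterS (lt_nbhsl x0) => y; exact: ltW.
rewrite -[RHS](derive_cst (1 : R) x (1 : R)); apply: near_eq_derive.
by near=> y; rewrite /cst step_ge1//; near: y; apply: filterS (lt_nbhsr x1) => y; exact: ltW.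
Unshelve. all: by end_near. Qed.

Lemma dstep_bound : exists2 C, 0 <= C & forall x, `|dstep x| <= C.
Proof.
have [c _ Hc] : exists2 c, c \in `[0, 1]%R & forall t, t \in `[0, 1]%R -> `|dstep t| <= `|dstep c|.
  apply: (@EVT_max R (fun t => `|dstep t|)) => //.
  by apply: continuous_subspaceT => x; apply: continuous_comp; [exact: continuous_dstep|exact: norm_continuous].
exists `|dstep c|; first exact: normr_ge0.
move=> x; have [x0|x0] := ltP x 0; first by rewrite (dstep_out (or_introl x0)) normr0 normr_ge0.
have [x1|x1] := ltP 1 x; first by rewrite (dstep_out (or_intror x1)) normr0 normr_ge0.
by apply: Hc; rewrite in_itv/= x0.
Qed.

Lemma Rint_supported d (T : measurableType d) (mu : {measure set T -> \bar R}) (A B : set T) (g : T -> R) :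
  measurable A -> A `<=` B -> (forall x, B x -> ~ A x -> g x = 0) ->
  \int[mu]_(x in A) g x = \int[mu]_(x in B) g x.
Proof.
move=> mA AB g0; rewrite (@eq_Rint _ _ _ mu B g (g \_ A)).
  by rewrite Rint_restrict setIidr.
move=> x Bx; rewrite patchE; case: ifPn => // xA; apply: g0 => // Ax.
by move: xA; rewrite mem_set.
Qed.

Lemma Rint_cst d (T : measurableType d) (mu : {measure set T -> \bar R}) (A : set T) (c : R) :
  measurable A -> (mu A < +oo)%E -> \int[mu]_(x in A) c = c * fine (mu A).
Proof. by move=> mA fA; rewrite /Rintegral integral_cst//= fineM// ge0_fin_numE. Qed.

(** The derivative of a rescaled step: an approximate identity of mass 1 supported in the interval
    from [s] to [s + e], on the right of [s]. *)
Definition bump1 (s e r : R) : R := e^-1 * dstep ((r - s) / e).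

Lemma continuous_bump1 s e : continuous (bump1 s e).
Proof.
move=> r; apply: cvgMr; apply: continuous_comp; last exact: continuous_dstep.
by apply: cvgMl; apply: cvgB; [exact: cvg_id|exact: cvg_cst].
Qed.

Lemma bump1_out s e r : 0 < e -> r \notin `[s, s + e] -> bump1 s e r = 0.
Proof.
move=> e0; rewrite in_itv/= negb_and -!ltNge => h; rewrite /bump1 dstep_out ?mulr0//.
case/orP: h => h; [left|right].
  by rewrite pmulr_llt0 ?invr_gt0// subr_lt0.
by rewrite ltr_pdivlMr// mul1r ltrBrDl.
Qed.

Lemma bump1_Rint s e : 0 < e -> \int[leb]_(r in `[s, s + e]) bump1 s e r = 1.
Proof.
move=> e0; rewrite /Rintegral (@continuous_FTC2 _ _ (fun r => step ((r - s) / e))).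
- have -> : (s + e - s) / e = 1 by rewrite addrAC subrr add0r divff// gt_eqF.
  have -> : (s - s) / e = 0 by rewrite subrr mul0r.
  by rewrite step_ge1// step_le0// sube0.
- by rewrite ltrDl.
- by apply: continuous_subspaceT; exact: continuous_bump1.
- have cs : continuous (fun r => step ((r - s) / e)).
    move=> r; apply: differentiable_continuous; apply/derivable1_diffP.
    by case: (is_derive_step s e r).
  split; first by move=> r _; case: (is_derive_step s e r).
  + exact/cvg_at_right_filter/cs.
  + exact/cvg_at_left_filter/cs.
- by move=> r _; rewrite derive1E; case: (is_derive_step s e r).
Qed.

Lemma bump1_average (T s : R) (y : R -> R) (a : R) : {within `[0, T], continuous y} ->
  0 < s < T -> 0 < a ->
  exists2 e0, 0 < e0 & forall e, 0 < e < e0 ->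
    `|\int[leb]_(r in `]0, T[) (bump1 s e r * y r) - y s| <= a.
Proof.
move=> cy /andP[s0 sT] a0; have [C C0 HC] := dstep_bound.
have a1 : 0 < a / (C + 1) by rewrite divr_gt0// ltr_wpDl.
have ys : {for s, continuous y}.
  by apply: (within_continuous_continuous (lt_trans s0 sT) cy); rewrite in_itv/= s0.
move/cvgrPdist_le: ys => /(_ _ a1) /nbhs_ballP[d /= d0 Hd].
pose e0 := Num.min d (T - s).
have e00 : 0 < e0 by rewrite lt_min d0 subr_gt0.
exists e0 => // e /andP[ep]; rewrite lt_min => /andP[ed eT].
pose A : set mt := `[s, s + e]%classic.
have mA : measurable A by exact: measurable_itv.
have Afin : leb A = e%:E by rewrite /A lebesgue_measure_itv/= lte_fin ltrDl ep -EFinB addrAC subrr add0r.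
have Al : (leb A < +oo)%E by rewrite Afin ltry.
have AT : A `<=` (`]0, T[%classic : set mt).
  move=> r; rewrite /A /= !in_itv/= => /andP[sr rs]; rewrite (lt_le_trans s0)//=.
  by apply: le_lt_trans rs _; rewrite -ltrBrDl.
rewrite -(@Rint_supported _ _ leb A)//; last first.
  by move=> r _ /negP nA; rewrite bump1_out ?mul0r.
have my : measurable_fun (A : set mt) y.
  have m0 : measurable (`[0, T]%classic : set mt) by exact: measurable_itv.
  apply: (@measurable_funS _ _ _ _ (`[0, T]%classic : set mt)) => //.
    by move=> r /AT; exact: subset_itv_oo_cc.
  exact: subspace_continuous_measurable_fun.
have mb : measurable_fun A (bump1 s e) by apply: measurable_funTS; exact: continuous_measurable_fun (@continuous_bump1 s e).
have ei : 0 <= e^-1 by rewrite invr_ge0 ltW.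
have bb r : `|bump1 s e r| <= e^-1 * C by rewrite normrM (ger0_norm ei) ler_wpM2l.
have yb r : A r -> `|y r - y s| <= a / (C + 1).
  rewrite /A /= in_itv/= => /andP[sr rs]; rewrite distrC; apply: Hd.
  by rewrite /ball /= distrC ger0_norm ?subr_ge0// ltrBlDl (le_lt_trans rs)// ltrD2l.
have ib : intg leb A (bump1 s e).
  by apply: (intg_bounded (M := e^-1 * C) mA Al).
have i1 : intg leb A (fun r => bump1 s e r * (y r - y s)).
  apply: (intg_bounded (M := e^-1 * C * (a / (C + 1))) mA Al).
    by apply: measurable_funM => //; exact: measurable_funB.
  by move=> r Ar; rewrite normrM ler_pM// yb.
have i2 : intg leb A (fun r => bump1 s e r * y s) by exact: intgZr.
have -> : \int[leb]_(r in A) (bump1 s e r * y r) - y s = \int[leb]_(r in A) (bump1 s e r * (y r - y s)).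
  have E : \int[leb]_(r in A) (bump1 s e r * y s) = y s.
    transitivity (\int[leb]_(r in A) (y s * bump1 s e r)); first by apply: eq_Rint => r _; rewrite mulrC.
    by rewrite (Rint_Z mA _ ib) bump1_Rint// mulr1.
  have i3 : intg leb A (fun r => bump1 s e r * y r).
    by apply: (eq_intg mA _ (intgD mA i1 i2)) => r _; rewrite -mulrDr subrK.
  transitivity (\int[leb]_(r in A) (bump1 s e r * y r) - \int[leb]_(r in A) (bump1 s e r * y s)); first by rewrite E.
  apply: etrans (esym (Rint_B mA i3 i2)) _; apply: eq_Rint => r _; exact/esym/mulrBr.
have ic : intg leb A (fun=> e^-1 * C * (a / (C + 1))) by exact: (sqi_intg mA Al (sqi_cst mA _ Al)).
apply: le_trans (norm_Rint_le mA i1 ic _) _.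
  by apply: aeW => r Ar; rewrite normrM ler_pM// yb.
apply: (@le_trans _ _ (e^-1 * C * (a / (C + 1)) * e)).
  by rewrite le_eqVlt; apply/orP; left; apply/eqP; apply: (etrans (Rint_cst _ mA Al)); congr (_ * _); exact: (congr1 fine Afin).
have -> : e^-1 * C * (a / (C + 1)) * e = C * (a / (C + 1)).
  by rewrite -(mulrA e^-1) [LHS]mulrC mulVKf// gt_eqF.
rewrite mulrA ler_pdivrMr ?ltr_wpDl// mulrC ler_wpM2l ?lerDl//; exact: ltW.
Qed.

(** As [e] tends to 0 this converges at every point to the indicator of the half-open interval from
    [s] (excluded) to [t] (included). *)
Definition cutoff (s t e r : R) : R := step ((r - s) / e) - step ((r - t) / e).

Lemma is_derive_cutoff s t e r : is_derive r (1 : R) (cutoff s t e) (bump1 s e r - bump1 t e r).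
Proof. by apply: is_deriveB; exact: is_derive_step. Qed.

Lemma cutoff_testfun (T s t e : R) : 0 < s -> s < t -> 0 < e -> t + e < T ->
  testfun `]0, T[%classic (cutoff s t e).
Proof.
move=> s0 st e0 tT; split.
  have Ca u k : Ck k (fun r : R => step ((r - u) / e)).
    apply: (@Ck_comp _ _ k (fun r : R => (r - u) / e)); last exact: Ck_step.
    have -> : (fun r : R => (r - u) / e) = (fun r => e^-1 * (id r + - u)) by apply/funext => r; rewrite mulrC.
    by apply: CkZ; apply: CkD; [exact: Ck_id|exact: Ck_cst].
  move=> k; apply: CkD; first exact: Ca.
  by apply: CkN; exact: Ca.
exists `[s, t + e]%classic; split; first exact: segment_compact.
  by move=> r /=; rewrite !in_itv/= => /andP[a b]; rewrite (lt_le_trans s0)//= (le_lt_trans b).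
move=> r /negP; rewrite in_itv/= negb_and -!ltNge /cutoff => /orP[rs|tr].
  by rewrite !step_le0 ?subrr// pmulr_lle0 ?invr_gt0// subr_le0 ltW// (lt_trans rs).
rewrite !step_ge1 ?subrr// ler_pdivlMr// mul1r; first by rewrite lerBrDl ltW.
by rewrite lerBrDl ltW// (lt_trans _ tr)// ltrD2r.
Qed.

Lemma cutoff_norm s t e r : `|cutoff s t e r| <= 1.
Proof.
have /andP[a b] := step_itv ((r - s) / e); have /andP[c d] := step_itv ((r - t) / e).
by rewrite ler_norml /cutoff; apply/andP; split; lra.
Qed.

(** Test with [cutoff s t]: its derivative is a difference of two approximate identities, which
    yields [y s - y t] by continuity of [y], while the other side converges by domination. *)
Lemma weak_ftc (T : R) (y k : R -> R) : {within `[0, T], continuous y} ->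
  intg leb (`]0, T[%classic : set mt) k ->
  (forall chi : R -> R, testfun `]0, T[%classic chi ->
    \int[leb]_(t in `]0, T[) ((chi^`())%classic t * y t) = - \int[leb]_(t in `]0, T[) (chi t * k t)) ->
  forall s t, 0 < s -> s < t -> t < T -> y t - y s = \int[leb]_(r in `]s, t]) k r.
Proof.
move=> cy ki H s t s0 st tT.
pose D : set mt := `]0, T[%classic; have mD : measurable D := measurable_oo 0 T.
pose e n : R := (T - t) / 2 / n.+1%:R.
have Tt : 0 < (T - t) / 2 by rewrite divr_gt0// subr_gt0.
have e0 n : 0 < e n by rewrite divr_gt0.
have eT n : t + e n < T.
  rewrite -ltrBrDl; apply: (@le_lt_trans _ _ ((T - t) / 2)); last by lra.
  by rewrite /e ler_pdivrMr// ler_pMr// ler1n.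
have ecvg : e @ \oo --> (0 : R).
  by rewrite -[0](mulr0 ((T - t) / 2)); apply: cvgMr; exact: cvg_harmonic.
have tf n := cutoff_testfun s0 st (e0 n) (eT n).
have iy : intg leb D y.
  have := continuous_compact_integrable (@segment_compact R 0 T) cy.
  by apply: integrableS => //; exact: subset_itv_oo_cc.
have [C C0 HC] := dstep_bound.
have iby u n : intg leb D (fun r => bump1 u (e n) r * y r).
  have ei : 0 <= (e n)^-1 by rewrite invr_ge0 ltW.
  apply: (intg_dom mD _ (intgZ mD ((e n)^-1 * C) (intg_abs iy))).
    apply: measurable_funM; last exact: intg_meas iy.
    by apply: measurable_funTS; exact: continuous_measurable_fun (@continuous_bump1 u (e n)).
  by move=> r _; rewrite normrM ler_wpM2r// normrM (ger0_norm ei) ler_wpM2l.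
have c1 u : 0 < u < T -> (fun n => \int[leb]_(r in D) (bump1 u (e n) r * y r)) @ \oo --> y u.
  move=> uT; apply/cvgrPdist_le => a a0; have [d0 d00 Hd] := bump1_average cy uT a0.
  have : \forall n \near \oo, e n < d0 by apply: (cvgr_lt _ ecvg).
  by apply: filterS => n en; rewrite distrC; apply: Hd; rewrite e0.
have mA : measurable (`]s, t]%classic : set mt) by exact: measurable_itv.
have c2 : (fun n => \int[leb]_(r in D) (cutoff s t (e n) r * k r)) @ \oo -->
    \int[leb]_(r in D) (\1_(`]s, t]%classic : set mt) r * k r).
  have mk := intg_meas ki.
  apply: (@dominated_Rint _ _ _ leb D mD (fun n r => cutoff s t (e n) r * k r)
    (fun r => \1_(`]s, t]%classic : set mt) r * k r) (fun r => `|k r|) _ _ _ (intg_abs ki) _).2.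
  - move=> n; apply: measurable_funM => //; apply: measurable_funTS; apply: continuous_measurable_fun.
    by move=> r; apply: differentiable_continuous; apply/derivable1_diffP; case: (is_derive_cutoff s t (e n) r).
  - by apply: measurable_funM => //; exact: measurable_indic.
  - apply: aeW => r _; apply: cvgMl; apply: cvg_near_cst.
    have far u : u < r -> \forall n \near \oo, 1 <= (r - u) / e n.
      rewrite -subr_gt0 => ur; have : \forall n \near \oo, e n < r - u by apply: (cvgr_lt _ ecvg).
      by apply: filterS => n en; rewrite ler_pdivlMr// mul1r ltW.
    have close u n : r <= u -> step ((r - u) / e n) = 0.
      by move=> ru; rewrite step_le0// pmulr_lle0 ?invr_gt0// subr_le0.
    rewrite indicE; have [rs|sr] := leP r s.
      apply: nearW => n; rewrite /cutoff !close// ?(le_trans rs (ltW st))// subrr memNset//.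
      by rewrite /= in_itv/= ltNge rs.
    have [rt|tr] := leP r t.
      apply: filterS (far s sr) => n h; rewrite /cutoff (close t)// step_ge1// subr0 mem_set//.
      by rewrite /= in_itv/= sr.
    apply: filterS2 (far s sr) (far t tr) => n h h'; rewrite /cutoff !step_ge1// subrr memNset//.
    by rewrite /= in_itv/= sr leNgt tr.
  - by move=> n r _; rewrite normrM ler_piMl// cutoff_norm.
have E n : \int[leb]_(r in D) (bump1 s (e n) r * y r) - \int[leb]_(r in D) (bump1 t (e n) r * y r) =
    - \int[leb]_(r in D) (cutoff s t (e n) r * k r).
  rewrite -(H _ (tf n)); apply: etrans (esym (Rint_B mD (iby s n) (iby t n))) _; apply: eq_Rint => r _.
  by rewrite derive1E (is_deriveE (is_derive_cutoff s t (e n) r)).2 mulrBl.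
have sT : 0 < s < T by rewrite s0 (lt_trans st).
have tT' : 0 < t < T by rewrite tT (lt_trans s0 st).
have h := eq_cvg_unique E (cvgB (c1 s sT) (c1 t tT')) (cvgN c2).
have -> : y t - y s = \int[leb]_(r in D) (\1_(`]s, t]%classic : set mt) r * k r) by rewrite -[RHS]opprK -(h _ _) ?opprB//; exact: filter_filter.
have AD : (`]s, t]%classic : set mt) `<=` D.
  by move=> r; rewrite /D /= !in_itv/= => /andP[sr rt]; rewrite (lt_trans s0 sr)/= (le_lt_trans rt).
rewrite -(@Rint_supported _ _ leb _ D _ mA AD); last first.
  by move=> r _ nA; rewrite indicE memNset ?mul0r.
by apply: eq_Rint => r rA; rewrite indicE mem_set// mul1r.
Qed.

(** Test functions vanish near 0, so the initial time is reached as a limit of interior times, by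
    continuity of [y] at 0 from the right. *)
Lemma weak_ftc0 (T : R) (y k : R -> R) : {within `[0, T], continuous y} ->
  intg leb (`]0, T[%classic : set mt) k ->
  (forall chi : R -> R, testfun `]0, T[%classic chi ->
    \int[leb]_(t in `]0, T[) ((chi^`())%classic t * y t) = - \int[leb]_(t in `]0, T[) (chi t * k t)) ->
  forall s t, 0 <= s -> s < t -> t < T -> y t - y s = \int[leb]_(r in `]s, t]) k r.
Proof.
move=> cy ki H s t; rewrite le_eqVlt => /orP[/eqP <-|]; last by move=> *; exact: (weak_ftc cy ki H).
move=> t0 tT; pose e n : R := t / 2 / n.+1%:R.
have t20 : 0 < t / 2 by rewrite divr_gt0.
have e0 n : 0 < e n by rewrite divr_gt0.
have et n : e n < t.
  apply: (@le_lt_trans _ _ (t / 2)); last by lra.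
  by rewrite /e ler_pdivrMr// ler_pMr// ler1n.
have ecvg : e @ \oo --> (0 : R).
  by rewrite -[0](mulr0 (t / 2)); apply: cvgMr; exact: cvg_harmonic.
have [_ y0 _] := (continuous_within_itvP y (lt_trans t0 tT)).1 cy.
have ye : (fun n => y (e n)) @ \oo --> y 0.
  by have := (cvg_at_rightP y 0 (y 0)).1 y0 e; apply; split.
pose A : set mt := `]0, t]%classic.
have mA : measurable A by exact: measurable_itv.
have kA : intg leb A k.
  apply: integrableS ki => //.
  by move=> r; rewrite /A /= !in_itv/= => /andP[-> rt]; exact: le_lt_trans tT.
have c2 : (fun n => \int[leb]_(r in A) (\1_(`]e n, t]%classic : set mt) r * k r)) @ \oo -->
    \int[leb]_(r in A) k r.
  have mk := intg_meas kA.
  apply: (@dominated_Rint _ _ _ leb A mA (fun n r => \1_(`]e n, t]%classic : set mt) r * k r)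
    k (fun r => `|k r|) _ mk _ (intg_abs kA) _).2.
  - by move=> n; apply: measurable_funM => //; apply: measurable_indic; exact: measurable_itv.
  - apply: aeW => r; rewrite /A /= in_itv/= => /andP[r0 rt]; apply: cvg_near_cst.
    have : \forall n \near \oo, e n < r by apply: (cvgr_lt _ ecvg).
    by apply: filterS => n en; rewrite indicE mem_set ?mul1r//= in_itv/= en.
  - move=> n r _; rewrite normrM ler_piMl//; rewrite indicE.
    by case: (_ \in _); rewrite ?normr1 ?normr0.
have E n : y t - y (e n) = \int[leb]_(r in A) (\1_(`]e n, t]%classic : set mt) r * k r).
  rewrite (weak_ftc cy ki H (e0 n) (et n) tT).
  have mB : measurable (`]e n, t]%classic : set mt) by exact: measurable_itv.
  have BA : (`]e n, t]%classic : set mt) `<=` A.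
    by move=> r; rewrite /A /= !in_itv/= => /andP[er ->]; rewrite (lt_trans (e0 n)).
  rewrite -(@Rint_supported _ _ leb _ A _ mB BA); last first.
    by move=> r _ nB; rewrite indicE memNset ?mul0r.
  by apply: eq_Rint => r rB; rewrite indicE mem_set// mul1r.
have := eq_cvg_unique E (cvgB (cvg_cst (y t)) ye) c2.
by apply; exact: filter_filter.
Qed.

Section dual_space.
Variable X : nspace R.
Hypothesis SX : seminormed X.

Lemma dual0 (l : dual X) : mem_of l -> l 0 = 0.
Proof.
move=> [lin _]; have := lin 1 0 0 (mem0 SX) (mem0 SX).
by rewrite scaler0 addr0 mul1r => /eqP; rewrite -{1}[l 0]addr0 (inj_eq (addrI _)) eq_sym => /eqP.
Qed.

Lemma dual_le (l : dual X) (v : X) : mem_of l -> mem_of v -> `|l v| <= nrm l * nrm v.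
Proof.
move=> ml mv; have l0 := dual0 ml; have [lin [C HC]] := ml.
(* A vector of seminorm 0 cannot be normalised; there the continuity bound of [l] gives the
   claim. *)
have [v0|v0] := eqVneq (nrm v) 0; first by have := HC v mv; rewrite v0 !mulr0.
have vp : 0 < nrm v by rewrite lt_neqAle eq_sym v0 (nrm_pos SX).
rewrite -ler_pdivrMr//; apply: sup_upper_bound.
  split; first by exists `|l 0|; exists 0 => //; split; [exact: (mem0 SX)|rewrite (nrm0 SX)].
  exists `|C| => _ [w [mw w1] <-]; apply: le_trans (HC w mw) _.
  apply: le_trans (ler_norm _) _; rewrite normrM ler_piMr// ger0_norm//; exact: (nrm_pos SX).
exists ((nrm v)^-1 *: v).
  split; first exact: memZ.
  apply: le_trans (nrmZ_le SX _ mv) _; rewrite ger0_norm ?mulVf//.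
  by rewrite invr_ge0 ltW.
have := lin (nrm v)^-1 v 0 mv (mem0 SX); rewrite addr0 l0 addr0 => ->.
by rewrite normrM mulrC (ger0_norm (_ : 0 <= (nrm v)^-1))// invr_ge0 ltW.
Qed.

Lemma dual_memB (l k : dual X) : mem_of l -> mem_of k -> mem_of (l - k).
Proof.
move=> [lin [C HC]] [lin' [C' HC']]; split.
  by move=> a v w mv mw; rewrite /= !fctE lin// lin'//; ring.
exists (C + C') => v mv; rewrite mulrDl; apply: le_trans (ler_normB _ _) _.
by apply: lerD; [exact: HC|exact: HC'].
Qed.

(** Evaluation at [v] is Lipschitz for the dual norm, so [strong_meas_lip] supplies a measurable
    representative; the power [r >= 1] of the norm dominates it up to a constant. *)
Lemma dual_rep (T r : R) (f : R -> dual X) (v : X) : 1 <= r -> Bochner T r%:E f -> mem_of v ->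
  exists2 g, intg leb (`]0, T[%classic : set mt) g &
    {ae leb, forall t, t \in `]0, T[ -> f t v = g t}.
Proof.
move=> r1 [sf [G GL fG]] mv.
have mD : measurable (`]0, T[%classic : set mt) := measurable_oo 0 T.
have [|l k ml mk|g mg fg] := @strong_meas_lip _ T (nrm v) _ f (fun l : dual X => l v) sf.
- by apply: ae_mono fG => t h t0; case: (h t0).
- by rewrite mulrC; exact: (dual_le (dual_memB ml mk) mv).
have [mG iG] := LfunrW mD r1 GL.
exists g => //; apply: (intg_dom_ae mD (g := fun t => nrm v * (1 + `|G t| `^ r))).
- exact: measurable_funTS.
- apply: intgZ => //; apply: intgD => //.
  exact: (sqi_intg mD (finite_oo 0 T) (sqi_cst mD _ (finite_oo 0 T))).
apply: ae_mono (ae_and fG fg) => t [h h'] t0; have [mf nf] := h t0.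
rewrite -(h' t0); apply: le_trans (dual_le mf mv) _; rewrite nf mulrC ler_wpM2l ?(nrm_pos SX)//.
apply: le_trans (ler_norm _) _; have [G1|G1] := leP `|G t| 1; first by rewrite ler_wpDr// powR_ge0.
by rewrite ler_wpDl//; apply: le_trans (ler_powR (ltW G1) r1); rewrite powRr1.
Qed.

(** The form in which the weak equations are used: increments against one fixed test function. *)
Lemma weak_increment (T r : R) (ip : X -> X -> R) (f : R -> X) (f' : R -> dual X) (v : X) :
  1 <= r -> Bochner T r%:E f' -> time_derivative T ip f f' -> mem_of v ->
  {within `[0, T], continuous (fun t => ip (f t) v)} ->
  exists g, [/\ intg leb (`]0, T[%classic : set mt) g,
    {ae leb, forall t, t \in `]0, T[ -> f' t v = g t} &
    forall s t, 0 <= s -> s < t -> t < T ->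
      ip (f t) v - ip (f s) v = \int[leb]_(r in `]s, t]) g r].
Proof.
move=> r1 Bf' td mv cy; have [g gi fg] := dual_rep r1 Bf' mv.
exists g; split=> //; apply: (weak_ftc0 cy gi) => chi tc; rewrite (td v mv chi tc).
by congr (- _); apply: eq_Rintegral_ae; apply: ae_mono fg => t h t0; rewrite (h t0).
Qed.
End dual_space.

End weak_time_derivative.

(** * From a one-step estimate to the energy inequality *)

Section energy_scheme.
Context {R : realType}.
Notation leb := (@lebesgue_measure R).
Notation mt := (measurableTypeR R).

Lemma measurable_oc (s t : R) : measurable (`]s, t]%classic : set mt).
Proof. exact: measurable_itv. Qed.

Lemma lebesgue_oc (s t : R) : s <= t -> leb (`]s, t]%classic : set mt) = (t - s)%:E.
Proof.
move=> st; rewrite lebesgue_measure_itv/= lte_fin; case: ltP => // ts.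
by have -> : s = t; [apply/eqP; rewrite eq_le st|rewrite subrr].
Qed.

Lemma intg_oc (T s t : R) (f : R -> R) : intg leb (`]0, T[%classic : set mt) f -> 0 <= s -> t < T ->
  intg leb (`]s, t]%classic : set mt) f.
Proof.
move=> fi s0 tT; apply: integrableS fi => //.
by move=> r /=; rewrite !in_itv/= => /andP[sr rt]; rewrite (le_lt_trans s0 sr) (le_lt_trans rt).
Qed.

Lemma Rint_ocD (T s t u : R) (f : R -> R) : intg leb (`]0, T[%classic : set mt) f ->
  0 <= s -> s <= t -> t <= u -> u < T ->
  \int[leb]_(r in `]s, u]) f r = \int[leb]_(r in `]s, t]) f r + \int[leb]_(r in `]t, u]) f r.
Proof.
move=> fi s0 st tu uT; have := @Rintegral_itvB R f (BRight s) (BRight u) t (intg_oc fi s0 uT).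
by rewrite !bnd_simp => /(_ st tu) <-; rewrite subrKC.
Qed.

(** If almost every point of the cell violated the last inequality, the integral of [g] would be at
    least itself plus [k]. *)
Lemma cell_point (T s t k : R) (g : R -> R) (P : R -> Prop) :
  intg leb (`]0, T[%classic : set mt) g ->
  {ae leb, forall r, r \in `]0, T[ -> P r} -> 0 <= s -> s < t -> t < T -> 0 < k ->
  exists r, [/\ s < r, r <= t, P r & (t - s) * g r <= \int[leb]_(r in `]s, t]) g r + k].
Proof.
move=> gi aeP s0 st tT k0; apply: contrapT => H.
have mA := measurable_oc s t; have gA := intg_oc gi s0 tT.
have Afin : (leb (`]s, t]%classic : set mt) < +oo)%E by rewrite lebesgue_oc ?ltW// ltry.
pose m := (\int[leb]_(r in `]s, t]) g r + k) / (t - s).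
have ic : intg leb (`]s, t]%classic : set mt) (fun=> m) by exact: (sqi_intg mA Afin (sqi_cst mA _ Afin)).
have : \int[leb]_(r in `]s, t]) m <= \int[leb]_(r in `]s, t]) g r.
  apply: (le_Rint_ae mA ic gA); apply: ae_mono aeP => r Pr; rewrite /= in_itv/= => /andP[sr rt].
  rewrite leNgt; apply/negP => gm; apply: H; exists r; split=> //.
    by apply: Pr; rewrite in_itv/= (le_lt_trans s0)//= (le_lt_trans rt).
  by move: gm; rewrite /m ltr_pdivlMr ?subr_gt0// mulrC; exact: ltW.
rewrite (Rint_cst _ mA Afin) (congr1 fine (lebesgue_oc (ltW st))) /= /m divfK ?gt_eqF ?subr_gt0//.
by rewrite leNgt ltrDl k0.
Qed.

(* The step from s to t costs (t - s) * g t, with g taken at the right endpoint only.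
   Picking each partition point where g is at most about its mean over the cell makes
   these costs add up to at most about the integral of g. *)
Lemma energy_scheme (T : R) (E : R -> R) (ok P : R -> Prop) (d : R -> R) :
  intg leb (`]0, T[%classic : set mt) d ->
  {ae leb, forall t, t \in `]0, T[ -> P t} ->
  (forall e, 0 < e -> exists eta (b g : R -> R) (Q : R -> Prop),
    [/\ 0 < eta, intg leb (`]0, T[%classic : set mt) b /\ intg leb (`]0, T[%classic : set mt) g,
    (forall t, 0 <= b t) /\ (forall t, 0 <= g t),
    \int[leb]_(t in `]0, T[) b t <= e /\ \int[leb]_(t in `]0, T[) g t <= e &
    {ae leb, forall t, t \in `]0, T[ -> Q t} /\
    forall s t, 0 <= s -> s < t -> t < T -> t - s < eta -> ok s -> Q t -> ok t /\
      E t - E s <= (- (\int[leb]_(r in `]s, t]) d r)) + \int[leb]_(r in `]s, t]) b r + (t - s) * g t]) ->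
  forall t1 t2 th, 0 <= t1 -> t1 < t2 -> t2 < T -> 0 < th -> ok t1 ->
  exists t, [/\ t1 < t, t2 - th < t <= t2, ok t, P t & E t <= E t1 - (\int[leb]_(r in `]t1, t]) d r) + th].
Proof.
move=> di aeP H t1 t2 th t10 t12 t2T th0 ok1.
(* The total error is [th / 6] from [b], twice [th / 6] from [g] and [th / 3] from the slacks [k],
   hence less than [th]. *)
have [eta [b [g [Q [eta0 [bi gi] [b0 g0] [bE gE] [aeQ Hs]]]]]] := H (th / 6) (divr_gt0 th0 (ltr0Sn R 5)).
have t21 : 0 < t2 - t1 by rewrite subr_gt0.
pose mn := Num.min (eta / 2) th.
have mn0 : 0 < mn by rewrite lt_min divr_gt0.
have [N HN] : exists N : nat, (t2 - t1) / N.+1%:R < mn.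
  exists (Num.truncn ((t2 - t1) / mn)); rewrite ltr_pdivrMr// mulrC -ltr_pdivrMr//.
  exact: truncnS_gt.
(* The mesh: points chosen in consecutive cells are at most [h + h] apart, which has to stay below
   [eta]; [h < th] puts the last point within [th] of [t2]. *)
pose h := (t2 - t1) / N.+1%:R; have h0 : 0 < h by rewrite divr_gt0.
have h2 : h + h < eta.
  by move: HN; rewrite -/h lt_min => /andP[a _]; move: a; lra.
have hth : h < th by move: HN; rewrite -/h lt_min => /andP[_].
pose k := th / 6 / N.+1%:R; have k0 : 0 < k by rewrite !divr_gt0.
pose c (i : nat) := t1 + i%:R * h.
have cS i : c i.+1 = c i + h by rewrite /c -natr1 mulrDl mul1r addrA.
have cN : c N.+1 = t2 by rewrite /c /h mulrC divfK// addrC subrK.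
have cmono i j : (i <= j)%N -> c i <= c j by move=> ij; rewrite /c lerD2l ler_wpM2r ?ler_nat// ltW.
have c0 i : t1 <= c i by rewrite /c lerDl mulr_ge0// ltW.
have aePQ := ae_and aeP aeQ.
have PQ : {ae leb, forall t, t \in `]0, T[ -> P t /\ Q t}.
  by apply: ae_mono aePQ => t [h1 h3] t0; split; [exact: h1|exact: h3].
(* The point of cell [i] is admissible for the next step. The factor 2 reflects that a step may have
   twice the length of a cell. *)
have claim i : (i <= N)%N -> exists t, [/\ c i < t, t <= c i.+1, ok t, P t &
    E t <= E t1 - (\int[leb]_(r in `]t1, t]) d r) + \int[leb]_(r in `]t1, t]) b r
      + 2 * \int[leb]_(r in `]t1, c i.+1]) g r + 2 * (i.+1%:R * k)].
  have step s i' t : (i' <= N)%N -> t1 <= s -> s <= c i' -> c i' < t -> t <= c i'.+1 ->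
      c i' - s <= h ->
      ok s -> Q t -> (c i'.+1 - c i') * g t <= \int[leb]_(r in `]c i', c i'.+1]) g r + k ->
      ok t /\ E t - E s <= (- (\int[leb]_(r in `]s, t]) d r)) + \int[leb]_(r in `]s, t]) b r
        + 2 * (\int[leb]_(r in `]c i', c i'.+1]) g r + k).
    move=> iN s1 sc ct tc cs oks Qt gt.
    have tT : t < T by apply: le_lt_trans tc _; apply: le_lt_trans t2T; rewrite -cN; exact: cmono.
    have st := le_lt_trans sc ct; have ts : t - s <= h + h.
      by move: tc cs; rewrite cS; lra.
    have [okt Et] := Hs s t (le_trans t10 s1) st tT (le_lt_trans ts h2) oks Qt.
    split=> //; apply: le_trans Et _; rewrite lerD2l.
    apply: (@le_trans _ _ (2 * ((c i'.+1 - c i') * g t))); last by rewrite ler_pM2l.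
    by rewrite mulrA ler_wpM2r// cS addrAC subrr add0r; move: ts; lra.
  have pt i' : (i' <= N)%N -> exists r, [/\ c i' < r, r <= c i'.+1, P r /\ Q r &
      (c i'.+1 - c i') * g r <= \int[leb]_(r in `]c i', c i'.+1]) g r + k].
    move=> iN; apply: (cell_point gi PQ) => //; first exact: le_trans (c0 _).
      by rewrite cS ltrDl.
    by apply: le_lt_trans t2T; rewrite -cN; exact: cmono.
  elim: i => [|i IH] iN.
    have [t [ct tc [Pt Qt] gt]] := pt 0 isT.
    have cE : c 0 = t1 by rewrite /c mul0r addr0.
    have sc0 : t1 <= c 0 by rewrite cE.
    have z : c 0 - t1 <= h by rewrite cE subrr ltW.
    have [okt Et] := step t1 0 t isT (lexx _) sc0 ct tc z ok1 Qt gt.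
    exists t; split=> //; move: Et; rewrite cE.
    move: (\int[leb]_(r in _) d r) (\int[leb]_(r in _) b r) (\int[leb]_(r in `]t1, _]) g r) => *; lra.
  have [s [cs sc oks Ps Es]] := IH (ltnW iN).
  have [t [ct tc [Pt Qt] gt]] := pt i.+1 iN.
  have s1 : t1 <= s by apply: le_trans (c0 i) _; exact: ltW.
  have cs' : c i.+1 - s <= h by move: cs; rewrite cS; lra.
  have [okt Et] := step s i.+1 t iN s1 sc ct tc cs' oks Qt gt.
  exists t; split=> //.
  have st : s <= t by apply: ltW; exact: le_lt_trans ct.
  have cT j : (j <= N.+1)%N -> c j < T by move=> jN; apply: le_lt_trans t2T; rewrite -cN; exact: cmono.
  have tT : t < T by apply: le_lt_trans tc (cT _ _).
  rewrite (Rint_ocD di t10 s1 st tT) (Rint_ocD bi t10 s1 st tT).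
  rewrite (Rint_ocD gi t10 (c0 i.+1) (cmono i.+1 i.+2 (leqnSn _)) (cT i.+2 iN)).
  move: Es Et; rewrite -(natr1 i.+1); move: (E t) (E s) (E t1) (\int[leb]_(r in `]t1, s]) d r) (\int[leb]_(r in `]s, t]) d r)
   (\int[leb]_(r in `]t1, s]) b r) (\int[leb]_(r in `]s, t]) b r)
   (\int[leb]_(r in `]t1, c i.+1]) g r) (\int[leb]_(r in `]c i.+1, c i.+2]) g r) => *; lra.
have [t [ct tc okt Pt Et]] := claim N (leqnn N).
have tT : t < T by apply: le_lt_trans tc _; rewrite cN.
have tt1 : t1 < t by apply: le_lt_trans ct.
exists t; split=> //.
  by rewrite -{2}cN tc andbT; apply: lt_trans ct; move: hth; rewrite -cN cS; lra.
have sub (f : R -> R) u : (forall r, 0 <= f r) -> intg leb (`]0, T[%classic : set mt) f ->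
    u < T -> \int[leb]_(r in `]t1, u]) f r <= \int[leb]_(r in `]0, T[) f r.
  move=> f0 fi uT; have AB : (`]t1, u]%classic : set mt) `<=` `]0, T[%classic.
    by move=> r /=; rewrite !in_itv/= => /andP[a b']; rewrite (le_lt_trans t10 a) (le_lt_trans b').
  rewrite -[leLHS](_ : \int[leb]_(r in (`]0, T[%classic : set mt)) (f \_ `]t1, u]%classic) r = _); last first.
    by rewrite Rint_restrict setIidr.
  have mD := measurable_oo 0 T.
  apply: (le_Rint mD) => //.
    by apply: intg_restrict => //; rewrite setIidr//; exact: intg_oc fi t10 uT.
  by move=> r _; rewrite patchE; case: ifP.
have h1 := sub b t b0 bi tT; have h3 := sub g (c N.+1) g0 gi; rewrite cN in h3; have {}h3 := h3 t2T.
have h4 : 2 * (N.+1%:R * k) = th / 3 by rewrite /k [_ * (_ / _)]mulrC divfK//; lra.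
apply: le_trans Et _; rewrite cN h4.
move: h1 bE h3 gE; move: (\int[leb]_(r in `]t1, t]) b r) (\int[leb]_(r in `]0, T[) b r)
 (\int[leb]_(r in `]t1, t2]) g r) (\int[leb]_(r in `]0, T[) g r) (\int[leb]_(r in `]t1, t]) d r) => *; lra.
Qed.

Lemma Rint_oc_lower (T s t c : R) (d : R -> R) : intg leb (`]0, T[%classic : set mt) d ->
  0 <= s -> s <= t -> t < T -> {ae leb, forall r, r \in `]s, t] -> c <= d r} ->
  c * (t - s) <= \int[leb]_(r in `]s, t]) d r.
Proof.
move=> di s0 st tT cd; have mA := measurable_oc s t.
have Afin : (leb (`]s, t]%classic : set mt) < +oo)%E by rewrite lebesgue_oc// ltry.
have <- : \int[leb]_(r in `]s, t]) c = c * (t - s).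
  by rewrite (Rint_cst _ mA Afin) (congr1 fine (lebesgue_oc st)).
apply: (le_Rint_ae mA _ (intg_oc di s0 tT)) => //.
exact: (sqi_intg mA Afin (sqi_cst mA _ Afin)).
Qed.

(* Above the level (C + 1) / k the energy decreases at rate at least 1. *)
Lemma dissipation_bound (T k C C1 : R) (E : R -> R) (ok : R -> Prop) (d : R -> R) :
  0 < k -> intg leb (`]0, T[%classic : set mt) d ->
  (forall t1 t2, 0 <= t1 -> t1 < t2 -> t2 < T -> ok t1 ->
    ok t2 /\ E t2 <= E t1 - (\int[leb]_(r in `]t1, t2]) d r)) ->
  {ae leb, forall t, t \in `]0, T[ -> k * E t - C <= d t /\ - C1 <= d t} ->
  ok 0 -> forall t, 0 < t -> t < T -> E 0 - t <= (C + 1) / k -> E t <= (C + 1) / k.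
Proof.
move=> k0 di H aed ok0 t2 t20 t2T; set K := (C + 1) / k => Et.
have C10 : 0 <= `|C1| by [].
have kd r : K < E r -> k * E r - C <= d r -> 1 <= d r.
  by rewrite /K ltr_pdivrMr// mulrC => h1 h2; lra.
have okr r : 0 <= r -> r < T -> ok r.
  by rewrite le_eqVlt => /orP[/eqP <-//|r0] rT; have [] := H 0 r (lexx _) r0 rT ok0.
have inT r s : 0 <= s -> r \in `]s, t2] -> r \in `]0, T[.
  by move=> s0; rewrite !in_itv/= => /andP[sr rt]; rewrite (le_lt_trans s0 sr) (le_lt_trans rt).
rewrite leNgt; apply/negP => KE.
(* If [S] is empty, the energy decreases at rate at least 1 on the whole interval; otherwise it does
   so after the supremum of [S]. *)
pose S : set R := [set t | [/\ 0 <= t, t <= t2 & E t <= K]].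
have [S0|S0] := pselect (S !=set0); last first.
  have := (H 0 t2 (lexx _) t20 t2T ok0).2.
  have : 1 * (t2 - 0) <= \int[leb]_(r in `]0, t2]) d r.
    apply: (Rint_oc_lower di) => //; first exact: ltW.
    apply: ae_mono aed => r hr rt; have [h1 h2] := hr (inT _ _ (lexx _) rt).
    apply: kd h1; rewrite ltNge; apply/negP => rK; apply: S0; exists r.
    by move: rt; rewrite in_itv/= => /andP[r0 rt]; split=> //; exact: ltW.
  by move: Et KE; lra.
have hS : has_sup S by split=> //; exists t2 => r [].
have st2 : sup S <= t2 by apply: ge_sup => // r [].
suff : E t2 <= K by rewrite leNgt KE.
apply/ler_addgt0Pr => a a0.
have aC : 0 < a / (`|C1| + 1) by rewrite divr_gt0// ltr_wpDl.
(* [E] need not be continuous, so its value at [sup S] is unknown. A slightly earlier time of [S] is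
   used, and the lower bound on [d] limits the possible gain in between to [a]. *)
have [t [t0 tt2 tK] ts] := sup_adherent aC hS.
have tsup : t <= sup S by apply: sup_upper_bound.
have {}tt2 : t < t2.
  by rewrite lt_neqAle tt2 andbT; apply/eqP => E'; move: KE; rewrite ltNge -E' tK.
have tT := lt_trans tt2 t2T.
have h0 := (H t t2 t0 tt2 t2T (okr t t0 tT)).2.
rewrite (Rint_ocD di t0 tsup st2 t2T) in h0.
have h1 : - `|C1| * (sup S - t) <= \int[leb]_(r in `]t, sup S]) d r.
  apply: (Rint_oc_lower di) => //; first exact: le_lt_trans t2T.
  apply: ae_mono aed => r hr rt; have [|_ h2] := hr.
    by apply: (inT r t) => //; move: rt; rewrite !in_itv/= => /andP[-> rt]; exact: le_trans st2.
  by apply: le_trans h2; rewrite lerN2 ler_norm.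
have h2 : 1 * (t2 - sup S) <= \int[leb]_(r in `]sup S, t2]) d r.
  apply: (Rint_oc_lower di) => //; first exact: le_trans tsup.
  apply: ae_mono aed => r hr rt; have [h1' _] := hr (inT _ _ (le_trans t0 tsup) rt).
  apply: kd h1'; rewrite ltNge; apply/negP => rK.
  move: rt; rewrite in_itv/= => /andP[r0 rt].
  suff : r <= sup S by rewrite leNgt r0.
  by apply: sup_upper_bound => //; split=> //; apply: le_trans (le_trans t0 tsup) (ltW r0).
have h3 : `|C1| * (sup S - t) <= a.
  have h4 : sup S - t <= a / (`|C1| + 1) by rewrite lerBlDr -lerBlDl; exact: ltW.
  apply: le_trans (ler_wpM2l C10 h4) _.
  by rewrite mulrA ler_pdivrMr ?ltr_wpDl// mulrC ler_wpM2l ?lerDl// ltW.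
move: h0 h1 h2 h3 st2 tK; move: (\int[leb]_(r in `]t, _]) d r) (\int[leb]_(r in `]_, t2]) d r) => *; lra.
Qed.

End energy_scheme.

Lemma coefficient_bound (R : realFieldType) (n L K C V M : R) :
  0 <= n -> 0 <= L -> 0 <= K -> 0 <= C -> 0 <= V -> 0 <= M ->
  (8 * n + 8 * L) * V + 2 * K * M + C <= (8 * n + 8 * L + 4 * K + C + 2) * (1 + V + M) /\
  2 * (M + K * V) <= (8 * n + 8 * L + 4 * K + C + 2) * (1 + V + M).
Proof.
move=> n0 L0 K0 C0 V0 M0.
have a1 := mulr_ge0 n0 V0; have a2 := mulr_ge0 L0 V0; have a3 := mulr_ge0 K0 M0.
have a4 := mulr_ge0 C0 V0; have a5 := mulr_ge0 C0 M0; have a6 := mulr_ge0 n0 M0.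
have a7 := mulr_ge0 L0 M0; have a8 := mulr_ge0 K0 V0; split; lra.
Qed.

Lemma forms_algebra (R : realFieldType) (a b c d e f w g k x y z t : R) :
  b = - a + c -> d = - e + f -> b <= k * w -> d <= k * g ->
  a + e <= - x + y - z -> y <= 2^-1 * x + t -> 0 <= z ->
  c + f <= - (2^-1 * (x + z) - t) + k * (w + g).
Proof. rewrite mulrDr; lra. Qed.

(** * The two equations as linear forms at a fixed time *)

Section fixed_time_forms.
Context {R : realType}.
Notation pt := (R * R)%type.
Notation mpt := (measurableTypeR R * measurableTypeR R)%type.
Notation mu2 := (@mu2 R).
Notation vfield := (@vfield R).
Variable D : set pt.
Hypothesis oD : open D.
Hypothesis Dfin : (mu2 D < +oo)%E.
Let mD : measurable (D : set mpt). Proof. exact: open_measurable2. Qed.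
Notation vmem u := (@mem_of _ (Vdiv D) u).
Notation vnorm := (vnorm D).
Variables (nu : R -> R) (nu1 nu2 : R).
Hypotheses (cnu : continuous nu) (nu10 : 0 < nu1) (nub : forall s, nu1 <= nu s <= nu2).
Variables (h : vfield -> R) (Ch L K : R).
Hypothesis hlin : forall a v w, vmem v -> vmem w -> h (a *: v + w : vfield) = a * h v + h w.
Hypothesis hb : forall v, vmem v -> `|h v| <= Ch * vnorm v.
Variables (u : vfield) (phi mu : pt -> R).
Hypotheses (uV : vmem u) (muH : inH1 D mu) (phis : sqi mu2 D phi).
Hypothesis uL : forall i, n2 mu2 D (u i) <= L.
Hypotheses (K0 : 0 <= K) (Ch0 : 0 <= Ch).
Hypothesis phiK : forall f, H10 D f -> sqi mu2 D (fun x => f x * phi x) /\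
  n2 mu2 D (fun x => f x * phi x) <= K * gradnorm D f.

(** The value that the momentum equation prescribes for the pairing of the time derivative of [u]
    with [v]; [mass] plays this part for the phase equation. *)
Definition momentum (v : vfield) : R :=
  - viscous D nu phi u v - trilinear D u u v - ip_fgrad D v phi mu + h v.
Definition mass (psi : pt -> R) : R := - ip_grad D mu psi + ip_fgrad D u phi psi.

Let S i j : mpt -> R := stress (fun x : mpt => nu (phi x)) (jac D u) i j.
Let N (i j : 'I_2) : mpt -> R := fun x => u j x * u i x.
Let Q (v : vfield) (i : 'I_2) : mpt -> R := fun x => v i x * phi x.
Let V := vnorm u.
Let M := gradnorm D mu.

Let Ss i j : sqi mu2 D (S i j).
Proof. exact: (visc_stress_sqi oD cnu nu10 nub phis.1 i j uV). Qed.

Let Ns i j : sqi mu2 D (N i j).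
Proof. exact: (H10_mul oD Dfin (uV.1 j) (uV.1 i)).1. Qed.

Let Qs v i : vmem v -> sqi mu2 D (Q v i).
Proof. by move=> vV; exact: (phiK (vV.1 i)).1. Qed.

Let QK v i : vmem v -> n2 mu2 D (Q v i) <= K * vnorm v.
Proof.
move=> vV; apply: le_trans (phiK (vV.1 i)).2 _.
by apply: ler_wpM2l => //; exact: (gradnorm_le_vnorm oD).
Qed.

Let triE v : vmem v -> trilinear D u u v = - flux D N v.
Proof.
move=> vV; rewrite (trilinear_anti oD Dfin uV uV vV) (trilinearE oD Dfin uV vV uV).
by [].
Qed.

Let momentumE v : vmem v ->
  momentum v = - flux D S v + flux D N v - vflux D (Q v) mu + h v.
Proof.
move=> vV; rewrite /momentum (viscousE oD cnu nu10 nub phis.1 uV vV) (triE vV).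
by rewrite (ip_fgradE oD (fun i => @Qs v i vV) muH) opprK.
Qed.

Lemma momentum_lin a v w : vmem v -> vmem w ->
  momentum (a *: v + w : vfield) = a * momentum v + momentum w.
Proof.
move=> vV wV; have avw := vmem_lin oD a vV wV.
have E := ip_fgrad_linl oD a (fun i => @Qs v i vV) (fun i => @Qs w i wV) muH.
have F0 := flux_lin oD a Ss vV wV; have F1 := flux_lin oD a Ns vV wV.
rewrite /momentum (viscousE oD cnu nu10 nub phis.1 uV avw) (triE avw) E hlin//.
rewrite (viscousE oD cnu nu10 nub phis.1 uV vV) (triE vV).
rewrite (viscousE oD cnu nu10 nub phis.1 uV wV) (triE wV).
apply: (etrans (congr2 (fun x y => - x - - y - _ + _) F0 F1)).
move: (flux D _ v) (flux D _ w) (flux D N v) (flux D N w) (ip_fgrad _ v _ _) (ip_fgrad _ w _ _) (h v) (h w).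
by move=> *; ring.
Qed.

Lemma momentum_bound v : vmem v ->
  `|momentum v| <= ((8 * nu2 + 8 * L) * V + 2 * K * M + Ch) * vnorm v.
Proof.
move=> vV; rewrite (momentumE vV).
have b1 := flux_bound oD Ss (fun i j => visc_stress_le oD cnu nu10 nub phis.1 i j uV) vV.
have b2 := flux_bound oD Ns (fun i j => vmem_mul_le oD Dfin i j uV uL) vV.
have b3 := vflux_bound oD (fun i => @Qs v i vV) (fun i => @QK v i vV) muH.
have b4 := hb vV; move: b1 b2 b3 b4; rewrite -/V -/M.
rewrite -/(flux D S v).
move: (flux D _ v) (flux D N v) (vflux D (Q v) mu) (h v) (vnorm v) => a b c e x b1 b2 b3 b4.
have t1 := ler_normD (- a + b - c) e; have t2 := ler_normB (- a + b) c; have t3 := ler_normD (- a) b.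
rewrite normrN in t3; lra.
Qed.

Let Ps i : sqi mu2 D (wD D i mu). Proof. exact: (inH1_wD oD i muH).2. Qed.

Let massE psi : inH1 D psi -> mass psi = - vflux D (fun i => wD D i mu) psi + vflux D (Q u) psi.
Proof.
move=> pH; rewrite /mass (ip_fgradE oD (fun i => @Qs u i uV) pH).
by rewrite (ip_gradE oD muH pH).
Qed.

Lemma mass_lin a f g : inH1 D f -> inH1 D g ->
  mass (fun x => a * f x + g x) = a * mass f + mass g.
Proof.
move=> fH gH; rewrite (massE (inH1_lin oD a fH gH).1) (massE fH) (massE gH).
have F0 := vflux_lin oD a Ps fH gH; have F1 := vflux_lin oD a (fun i => @Qs u i uV) fH gH.
apply: (etrans (congr2 (fun x y => - x + y) F0 F1)).
by move: (vflux D _ f) (vflux D _ g) (vflux D (Q u) f) (vflux D (Q u) g) => *; ring.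
Qed.

Lemma mass_bound psi : inH1 D psi -> `|mass psi| <= 2 * (M + K * V) * gradnorm D psi.
Proof.
move=> pH; rewrite (massE pH).
have b1 := vflux_bound oD Ps (fun i => wD_le_gradnorm D mu i) pH.
have b2 := vflux_bound oD (fun i => @Qs u i uV) (fun i => @QK u i uV) pH.
apply: le_trans (ler_normD _ _) _; rewrite normrN mulrDr mulrDl; apply: lerD => //.
Qed.

Lemma energy_identity : momentum u + mass mu <= - nu1 * V ^+ 2 + Ch * V - M ^+ 2.
Proof.
rewrite /momentum /mass (trilinear_zero oD Dfin uV uV) (ip_grad_self oD muH).
have := korn oD Dfin cnu nu10 nub phis.1 uV; have := le_trans (ler_norm _) (hb uV).
rewrite -/V -/M; move: (viscous _ _ _ _ _) (ip_fgrad _ _ _ _) (h u) => *; lra.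
Qed.

(** Linearity splits off the values at [u] and [mu], where [energy_identity] applies, and the norms
    of the forms bound the rest. Half of the viscous dissipation pays for [h] by Young's inequality,
    which is where [Ch ^+ 2 / (2 * nu1)] comes from. *)
Lemma forms_bound v psi : vmem v -> inH1 D psi ->
  momentum v + mass psi <= - (2^-1 * (nu1 * V ^+ 2 + M ^+ 2) - Ch ^+ 2 / (2 * nu1)) +
    (8 * nu2 + 8 * L + 4 * K + Ch + 2) * (1 + V + M) *
      (vnorm (v - u : vfield) + gradnorm D (fun x => psi x - mu x)).
Proof.
move=> vV pH.
have wV := vmem_lin oD (-1) uV vV; have qH := (inH1_lin oD (-1) muH pH).1.
have Ev : -1 *: u + v = v - u :> vfield by rewrite scaleN1r addrC.
have Eq : (fun x => -1 * mu x + psi x) = (fun x => psi x - mu x).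
  by apply/funext => x; rewrite mulN1r addrC.
have l1 := momentum_lin (-1) uV vV; have l2 := mass_lin (-1) muH pH.
have b1 := momentum_bound wV; have b2 := mass_bound qH.
rewrite Ev in l1 b1; rewrite Eq in l2 b2.
have e := energy_identity.
have V0 : 0 <= V := vnorm_ge0 _ _; have M0 : 0 <= M := gradnorm_ge0 _ _.
have L0 : 0 <= L := le_trans (n2_ge0 _ _ _) (uL ord0).
have n20 : 0 <= nu2 by have /andP[h1 h2] := nub 0; apply: le_trans h2; exact: le_trans (ltW nu10) h1.
have W0 := vnorm_ge0 D (v - u : vfield); have G0 := gradnorm_ge0 D (fun x => psi x - mu x).
have y : Ch * V <= 2^-1 * nu1 * V ^+ 2 + Ch ^+ 2 / (2 * nu1).
  rewrite -subr_ge0 (_ : _ - _ = (nu1 * V - Ch) ^+ 2 / (2 * nu1)); last by field; rewrite gt_eqF.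
  by rewrite divr_ge0 ?sqr_ge0// mulr_ge0// ltW.
have [p1 p2] := coefficient_bound n20 L0 K0 Ch0 V0 M0.
have {}b1 := le_trans (ler_norm _) (le_trans b1 (ler_wpM2r W0 p1)).
have {}b2 := le_trans (ler_norm _) (le_trans b2 (ler_wpM2r G0 p2)).
rewrite mulN1r in l1; rewrite mulN1r in l2; rewrite mulNr in e; rewrite -mulrA in y.
exact: (forms_algebra l1 l2 b1 b2 e y (sqr_ge0 M)).
Qed.

End fixed_time_forms.

(** * The energy functional *)

Section potential.
Context {R : realType}.

(** The second derivative is bounded below only between the two points: in [pot_growth] a large
    lower bound holds on half-lines, away from 0. *)
Lemma convex_bound_seg (H H1 H2 : R -> R) (c s0 s1 : R) :
  (forall s : R, is_derive s (1 : R) H (H1 s)) ->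
  (forall s : R, is_derive s (1 : R) H1 (H2 s)) ->
  (forall s, (s0 <= s <= s1) \/ (s1 <= s <= s0) -> c <= H2 s) ->
  H s0 + H1 s0 * (s1 - s0) + c / 2 * (s1 - s0) ^+ 2 <= H s1.
Proof.
move=> dH dH1 cH.
have d2 (s : R) : is_derive s (1 : R) (fun s => H s - c / 2 * s ^+ 2) (H1 s - c * s).
  have := is_deriveB (dH s) (is_deriveZ (c / 2) (is_derive_pow 2 s)).
  by rewrite /GRing.scale/= (_ : c / 2 * (2 * s ^+ 1) = c * s)//; field.
have d1 (s : R) : is_derive s (1 : R) (fun s => H1 s - c * s) (H2 s - c).
  have := is_deriveB (dH1 s) (is_deriveZ c (is_derive_id s (1 : R))).
  by rewrite /GRing.scale/= mulr1.
have [t ht Et] := mvt_sign s0 s1 d2; have [t' ht' Et'] := mvt_sign s0 t d1.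
have ct : c <= H2 t'.
  by apply: cH; case: ht => /andP[a b]; case: ht' => /andP[a' b'];
    [left|left|right|right]; apply/andP; split; lra.
have sgn : 0 <= (t - s0) * (s1 - s0).
  case: ht => /andP[a b]; first by rewrite mulr_ge0 ?subr_ge0// (le_trans a).
  by rewrite mulr_le0 ?subr_le0// (le_trans a).
rewrite -subr_ge0 in ct; have := mulr_ge0 ct sgn; rewrite mulrA -Et' mulrBl -Et.
move: (H s0) (H s1) (H1 s0) => a b e; rewrite !expr2; lra.
Qed.

Lemma continuous_bounded (f : R -> R) (N : R) : continuous f ->
  exists2 M, 0 <= M & forall s, `|s| <= N -> `|f s| <= M.
Proof.
move=> cf; have [N0|N0] := ltP N 0.
  by exists 0 => // s sN; have := le_lt_trans (le_trans (normr_ge0 s) sN) N0; rewrite ltxx.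
have [||c _ Hc] := @EVT_max R (fun t => `|f t|) (- N) N.
- by lra.
- by apply: continuous_subspaceT => x; apply: continuous_comp; [exact: cf|exact: norm_continuous].
exists `|f c|; first exact: normr_ge0.
by move=> s sN; apply: Hc; rewrite in_itv/= -ler_norml.
Qed.

Variable F : R -> R.
Hypothesis CF : Ck 2 F.
Let F1 := (F^`())%classic.
Let F2 := (F^`(2))%classic.

Let dF s : is_derive s (1 : R) F (F1 s).
Proof. by rewrite /F1 derive1E; apply/derivableP; exact: Ck_derivable CF. Qed.

Let E1 : F1 = fun s => 'D_1 F s.
Proof. by apply/funext => s; rewrite /F1 derive1E. Qed.

Let CF1 : Ck 1 F1.
Proof. by rewrite E1; exact: Ck_derive. Qed.

Let dF1 s : is_derive s (1 : R) F1 (F2 s).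
Proof. by rewrite /F2 /= -/F1 derive1E; apply/derivableP; exact: Ck_derivable CF1. Qed.

Lemma continuous_F : continuous F. Proof. exact: Ck_continuous CF. Qed.
Lemma continuous_F1 : continuous F1. Proof. exact: Ck_continuous CF1. Qed.
Lemma continuous_F2 : continuous F2.
Proof.
have -> : F2 = fun s => 'D_1 F1 s by apply/funext => s; rewrite /F2 /= -/F1 derive1E.
exact: (Ck_continuous (Ck_derive (1 : R) CF1)).
Qed.

Definition pot (a s : R) : R := F s + a / 2 * s ^+ 2.
Definition pot1 (a s : R) : R := a * s + F1 s.

Let dpot a s : is_derive s (1 : R) (pot a) (pot1 a s).
Proof.
have i := is_deriveD (dF s) (is_deriveZ (a / 2) (is_derive_pow 2 s)).
by rewrite /GRing.scale/= in i; apply: (is_derive_eq i); rewrite /pot1 expr1; field.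
Qed.

Let dpot1 a s : is_derive s (1 : R) (pot1 a) (F2 s + a).
Proof.
have i := is_deriveD (is_deriveZ a (is_derive_id s (1 : R))) (dF1 s).
by rewrite /GRing.scale/= in i; apply: (is_derive_eq i); rewrite mulr1 addrC.
Qed.

Lemma pot_convex a c s0 s1 : (forall s, c <= F2 s + a) ->
  pot a s0 + pot1 a s0 * (s1 - s0) + c / 2 * (s1 - s0) ^+ 2 <= pot a s1.
Proof. by move=> h; apply: (convex_bound_seg (dpot a) (dpot1 a)) => s _. Qed.

Lemma pot_bounded A N : exists2 M, 0 <= M & forall a s, `|a| <= A -> `|s| <= N ->
  `|pot a s| <= M /\ `|pot1 a s| <= M.
Proof.
have [M M0 HM] := continuous_bounded N continuous_F.
have [M' M0' HM'] := continuous_bounded N continuous_F1.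
exists (M + M' + `|A| * (N ^+ 2 + `|N|)).
  by rewrite !addr_ge0// mulr_ge0// addr_ge0// sqr_ge0.
move=> a s aA sN; have N0 : 0 <= N := le_trans (normr_ge0 s) sN.
have A0 : 0 <= A := le_trans (normr_ge0 a) aA.
have h1 := HM s sN; have h2 := HM' s sN; rewrite (ger0_norm A0) (ger0_norm N0).
have s2 : s ^+ 2 <= N ^+ 2 by rewrite -(real_normK (num_real s)) lerXn2r.
have q1 : `|a / 2 * s ^+ 2| <= A * N ^+ 2.
  rewrite normrM [`|s ^+ 2|]ger0_norm ?sqr_ge0// ler_pM ?sqr_ge0// normrM.
  by apply: le_trans aA; rewrite ler_piMr// ger0_norm ?invr_ge0// invf_le1// ler1n.
have q2 : `|a * s| <= A * N by rewrite normrM ler_pM.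
have p1 := mulr_ge0 A0 N0; have p2 := mulr_ge0 A0 (sqr_ge0 N).
have := ler_normD (F s) (a / 2 * s ^+ 2); have := ler_normD (a * s) (F1 s).
rewrite -/(pot a s) -/(pot1 a s) mulrDr; move: q1 q2 h1 h2 p1 p2.
move: (`|F s|) (`|F1 s|) (`|pot a s|) (`|pot1 a s|) (`|a * s|) (`|a / 2 * _|) (A * N) (A * N ^+ 2) => *.
by split; lra.
Qed.

(** Beyond [S] the second derivative is at least [k]; expanding at [S] or at [- S] gives growth with
    any prescribed quadratic coefficient. The constant depends on [a] only through the bound [A], so
    it is uniform in space. *)
Lemma pot_growth c7 c8 q A B : 0 < c7 -> 0 < q ->
  exists2 C, 0 <= C & forall a, `|a| <= A -> (forall s, c7 * `|s| `^ (2 * q) - c8 <= F2 s + a) ->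
    forall s, B * s ^+ 2 - C <= pot a s.
Proof.
(* At distance [y] from the expansion point the gain is [(3 * b + 1) * y ^+ 2]: a part
   [2 * b * y ^+ 2] covers [B * s ^+ 2] up to a constant, and [y ^+ 2] absorbs the linear term
   [M * y]. *)
move=> c70 q0; pose b := `|B|; pose k := 6 * b + 2.
have b0 : 0 <= b by exact: normr_ge0.
have q2 : 0 < 2 * q by rewrite mulr_gt0.
(* Solves [c7 * S ^ (2q) - c8 >= k]; the maximum keeps the base nonnegative. *)
pose S := Num.max 0 ((c8 + k) / c7) `^ (2 * q)^-1.
have S0 : 0 <= S by exact: powR_ge0.
have HS s : S <= `|s| -> k <= c7 * `|s| `^ (2 * q) - c8.
  move=> Ss; have : S `^ (2 * q) <= `|s| `^ (2 * q).
    by apply: ge0_ler_powR => //; [exact: ltW|rewrite nnegrE].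
  rewrite /S -powRrM mulVf ?gt_eqF// powRr1; last by rewrite le_max lexx.
  rewrite ge_max => /andP[_]; rewrite ler_pdivrMr// mulrC; lra.
have [M M0 HM] := pot_bounded A S.
exists (M + 2 * b * S ^+ 2 + M ^+ 2); first by rewrite !addr_ge0 ?mulr_ge0// sqr_ge0.
move=> a aA H2 s.
have Bb : B * s ^+ 2 <= b * s ^+ 2 by rewrite ler_wpM2r ?sqr_ge0// ler_norm.
have bS := mulr_ge0 b0 (sqr_ge0 S).
have main y s0 : 0 <= y -> `|s0| <= S -> `|s - s0| = y -> s ^+ 2 <= 2 * y ^+ 2 + 2 * S ^+ 2 ->
    pot a s0 + pot1 a s0 * (s - s0) + k / 2 * (s - s0) ^+ 2 <= pot a s ->
    B * s ^+ 2 - (M + 2 * b * S ^+ 2 + M ^+ 2) <= pot a s.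
  move=> y0 s0S sy s2 h; have [m1 m2] := HM a s0 aA s0S.
  have e1 : - (M * y) <= pot1 a s0 * (s - s0).
    by apply: le_trans (lerNnormlW (lexx _)); rewrite lerN2 normrM sy ler_wpM2r.
  have e2 : (s - s0) ^+ 2 = y ^+ 2 by rewrite -sy real_normK ?num_real.
  have e3 : - M <= pot a s0 by apply: lerNnormlW.
  rewrite e2 in h; have e4 := ler_wpM2l b0 s2; have e5 := sqr_ge0 (y - M).
  have e6 : M * y <= y ^+ 2 + M ^+ 2.
    by have := sqr_ge0 (y + M); move: e5; rewrite !expr2; nra.
  have e7 := mulr_ge0 b0 (sqr_ge0 y).
  move: h Bb e1 e3 e4 e6 e7 bS; rewrite /k mulrDr.
  move: (pot a s) (pot a s0) (pot1 a s0 * _) (y ^+ 2) (M ^+ 2) (M * y) (S ^+ 2) (s ^+ 2) => *; nra.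
have [sS|Ss] := leP `|s| S.
  have [m1 _] := HM a s aA sS; have : - M <= pot a s by apply: lerNnormlW.
  have : b * s ^+ 2 <= b * S ^+ 2.
    by rewrite ler_wpM2l// -(real_normK (num_real s)) lerXn2r.
  move: Bb bS (sqr_ge0 M); rewrite -(mulrA 2); move: (b * s ^+ 2) (b * S ^+ 2) => *; lra.
have [s0|s0] := leP 0 s.
  have sS : S < s by move: Ss; rewrite ger0_norm.
  have sS0 : 0 <= s - S by rewrite subr_ge0 ltW.
  apply: (main (s - S) S); [by []|by rewrite ger0_norm|by rewrite ger0_norm| |].
    by have := sqr_ge0 (s - S - S); rewrite !expr2; nra.
  apply: (convex_bound_seg (dpot a) (dpot1 a)) => t ht; apply: le_trans (H2 t); apply: HS.
  apply: le_trans (ler_norm _); case: ht => /andP[h1 h2] //; by apply: le_trans h1; exact: ltW.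
have sS : s < - S by move: Ss; rewrite ltr0_norm// ltrNr.
have sS' : s - - S <= 0 by rewrite subr_le0 ltW.
apply: (main (- S - s) (- S)).
- by rewrite subr_ge0 ltW.
- by rewrite normrN ger0_norm.
- by rewrite ler0_norm// opprB.
- by have := sqr_ge0 (- S - s - S); rewrite !expr2; nra.
apply: (convex_bound_seg (dpot a) (dpot1 a)) => t ht; apply: le_trans (H2 t); apply: HS.
rewrite -normrN; apply: le_trans (ler_norm _); rewrite lerNr.
by case: ht => /andP[h1 h2]; lra.
Qed.

(** The exceptional null set may depend on [s]; over the rationals it can be made common.
    Approaching [s] by rationals of larger absolute value keeps [f s <= f r], so that continuity is
    used for [F2] only. *)
Lemma ae_forall_rat d (T : measurableType d) (mu : {measure set T -> \bar R}) (D : set T)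
  (a : T -> R) (f : R -> R) :
  (forall s r, `|s| <= `|r| -> f s <= f r) ->
  (forall s, {ae mu, forall x, D x -> f s <= F2 s + a x}) ->
  {ae mu, forall x, D x -> forall s, f s <= F2 s + a x}.
Proof.
move=> fm H; pose P n x := forall r : rat, unpickle n = Some r -> D x -> f (ratr r) <= F2 (ratr r) + a x.
have : {ae mu, forall x, forall n, P n x}.
  apply: ae_all_nat => n; rewrite /P; case: (unpickle n) => [r|]; last exact: aeW.
  by apply: ae_mono (H (ratr r)) => x h r' [<-].
apply: ae_mono => x Px Dx s; rewrite -lerBlDr; apply/ler_addgt0Pr => e e0.
have cs : {for s, continuous F2} by exact: continuous_F2.
move/cvgrPdist_le: cs => /(_ _ e0) /nbhs_ballP[d' /= d0 Hd].
have near r : ball s d' (ratr r) -> `|s| <= `|ratr r| -> f s - a x <= F2 s + e.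
  move=> sr srn; move: (Px (pickle r) r (pickleK r) Dx) (fm _ _ srn) (Hd _ sr) => /=.
  rewrite ler_norml => h1 h2 /andP[h3 h4]; move: h1 h2 h3 h4.
  by move: (ratr r) => y; move: (F2 y) (f y) (F2 s) (f s) (a x) => *; lra.
have [s0|s0] := leP 0 s.
  have [r] := @rat_in_itvoo R s (s + d') (ltac:(by rewrite ltrDl)).
  rewrite in_itv/= => /andP[r1 r2]; apply: (near r).
    by rewrite /ball/= distrC gtr0_norm ?subr_gt0// ltrBlDl.
  by rewrite (ger0_norm s0) ger0_norm ?(ltW r1)// (le_trans s0 (ltW r1)).
have [r] := @rat_in_itvoo R (s - d') s (ltac:(by rewrite gtrBl)).
rewrite in_itv/= => /andP[r1 r2]; apply: (near r).
  by rewrite /ball/= gtr0_norm ?subr_gt0// ltrBlDl -ltrBlDr.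
by rewrite (ltr0_norm s0) (ltr0_norm (lt_trans r2 s0)) lerN2 ltW.
Qed.

End potential.

Lemma upper_algebra (R : realFieldType) (X h0 w1 w2 N b C G A k : R) :
  X <= h0 + (w1 + w2) -> h0 <= k -> w1 <= 2^-1 * N + 2^-1 * G -> w2 <= A * N ->
  (1 + 2 * A) * N - C <= X -> - (A * N) <= b -> 0 <= A * N -> 0 <= N -> 0 <= k -> 0 <= G -> 0 <= C ->
  X - 2^-1 * b <= 3 * k + 2 * G + 4 * C.
Proof.
rewrite mulrDl mul1r -mulrA; move: (A * N) => AN *; lra.
Qed.

(** * Convexity, coercivity and lower semicontinuity of the energy *)

Section energy.
Context {R : realType}.
Notation pt := (R * R)%type.
Notation mpt := (measurableTypeR R * measurableTypeR R)%type.
Notation mu2 := (@mu2 R).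
Notation vfield := (@vfield R).
Variable D : set pt.
Hypothesis oD : open D.
Hypothesis Dfin : (mu2 D < +oo)%E.
Let mD : measurable (D : set mpt). Proof. exact: open_measurable2. Qed.

Lemma ipC f g : ip D f g = ip D g f.
Proof. by apply: eq_Rint => x _; rewrite mulrC. Qed.

Lemma ip_linl a f f' g : sqi mu2 D f -> sqi mu2 D f' -> sqi mu2 D g ->
  ip D (fun x => a * f x + f' x) g = a * ip D f g + ip D f' g.
Proof.
move=> fs fs' gs; have i1 := sqi_mul mD fs gs; have i2 := sqi_mul mD fs' gs.
rewrite /ip -(Rint_Z mD a i1); apply: etrans (Rint_D mD (intgZ mD a i1) i2).
by apply: eq_Rint => x _; ring.
Qed.

Lemma ip_Bl f f' g : sqi mu2 D f -> sqi mu2 D f' -> sqi mu2 D g ->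
  ip D (fun x => f x - f' x) g = ip D f g - ip D f' g.
Proof.
move=> fs fs' gs; rewrite addrC -mulN1r -(ip_linl (-1) fs' fs gs).
by apply: eq_Rint => x _; ring.
Qed.

Lemma ip_ge0 f : 0 <= ip D f f.
Proof. by apply: Rintegral_ge0 => x _; rewrite -expr2 sqr_ge0. Qed.

Lemma ip_n2 f : ip D f f = n2 mu2 D f ^+ 2.
Proof. by rewrite n2_sqr; apply: eq_Rint => x _; rewrite expr2. Qed.

Lemma ip_le f g : sqi mu2 D f -> sqi mu2 D g -> `|ip D f g| <= n2 mu2 D f * n2 mu2 D g.
Proof. by move=> fs gs; exact: (cauchy_schwarz mD fs gs). Qed.

(** Convexity of half the squared norm, with the subgradient taken at [f]. *)
Lemma ip_polar f g : sqi mu2 D f -> sqi mu2 D g ->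
  2^-1 * ip D f f <= 2^-1 * ip D g g + (ip D f f - ip D g f).
Proof.
move=> fs gs; have fg := sqiB mD fs gs; have := ip_ge0 (fun x => f x - g x).
rewrite (ip_Bl fs gs fg) [ip D f _]ipC [ip D g _]ipC (ip_Bl fs gs fs) (ip_Bl fs gs gs).
rewrite [ip D f g]ipC; move: (ip D f f) (ip D g g) (ip D g f) => *; lra.
Qed.

Lemma ipvE (u v : vfield) : (forall i, sqi mu2 D (u i)) -> (forall i, sqi mu2 D (v i)) ->
  ipv D u v = \sum_i ip D (u i) (v i).
Proof. by move=> us vs; apply: (Rint_sumI2 mD) => i; exact: sqi_mul. Qed.

Lemma ipv_polar (u v : vfield) : (forall i, sqi mu2 D (u i)) -> (forall i, sqi mu2 D (v i)) ->
  2^-1 * ipv D u u <= 2^-1 * ipv D v v + (ipv D u u - ipv D v u).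
Proof.
move=> us vs; rewrite !ipvE// -sumrB !mulr_sumr -big_split/=.
by apply: ler_sum => i _; exact: ip_polar.
Qed.

Variables (J : pt -> R) (F : R -> R) (c0 c7 c8 q : R).
Hypothesis J1 : W1p setT 1%:E J.
Hypothesis Jev : {ae mu2, forall x : pt, J x = J (- x)}.
Hypothesis CF : Ck 2 F.
Hypotheses (c00 : 0 < c0) (c70 : 0 < c7) (q0 : 0 < q).
Let a : mpt -> R := acoef D J.
Hypothesis Fc0 : {ae mu2, forall x : pt, D x -> forall s, c0 <= (F^`(2))%classic s + a x}.
Hypothesis Fc7 : {ae mu2, forall x : pt, D x -> forall s,
  c7 * (`|s| `^ (2 * q)) - c8 <= (F^`(2))%classic s + a x}.

Let Ji : intg mu2 setT J := (W11_intg J1).1.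
Let A := norm1 J.
Let A0 : 0 <= A. Proof. exact: norm1_ge0. Qed.
Let aA x : `|a x| <= A. Proof. exact: (acoef_bound oD Dfin Ji).2. Qed.
Let ma : measurable_fun D a.
Proof. by apply: measurable_funTS; exact: (acoef_bound oD Dfin Ji).1. Qed.
Let JL2 f : sqi mu2 D f -> sqi mu2 D (convol D J f) /\ n2 mu2 D (convol D J f) <= A * n2 mu2 D f.
Proof. exact: convol_L2. Qed.

Definition dens (phi : pt -> R) : mpt -> R := fun x => pot F (a x) (phi x).

Let mF phi : measurable_fun D phi -> measurable_fun (D : set mpt) (fun x => F (phi x)).
Proof.
by move=> mphi; apply: measurableT_comp => //; exact: continuous_measurable_fun (continuous_F CF).
Qed.

Let mdens phi : measurable_fun D phi -> measurable_fun (D : set mpt) (dens phi).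
Proof.
move=> mphi; apply: measurable_funD; first exact: mF.
apply: measurable_funM; first by apply: measurable_funM.
by apply: measurable_funX.
Qed.

Let asq phi : sqi mu2 D phi -> intg mu2 D (fun x => a x / 2 * phi x ^+ 2).
Proof.
move=> ps; apply: (intg_dom mD _ (intgZ mD A ps.2)).
  apply: measurable_funM; first by apply: measurable_funM.
  by apply: measurable_funX; exact: ps.1.
move=> x _; rewrite normrM [`|_ ^+ 2|]ger0_norm ?sqr_ge0// ler_wpM2r ?sqr_ge0// normrM.
by apply: le_trans (aA x); rewrite ler_piMr// ger0_norm ?invr_ge0// invf_le1// ler1n.
Qed.

Lemma intg_dens phi : sqi mu2 D phi -> (intg mu2 D (dens phi) <-> intg mu2 D (fun x => F (phi x))).
Proof.
move=> ps; have i := asq ps; split=> h.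
  by apply: (eq_intg mD _ (intgB mD h i)) => x _; rewrite /dens /pot addrK.
exact: (intgD mD h i).
Qed.

Definition potE (phi : pt -> R) : R :=
  \int[mu2]_(x in D) dens phi x - 2^-1 * ip D phi (convol D J phi).

Lemma convolB f g : sqi mu2 D f -> sqi mu2 D g ->
  {ae mu2, forall x, D x -> convol D J (fun x => f x - g x) x = convol D J f x - convol D J g x}.
Proof.
move=> fs gs; have [Cf _] := convol_ae oD Ji (sqi_intg mD Dfin fs).
have [Cg _] := convol_ae oD Ji (sqi_intg mD Dfin gs).
apply: ae_mono (ae_and Cf Cg) => x [h1 h2] _.
rewrite /convol; apply: etrans (Rint_B mD h1 h2).
by apply: eq_Rint => y _; rewrite mulrBr.
Qed.

(** Expansion at [f] of the quadratic form of a symmetric operator. *)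
Lemma convol_quad f g : sqi mu2 D f -> sqi mu2 D g ->
  2^-1 * ip D f (convol D J f) - 2^-1 * ip D g (convol D J g) =
  ip D (fun x => f x - g x) (convol D J f) -
  2^-1 * ip D (fun x => f x - g x) (convol D J (fun x => f x - g x)).
Proof.
move=> fs gs; have fg := sqiB mD fs gs.
have [Jf _] := JL2 fs; have [Jg _] := JL2 gs; have [Jfg _] := JL2 fg.
have E : ip D (fun x => f x - g x) (convol D J (fun x => f x - g x)) =
    ip D (fun x => convol D J f x - convol D J g x) (fun x => f x - g x).
  rewrite ipC; apply: eq_Rintegral_ae; apply: ae_mono (convolB fs gs) => x h Dx.
  by rewrite h.
rewrite E (ip_Bl Jf Jg fg) ![ip D (convol _ _ _) _]ipC !(ip_Bl fs gs)//.
have -> : ip D f (convol D J g) = ip D g (convol D J f).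
  by rewrite [RHS]ipC; apply: esym; exact: (convol_sym oD Dfin Ji Jev fs gs).
by move: (ip D f _) (ip D g _) (ip D g _) => *; field.
Qed.

Lemma chemE phi x : pot1 F (a x) (phi x) = chem_potential D J F phi x + convol D J phi x.
Proof. by rewrite /pot1 /chem_potential -/(a x) addrAC subrK. Qed.

Lemma ae_convex phi psi : {ae mu2, forall x, D x ->
  dens phi x + pot1 F (a x) (phi x) * (psi x - phi x) + c0 / 2 * (psi x - phi x) ^+ 2 <= dens psi x}.
Proof.
by apply: ae_mono Fc0 => x h Dx; apply: (pot_convex CF) => s; exact: h.
Qed.

Let pot1_sqi phi : sqi mu2 D phi -> sqi mu2 D (chem_potential D J F phi) ->
  sqi mu2 D (fun x => pot1 F (a x) (phi x)).
Proof.
move=> ps ms; apply: (eq_sqi mD _ (sqiD mD ms (JL2 ps).1)) => x _.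
by rewrite chemE.
Qed.

(** Subgradient inequality for the convex density at [phi]. The remainder of the nonlocal form is
    kept next to the gain from [c0], which outweighs it in [absorb]. *)
Lemma potE_step phi psi : sqi mu2 D phi -> sqi mu2 D (chem_potential D J F phi) ->
  sqi mu2 D psi -> intg mu2 D (dens phi) -> intg mu2 D (dens psi) ->
  forall dl, dl = (fun x => phi x - psi x) ->
  potE phi - potE psi <= ip D phi (chem_potential D J F phi) - ip D psi (chem_potential D J F phi)
    + 2^-1 * ip D dl (convol D J dl) - c0 / 2 * ip D dl dl.
Proof.
move=> ps ms ss pi si dl dlE; have ds : sqi mu2 D dl by rewrite dlE; exact: sqiB.
have [Js _] := JL2 ps.
have p1 := pot1_sqi ps ms; have i1 := sqi_mul mD p1 ds.
have i2 : intg mu2 D (fun x => c0 / 2 * dl x ^+ 2) := intgZ mD _ ds.2.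
have : \int[mu2]_(x in D) (dens phi x - dens psi x) <=
    \int[mu2]_(x in D) (pot1 F (a x) (phi x) * dl x - c0 / 2 * dl x ^+ 2).
  apply: (le_Rint_ae mD (intgB mD pi si) (intgB mD i1 i2)).
  apply: ae_mono (ae_convex phi psi) => x h Dx; have := h Dx; rewrite dlE !expr2; lra.
rewrite (Rint_B mD pi si) (Rint_B mD i1 i2) (Rint_Z mD _ ds.2).
have -> : \int[mu2]_(x in D) (pot1 F (a x) (phi x) * dl x) =
    ip D dl (chem_potential D J F phi) + ip D dl (convol D J phi).
  rewrite /ip -(Rint_D mD (sqi_mul mD ds ms) (sqi_mul mD ds Js)); apply: eq_Rint => x _.
  by rewrite chemE; ring.
have -> : \int[mu2]_(x in D) dl x ^+ 2 = ip D dl dl by apply: eq_Rint => x _; rewrite expr2.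
have := convol_quad ps ss; rewrite -dlE /potE.
have -> : ip D dl (chem_potential D J F phi) = ip D phi (chem_potential D J F phi) - ip D psi (chem_potential D J F phi).
  by rewrite dlE (ip_Bl ps ss ms).
move: (\int[mu2]_(x in D) dens phi x) (\int[mu2]_(x in D) dens psi x) (ip D phi _) (ip D psi _)
  (ip D phi _) (ip D psi _) (ip D dl _) (ip D dl _) (ip D dl _) => *; lra.
Qed.

Lemma dens_lower B : exists2 C, 0 <= C &
  {ae mu2, forall x, D x -> forall s, B * s ^+ 2 - C <= pot F (a x) s}.
Proof.
have [C C0 HC] := pot_growth CF c8 A B c70 q0; exists C => //.
by apply: ae_mono Fc7 => x h Dx; apply: HC => //; exact: h.
Qed.

(** Convexity towards the value 0 bounds the density of [phi] by a constant plus [phi] times the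
    derivative of the density, a product of two square-integrable functions; so the energy is finite
    whenever the chemical potential is square-integrable. *)
Lemma intg_dens_chem phi : sqi mu2 D phi -> sqi mu2 D (chem_potential D J F phi) ->
  intg mu2 D (dens phi).
Proof.
move=> ps ms; have [C C00 HC] := dens_lower 0; have [M M0 HM] := pot_bounded CF A 0.
have i1 := sqi_mul mD (pot1_sqi ps ms) ps.
have ic := sqi_intg mD Dfin (sqi_cst mD (C + M) Dfin).
apply: (intg_dom_ae mD (mdens ps.1) (intgD mD ic (intg_abs i1))).
apply: ae_mono (ae_and HC (ae_convex phi (fun=> 0))) => x [h1 h2] Dx.
have := h1 Dx (phi x); have := h2 Dx; rewrite mul0r !sub0r sqrrN mulrN => {h1 h2}.
have n00 : `|0 : R| <= 0 by rewrite normr0.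
have [hM _] := HM (a x) 0 (aA x) n00.
have := ler_norm (pot F (a x) 0); rewrite {1}/dens /=.
have := ler_norm (pot1 F (a x) (phi x) * phi x).
have : 0 <= c0 / 2 * phi x ^+ 2 by rewrite mulr_ge0 ?sqr_ge0// divr_ge0// ltW.
have := normr_ge0 (pot1 F (a x) (phi x) * phi x).
rewrite ler_norml; move: hM; rewrite -/(dens (fun=> 0) x) -/(dens phi x).
move: (dens phi x) (dens (fun=> 0) x) (c0 / 2 * phi x ^+ 2) (`|pot1 F (a x) (phi x) * phi x|)
  (pot1 F (a x) (phi x) * phi x) => *.
by apply/andP; split; lra.
Qed.

Let Rc (c : R) : \int[mu2]_(x in D) c = c * fine (mu2 D) := Rint_cst c mD Dfin.

Lemma dens_ge B : exists2 C, 0 <= C & forall phi, sqi mu2 D phi -> intg mu2 D (dens phi) ->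
  B * ip D phi phi - C <= \int[mu2]_(x in D) dens phi x.
Proof.
have [C C00 HC] := dens_lower B; exists (C * fine (mu2 D)).
  by rewrite mulr_ge0 ?fine_ge0.
move=> phi ps di; have i1 := intgZ mD B ps.2; have i2 := sqi_intg mD Dfin (sqi_cst mD C Dfin).
have h : {ae mu2, forall x, D x -> B * phi x ^+ 2 - C <= dens phi x}.
  by apply: ae_mono HC => x h Dx; exact: h.
have := le_Rint_ae mD (intgB mD i1 i2) di h.
rewrite (Rint_B mD i1 i2) (Rint_Z mD _ ps.2) Rc.
by have -> : ip D phi phi = \int[mu2]_(x in D) phi x ^+ 2 by apply: eq_Rint => x _; rewrite expr2.
Qed.

Let quad phi : sqi mu2 D phi -> `|ip D phi (convol D J phi)| <= A * ip D phi phi.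
Proof.
move=> ps; have [Js Jn] := JL2 ps; apply: le_trans (ip_le ps Js) _.
rewrite ip_n2 mulrC; apply: le_trans (ler_wpM2r (n2_ge0 _ _ _) Jn) _.
by rewrite -mulrA -expr2.
Qed.

(** Quadratic growth with coefficient [1 + A] pays for the nonlocal term, which is at most [A / 2]
    times the squared norm. *)
Lemma potE_lower : exists2 C, 0 <= C & forall phi, sqi mu2 D phi -> intg mu2 D (dens phi) ->
  ip D phi phi - C <= potE phi.
Proof.
have [C C00 HC] := dens_ge (1 + A); exists C => // phi ps di.
have := HC phi ps di; have := quad ps; rewrite ler_norml => /andP[_]; rewrite /potE.
have := mulr_ge0 A0 (ip_ge0 phi); rewrite mulrDl mul1r.
move: (ip D phi (convol _ _ _)) (ip D phi phi) => b e; move: (A * e) (Rintegral _ _ _) => *; lra.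
Qed.

(** The source of the bound of the energy by the dissipation: convexity compares [phi] with its
    mean, whose energy is controlled by [m], and the difference has mean zero, so that Poincare's
    inequality for the chemical potential applies. *)
Lemma potE_upper m : (0 < mu2 D)%E -> (exists2 CP, 0 <= CP & forall f, inH1 D f -> exists c,
    \int[mu2]_(x in D) (f x - c) ^+ 2 <= CP * (gradnorm D f ^+ 2 + 1)) ->
  exists2 C, 0 <= C & forall phi, sqi mu2 D phi -> inH1 D (chem_potential D J F phi) ->
    `|\int[mu2]_(x in D) phi x| <= m ->
    potE phi <= C * (gradnorm D (chem_potential D J F phi) ^+ 2 + 1).
Proof.
move=> D0 [CP CP0 HP]; pose V := fine (mu2 D).
have V0 : 0 < V by rewrite fine_gt0// D0.
(* The upper bound produces [2^-1 + A] times the squared norm of [phi], half of the coefficient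
   taken here, so it can be absorbed by the density. *)
have [C' C'0 HC] := dens_ge (1 + 2 * A); have [M M0 HM] := pot_bounded CF A (m / V).
exists (3 * (M * V) + 2 * CP + 4 * C'); first by rewrite !addr_ge0 ?mulr_ge0// ltW.
move=> phi ps mH pm; have ms := inH1_sqi mH; have di := intg_dens_chem ps ms.
have pi := sqi_intg mD Dfin ps.
pose cb := (\int[mu2]_(x in D) phi x) / V.
have V1 : 0 <= V^-1 by rewrite invr_ge0 ltW.
have cbm : `|cb| <= m / V by rewrite normrM (ger0_norm V1) ler_wpM2r.
pose w := fun x => phi x - cb.
have cs (c : R) : sqi mu2 D (fun=> c) := sqi_cst mD c Dfin.
have ws : sqi mu2 D w := sqiB mD ps (cs cb).
have w0 : ip D w (fun=> 1) = 0.
  rewrite (ip_Bl ps (cs cb) (cs 1)) /ip.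
  rewrite (_ : \int[mu2]_(x in D) (phi x * 1) = \int[mu2]_(x in D) phi x); last by apply: eq_Rint => x _; rewrite mulr1.
  by rewrite Rc mulr1 /cb divfK ?subrr// gt_eqF.
have [c Hc] := HP _ mH.
have mc : sqi mu2 D (fun x => chem_potential D J F phi x - c) := sqiB mD ms (cs c).
have nmc : n2 mu2 D (fun x => chem_potential D J F phi x - c) ^+ 2 <=
   CP * (gradnorm D (chem_potential D J F phi) ^+ 2 + 1) by rewrite n2_sqr.
have nw : n2 mu2 D w ^+ 2 <= n2 mu2 D phi ^+ 2.
  rewrite -!ip_n2 {1}/w (ip_Bl ps (cs cb) ws).
  have -> : ip D (fun=> cb) w = cb * ip D w (fun=> 1).
    rewrite [ip D w _]ipC /ip -(Rint_Z mD cb (sqi_mul mD (cs 1) ws)).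
    by apply: eq_Rint => x _; rewrite mul1r.
  rewrite w0 mulr0 subr0 ipC (ip_Bl ps (cs cb) ps).
  have -> : ip D (fun=> cb) phi = cb * \int[mu2]_(x in D) phi x by rewrite -(Rint_Z mD cb pi).
  have -> : \int[mu2]_(x in D) phi x = cb * V by rewrite /cb divfK// gt_eqF.
  by rewrite lerBlDr lerDl mulrA mulr_ge0 ?(ltW V0)// -expr2 sqr_ge0.
have nw' : n2 mu2 D w <= n2 mu2 D phi by rewrite -(@ler_pXn2r _ 2)// nnegrE n2_ge0.
have [Js Jn] := JL2 ps.
have di' : intg mu2 D (dens (fun=> cb)).
  apply: (intg_bounded (M := M) mD Dfin); first by apply: mdens.
  by move=> x _; have [] := HM (a x) cb (aA x) cbm.
have Icb : \int[mu2]_(x in D) dens (fun=> cb) x <= M * V.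
  rewrite -Rc; apply: (le_Rint mD di' (sqi_intg mD Dfin (cs M))) => x _.
  by apply: le_trans (ler_norm _) _; have [] := HM (a x) cb (aA x) cbm.
have i1 := sqi_mul mD (pot1_sqi ps ms) ws.
(* Convexity at [phi] in the direction of the constant [cb]; since [w] has mean zero, the constant
   [c] may be subtracted from the chemical potential. *)
have upper : \int[mu2]_(x in D) dens phi x <= \int[mu2]_(x in D) dens (fun=> cb) x +
    (ip D w (fun x => chem_potential D J F phi x - c) + ip D w (convol D J phi)).
  have -> : ip D w (fun x => chem_potential D J F phi x - c) = ip D w (chem_potential D J F phi).
    rewrite ipC (ip_Bl ms (cs c) ws) [ip D w _]ipC.
    have -> : ip D (fun=> c) w = c * ip D w (fun=> 1).
      rewrite [ip D w _]ipC /ip -(Rint_Z mD c (sqi_mul mD (cs 1) ws)).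
      by apply: eq_Rint => x _; rewrite mul1r.
    by rewrite w0 mulr0 subr0.
  have -> : ip D w (chem_potential D J F phi) + ip D w (convol D J phi) =
      \int[mu2]_(x in D) (w x * chem_potential D J F phi x + w x * convol D J phi x).
    exact: esym (Rint_D mD (sqi_mul mD ws ms) (sqi_mul mD ws Js)).
  have ij := intgD mD (sqi_mul mD ws ms) (sqi_mul mD ws Js).
  rewrite -(Rint_D mD di' ij); apply: (le_Rint_ae mD di (intgD mD di' ij)).
  apply: ae_mono (ae_convex phi (fun=> cb)) => x h Dx; have := h Dx; rewrite chemE /w.
  have : 0 <= c0 / 2 * (cb - phi x) ^+ 2 by rewrite mulr_ge0 ?sqr_ge0// divr_ge0// ltW.
  move: (dens phi x) (dens _ x) (chem_potential _ _ _ _ _) (convol _ _ _ _) (phi x) => *; nra.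
have b1 := le_trans (ler_norm _) (ip_le ws mc); have b2 := le_trans (ler_norm _) (ip_le ws Js).
have b3 := quad ps; rewrite ip_n2 in b3.
have H' := HC phi ps di; rewrite ip_n2 in H'.
have b4 : n2 mu2 D w * n2 mu2 D (convol D J phi) <= A * n2 mu2 D phi ^+ 2.
  by rewrite expr2 mulrCA ler_pM ?n2_ge0.
have b5 : n2 mu2 D w * n2 mu2 D (fun x => chem_potential D J F phi x - c) <=
    2^-1 * n2 mu2 D phi ^+ 2 + 2^-1 * (CP * (gradnorm D (chem_potential D J F phi) ^+ 2 + 1)).
  have := sqr_ge0 (n2 mu2 D w - n2 mu2 D (fun x => chem_potential D J F phi x - c)).
  rewrite sqrrB; move: nw nmc; rewrite -mulr_natr.
  move: (n2 mu2 D w * _) (n2 mu2 D w ^+ 2) (n2 mu2 D phi ^+ 2) (n2 mu2 D _ ^+ 2) (CP * _) => *; lra.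
have g0 : 0 <= gradnorm D (chem_potential D J F phi) ^+ 2 by exact: sqr_ge0.
have {}b3 := lerNnormlW b3.
have a2 := mulr_ge0 A0 (sqr_ge0 (n2 mu2 D phi)).
have fin := upper_algebra upper Icb (le_trans b1 b5) (le_trans b2 b4) H' b3 a2 (sqr_ge0 _)
  (mulr_ge0 M0 (ltW V0)) (mulr_ge0 CP0 (ler_wpDr ler01 g0)) C'0.
apply: le_trans fin _; set g := gradnorm _ _ ^+ 2 in g0 *.
have z : 0 <= 3 * (M * V) + 4 * C' by rewrite addr_ge0 ?mulr_ge0// ltW.
by have := mulr_ge0 z g0; move: (M * V) => y; rewrite !mulrDl; lra.
Qed.

(** Two test functions are required at a time: the truncated subgradient of [weak_lsc] and
    [convol D J phi]. With the last smallness condition the nonlocal form passes to the limit by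
    [convol_quad]. *)
Lemma potE_lsc phi c : sqi mu2 D phi ->
  (forall w1 w2 eps, sqi mu2 D w1 -> sqi mu2 D w2 -> 0 < eps -> exists psi, [/\ sqi mu2 D psi,
     intg mu2 D (dens psi), potE psi <= c + eps,
     `|ip D psi w1 - ip D phi w1| <= eps /\ `|ip D psi w2 - ip D phi w2| <= eps &
     `|ip D (fun x => phi x - psi x) (convol D J (fun x => phi x - psi x))| <= eps]) ->
  intg mu2 D (dens phi) /\ potE phi <= c.
Proof.
move=> ps H; have [C C00 HC] := dens_lower 0.
have [Js _] := JL2 ps.
have mp1 : measurable_fun (D : set mpt) (fun x => pot1 F (a x) (phi x)).
  apply: measurable_funD; first by apply: measurable_funM => //; exact: ps.1.
  by apply: measurableT_comp; [exact: continuous_measurable_fun (continuous_F1 CF)|exact: ps.1].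
have [||||di dE] := @weak_lsc _ _ _ mu2 D mD Dfin (fun x s => pot F (a x) s)
  (fun x s => pot1 F (a x) s) phi (c + 2^-1 * ip D phi (convol D J phi)) C (mdens ps.1) mp1 ps.
- apply: ae_mono Fc0 => x h Dx s.
  apply: le_trans (pot_convex CF (phi x) s (fun s => h Dx s)).
  by rewrite lerDl mulr_ge0 ?sqr_ge0// divr_ge0// ltW.
- by apply: ae_mono HC => x h Dx s; have := h Dx s; rewrite mul0r sub0r.
- move=> N; have [M M0 HM] := pot_bounded CF A N; exists M; apply: aeW => x _ pN.
  exact: HM (aA x) pN.
- move=> w eps ws e0; have e3 : 0 < eps / 3 by rewrite divr_gt0.
  have [psi [ss si sE [h1 h2] h3]] := H w _ _ ws Js e3; exists psi; split => //.
    have := convol_quad ps ss; rewrite (ip_Bl ps ss Js).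
    move: h2 h3 sE; rewrite !ler_norml /potE => /andP[_ h2] /andP[_ h3] sE E.
    suff : \int[mu2]_(x in D) dens psi x <= c + 2^-1 * ip D phi (convol D J phi) + eps by [].
    move: sE h2 h3 E.
    move: (\int[mu2]_(x in D) dens psi x) (ip D psi (convol D J psi)) (ip D psi (convol D J phi)) (ip D phi _)
      (ip D (fun x => phi x - psi x) _) => *; lra.
  have -> : \int[mu2]_(x in D) (w x * psi x) = ip D psi w by rewrite ipC.
  have -> : \int[mu2]_(x in D) (w x * phi x) = ip D phi w by rewrite ipC.
  by apply: le_trans h1 _; rewrite ler_pdivrMr// ler_peMr ?ler1n// ltW.
- by split; [exact: di|]; rewrite /potE lerBlDr.
Qed.

End energy.

(** * Energy decay along weak solutions *)

Section function_spaces.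
Context {R : realType}.
Notation pt := (R * R)%type.
Notation mpt := (measurableTypeR R * measurableTypeR R)%type.
Notation mu2 := (@mu2 R).
Notation leb := (@lebesgue_measure R).
Notation vfield := (@vfield R).

Lemma lipschitz_continuous (f : R -> R) : locally_lipschitz f -> continuous f.
Proof.
move=> lf s; have [U Us lU] := lf s.
have [M M0 HM] := pinfty_ex_gt0 lU; have Uss := nbhs_singleton Us.
apply/cvgrPdist_le => e e0.
have eM : 0 < e / M by rewrite divr_gt0.
apply: filterS2 Us (nbhsx_ballx s _ eM) => t Ut st.
have := HM (s, t) (conj Uss Ut) => /= h; apply: le_trans h _.
by rewrite mulrC -ler_pdivlMr// ltW.
Qed.

Variable D : set pt.
Hypothesis oD : open D.
Hypothesis Dfin : (mu2 D < +oo)%E.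
Let mD : measurable (D : set mpt). Proof. exact: open_measurable2. Qed.

Lemma testfun0 : testfun D (fun=> 0).
Proof.
split; first by move=> k; exact: Ck_cst.
by exists set0; split=> //; exact: compact0.
Qed.

Lemma wD0 i : {ae mu2, forall x, D x -> wD D i (fun=> 0) x = 0}.
Proof.
apply: ae_mono (testfun_wD oD i testfun0) => x h Dx; rewrite h//.
exact: (derive_cst (0 : R) x (e_ i)).
Qed.

Lemma gradnorm0 : gradnorm D (fun=> 0) = 0.
Proof.
apply/eqP; rewrite -sqrf_eq0; apply/eqP; rewrite gradnorm_sqr.
apply: big1 => i _; rewrite -[RHS](_ : \int[mu2]_(x in D) 0 = 0); last by rewrite /Rintegral integral0.
apply: eq_Rintegral_ae; apply: ae_mono (wD0 i) => x h Dx.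
by rewrite h// expr0n.
Qed.

Lemma H1_norm0 : H1_norm D (fun=> 0) = 0.
Proof.
rewrite H1_normE//; last exact: testfun_inH1 testfun0.
have -> : n2 mu2 D (fun=> 0) = 0.
  rewrite /n2 (_ : \int[mu2]_(x in D) 0 ^+ 2 = 0) ?sqrtr0//.
  rewrite -[RHS](_ : \int[mu2]_(x in D) 0 = 0); last by rewrite /Rintegral integral0.
  by apply: eq_Rint => x _; rewrite expr0n.
by rewrite gradnorm0 expr0n addr0 sqrtr0.
Qed.

Lemma H1_seminormed : seminormed (H1 D).
Proof.
split.
- by apply/(W12P oD); exact: testfun_inH1 testfun0.
- by move=> a v w /(W12P oD) vH /(W12P oD) wH; apply/(W12P oD); exact: (inH1_lin oD a vH wH).1.
- exact: H1_norm0.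
- by move=> v _; exact: sqrtr_ge0.
- by move=> a v w /(W12P oD) vH /(W12P oD) wH; exact: H1_norm_lin.
Qed.

Lemma Vdiv_seminormed : seminormed (Vdiv D).
Proof.
have m0 : @mem_of _ (Vdiv D) 0.
  split=> [i|].
    split; first by apply/(W12P oD); exact: testfun_inH1 testfun0.
    move=> e e0; exists (fun=> 0); first exact: testfun0.
    rewrite (_ : _ - _ = fun=> 0) ?H1_norm0//; apply/funext => x.
    by rewrite !fctE subrr.
  apply: ae_mono (ae_all_fin wD0) => x h Dx.
  by apply: big1 => i _; exact: h.
split.
- exact: m0.
- by move=> a v w vV wV; exact: (vmem_lin oD a vV wV).
- apply/eqP; rewrite -sqrf_eq0; apply/eqP; apply: (etrans (vnorm_sqr oD m0)).
  by apply: big1 => i _; apply: (etrans (congr1 (fun x => x ^+ 2) gradnorm0)); rewrite expr0n.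
- by move=> v _; exact: vnorm_ge0.
- by move=> a v w vV wV; exact: (vnorm_lin oD a vV wV).
Qed.

Lemma L2v_normE (u : vfield) : (forall i, sqi mu2 D (u i)) ->
  L2v_norm D u = Num.sqrt (\sum_i n2 mu2 D (u i) ^+ 2).
Proof.
by move=> us; congr Num.sqrt; apply: eq_bigr => i _; rewrite /Lp_norm Lnorm2E.
Qed.

Lemma n2_le_L2v (u : vfield) i : (forall i, sqi mu2 D (u i)) -> n2 mu2 D (u i) <= L2v_norm D u.
Proof.
move=> us; rewrite L2v_normE// -[leLHS]ger0_norm ?n2_ge0// -sqrtr_sqr ler_sqrt.
  by rewrite (bigD1 i)//= lerDl; apply: sumr_ge0 => j _; exact: sqr_ge0.
by apply: sumr_ge0 => j _; exact: sqr_ge0.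
Qed.

Lemma Gdiv_sqi (u : vfield) : @mem_of _ (Gdiv D) u -> forall i, sqi mu2 D (u i).
Proof. by move=> [H _] i; apply/(Lfun2P _ mD); exact: H. Qed.

Lemma L2_sqi (f : pt -> R) : @mem_of _ (L2 D) f -> sqi mu2 D f.
Proof. by move=> /(Lfun2P _ mD). Qed.

Lemma weakly_continuous_ip (T : R) (f : R -> pt -> R) (g : pt -> R) :
  weakly_continuous T (fun t => f t : L2 D) -> sqi mu2 D g ->
  {within `[0, T], continuous (fun t => ip D (f t) g)}.
Proof.
move=> [_ H] gs; apply: (H (fun f : L2 D => ip D f g)); split.
  by move=> a v w /L2_sqi vs /L2_sqi ws; exact: (ip_linl oD a vs ws gs).
exists (n2 mu2 D g) => v vm; have vs := L2_sqi vm.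
by rewrite /= /Lp_norm Lnorm2E// mulrC; exact: (ip_le oD vs gs).
Qed.

Lemma weakly_continuous_ipv (T : R) (u : R -> vfield) (w : vfield) :
  weakly_continuous T (fun t => u t : Gdiv D) -> (forall i, sqi mu2 D (w i)) ->
  {within `[0, T], continuous (fun t => ipv D (u t) w)}.
Proof.
move=> [_ H] ws; apply: (H (fun u : Gdiv D => ipv D u w)); split.
  move=> a v v' vm vm'; have vs := Gdiv_sqi vm; have vs' := Gdiv_sqi vm'.
  rewrite (ipvE oD vs ws) (ipvE oD vs' ws) ipvE//; last first.
    by move=> i; apply: (sqiD mD (sqiZ mD a (vs i)) (vs' i)).
  by rewrite mulr_sumr -big_split; apply: eq_bigr => i _; exact: (ip_linl oD a (vs i) (vs' i) (ws i)).
exists (\sum_i n2 mu2 D (w i)) => v vm; have vs := Gdiv_sqi vm.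
rewrite (ipvE oD vs ws) mulr_suml; apply: le_trans (ler_norm_sum _ _ _) _.
apply: ler_sum => i _; apply: le_trans (ip_le oD (vs i) (ws i)) _.
by rewrite mulrC ler_wpM2l ?n2_ge0//; exact: n2_le_L2v.
Qed.

End function_spaces.

Section lebesgue_norm_power.
Context d (T : measurableType d) (R : realType) (mu : {measure set T -> \bar R}).
Variables (D : set T) (mD : measurable D).

Lemma LnormrE (f : T -> R) (r : R) : 1 <= r -> intg mu D (fun x => `|f x| `^ r) ->
  \int[mu]_(x in D) (`|f x| `^ r) = (fine ('N[mu]_(r%:E)[EFin \o (f \_ D)])%E) `^ r.
Proof.
move=> r1 fi; have r0 : 0 < r by exact: lt_le_trans r1.
rewrite unlock.
have -> : (\int[mu]_x (`|(EFin \o f \_ D) x| `^ r))%E = (\int[mu]_(x in D) (`|f x| `^ r))%:E.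
  apply: etrans (integral_intg mD fi); rewrite [RHS]integral_mkcond; apply: eq_integral => x _ /=.
  rewrite !patchE; case: ifPn => // _; rewrite ?normr0 ?powR0 ?gt_eqF//.
rewrite poweR_EFin /= -powRrM mulVf ?gt_eqF// powRr1//.
by apply: Rintegral_ge0 => x _; exact: powR_ge0.
Qed.

End lebesgue_norm_power.

(** * Elementary inequalities for one time step *)

Section step_algebra.
Variable R : realFieldType.

(** Here [hh] is the length of a step, and [S], [A] are the integrals of a function and of its
    square over it. The cost splits into a small multiple of [A], which is additive over steps, and
    a term proportional to [hh]. *)
Lemma young_interval (x S A hh lam : R) : 0 < lam -> 0 < hh -> S ^+ 2 <= hh * A ->
  x * S <= 2^-1 * (lam * A) + hh * (x ^+ 2 / (2 * lam)).
Proof.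
move=> lam0 h0 SA; have l2 : 0 < 2 * lam * hh by rewrite !mulr_gt0.
rewrite -(ler_pM2l l2).
have -> : 2 * lam * hh * (2^-1 * (lam * A) + hh * (x ^+ 2 / (2 * lam))) =
    lam ^+ 2 * (hh * A) + hh ^+ 2 * x ^+ 2 by field; rewrite gt_eqF.
have := ler_wpM2l (sqr_ge0 lam) SA; have := sqr_ge0 (lam * S - hh * x).
rewrite !expr2; nra.
Qed.

(** Maximising over [n] leaves [CJ ^+ 2 * S ^+ 2 / (8 * c0)], and [S ^+ 2 <= hh * A] carries the
    small factor [eta]. *)
Lemma absorb (n S A hh CJ c0 eta : R) : 0 < c0 -> 0 <= A -> hh <= eta -> S ^+ 2 <= hh * A ->
  2^-1 * (CJ * n * S) - c0 / 2 * n ^+ 2 <= CJ ^+ 2 / (8 * c0) * eta * A.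
Proof.
move=> c00 A0 he SA; have c8 : 0 < 8 * c0 by rewrite mulr_gt0.
rewrite -(ler_pM2l c8).
have -> : 8 * c0 * (CJ ^+ 2 / (8 * c0) * eta * A) = CJ ^+ 2 * (eta * A) by field; rewrite gt_eqF.
have h1 := ler_wpM2l (sqr_ge0 CJ) (le_trans SA (ler_wpM2r A0 he)).
have h2 := sqr_ge0 (2 * c0 * n - CJ * S).
rewrite -subr_ge0; rewrite -subr_ge0 in h1.
apply: le_trans (addr_ge0 h1 h2) _; rewrite le_eqVlt; apply/orP; left; apply/eqP; by field.
Qed.

Lemma step_algebra (dE I1 I3 Id Iad Idd S A n dt hh eta lam CJ c0 : R) :
  0 < c0 -> 0 < lam -> 0 < hh -> hh <= eta -> 0 <= A ->
  dE <= I1 + 2^-1 * I3 - c0 / 2 * n ^+ 2 -> I1 <= - Id + dt * S + Iad -> I3 <= CJ * n * S ->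
  Iad <= 2^-1 * (lam * A) + Idd -> S ^+ 2 <= hh * A ->
  dE <= - Id + ((lam + CJ ^+ 2 / (8 * c0) * eta) * A + Idd) + hh * (dt ^+ 2 / (2 * lam)).
Proof.
move=> c00 l0 h0 he A0 h1 h2 h3 h4 h5.
have y := young_interval dt l0 h0 h5; have z := absorb n CJ c00 A0 he h5.
move: h1 h2 h3 h4 y z; rewrite [(lam + _) * A]mulrDl; move: (dt * S) (CJ * n * S) (_ * n ^+ 2) (hh * _) (_ * eta * A) (lam * A).
move=> *; lra.
Qed.

Lemma dissipation_algebra (P U X Y N G c : R) : P <= X -> U <= Y -> Y <= N ->
  X <= 2^-1 * (G + 1) -> 0 <= N -> 0 <= G ->
  2^-1 * U + P - (2^-1 + c) <= 2^-1 * (N + G) - c /\ - c <= 2^-1 * (N + G) - c.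
Proof. by move=> *; split; lra. Qed.

End step_algebra.

(** * The energy along one weak solution *)

Section trajectory.
Context {R : realType}.
Notation pt := (R * R)%type.
Notation mpt := (measurableTypeR R * measurableTypeR R)%type.
Notation mt := (measurableTypeR R).
Notation mu2 := (@mu2 R).
Notation leb := (@lebesgue_measure R).
Notation vfield := (@vfield R).
Variable D : set pt.
Hypothesis oD : open D.
Hypothesis Dfin : (mu2 D < +oo)%E.
Let mD : measurable (D : set mpt). Proof. exact: open_measurable2. Qed.
Notation vmem u := (@mem_of _ (Vdiv D) u).
Notation vnorm := (vnorm D).
Variables (J : pt -> R) (nu F : R -> R) (nu1 nu2 c0 c7 c8 q : R).
Hypothesis J1 : W1p setT 1%:E J.
Hypothesis Jev : {ae mu2, forall x : pt, J x = J (- x)}.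
Hypotheses (cnu : continuous nu) (nu10 : 0 < nu1) (nub : forall s, nu1 <= nu s <= nu2).
Hypothesis CF : Ck 2 F.
Hypotheses (c00 : 0 < c0) (c70 : 0 < c7) (q0 : 0 < q).
Hypothesis Fc0 : {ae mu2, forall x : pt, D x -> forall s, c0 <= (F^`(2))%classic s + acoef D J x}.
Hypothesis Fc7 : {ae mu2, forall x : pt, D x -> forall s,
  c7 * (`|s| `^ (2 * q)) - c8 <= (F^`(2))%classic s + acoef D J x}.
Variables (h : dual (Vdiv D)) (Ch : R).
Hypothesis mh : mem_of h.
Hypotheses (Ch0 : 0 <= Ch) (hb : forall v : Vdiv D, vmem v -> `|h v| <= Ch * vnorm v).
Variables (T : R) (z0 : @state R) (z : R -> @state R).
Hypothesis W : weak_solution D J nu F q h T z0 z.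

Let u t : vfield := (z t).1.
Let phi t : pt -> R := (z t).2.
Let mu t : pt -> R := chem_potential D J F (phi t).
Notation I := (`]0, T[%classic : set mt).
Let mI : measurable I := measurable_oo 0 T.
Let Ifin : (leb I < +oo)%E := finite_oo 0 T.

Let us t : t \in `[0, T] -> forall i, sqi mu2 D (u t i).
Proof. by move=> tT; have [H _] := ws_u_cont W; exact: (Gdiv_sqi oD (H t tT)). Qed.

Let ps t : t \in `[0, T] -> sqi mu2 D (phi t).
Proof. by move=> tT; have [H _] := ws_phi_cont W; exact: (L2_sqi oD (H t tT)). Qed.

Lemma inH1_sub f g : inH1 D f -> inH1 D g -> inH1 D (f - g).
Proof.
move=> fH gH; have := (inH1_lin oD (-1) gH fH).1.
by congr inH1; apply/funext => x; rewrite mulN1r addrC.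
Qed.

Lemma gradnorm_dist f g : inH1 D f -> inH1 D g -> gradnorm D f - gradnorm D g <= gradnorm D (f - g).
Proof.
move=> fH gH; have := gradnorm_lin oD 1 (inH1_sub fH gH) gH.
have E : (fun x => 1 * (f - g) x + g x) = f by apply/funext => x; rewrite !fctE mul1r subrK.
by rewrite E normr1 mul1r lerBlDr.
Qed.

(** What holds at almost every time. [L] and [K] are independent of the time; only the gradient
    norms [gu] and [G] vary, in a square-integrable way. *)
Definition good (gu G : R -> R) (L K : R) (r : R) : Prop :=
  [/\ vmem (u r), vnorm (u r) = gu r /\ gradnorm D (mu r) = G r, forall i, n2 mu2 D (u r i) <= L,
    inH1 D (mu r) & forall f, H10 D f -> sqi mu2 D (fun x => f x * phi r x) /\
      n2 mu2 D (fun x => f x * phi r x) <= K * gradnorm D f].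

Lemma good_times : exists (gu G : mt -> R) (L K : R),
  [/\ sqi leb I gu, sqi leb I G, 0 <= K & {ae leb, forall r, r \in `]0, T[ -> good gu G L K r}].
Proof.
have [_ [gu /(Lfun2P leb mI) gus Hu]] := ws_u_L2 W.
have [smu [gm /(Lfun2P leb mI) gms Hm]] := ws_mu W.
have [_ [gL gLL HL]] := ws_u_Linfty W; have [_ [L HL']] := LfunyW mI gLL.
have [_ [gQ gQL HQ]] := ws_phi_Lq W; have [_ [Q HQ']] := LfunyW mI gQL.
(* [Bochner] provides a representative of the full norm of [mu]; that of the gradient norm comes
   from its Lipschitz dependence on the function. *)
have [|v w /(W12P oD) vH /(W12P oD) wH|G mG HG] := @strong_meas_lip R T 1 (H1 D) mu (gradnorm D) smu.
- by apply: ae_mono Hm => r hr r0; case: (hr r0).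
- have h1 := gradnorm_dist vH wH; have h2 := gradnorm_dist wH vH.
  have e1 := le_trans h1 (gradnorm_le_H1 oD (inH1_sub vH wH)).
  have e2 := le_trans h2 (gradnorm_le_H1 oD (inH1_sub wH vH)).
  rewrite mul1r ler_norml; apply/andP; split; last exact: e1.
  rewrite lerNl opprB; apply: le_trans e2 _; rewrite le_eqVlt; apply/orP; left; apply/eqP.
  by apply: (@nrmC R (H1 D) (H1_seminormed oD) w v); exact/(W12P oD).
have [K0 K00 HK] := H10_mul_Lq oD Dfin q0.
have r1 : 1 <= 2 + 2 * q by rewrite ler_wpDr ?mulr_ge0 ?ltW// ltr1n.
(* The square root of the constant of [H10_mul_Lq], with the bound [Q] on the L^(2+2q) norm
   inserted. *)
exists gu, G, L, (Num.sqrt (K0 * (1 + `|Q| `^ (2 + 2 * q)))); split => //.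
- split; first exact: measurable_funTS.
  apply: (intg_dom_ae mI _ gms.2); first by apply: measurable_funX; exact: measurable_funTS.
  apply: ae_mono (ae_and HG Hm) => r [h1 h2] r0; have [/(W12P oD) mH mn] := h2 r0.
  rewrite -(h1 r0) -mn ger0_norm ?sqr_ge0//.
  have g0 := gradnorm_ge0 D (mu r); have gle := gradnorm_le_H1 oD mH.
  by rewrite lerXn2r// nnegrE; exact: le_trans gle.
- have := ae_and (ae_and Hu Hm) (ae_and (ae_and HL HL') (ae_and HG (ae_and HQ HQ'))).
  apply: ae_mono => r [[h1 h2] [[h3 h4] [h5 [h6 h7]]]] r0.
  have [uV un] := h1 r0; have [/(W12P oD) mH mn] := h2 r0; have [uG uL] := h3 r0.
  have [pQ pn] := h6 r0.
  split => //; first by split; [exact: un|exact: h5].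
    move=> i; apply: le_trans (n2_le_L2v oD i (Gdiv_sqi oD uG)) _.
    apply: (le_trans _ (h4 r0)); rewrite -uL; exact: ler_norm.
  have [mp ip] := LfunrW mD r1 pQ.
  have IQ : \int[mu2]_(x in D) (`|phi r x| `^ (2 + 2 * q)) <= `|Q| `^ (2 + 2 * q).
    rewrite (LnormrE mD r1 ip); apply: ge0_ler_powR.
    + by rewrite addr_ge0// mulr_ge0// ltW.
    + by rewrite nnegrE; exact: fine_ge0 (Lnorm_ge0 _ _ _).
    + by rewrite nnegrE.
    + by have := h7 r0; rewrite -pn => h8; apply: le_trans (ler_norm _) (le_trans h8 (ler_norm _)).
  move=> f fH; have [fs fn] := HK f (phi r) fH mp ip; split=> //.
  rewrite -(@ler_pXn2r _ 2) ?nnegrE ?n2_ge0 ?mulr_ge0 ?sqrtr_ge0 ?gradnorm_ge0//.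
  have K2 : 0 <= K0 * (1 + `|Q| `^ (2 + 2 * q)) by rewrite mulr_ge0// addr_ge0// powR_ge0.
  apply: le_trans fn _; rewrite exprMn (sqr_sqrtr K2).
  by rewrite mulrC ler_wpM2r ?sqr_ge0// ler_wpM2l// lerD2l.
Qed.

Let Vs := Vdiv_seminormed oD.
Let Hs := H1_seminormed oD.

Lemma u_increment (v : vfield) : vmem v -> exists g, [/\ intg leb I g,
  {ae leb, forall r, r \in `]0, T[ -> momentum D nu h (u r) (phi r) (mu r) v = g r} &
  forall s t, 0 <= s -> s < t -> t < T ->
    ipv D (u t) v - ipv D (u s) v = \int[leb]_(r in `]s, t]) g r].
Proof.
move=> vV; have [u' [td Bu eqn]] := ws_u_eq W.
(* Any exponent above 1 suffices for integrated equations; 2 - 1/2 is taken. *)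
have g2 : 0 < (2^-1 : R) < 1 by rewrite invr_gt0 ltr0n invf_lt1// ltr1n.
have r1 : 1 <= (2 - 2^-1 : R) by lra.
have [i] := ws_u_cont W; have cont := weakly_continuous_ipv oD (ws_u_cont W) (fun i => vmem_sqi oD i vV).
move=> _; have [g [gi fg inc]] := weak_increment Vs r1 (Bu _ g2) td vV cont.
exists g; split=> //; apply: ae_mono (ae_and fg (eqn v vV)) => r [h1 h2] r0.
rewrite -(h1 r0); have := h2 r0; rewrite /momentum.
rewrite -/(u r) -/(phi r) -/(mu r).
move: (u' r v) (viscous _ _ _ _ _) (trilinear _ _ _ _) (ip_fgrad _ _ _ _) (h v) => *; lra.
Qed.

Lemma phi_increment (psi : pt -> R) : inH1 D psi -> exists g, [/\ intg leb I g,
  {ae leb, forall r, r \in `]0, T[ -> mass D (u r) (phi r) (mu r) psi = g r} &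
  forall s t, 0 <= s -> s < t -> t < T ->
    ip D (phi t) psi - ip D (phi s) psi = \int[leb]_(r in `]s, t]) g r].
Proof.
move=> pH; have pm : @mem_of _ (H1 D) psi by exact/(W12P oD).
have [p' [td Bp eqn]] := ws_phi_eq W.
have g2 : 0 < (2^-1 : R) < 1 by rewrite invr_gt0 ltr0n invf_lt1// ltr1n.
have r1 : 1 <= (2 - 2^-1 : R) by lra.
have cont := weakly_continuous_ip oD (ws_phi_cont W) (inH1_sqi pH).
have [g [gi fg inc]] := weak_increment Hs r1 (Bp _ g2) td pm cont.
exists g; split=> //; apply: ae_mono (ae_and fg (eqn psi pm)) => r [h1 h2] r0.
rewrite -(h1 r0); have := h2 r0; rewrite /mass.
rewrite -/(u r) -/(phi r) -/(mu r).
move: (p' r psi) (ip_grad _ _ _) (ip_fgrad _ _ _ _) => *; lra.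
Qed.

Lemma Rint_oc_schwarz (f : mt -> R) s t : sqi leb I f -> 0 <= s -> s <= t -> t < T ->
  (\int[leb]_(r in `]s, t]) f r) ^+ 2 <= (t - s) * \int[leb]_(r in `]s, t]) f r ^+ 2.
Proof.
move=> fs s0 st tT; have mA := measurable_oc s t.
have Afin : (leb (`]s, t]%classic : set mt) < +oo)%E by rewrite lebesgue_oc// ltry.
have fA : sqi leb (`]s, t]%classic : set mt) f.
  split; last exact: intg_oc fs.2 s0 tT.
  exact: intg_meas (intg_oc (sqi_intg mI Ifin fs) s0 tT).
have c1 := sqi_cst mA 1 Afin; have := cauchy_schwarz_sqr mA c1 fA.
have -> : \int[leb]_(r in `]s, t]) (1 * f r) = \int[leb]_(r in `]s, t]) f r.
  by apply: eq_Rint => r _; rewrite mul1r.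
by rewrite expr1n (Rint_cst _ mA Afin) (congr1 fine (lebesgue_oc st)) mul1r.
Qed.

Definition energy_at t : R := 2^-1 * ipv D (u t) (u t) + potE D J F (phi t).
Definition finite_at t : Prop := intg mu2 D (dens D J F (phi t)).

Let hlin : forall a (v w : vfield), vmem v -> vmem w -> h (a *: v + w : vfield) = a * h v + h w.
Proof. exact: mh.1. Qed.

Let oc_I s t : 0 <= s -> t < T -> forall r, r \in `]s, t] -> r \in `]0, T[.
Proof.
by move=> s0 tT r; rewrite !in_itv/= => /andP[sr rt]; rewrite (le_lt_trans s0 sr) (le_lt_trans rt).
Qed.

(** [al] is the square-integrable bound of the two forms, [d] the dissipation. The first estimate
    will be used with constants and with convolutions, the second with [u t] and [mu t]; there [w]
    is any integrable majorant, since the distance to [u r] is not known to be measurable in [r]. *)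
Lemma energy_increment : exists (d al : mt -> R), [/\ intg leb I d, sqi leb I al,
  {ae leb, forall r, r \in `]0, T[ -> vmem (u r) /\ inH1 D (mu r)},
  {ae leb, forall r, r \in `]0, T[ -> 0 <= al r /\
    d r = 2^-1 * (nu1 * vnorm (u r) ^+ 2 + gradnorm D (mu r) ^+ 2) - Ch ^+ 2 / (2 * nu1)} &
  forall psi, inH1 D psi -> forall s t, 0 <= s -> s < t -> t < T ->
    (ip D (phi t) psi - ip D (phi s) psi <= gradnorm D psi * \int[leb]_(r in `]s, t]) al r) /\
    forall (v : vfield) (w : mt -> R), vmem v -> intg leb (`]s, t]%classic : set mt) w ->
      {ae leb, forall r, r \in `]s, t] -> 
         al r * (vnorm (v - u r : vfield) + gradnorm D (fun x => psi x - mu r x)) <= w r} ->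
      ipv D (u t) v - ipv D (u s) v + (ip D (phi t) psi - ip D (phi s) psi) <=
        - (\int[leb]_(r in `]s, t]) d r) + \int[leb]_(r in `]s, t]) w r].
Proof.
have [gu [G [L [K [gus Gs K0 aeG]]]]] := good_times.
pose c := 8 * nu2 + 8 * L + 4 * K + Ch + 2.
pose al (r : mt) := c * (1 + gu r + G r).
pose d (r : mt) := 2^-1 * (nu1 * gu r ^+ 2 + G r ^+ 2) - Ch ^+ 2 / (2 * nu1).
have als : sqi leb I al.
  apply: (sqiZ mI); apply: (sqiD mI) => //; apply: (sqiD mI) => //; exact: sqi_cst.
have di : intg leb I d.
  apply: (intgB mI); last exact: (sqi_intg mI Ifin (sqi_cst mI _ Ifin)).
  by apply: (intgZ mI); apply: (intgD mI _ Gs.2); exact: intgZ gus.2.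
exists d, al; split=> //.
- by apply: ae_mono aeG => r hr r0; have [? _ _ ? _] := hr r0.
- apply: ae_mono aeG => r hr r0; have [_ [E1 E2] uL _ _] := hr r0.
  rewrite /d /al -E1 -E2; split=> //.
  have L0 : 0 <= L := le_trans (n2_ge0 _ _ _) (uL ord0).
  have n20 : 0 <= nu2 by have /andP[a1 a2] := nub 0; apply: le_trans a2; exact: le_trans (ltW nu10) a1.
  have v0 := vnorm_ge0 D (u r); have g0 := gradnorm_ge0 D (mu r).
  by rewrite mulr_ge0// /c !addr_ge0// mulr_ge0.
move=> psi pH s t s0 st tT; have mA := measurable_oc s t.
have [g2 [g2i mg2 inc2]] := phi_increment pH; rewrite (inc2 _ _ s0 st tT).
have pr r : r \in `]0, T[ -> sqi mu2 D (phi r) by move=> r0; apply: ps; exact: subset_itv_oo_cc.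
have alA := intg_oc (sqi_intg mI Ifin als) s0 tT.
split.
  rewrite -(Rint_Z mA _ alA); apply: (le_Rint_ae mA (intg_oc g2i s0 tT) (intgZ mA _ alA)).
  apply: ae_mono (ae_and mg2 aeG) => r [h1 h2] rA; have r0 := oc_I s0 tT rA.
  have [uV [E1 E2] uL mH HK] := h2 r0; rewrite -(h1 r0).
  have b := mass_bound oD uV mH K0 HK pH; apply: le_trans (ler_norm _) (le_trans b _).
  rewrite [leRHS]mulrC ler_wpM2r ?gradnorm_ge0//.
  have L0 : 0 <= L := le_trans (n2_ge0 _ _ _) (uL ord0).
  have n20 : 0 <= nu2 by have /andP[a1 a2] := nub 0; apply: le_trans a2; exact: le_trans (ltW nu10) a1.
  have := (coefficient_bound n20 L0 K0 Ch0 (vnorm_ge0 D (u r)) (gradnorm_ge0 D (mu r))).2.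
  by rewrite E1 E2.
move=> v w vV wi wb; have [g1 [g1i mg1 inc1]] := u_increment vV.
rewrite (inc1 _ _ s0 st tT).
have i1 := intg_oc g1i s0 tT; have i2 := intg_oc g2i s0 tT; have i3 := intg_oc di s0 tT.
rewrite -(Rint_D mA i1 i2) -(Rint_N mA i3) -(Rint_D mA (intgN mA i3) wi).
apply: (le_Rint_ae mA (intgD mA i1 i2) (intgD mA (intgN mA i3) wi)).
apply: ae_mono (ae_and (ae_and mg1 mg2) (ae_and aeG wb)) => r [[h1 h2] [h3 h4]] rA.
have r0 := oc_I s0 tT rA; have [uV [E1 E2] uL mH HK] := h3 r0.
rewrite -(h1 r0) -(h2 r0).
have b := forms_bound oD Dfin cnu nu10 nub hlin hb uV mH (pr r r0) uL K0 Ch0 HK vV pH.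
apply: le_trans b _; rewrite /d -E1 -E2 lerD2l.
by apply: le_trans (h4 rA); rewrite /al -E1 -E2.
Qed.

(** The hypothesis of [energy_scheme]. The cost [g t] at the right endpoint appears because the
    oscillation bound [del t] multiplies the integral of [al] over the step; the rest is integrated
    over the step in [b]. *)
Lemma energy_steps (d al : mt -> R) : intg leb I d -> sqi leb I al ->
  {ae leb, forall r, r \in `]0, T[ -> vmem (u r) /\ inH1 D (mu r)} ->
  {ae leb, forall r, r \in `]0, T[ -> 0 <= al r} ->
  (forall psi, inH1 D psi -> forall s t, 0 <= s -> s < t -> t < T ->
    (ip D (phi t) psi - ip D (phi s) psi <= gradnorm D psi * \int[leb]_(r in `]s, t]) al r) /\
    forall (v : vfield) (w : mt -> R), vmem v -> intg leb (`]s, t]%classic : set mt) w ->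
      {ae leb, forall r, r \in `]s, t] -> 
         al r * (vnorm (v - u r : vfield) + gradnorm D (fun x => psi x - mu r x)) <= w r} ->
      ipv D (u t) v - ipv D (u s) v + (ip D (phi t) psi - ip D (phi s) psi) <=
        - (\int[leb]_(r in `]s, t]) d r) + \int[leb]_(r in `]s, t]) w r) ->
  forall e, 0 < e -> exists eta (b g : R -> R) (Q : R -> Prop),
    [/\ 0 < eta, intg leb I b /\ intg leb I g,
    (forall t, 0 <= b t) /\ (forall t, 0 <= g t),
    \int[leb]_(t in `]0, T[) b t <= e /\ \int[leb]_(t in `]0, T[) g t <= e &
    {ae leb, forall t, t \in `]0, T[ -> Q t} /\
    forall s t, 0 <= s -> s < t -> t < T -> t - s < eta -> finite_at s -> Q t -> finite_at t /\
      energy_at t - energy_at s <=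
      (- (\int[leb]_(r in `]s, t]) d r)) + \int[leb]_(r in `]s, t]) b r + (t - s) * g t].
Proof.
move=> di als aeV al0 inc e e0.
have [CJ CJ0 HJ] := convol_H1 oD Dfin J1.
pose A := \int[leb]_(r in I) al r ^+ 2.
have A0 : 0 <= A by apply: Rintegral_ge0 => r _; exact: sqr_ge0.
have A1 : 0 < A + 1 by rewrite ltr_wpDl.
(* Makes [lam * A] at most [e / 4]. *)
pose lam := e / (4 * (A + 1)); have lam0 : 0 < lam by rewrite divr_gt0// mulr_gt0.
pose k2 := CJ ^+ 2 / (8 * c0).
have k20 : 0 <= k2 by rewrite divr_ge0 ?sqr_ge0// mulr_ge0// ltW.
have k21 : 0 < k2 + 1 by rewrite ltr_wpDl.
(* With this step length the absorbed nonlocal remainder [k2 * eta * A] is at most [e / 4]. *)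
have eta00 : 0 < e / (4 * (k2 + 1) * (A + 1)) by rewrite divr_gt0// !mulr_gt0.
(* Makes the integral of [del ^+ 2] at most [lam * e / 2], hence that of [g] at most [e / 4]. *)
have e'0 : 0 < lam * e / 8 by rewrite divr_gt0// mulr_gt0.
have [eta1 [du [Pu [eta10 dus idu du0 [aePu HPu]]]]] := bochner_osc Vs (ws_u_L2 W) e'0.
have [eta2 [dm [Pm [eta20 dms idm dm0 [aePm HPm]]]]] := bochner_osc Hs (ws_mu W) e'0.
pose eta := Num.min (e / (4 * (k2 + 1) * (A + 1))) (Num.min eta1 eta2).
have etap : 0 < eta by rewrite !lt_min eta00 eta10.
pose del (r : mt) := du r + dm r.
have dels : sqi leb I del := sqiD mI dus dms.
have l2 : 0 < 2 * lam by rewrite mulr_gt0.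
pose g (r : mt) := del r ^+ 2 / (2 * lam).
pose b (r : mt) := (lam + k2 * eta) * al r ^+ 2 + g r.
have gi : intg leb I g by exact: intgZr dels.2.
have bi : intg leb I b by apply: (intgD mI _ gi); exact: intgZ als.2.
have g0 r : 0 <= g r by rewrite divr_ge0 ?sqr_ge0// ltW.
have lk : 0 <= lam + k2 * eta := addr_ge0 (ltW lam0) (mulr_ge0 k20 (ltW etap)).
have Ig : \int[leb]_(r in I) g r <= e / 4.
  have i1 := intgZ mI 2 dus.2; have i2 := intgZ mI 2 dms.2.
  have h1 : \int[leb]_(r in I) del r ^+ 2 <= 2 * (lam * e / 8) + 2 * (lam * e / 8).
    apply: (@le_trans _ _ (\int[leb]_(r in I) (2 * du r ^+ 2 + 2 * dm r ^+ 2))).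
      apply: (le_Rint mI dels.2 (intgD mI i1 i2)) => r _.
      by have := sqr_ge0 (du r - dm r); rewrite /del !expr2; nra.
    by rewrite (Rint_D mI i1 i2) (Rint_Z mI _ dus.2) (Rint_Z mI _ dms.2) lerD// ler_pM2l.
  have -> : \int[leb]_(r in I) g r = (2 * lam)^-1 * \int[leb]_(r in I) del r ^+ 2.
    by rewrite -(Rint_Z mI _ dels.2); apply: eq_Rint => r _; rewrite mulrC.
  by rewrite mulrC ler_pdivrMr//; move: h1; lra.
exists eta, b, g, (fun t => [/\ Pu t, Pm t, vmem (u t) & inH1 D (mu t)]); split => //.
- by split=> // r; rewrite addr_ge0// mulr_ge0// sqr_ge0.
- split; last by apply: le_trans Ig _; rewrite ler_pdivrMr// ler_peMr ?ler1n// ltW.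
  rewrite (Rint_D mI (intgZ mI _ als.2) gi) (Rint_Z mI _ als.2) -/A.
  have h1 : lam * A <= e / 4.
    have E : 4 * (lam * A) + 4 * lam = e by rewrite /lam; field; rewrite gt_eqF.
    by move: E lam0; move: (lam * A) => *; lra.
  have h2 : k2 * eta * A <= e / 4.
    have e1 : eta <= e / (4 * (k2 + 1) * (A + 1)) by rewrite ge_min lexx.
    have E : (k2 + 1) * (e / (4 * (k2 + 1) * (A + 1))) * (A + 1) = e / 4.
      by field; rewrite !gt_eqF.
    have kk : k2 <= k2 + 1 by rewrite lerDl.
    have AA : A <= A + 1 by rewrite lerDl.
    rewrite -E; exact: ler_pM (mulr_ge0 k20 (ltW etap)) A0 (ler_pM k20 (ltW etap) kk e1) AA.
  by rewrite mulrDl; move: Ig; lra.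
split.
  apply: ae_mono (ae_and aeV (ae_and aePu aePm)) => r [h1 [h2 h3]] r0; have [? ?] := h1 r0.
  by split=> //; [exact: h2|exact: h3].
move=> s t s0 st tT ts oks [Put Pmt uV mH].
have t0 : t \in `]0, T[ by rewrite in_itv/= (le_lt_trans s0 st).
have tc : t \in `[0, T] := subset_itv_oo_cc t0.
have sc : s \in `[0, T] by rewrite in_itv/= s0 ltW// (lt_trans st).
have okt : finite_at t := intg_dens_chem oD Dfin J1 CF c00 c70 q0 Fc0 Fc7 (ps tc) (inH1_sqi mH).
split=> //.
pose dl : mpt -> R := fun x => phi t x - phi s x.
have dls : sqi mu2 D dl := sqiB mD (ps tc) (ps sc).
have [JH Jn Jg] := HJ dl dls.
have mA := measurable_oc s t.
have alA := intg_oc (sqi_intg mI Ifin als) s0 tT; have al2A := intg_oc als.2 s0 tT.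
have gA := intg_oc gi s0 tT.
have adi := intg_oc (sqi_mul mI als dels) s0 tT.
have wi : intg leb (`]s, t]%classic : set mt) (fun r => del t * al r + al r * del r).
  by apply: (intgD mA) => //; exact: intgZ.
pose S := \int[leb]_(r in `]s, t]) al r.
have S0 : 0 <= S.
  apply: Rint_ge0_ae; apply: ae_mono al0 => r hr rA; exact: hr (oc_I s0 tT rA).
(* The distances of [u t] and [mu t] to their values at [r] are bounded by the oscillation functions
   at both times. *)
have wb : {ae leb, forall r, r \in `]s, t] ->
    al r * (vnorm (u t - u r : vfield) + gradnorm D (fun x => mu t x - mu r x)) <=
      del t * al r + al r * del r}.
  apply: ae_mono (ae_and (ae_and al0 aeV) (ae_and aePu aePm)) => r [[a1 a2] [a3 a4]] rA.
  have r0 := oc_I s0 tT rA; have [urV mrH] := a2 r0.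
  have tr : `|t - r| < Num.min eta1 eta2.
    move: rA; rewrite in_itv/= => /andP[sr rt]; rewrite ger0_norm ?subr_ge0//.
    have : t - s < Num.min eta1 eta2 by apply: lt_le_trans ts _; rewrite ge_min lexx orbT.
    by apply: le_lt_trans; rewrite lerD2l lerN2 ltW.
  move: tr; rewrite lt_min => /andP[tr1 tr2].
  have b1 := HPu t r t0 r0 Put (a3 r0) tr1; have b2 := HPm t r t0 r0 Pmt (a4 r0) tr2.
  have b3 := le_trans (gradnorm_le_H1 oD (inH1_sub mH mrH)) b2.
  rewrite [del t * _]mulrC -mulrDr; apply: ler_wpM2l; first exact: a1.
  have -> : del t + del r = (du t + du r) + (dm t + dm r) by rewrite addrACA.
  exact: lerD b1 b3.
have h2 := (inc _ mH s t s0 st tT).2 (u t) _ uV wi wb.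
rewrite (Rint_D mA (intgZ mA _ alA) adi) (Rint_Z mA _ alA) -/S [leRHS]addrA in h2.
(* [convol D J dl] is an admissible test function with gradient at most [CJ] times the norm of
   [dl]. *)
have h3 : ip D dl (convol D J dl) <= CJ * n2 mu2 D dl * S.
  rewrite (ip_Bl oD (ps tc) (ps sc) (inH1_sqi JH)).
  by apply: le_trans (inc _ JH s t s0 st tT).1 _; rewrite ler_wpM2r.
have h4 : \int[leb]_(r in `]s, t]) (al r * del r) <=
    2^-1 * (lam * \int[leb]_(r in `]s, t]) al r ^+ 2) + \int[leb]_(r in `]s, t]) g r.
  have i1 := intgZ mA (2^-1 * lam) al2A.
  rewrite mulrA -(Rint_Z mA _ al2A) -(Rint_D mA i1 gA); apply: (le_Rint mA adi (intgD mA i1 gA)) => r _.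
  have le1 : al r ^+ 2 <= 1 * al r ^+ 2 by rewrite mul1r.
  by have := young_interval (del r) lam0 ltr01 le1; rewrite mul1r [del r * _]mulrC [2^-1 * _]mulrA.
have h5 := Rint_oc_schwarz als s0 (ltW st) tT; rewrite -/S in h5.
have h1 : energy_at t - energy_at s <=
    (ipv D (u t) (u t) - ipv D (u s) (u t) + (ip D (phi t) (mu t) - ip D (phi s) (mu t))) +
    2^-1 * ip D dl (convol D J dl) - c0 / 2 * n2 mu2 D dl ^+ 2.
  have p1 := ipv_polar oD (us tc) (us sc).
  have p2 := potE_step oD Dfin J1 Jev CF Fc0 (ps tc) (inH1_sqi mH) (ps sc) okt oks (erefl dl).
  rewrite -(ip_n2 D dl); move: p1 p2; rewrite /energy_at -/(mu t).
  move: (ipv D (u t) (u t)) (ipv D (u s) (u s)) (ipv D (u s) (u t)) (potE _ _ _ (phi t)) (potE _ _ _ (phi s))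
    (ip D (phi t) _) (ip D (phi s) _) (ip D dl (convol _ _ _)) (c0 / 2 * _) => *; lra.
have ts0 : 0 < t - s by rewrite subr_gt0.
have A2 : 0 <= \int[leb]_(r in `]s, t]) al r ^+ 2 by apply: Rintegral_ge0 => r _; exact: sqr_ge0.
have := step_algebra c00 lam0 ts0 (ltW ts) A2 h1 h2 h3 h4 h5.
have -> : \int[leb]_(r in `]s, t]) b r = (lam + CJ ^+ 2 / (8 * c0) * eta) *
    \int[leb]_(r in `]s, t]) al r ^+ 2 + \int[leb]_(r in `]s, t]) g r.
  by rewrite (Rint_D mA (intgZ mA _ al2A) gA) (Rint_Z mA _ al2A).
by [].
Qed.

Lemma continuous_left (y : R -> R) t e : {within `[0, T], continuous y} -> t \in `]0, T[ -> 0 < e ->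
  exists2 th, 0 < th & forall s, t - th < s -> s <= t -> `|y s - y t| <= e.
Proof.
move=> cy tT e0; have T0 : 0 < T by move: tT; rewrite in_itv/= => /andP[]; exact: lt_trans.
have cyt : {for t, continuous y} := within_continuous_continuous T0 cy tT.
move/cvgrPdist_le: cyt => /(_ _ e0) /nbhs_ballP[th /= th0 H]; exists th => // s ts st.
by rewrite distrC; apply: H; rewrite /ball/= ger0_norm ?subr_ge0// ltrBlDr addrC -ltrBlDr.
Qed.

Lemma Rint_oc_small (f : mt -> R) e : intg leb I f -> 0 < e ->
  exists2 th, 0 < th & forall s t, 0 <= s -> s <= t -> t < T -> t - s < th ->
    `|\int[leb]_(r in `]s, t]) f r| <= e.
Proof.
move=> fi e0.
have fT : intg leb setT (f \_ I) by apply: intg_restrict => //; rewrite setTI.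
have [th [th0 H]] := integral_normr_continuous fT e0; exists th => // s t s0 st tT ts.
have mA := measurable_oc s t; have fA := intg_oc fi s0 tT.
have lt : (leb (`]s, t]%classic : set mt) < th%:E)%E by rewrite lebesgue_oc// lte_fin.
apply: le_trans (norm_Rint_le mA fA (intg_abs fA) _) _; first exact: aeW.
apply: le_trans (ltW (H _ mA lt)); rewrite le_eqVlt; apply/orP; left; apply/eqP.
by apply: eq_Rint => r rA; rewrite patchE mem_set//; exact: (oc_I s0 tT rA).
Qed.

(** The scheme only reaches some good times [t] just before [t2]; weak continuity and lower
    semicontinuity extend the inequality to every [t2], together with finiteness of the energy
    there. *)
Lemma energy_decay : exists d : mt -> R, [/\ intg leb I d,
  {ae leb, forall r, r \in `]0, T[ -> [/\ vmem (u r), inH1 D (mu r) &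
    d r = 2^-1 * (nu1 * vnorm (u r) ^+ 2 + gradnorm D (mu r) ^+ 2) - Ch ^+ 2 / (2 * nu1)]} &
  forall t1 t2, 0 <= t1 -> t1 < t2 -> t2 < T -> finite_at t1 ->
    finite_at t2 /\ energy_at t2 <= energy_at t1 - (\int[leb]_(r in `]t1, t2]) d r)].
Proof.
have [d [al [di als aeV aed inc]]] := energy_increment.
have al0 : {ae leb, forall r, r \in `]0, T[ -> 0 <= al r}.
  by apply: ae_mono aed => r hr r0; have [] := hr r0.
have [_ [gP gPL HP]] := ws_phi_Linfty W; have [_ [N HN]] := LfunyW mI gPL.
(* Bounds the norm of [phi] at the selected times, so that the gradient of [convol D J dl] stays
   bounded as [t] approaches [t2]. *)
pose P r := n2 mu2 D (phi r) <= N.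
have aeP : {ae leb, forall r, r \in `]0, T[ -> P r}.
  apply: ae_mono (ae_and HP HN) => r [h1 h2] r0; have [_ nr] := h1 r0.
  have pr : sqi mu2 D (phi r) by apply: ps; exact: subset_itv_oo_cc.
  rewrite /P -(_ : Lp_norm D 2%:E (phi r) = n2 mu2 D (phi r)); last by rewrite /Lp_norm Lnorm2E.
  by apply: le_trans (h2 r0); rewrite -nr; exact: ler_norm.
have scheme := energy_scheme di aeP (energy_steps di als aeV al0 inc).
exists d; split=> //.
  by apply: ae_mono (ae_and aeV aed) => r [h1 h2] r0; have [? ?] := h1 r0; have [] := h2 r0; split.
move=> t1 t2 t10 t12 t2T ok1.
have t2I : t2 \in `]0, T[ by rewrite in_itv/= (le_lt_trans t10 t12).
have t2c : t2 \in `[0, T] := subset_itv_oo_cc t2I.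
have [CJ CJ0 HJ] := convol_H1 oD Dfin J1.
(* The kinetic energy at [t2] is moved to this side, leaving a bound on [potE] alone; [ipv_polar]
   and weak continuity take care of the kinetic part. *)
pose c := energy_at t1 - (\int[leb]_(r in `]t1, t2]) d r) - 2^-1 * ipv D (u t2) (u t2).
have ali := sqi_intg mI Ifin als.
have lsc : finite_at t2 /\ potE D J F (phi t2) <= c.
  apply: (potE_lsc oD Dfin J1 Jev CF c00 c70 q0 Fc0 Fc7 (ps t2c)) => w1 w2 eps w1s w2s e0.
  have e4 : 0 < eps / 4 by rewrite divr_gt0.
  have cphi w (ws : sqi mu2 D w) := weakly_continuous_ip oD (ws_phi_cont W) ws.
  have [a1 a10 H1'] := continuous_left (cphi _ w1s) t2I e0.
  have [a2 a20 H2'] := continuous_left (cphi _ w2s) t2I e0.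
  have [a3 a30 H3'] := continuous_left (weakly_continuous_ipv oD (ws_u_cont W) (us t2c)) t2I e4.
  have [a4 a40 H4'] := Rint_oc_small di e4.
  (* Bounds the gradient of [convol D J dl]; the integral of [al] is then made smaller than
     [eps / M]. *)
  pose M := CJ * (`|N| + n2 mu2 D (phi t2)) + 1.
  have M0 : 0 <= CJ * (`|N| + n2 mu2 D (phi t2)) by rewrite mulr_ge0// addr_ge0// n2_ge0.
  have M1 : 0 < M by rewrite ltr_wpDl.
  have [a5 a50 H5'] := Rint_oc_small ali (divr_gt0 e0 M1).
  pose th := Num.min (Num.min (eps / 4) a1) (Num.min (Num.min a2 a3) (Num.min a4 a5)).
  have th0 : 0 < th by rewrite !lt_min e4 a10 a20 a30 a40 a50.
  have [t [t1t /andP[tl tt2] okt Pt Et]] := scheme t1 t2 th t10 t12 t2T th0 ok1.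
  have le_th b : th <= b -> t2 - b < t by move=> tb; apply: le_lt_trans tl; rewrite lerD2l lerN2.
  have lt_th b : th <= b -> t2 - t < b.
    by move=> tb; have := le_th b tb; rewrite ltrBlDr -ltrBlDl.
  have [m1 m2 m3 m4 [m5 m6]] : [/\ th <= eps / 4, th <= a1, th <= a2, th <= a3 & th <= a4 /\ th <= a5].
    by split; [..|split]; rewrite /th !ge_min !lexx ?orbT.
  have t0 : 0 <= t := le_trans t10 (ltW t1t).
  have tc : t \in `[0, T] by rewrite in_itv/= t0 ltW// (le_lt_trans tt2).
  exists (phi t); split.
  - exact: ps.
  - exact: okt.
  - have k1 := ipv_polar oD (us t2c) (us tc).
    have := H3' t (le_th _ m4) tt2; rewrite ler_norml => /andP[k2 _].
    have := H4' t t2 t0 tt2 t2T (lt_th _ m5); rewrite ler_norml => /andP[_ k3].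
    have k4 := Rint_ocD di t10 (ltW t1t) tt2 t2T.
    move: Et k1 k2 k3 m1; rewrite /c k4 {1}/energy_at.
    move: (ipv D (u t) (u t)) (ipv D (u t2) (u t2)) (ipv D (u t) (u t2)) (potE _ _ _ (phi t)) (energy_at t1)
      (\int[leb]_(r in `]t1, t]) d r) (\int[leb]_(r in `]t, t2]) d r) => *; lra.
  - by split; [exact: H1' (le_th _ m2) tt2|exact: H2' (le_th _ m3) tt2].
  (* The increment estimate needs two distinct times; at [t = t2] the difference is zero. *)
  have [->|nt] := eqVneq t t2.
    rewrite (_ : (fun x => phi t2 x - phi t2 x) = fun=> 0); last by apply/funext => x; rewrite subrr.
    rewrite /ip (_ : \int[mu2]_(x in D) _ = 0) ?normr0 ?ltW//.
    rewrite -[RHS](_ : \int[mu2]_(x in D) 0 = 0); last by rewrite /Rintegral integral0.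
    by apply: eq_Rint => x _; rewrite mul0r.
  have tlt : t < t2 by rewrite lt_neqAle nt.
  pose dl : mpt -> R := fun x => phi t2 x - phi t x.
  have dls : sqi mu2 D dl := sqiB mD (ps t2c) (ps tc).
  have [JH Jn Jg] := HJ dl dls.
  have S5 := H5' t t2 t0 tt2 t2T (lt_th _ m6).
  have gM : gradnorm D (convol D J dl) <= CJ * (`|N| + n2 mu2 D (phi t2)).
    apply: le_trans Jg _; apply: ler_wpM2l => //; rewrite addrC.
    apply: le_trans (n2B mD (ps t2c) (ps tc)) _; rewrite lerD2l.
    by apply: le_trans Pt _; exact: ler_norm.
  have final g : gradnorm D g <= CJ * (`|N| + n2 mu2 D (phi t2)) ->
      gradnorm D g * \int[leb]_(r in `]t, t2]) al r <= eps.
    move=> gl; apply: le_trans (ler_norm _) _; rewrite normrM (ger0_norm (gradnorm_ge0 D g)).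
    apply: le_trans (ler_pM (gradnorm_ge0 D g) (normr_ge0 _) gl S5) _.
    by rewrite mulrA ler_pdivrMr// mulrC ler_pM2l// lerDl.
  rewrite -/dl (ip_Bl oD (ps t2c) (ps tc) (inH1_sqi JH)) ler_norml; apply/andP; split; last first.
    by apply: le_trans (inc _ JH t t2 t0 tlt t2T).1 _; exact: final.
  (* The increment estimate is one-sided, so the lower bound tests with the opposite function; the
     zero summand gives it the shape of [inH1_lin]. *)
  have NH := (inH1_lin oD (-1) JH (testfun_inH1 oD (testfun0 D))).1.
  have Ng := gradnorm_lin oD (-1) JH (testfun_inH1 oD (testfun0 D)).
  rewrite (gradnorm0 oD) normrN1 mul1r addr0 in Ng.
  have := le_trans (inc _ NH t t2 t0 tlt t2T).1 (final _ (le_trans Ng gM)).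
  have E s : sqi mu2 D (phi s) -> ip D (phi s) (fun x => -1 * convol D J dl x + 0) = - ip D (phi s) (convol D J dl).
    move=> ss; apply: etrans (Rint_N mD (sqi_mul mD ss (inH1_sqi JH))); apply: eq_Rint => x _.
    by rewrite addr0 mulN1r mulrN.
  by rewrite (E _ (ps t2c)) (E _ (ps tc)) lerNl opprB opprK addrC.
by split; [exact: lsc.1|have := lsc.2; rewrite /energy_at /c lerBrDl].
Qed.

Lemma cst_inH1 (c : R) : inH1 D (fun=> c) /\ gradnorm D (fun=> c) = 0.
Proof.
have wp i : is_weak_partial D i (fun=> c) (fun=> 0).
  split.
    split; first exact: measurable_cst.
    by move=> K cK _; apply: integrable0.
  move=> chi tc; rewrite (_ : \int[mu2]_(x in D) (0 * chi x) = 0); last first.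
    rewrite -[RHS](_ : \int[mu2]_(x in D) 0 = 0); last by rewrite /Rintegral integral0.
    by apply: eq_Rint => x _; rewrite mul0r.
  have i1 := sqi_intg mD Dfin (testfun_sqi oD (testfun_derive (e_ i) tc)).
  rewrite oppr0 (Rint_Z mD c i1) (testfun_Rint oD (testfun_derive (e_ i) tc)).
  by rewrite (Rint_testfun_derive (testfunS (@subsetT _ _) tc)) mulr0.
have s0 : sqi mu2 D (fun=> 0 : R) := sqi_cst mD 0 Dfin.
have cH : inH1 D (fun=> c) by split; [exact: sqi_cst|move=> i; exists (fun=> 0)].
split=> //; apply/eqP; rewrite -sqrf_eq0; apply/eqP; rewrite gradnorm_sqr.
apply: big1 => i _; rewrite -[RHS](_ : \int[mu2]_(x in D) 0 = 0); last by rewrite /Rintegral integral0.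
apply: eq_Rintegral_ae; apply: ae_mono (wD_ae oD (wp i)) => x e Dx.
by rewrite e// expr0n.
Qed.

(** Constants have zero gradient, so the one-sided increment estimate with 1 and with -1 gives both
    inequalities. *)
Lemma mass_conserved t : 0 <= t -> t < T ->
  \int[mu2]_(x in D) phi t x = \int[mu2]_(x in D) phi 0 x.
Proof.
rewrite le_eqVlt => /orP[/eqP <-//|t0] tT.
have [d [al [_ _ _ _ inc]]] := energy_increment.
have tc : t \in `[0, T] by rewrite in_itv/= !ltW.
have c0' : 0 \in `[0, T] by rewrite in_itv/= lexx ltW// (lt_trans t0).
have E c s : s \in `[0, T] -> ip D (phi s) (fun=> c) = c * \int[mu2]_(x in D) phi s x.
  move=> sc; rewrite -(Rint_Z mD c (sqi_intg mD Dfin (ps sc))); apply: eq_Rint => x _.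
  by rewrite mulrC.
have H c : c * \int[mu2]_(x in D) phi t x - c * \int[mu2]_(x in D) phi 0 x <= 0.
  have [cH cg] := cst_inH1 c.
  by have := (inc _ cH 0 t (lexx _) t0 tT).1; rewrite (E _ _ tc) (E _ _ c0') cg mul0r.
have := H 1; have := H (-1); rewrite !mul1r !mulN1r => h1 h2; apply/eqP; rewrite eq_le; apply/andP.
by move: h1 h2; move: (Rintegral _ _ _) (Rintegral _ _ _) => *; split; lra.
Qed.

(** The condition on [k] and the measure lets Poincare's inequality compare the kinetic energy with
    the viscous half of [d]; the condition [k * CU <= 2^-1] does the same for [potE] and the
    gradient of the chemical potential. The summand [2^-1] is the additive constant left by [HU]. *)
Lemma trajectory_dissipation (m CU k : R) : 0 <= CU ->
  (forall f, sqi mu2 D f -> inH1 D (chem_potential D J F f) -> `|\int[mu2]_(x in D) f x| <= m ->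
    potE D J F f <= CU * (gradnorm D (chem_potential D J F f) ^+ 2 + 1)) ->
  finite_at 0 -> `|\int[mu2]_(x in D) phi 0 x| <= m ->
  0 < k -> k * fine (mu2 D) <= nu1 -> k * CU <= 2^-1 ->
  forall t, 0 < t -> t < T -> finite_at t /\
    (energy_at 0 - t <= (2^-1 + Ch ^+ 2 / (2 * nu1) + 1) / k ->
     energy_at t <= (2^-1 + Ch ^+ 2 / (2 * nu1) + 1) / k).
Proof.
move=> CU0 HU ok0 m0 k0 k1 k2 t t0 tT.
have [d [di aed dec]] := energy_decay.
split; first by have [] := dec 0 t (lexx _) t0 tT ok0.
apply: (dissipation_bound (C1 := Ch ^+ 2 / (2 * nu1)) k0 di dec _ ok0 t0 tT).
apply: ae_mono aed => r hr r0; have [uV mH ->] := hr r0.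
have rc : r \in `[0, T] := subset_itv_oo_cc r0.
have mr : `|\int[mu2]_(x in D) phi r x| <= m.
  by rewrite mass_conserved//; move: r0; rewrite in_itv/= => /andP[/ltW].
have h1 := HU _ (ps rc) mH mr; rewrite -/(mu r) in h1.
have V0 : 0 <= fine (mu2 D) by rewrite fine_ge0.
have h2 : ipv D (u r) (u r) <= fine (mu2 D) * vnorm (u r) ^+ 2.
  rewrite (ipvE oD (us rc) (us rc)) (vnorm_sqr oD uV) mulr_sumr; apply: ler_sum => i _.
  by rewrite ip_n2; exact: (poincare_H10 oD Dfin (uV.1 i)).
have v2 := sqr_ge0 (vnorm (u r)); have g2 := sqr_ge0 (gradnorm D (mu r)).
have h3 := ler_wpM2l (ltW k0) h1; have h4 := ler_wpM2l (ltW k0) h2.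
rewrite mulrA in h3; rewrite mulrA in h4.
have h5 := ler_wpM2r v2 k1; have g3 : 0 <= gradnorm D (mu r) ^+ 2 + 1 by rewrite addr_ge0.
have h6 := ler_wpM2r g3 k2; have h7 := mulr_ge0 (ltW nu10) v2.
rewrite /energy_at mulrDr [k * (2^-1 * _)]mulrCA.
exact: (dissipation_algebra _ h3 h4 h5 h6 h7 g2).
Qed.

End trajectory.

(** * Energy bounds and metric bounds *)

Section state_bounds.
Context {R : realType}.
Notation pt := (R * R)%type.
Notation mpt := (measurableTypeR R * measurableTypeR R)%type.
Notation mu2 := (@mu2 R).
Notation vfield := (@vfield R).
Notation state := (@state R).
Variable D : set pt.
Hypothesis oD : open D.
Hypothesis Dfin : (mu2 D < +oo)%E.
Let mD : measurable (D : set mpt). Proof. exact: open_measurable2. Qed.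
Variables (J : pt -> R) (F : R -> R) (c7 c8 q : R).
Hypothesis J1 : W1p setT 1%:E J.
Hypothesis CF : Ck 2 F.
Hypotheses (c70 : 0 < c7) (q0 : 0 < q).
Hypothesis Fc7 : {ae mu2, forall x : pt, D x -> forall s,
  c7 * (`|s| `^ (2 * q)) - c8 <= (F^`(2))%classic s + acoef D J x}.

Definition state_energy (x : state) : R := 2^-1 * ipv D x.1 x.1 + potE D J F x.2.

Definition square_integrable (x : state) : Prop :=
  [/\ forall i, sqi mu2 D (x.1 i), sqi mu2 D x.2 & intg mu2 D (fun y => F (x.2 y))].

(** Mediates between the two notions of boundedness: the metric contains the integral of [F], the
    energy that of the convex density and the nonlocal form. *)
Definition state_le (M : R) (x : state) : Prop :=
  [/\ forall i, n2 mu2 D (x.1 i) <= M, n2 mu2 D x.2 <= M &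
      `|\int[mu2]_(y in D) F (x.2 y)| <= M].

Let Ji : intg mu2 setT J := (W11_intg J1).1.
Let A := norm1 J.
Let A0 : 0 <= A. Proof. exact: norm1_ge0. Qed.

Lemma dens_Rint f : sqi mu2 D f -> intg mu2 D (fun y => F (f y)) ->
  `|\int[mu2]_(y in D) dens D J F f y - \int[mu2]_(y in D) F (f y)| <= A * n2 mu2 D f ^+ 2.
Proof.
move=> fs Fi; have di := (intg_dens oD Dfin F J1 fs).2 Fi.
have i1 := intgZ mD A fs.2; rewrite -(Rint_B mD di Fi) n2_sqr -(Rint_Z mD A fs.2).
apply: (norm_Rint_le mD (intgB mD di Fi) i1); apply: aeW => y _.
rewrite /dens /pot addrAC subrr add0r normrM [`|_ ^+ 2|]ger0_norm ?sqr_ge0// ler_wpM2r ?sqr_ge0// normrM.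
apply: le_trans ((acoef_bound oD Dfin Ji).2 y); rewrite ler_piMr//.
by rewrite ger0_norm ?invr_ge0// invf_le1// ler1n.
Qed.

Lemma convol_le f : sqi mu2 D f -> `|ip D f (convol D J f)| <= A * n2 mu2 D f ^+ 2.
Proof.
move=> fs; have [Js Jn] := convol_L2 oD Dfin Ji fs; apply: le_trans (ip_le oD fs Js) _.
by rewrite mulrC; apply: le_trans (ler_wpM2r (n2_ge0 _ _ _) Jn) _; rewrite -mulrA -expr2.
Qed.

Lemma state_le_energy M : exists K, forall x, square_integrable x -> state_le M x ->
  state_energy x <= K.
Proof.
exists (M ^+ 2 + (M + A * M ^+ 2 + A * M ^+ 2)) => x [us ps Fi] [uM pM FM].
have sq y : 0 <= y -> y <= M -> y ^+ 2 <= M ^+ 2.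
  by move=> y0 yM; rewrite lerXn2r// nnegrE//; exact: le_trans yM.
have h1 : ipv D x.1 x.1 <= 2 * M ^+ 2.
  rewrite (ipvE oD us us) sumI2 mulr2n mulrDl !mul1r !ip_n2.
  by apply: lerD; apply: sq; rewrite ?n2_ge0//; exact: uM.
have h2 := ler_wpM2l A0 (sq _ (n2_ge0 mu2 D x.2) pM); have h3 := mulr_ge0 A0 (sqr_ge0 M).
have := dens_Rint ps Fi; have := convol_le ps; have := FM.
rewrite /state_energy /potE !ler_norml => /andP[_ a1] /andP[a2 _] /andP[_ a3].
move: h1 h2 h3 a1 a2 a3; move: (ipv _ _ _) (ip _ _ _) (Rintegral _ _ _) (Rintegral _ _ _) (A * n2 _ _ _ ^+ 2) (A * M ^+ 2) => *; lra.
Qed.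

(** The kinetic part is nonnegative and [potE] controls the squared norm of the phase field, so each
    norm is bounded; the integral of [F] differs from the energy by terms these norms control. *)
Lemma energy_state_le K : exists2 M, 0 <= M & forall x, square_integrable x ->
  state_energy x <= K -> state_le M x.
Proof.
have [C C0 HC] := potE_lower oD Dfin J1 CF c70 q0 Fc7.
have [C1 C10 HC1] := dens_ge oD Dfin J1 CF c70 q0 Fc7 0.
pose B := 2 * (`|K| + C).
have B0 : 0 <= B by rewrite mulr_ge0// addr_ge0.
have AB0 : 0 <= A * B := mulr_ge0 A0 B0.
exists (1 + B + (`|K| + C1 + 2 * (A * B))); first by rewrite !addr_ge0// mulr_ge0.
move=> x [us ps Fi] xK; have di := (intg_dens oD Dfin F J1 ps).2 Fi.
have h1 := HC _ ps di; rewrite ip_n2 in h1.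
have h0 : 0 <= ipv D x.1 x.1 by rewrite (ipvE oD us us); apply: sumr_ge0 => i _; exact: ip_ge0.
have kk := ler_norm K.
have hp : n2 mu2 D x.2 ^+ 2 <= B.
  have := addr_ge0 (normr_ge0 K) C0.
  move: xK h1 h0; rewrite /state_energy /B; move: (potE _ _ _ _) (n2 _ _ _ ^+ 2) (ipv _ _ _) => *; lra.
have p0 := sqr_ge0 (n2 mu2 D x.2).
have hu i : n2 mu2 D (x.1 i) ^+ 2 <= B.
  apply: (@le_trans _ _ (ipv D x.1 x.1)).
    rewrite (ipvE oD us us) (bigD1 i)//= ip_n2 lerDl; apply: sumr_ge0 => j _; exact: ip_ge0.
  move: xK h1 p0; rewrite /state_energy /B; move: (potE _ _ _ _) (n2 _ _ _ ^+ 2) (ipv _ _ _) => *; lra.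
have root y : 0 <= y -> y ^+ 2 <= B -> y <= 1 + B + (`|K| + C1 + 2 * (A * B)).
  move=> y0 yB; apply: (@le_trans _ _ (1 + B)); last first.
    by rewrite lerDl !addr_ge0// mulr_ge0.
  have := sqr_ge0 (y - 1); rewrite expr2; move: yB; rewrite expr2; nra.
split; [by move=> i; apply: root; rewrite ?n2_ge0|by apply: root; rewrite ?n2_ge0|].
have h2 := ler_wpM2l A0 hp; have h3 := HC1 _ ps di.
have := dens_Rint ps Fi; have := convol_le ps; move: xK h0 h3.
rewrite mul0r sub0r /state_energy /potE !ler_norml => xK h0 h3 /andP[b1 b2] /andP[a1 a2].
move: xK h0 h3 b1 b2 a1 a2 h2 kk AB0 B0 C10; move: (ipv _ _ _) (ip _ _ _) (Rintegral _ _ _) (Rintegral _ _ _)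
  (A * n2 _ _ _ ^+ 2) (A * B) => *.
by have k0 := normr_ge0 K; apply/andP; split; lra.
Qed.

Lemma phase_space_sqi m (x : state) : phase_space D F m x -> square_integrable x.
Proof. by move=> [uG pL Fi _]; split; [exact: Gdiv_sqi|exact: L2_sqi|exact: Fi]. Qed.

Lemma Lp_norm2 f : sqi mu2 D f -> Lp_norm D 2%:E f = n2 mu2 D f.
Proof. by move=> fs; rewrite /Lp_norm Lnorm2E. Qed.

Lemma state_le_dist M x y : 0 <= M -> square_integrable x -> square_integrable y ->
  state_le M x -> state_le M y ->
  phase_dist D F x y <= Num.sqrt (\sum_(i < 2) (2 * M) ^+ 2) + 2 * M + Num.sqrt (2 * M).
Proof.
move=> M0 [us ps _] [vs rs _] [uM pM FM] [vM rM GM]; rewrite /phase_dist.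
have ds i : sqi mu2 D ((x.1 - y.1) i) by exact: (sqiB mD (us i) (vs i)).
have dp : sqi mu2 D (x.2 - y.2) by exact: (sqiB mD ps rs).
have tri a b : a <= M -> b <= M -> a + b <= 2 * M by move=> *; lra.
apply: lerD; first apply: lerD.
- rewrite (L2v_normE oD ds) ler_sqrt; last by apply: sumr_ge0 => i _; exact: sqr_ge0.
  apply: ler_sum => i _; rewrite lerXn2r ?nnegrE ?n2_ge0 ?mulr_ge0//.
  by apply: le_trans (n2B mD (us i) (vs i)) _; exact: tri.
- by rewrite (Lp_norm2 dp); apply: le_trans (n2B mD ps rs) _; exact: tri.
- rewrite ler_sqrt ?mulr_ge0//; apply: le_trans (ler_normB _ _) _; exact: tri.
Qed.

(** A metric bound limits mutual distances only, so one state [y] serves as reference; [M ^+ 2]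
    undoes the square root in the metric. *)
Lemma dist_state_le M y : square_integrable y -> exists M', forall x, square_integrable x ->
  phase_dist D F x y <= M -> state_le M' x.
Proof.
move=> [vs rs _]; pose N := \sum_i n2 mu2 D (y.1 i); pose P := n2 mu2 D y.2.
pose G := `|\int[mu2]_(t in D) F (y.2 t)|.
have N0 : 0 <= N by apply: sumr_ge0 => i _; exact: n2_ge0.
have P0 : 0 <= P by exact: n2_ge0.
have G0 : 0 <= G by exact: normr_ge0.
exists (`|M| + M ^+ 2 + N + P + G) => x [us ps _] dM.
have M2 := sqr_ge0 M; have M1 := normr_ge0 M; have M3 := ler_norm M.
have ds i : sqi mu2 D ((x.1 - y.1) i) by exact: (sqiB mD (us i) (vs i)).
have dp : sqi mu2 D (x.2 - y.2) by exact: (sqiB mD ps rs).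
have a0 : 0 <= L2v_norm D (x.1 - y.1) by exact: sqrtr_ge0.
have b0 : 0 <= Lp_norm D 2%:E (x.2 - y.2) by rewrite (Lp_norm2 dp) n2_ge0.
have e0 := sqrtr_ge0 `|\int[mu2]_(t in D) F (x.2 t) - \int[mu2]_(t in D) F (y.2 t)|.
have tri f g : sqi mu2 D f -> sqi mu2 D g -> n2 mu2 D f <= n2 mu2 D (fun t => f t - g t) + n2 mu2 D g.
  move=> fs gs; have := n2D mD (sqiB mD fs gs) gs.
  by rewrite (_ : (fun t => f t - g t + g t) = f)//; apply/funext => t; rewrite subrK.
rewrite /phase_dist in dM; split.
- move=> i; apply: le_trans (tri _ _ (us i) (vs i)) _.
  have h1 : n2 mu2 D (fun t => x.1 i t - y.1 i t) <= L2v_norm D (x.1 - y.1) := n2_le_L2v oD i ds.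
  have h2 : n2 mu2 D (y.1 i) <= N.
    by rewrite /N (bigD1 i)//= lerDl; apply: sumr_ge0 => j _; exact: n2_ge0.
  move: dM a0 b0 e0 h1 h2; move: (L2v_norm _ _) (Lp_norm _ _ _) (Num.sqrt _) (n2 _ _ _) (n2 _ _ _) => *; lra.
- apply: le_trans (tri _ _ ps rs) _; rewrite -/P.
  have h1 : n2 mu2 D (fun t => x.2 t - y.2 t) = Lp_norm D 2%:E (x.2 - y.2) by rewrite (Lp_norm2 dp).
  rewrite h1; move: dM a0 b0 e0; move: (L2v_norm _ _) (Lp_norm _ _ _) (Num.sqrt _) => *; lra.
set X := \int[mu2]_(t in D) F (x.2 t); set Y := \int[mu2]_(t in D) F (y.2 t).
have h1 : `|X - Y| <= M ^+ 2.
  rewrite -(sqr_sqrtr (normr_ge0 (X - Y))) lerXn2r ?nnegrE//.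
    by move: dM a0 b0 e0; rewrite -/X -/Y; move: (L2v_norm _ _) (Lp_norm _ _ _) (Num.sqrt _) => *; lra.
  by move: dM a0 b0 e0; rewrite -/X -/Y; move: (L2v_norm _ _) (Lp_norm _ _ _) (Num.sqrt _) => *; lra.
have h2 : `|X| <= `|X - Y| + `|Y| by rewrite -{1}(subrK Y X) ler_normD.
by move: h1 h2; rewrite -/Y -/G => h1 h2; move: (`|X|) (`|X - Y|) h1 h2 => *; lra.
Qed.

End state_bounds.

(** * From energy decay to dissipativity *)

Section dissipative_flow.
Context {R : realType}.
Notation pt := (R * R)%type.
Notation mpt := (measurableTypeR R * measurableTypeR R)%type.
Notation mu2 := (@mu2 R).
Notation state := (@state R).
Variables (D : set pt) (J : pt -> R) (F : R -> R) (c7 c8 q m K : R) (G : set (R -> state)).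
Hypothesis oD : open D.
Hypothesis Dfin : (mu2 D < +oo)%E.
Hypothesis J1 : W1p setT 1%:E J.
Hypothesis CF : Ck 2 F.
Hypotheses (c70 : 0 < c7) (q0 : 0 < q).
Hypothesis Fc7 : {ae mu2, forall x : pt, D x -> forall s,
  c7 * (`|s| `^ (2 * q)) - c8 <= (F^`(2))%classic s + acoef D J x}.
Hypothesis HG : forall z, G z -> phase_space D F m (z 0) /\
  forall t, 0 < t -> phase_space D F m (z t) /\
    (state_energy D J F (z 0) - t <= K -> state_energy D J F (z t) <= K).
Notation X_m := (phase_space D F m).
Notation d := (phase_dist D F).

Lemma bounded_state_le M B : 0 <= M -> B `<=` X_m -> (forall x, B x -> state_le D F M x) ->
  bounded_in X_m d B.
Proof.
move=> M0 BX BM; split=> //.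
exists (Num.sqrt (\sum_(i < 2) (2 * M) ^+ 2) + 2 * M + Num.sqrt (2 * M)) => x y Bx By.
by apply: (state_le_dist oD M0); [exact: phase_space_sqi (BX _ Bx)|exact: phase_space_sqi (BX _ By)|exact: BM|exact: BM].
Qed.

Lemma flow_point_dissipative : point_dissipative X_m d G.
Proof.
have [M M0 HM] := energy_state_le oD Dfin J1 CF c70 q0 Fc7 K.
exists (X_m `&` state_le D F M); first by apply: (bounded_state_le M0) => x [].
move=> z Gz; have [z0 zt] := HG Gz.
(* After this time the initial energy minus [t] is below [K], whatever the signs. *)
exists (`|state_energy D J F (z 0)| + `|K| + 1); first by rewrite !addr_ge0.
move=> t ht; have e1 := ler_norm (state_energy D J F (z 0)); have e2 := ler_norm (- K).
rewrite normrN in e2; have n1 := normr_ge0 (state_energy D J F (z 0)); have n2 := normr_ge0 K.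
have [zX zE] := zt t (ltac:(lra)).
split=> //; apply: HM; first exact: phase_space_sqi zX.
by apply: zE; lra.
Qed.

Lemma flow_eventually_bounded : eventually_bounded X_m d G.
Proof.
move=> B [BX [M1 HB]].
have [M M0 HM] := energy_state_le oD Dfin J1 CF c70 q0 Fc7 K.
have [E0 HE] : exists E0, forall x, B x -> state_energy D J F x <= E0.
  (* The reference state is taken in [B] itself; an empty set has any energy bound. *)
  have [[y By]|nB] := pselect (B !=set0); last first.
    by exists 0 => x Bx; case: nB; exists x.
  have [M' HM'] := dist_state_le oD M1 (phase_space_sqi oD (BX _ By)).
  have [E0 HE0] := state_le_energy oD Dfin F J1 M'.
  exists E0 => x Bx; have xs := phase_space_sqi oD (BX _ Bx).
  by apply: HE0 => //; apply: HM' => //; exact: HB.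
exists (`|E0| + `|K| + 1); first by rewrite !addr_ge0.
apply: (bounded_state_le M0) => x [t /= ht [z [Gz Bz ->]]].
all: have e1 := ler_norm E0; have e2 := ler_norm (- K); rewrite normrN in e2.
all: have n1 := normr_ge0 E0; have n2 := normr_ge0 K; have h0 := HE _ Bz.
all: have [z0 zt] := HG Gz; have [zX zE] := zt t (ltac:(lra)).
- exact: zX.
by apply: HM; [exact: phase_space_sqi zX|apply: zE; lra].
Qed.

End dissipative_flow.

Theorem proposition4 (R : realType) (Omega : set (R * R))
    (J : R * R -> R) (nu F : R -> R)
    (nu1 nu2 c0 c3 c4 p c7 c8 q m : R) (h : dual (Vdiv Omega)) :
  smooth_bounded_domain Omega ->
  (* (i) *)
  W1p setT 1%:E J ->
  {ae mu2, forall x : R * R, J x = J (- x)} ->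
  {ae mu2, forall x : R * R, Omega x -> 0 <= acoef Omega J x} ->
  (* (ii) *)
  locally_lipschitz nu -> 0 < nu1 -> 0 < nu2 ->
  (forall s : R, nu1 <= nu s <= nu2) ->
  (* (iii) *)
  C21_loc F -> 0 < c0 ->
  (forall s : R, {ae mu2, forall x : R * R, Omega x ->
     c0 <= (F^`(2))%classic s + acoef Omega J x}) ->
  (* (iv) *)
  0 < c3 -> 0 <= c4 -> 1 < p <= 2 ->
  (forall s : R, `|(F^`())%classic s| `^ p <= c3 * `|F s| + c4) ->
  (* (v) *)
  0 < c7 -> 0 < c8 -> 0 < q ->
  (forall s : R, {ae mu2, forall x : R * R, Omega x ->
     c7 * (`|s| `^ (2 * q)) - c8 <= (F^`(2))%classic s + acoef Omega J x}) ->
  (* (vi) *)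
  mem_of h ->
  0 <= m ->
  let X_m := phase_space Omega F m in
  let G := weak_solutions Omega J nu F q h m in
  point_dissipative X_m (phase_dist Omega F) G /\
  eventually_bounded X_m (phase_dist Omega F) G.
Proof.
move=> SD J1 Jev _ lnu nu10 _ nub [CF _] c00 Hc0 _ _ _ _ c70 _ q0 Hc7 mh m0 X_m G.
have [D0 oD cD bD _] := SD.
have mD : measurable (Omega : set (measurableTypeR R * measurableTypeR R)) := open_measurable2 oD.
have Dfin := bounded_mu2 bD mD; have Dpos := open_mu2_gt0 oD D0.
have cnu := lipschitz_continuous lnu.
have Fc0 : {ae mu2, forall x : R * R, Omega x -> forall s, c0 <= (F^`(2))%classic s + acoef Omega J x}.
  by apply: (@ae_forall_rat R F CF _ _ mu2 Omega (acoef Omega J) (fun=> c0) _ Hc0).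
have Fc7 : {ae mu2, forall x : R * R, Omega x -> forall s,
    c7 * (`|s| `^ (2 * q)) - c8 <= (F^`(2))%classic s + acoef Omega J x}.
  apply: (@ae_forall_rat R F CF _ _ mu2 Omega (acoef Omega J) (fun s => c7 * (`|s| `^ (2 * q)) - c8) _ Hc7) => s r sr.
  rewrite lerD2r ler_wpM2l ?(ltW c70)//; apply: ge0_ler_powR; rewrite ?nnegrE//.
  by rewrite mulr_ge0// ltW.
have [hlin [Ch0 HCh]] := mh.
(* The constant given by continuity of [h] may be negative, hence the absolute value. *)
have hb (v : Vdiv Omega) : mem_of v -> `|h v| <= `|Ch0| * vnorm Omega v.
  by move=> vV; apply: le_trans (HCh v vV) _; rewrite ler_wpM2r ?vnorm_ge0// ler_norm.
have [CU CU0 HU] := potE_upper oD Dfin J1 CF c00 c70 q0 Fc0 Fc7 m Dpos (poincare_wirtinger SD).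
pose V := fine (mu2 Omega); have V0 : 0 <= V by rewrite fine_ge0.
(* The two terms realise the two conditions on [k] in [trajectory_dissipation]; adding 1 keeps the
   denominators positive. *)
pose k := Num.min (nu1 / (V + 1)) (2 * (CU + 1))^-1.
have k0 : 0 < k by rewrite lt_min divr_gt0 ?invr_gt0 ?mulr_gt0 ?ltr_wpDl.
have k1 : k * V <= nu1.
  have h1 : k <= nu1 / (V + 1) by rewrite ge_min lexx.
  have V1 : 0 < V + 1 by rewrite ltr_wpDl.
  by move: h1; rewrite ler_pdivlMr//; move: (mulr_ge0 (ltW k0) V0); move: k0; move: k => *; lra.
have k2 : k * CU <= 2^-1.
  have h1 : k <= (2 * (CU + 1))^-1 by rewrite ge_min lexx orbT.
  have C1 : 0 < 2 * (CU + 1) by rewrite mulr_gt0// ltr_wpDl.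
  move: h1; rewrite -[_^-1]mul1r ler_pdivlMr//; move: (mulr_ge0 (ltW k0) CU0); move: k0 {k1}; move: k => *; lra.
pose K := (2^-1 + `|Ch0| ^+ 2 / (2 * nu1) + 1) / k.
have HG z : G z -> phase_space Omega F m (z 0) /\ forall t, 0 < t -> phase_space Omega F m (z t) /\
    (state_energy Omega J F (z 0) - t <= K -> state_energy Omega J F (z t) <= K).
  move=> [z0 [z0G z0L z0F z0m] W].
  have W1 := W 1 ltr01; have i0 : 0 \in `[0, 1 : R] by rewrite in_itv/= lexx ler01.
  have uG : @mem_of _ (Gdiv Omega) (z 0).1 by have [H _] := ws_u_cont W1; exact: H.
  have pL : @mem_of _ (L2 Omega) (z 0).2 by have [H _] := ws_phi_cont W1; exact: H.
  have ps := L2_sqi oD pL.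
  (* [z 0] and the initial datum agree almost everywhere only, so integrability of the potential and
     the mass bound are transferred. *)
  have E : {ae mu2, forall x : R * R, Omega x -> z0.2 x = (z 0).2 x}.
    by apply: ae_mono (ws_init W1) => x hx Dx; have [_ ->] := hx Dx.
  have Fi : intg mu2 Omega (fun x => F ((z 0).2 x)).
    apply: (intg_ae_eq mD _ z0F).
      apply: measurableT_comp ps.1; exact: continuous_measurable_fun (continuous_F CF).
    by apply: ae_mono E => x hx Dx /=; rewrite hx.
  have mass0 : `|\int[mu2]_(x in Omega) (z 0).2 x| <= m.
    by rewrite -(eq_Rintegral_ae E).
  split=> [|t t0]; first by split.
  (* A horizon beyond [t], since the energy inequality is established strictly before the final
     time. *)
  have tT : t < t + 1 by rewrite ltrDl.
  have T0 : 0 < t + 1 by exact: lt_trans tT.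
  have Wt := W _ T0; have it : t \in `[0, t + 1] by rewrite in_itv/= !ltW.
  have fin0 := (intg_dens oD Dfin F J1 ps).2 Fi.
  have [fint dis] := trajectory_dissipation oD Dfin J1 Jev cnu nu10 nub CF c00 c70 q0 Fc0 Fc7 mh
    (normr_ge0 Ch0) hb Wt CU0 HU fin0 mass0 k0 k1 k2 t0 tT.
  split; last exact: dis.
  have pt : @mem_of _ (L2 Omega) (z t).2 by have [H _] := ws_phi_cont Wt; exact: H.
  split=> //.
  - by have [H _] := ws_u_cont Wt; exact: H.
  - exact: (intg_dens oD Dfin F J1 (L2_sqi oD pt)).1 fint.
  - by rewrite (mass_conserved oD Dfin cnu nu10 nub q0 mh (normr_ge0 Ch0) hb Wt (ltW t0) tT).
split.
- exact: (flow_point_dissipative oD Dfin J1 CF c70 q0 Fc7 HG).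
- exact: (flow_eventually_bounded oD Dfin J1 CF c70 q0 Fc7 HG).
Qed.
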